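(* Let $b>a>0$, $\alpha>0$, $\beta>0$. Set $\mu=\alpha\delta_a+\beta\delta_b$ and $\rho=b/a>1$, and for each integer $d\ge2$ let $\mu_d(dr)=r^{-d}\mu(dr)$, i.e. $\mu_d=\alpha a^{-d}\delta_a+\beta b^{-d}\delta_b$. Then $$\lim_{d\to+\infty}\frac1d\ln\big(\widetilde\lambda^c_d(\mu_d)\big)=\ln(\kappa^c_\rho)<0.$$
   Context: For an integer $d\ge2$, let $v_d$ denote the volume of the unit Euclidean ball of $\mathbb{R}^d$, and $B(c,r)$ the open Euclidean ball of center $c$ and radius $r$. For a measure $\nu$ on $(0,+\infty)$ and $\lambda>0$, let $\xi$ be a Poisson point process on $\mathbb{R}^d\times(0,+\infty)$ with intensity (Lebesgue)$\otimes\lambda\nu$, and $\Sigma(\lambda\nu)=\bigcup_{(c,r)\in\xi}B(c,r)$. $\Sigma(\lambda\nu)$ percolates if the connected component containing the origin is unbounded with positive probability; $\lambda^c_d(\nu)=\inf\{\lambda>0:\Sigma(\lambda\nu)\text{ percolates}\}$ and $\widetilde\lambda^c_d(\nu)=\lambda^c_d(\nu)\int v_d(2r)^d\nu(dr)$. Definition of $\kappa^c_\rho$: fix $\rho>1$ and an integer $k\ge1$. Set $r_1=r_{k+1}=1+\rho$ and $r_i=2$ for $2\le i\le k$. For $(a_i)_{2\le i\le k+1}\in[0,1)^k$ define $d_1=1+\rho$ and, for $2\le i\le k+1$, $d_i>0$ by $d_i^2=d_{i-1}^2+2r_ia_id_{i-1}+r_i^2$; write $\mathcal D(a_2,\dots,a_{k+1})=d_{k+1}$.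 Set $$\kappa^c_\rho(k)=\inf_{0\le a_2,\dots,a_{k+1}<1}\max\left(\left(\frac{4\rho}{(1+\rho)^2\sqrt{\prod_{2\le i\le k+1}(1-a_i^2)}}\right)^{\frac1{k+1}},\ \frac{2\rho}{\mathcal D(a_2,\dots,a_{k+1})}\right),$$ and $\kappa^c_\rho=\inf_{k\ge1}\kappa^c_\rho(k)$. *)

(* Defs.v *)
From HB Require Import structures.
From mathcomp Require Import all_boot all_order all_algebra.
From mathcomp Require Import all_classical all_reals all_analysis.
Set Implicit Arguments. Unset Strict Implicit. Unset Printing Implicit Defensive.
Import Order.TTheory GRing.Theory Num.Theory.
Import numFieldNormedType.Exports.
Local Open Scope classical_set_scope.
Local Open Scope ring_scope.
Local Open Scope card_scope.

Section Defs.
Variable R : realType.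

Definition enorm d (x : 'rV[R]_d) : R := Num.sqrt (\sum_(i < d) x 0 i ^+ 2).
Definition eball d (c : 'rV[R]_d) (r : R) : set 'rV[R]_d :=
  [set x | enorm (x - c) < r].

Definition box d (l u : 'rV[R]_d) : set 'rV[R]_d :=
  [set x | forall i, l 0 i <= x 0 i < u 0 i].
Definition boxvol d (l u : 'rV[R]_d) : R := \prod_(i < d) Num.max 0 (u 0 i - l 0 i).

Local Open Scope ereal_scope.
Definition lebesgue_d d (A : set 'rV[R]_d) : \bar R :=
  ereal_inf [set s | exists l u : nat -> 'rV[R]_d,
     A `<=` \bigcup_n box (l n) (u n) /\
     s = \sum_(0 <= n <oo) (boxvol (l n) (u n))%:E].
Definition vol_ball d : R := fine (lebesgue_d (eball (0 : 'rV[R]_d) 1)).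

(* the (outer) measure Lebesgue (x) lam * nu on R^d x R *)
Definition intensity d (lam : R) (nu : {measure set R -> \bar R})
   (A : set ('rV[R]_d * R)) : \bar R :=
  ereal_inf [set s | exists (l u : nat -> 'rV[R]_d) (B : nat -> set R),
     (forall n, measurable (B n)) /\
     A `<=` \bigcup_n (box (l n) (u n) `*` B n) /\
     s = \sum_(0 <= n <oo) ((boxvol (l n) (u n) * lam)%:E * nu (B n))].

Definition Borel d : set (set ('rV[R]_d * R)) :=
  <<s [set B : set ('rV[R]_d * R) | open B] >>.

Definition poisson_e (m : R) (k : nat) : \bar R :=
  (expR (- m) * m ^+ k / (k`!)%:R)%:E.

Definition count_eq d (S A : set ('rV[R]_d * R)) (k : nat) : Prop :=
  (S `&` A) #= `I_k.

Definition is_poisson_pp d dO (Omega : measurableType dO) (P : probability Omega R)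
  (xi : Omega -> set ('rV[R]_d * R)) (Lam : set ('rV[R]_d * R) -> \bar R) : Prop :=
  [/\ (forall A k, Borel A -> measurable [set w | count_eq (xi w) A k]),
      (forall A k, Borel A -> Lam A < +oo ->
          P [set w | count_eq (xi w) A k] = poisson_e (fine (Lam A)) k),
      (forall A, Borel A -> Lam A = +oo ->
          P [set w | ~ finite_set (xi w `&` A)] = 1) &
      (forall n (A : 'I_n -> set ('rV[R]_d * R)) (k : 'I_n -> nat),
          (forall i, Borel (A i)) ->
          (forall i j, i != j -> A i `&` A j = set0) ->
          P (\bigcap_(i in [set: 'I_n]) [set w | count_eq (xi w) (A i) (k i)]) =
          \prod_(i < n) P [set w | count_eq (xi w) (A i) (k i)])].

Definition Sigma d (S : set ('rV[R]_d * R)) : set 'rV[R]_d :=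
  \bigcup_(p in S) eball p.1 p.2.

Local Close Scope ereal_scope.
Definition percolation_event d dO (Omega : measurableType dO)
  (xi : Omega -> set ('rV[R]_d * R)) : set Omega :=
  [set w | ~ bounded_set (connected_component (Sigma (xi w)) 0)].

Local Open Scope ereal_scope.
Definition percolates d (lam : R) (nu : {measure set R -> \bar R}) : Prop :=
  forall dO (Omega : measurableType dO) (P : probability Omega R)
    (xi : Omega -> set ('rV[R]_d * R)),
  is_poisson_pp P xi (intensity lam nu) ->
  exists F, [/\ measurable F, F `<=` percolation_event xi & 0 < P F].

Definition lambda_c d (nu : {measure set R -> \bar R}) : \bar R :=
  ereal_inf [set x | exists lam : R, [/\ (0 < lam)%R, percolates d lam nu & x = lam%:E]].

Definition lambda_tilde d (nu : {measure set R -> \bar R}) : \bar R :=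
  lambda_c d nu * \int[nu]_(r in `]0%R, +oo[) (vol_ball d * (2 * r) ^+ d)%:E.

Local Close Scope ereal_scope.

Definition rad (rho : R) (k i : nat) : R := if i == k.+1 then 1 + rho else 2.

(* Dseq rho k a n = d_{n+1} *)
Fixpoint Dseq (rho : R) (k : nat) (a : nat -> R) (n : nat) : R :=
  match n with
  | 0 => 1 + rho
  | n'.+1 => Num.sqrt (Dseq rho k a n' ^+ 2
               + 2 * rad rho k n'.+2 * a n'.+2 * Dseq rho k a n'
               + rad rho k n'.+2 ^+ 2)
  end.

Definition kappa_term (rho : R) (k : nat) (a : nat -> R) : R :=
  Num.max ((4 * rho / ((1 + rho) ^+ 2 *
            Num.sqrt (\prod_(2 <= i < k.+2) (1 - a i ^+ 2)))) `^ (k.+1%:R^-1))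
       (2 * rho / Dseq rho k a k).

Definition kappa_k (rho : R) (k : nat) : R :=
  inf [set kappa_term rho k a | a in
        [set a : nat -> R | forall i, (2 <= i <= k.+1)%N -> 0 <= a i < 1]].

Definition kappa_c (rho : R) : R :=
  inf [set kappa_k rho k | k in [set k : nat | (1 <= k)%N]].

End Defs.

(* Main.v *)
(* Rescale lengths by 1/a and cut space into cubes of side 1/d: a site is a radius and a cube, and the
   sites occupied by the process are independent. In high dimension the neighbours of a ball are
   nearly orthogonal to the direction of the path, so a chain made of k balls of radius 1 followed by
   a ball of radius rho grows like Pythagoras' theorem says; tilting the steps by angles of cosines
   a_i changes the distance reached to D(a) and multiplies the number of chains by the product of
   the sqrt(1 - a_i^2) to the power d. The first term of the maximum defining kappa says when the
   expected number of open chains exceeds 1, the second one when D(a) exceeds the radius 2 rho / kappa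
   within which one expects about one center of a ball of radius rho, so that the open chains have
   enough distinct ends.

   Above the threshold, the second moment method applies to the paths that are concatenations of n
   such chains, provided that paths rarely meet: one coordinate is used as a time, and sixteen others
   as a transient walk, which makes the expected overlap of two paths bounded in n.

   Below the threshold, an infinite open path is first shortened, deleting short runs of small balls
   that return too close to the previous big ball; the expected number of reduced paths decreases
   geometrically by a supersolution argument. A Poisson process has to be exhibited here, since
   percolation is a statement about every process with the given intensity: the binary digits of a
   uniform variable give independent uniform variables, and each unit cube receives a Poisson number
   of independent points. *)

Require Import Defs.
From HB Require Import structures.
From mathcomp Require Import all_boot all_order all_algebra.
From mathcomp Require Import all_classical all_reals all_analysis.
From mathcomp Require Import measurable_realfun ring lra zify.
Set Implicit Arguments. Unset Strict Implicit. Unset Printing Implicit Defensive.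
Import Order.TTheory GRing.Theory Num.Theory.
Import numFieldNormedType.Exports.
Local Open Scope classical_set_scope.
Local Open Scope ring_scope.

(** * The intensity measure *)

(** Only exponential rates in [d] matter. A strict inequality on [kap] survives a perturbation
    [delta] or [eps] of the radii and leaves an exponential margin, which pays for the 17 dimensions
    set aside, for the powers of 1/d that they cost, and for the number of angle classes. The side
    1/d is chosen because the diameter of a cube then tends to 0.

    Above the threshold, a mean overlap of 1 + eps per chain is not enough: over n chains it could
    give (1 + eps)^n. The excess is paid only when two paths are in the same layer, and an explicit
    superharmonic function for the difference of layers keeps the total bounded.

    Below the threshold, the expected number of open paths need not decrease at each step: a big
    ball has about (kap (1 + rho) / 2)^d small neighbours, which may be huge. The loss comes only
    with the return to a big ball. The potential anticipates it, counting the possible returns; the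
    definition of kappa bounds those that end far away, and the reduction of paths disposes of those
    that end nearby.

    [intensity] is defined through covers, so its values on boxes have to be computed before any
    probability can be. *)

Section BoxIntegration.
Variables (R : realType) (d : nat).
Implicit Types (l u x : 'rV[R]_d).

Definition set_coord x (j : 'I_d) (t : R) : 'rV[R]_d :=
  \row_i (if i == j then t else x 0 i).

(* The indicator of the box with its first [j] coordinates already integrated. *)
Definition part_vol l u x (j : nat) : R :=
  \prod_(i < d) (if (i < j)%N then Num.max 0 (u 0 i - l 0 i)
                 else \1_(`[l 0 i, u 0 i[ : set R) (x 0 i)).

Lemma part_vol_ge0 l u x j : 0 <= part_vol l u x j.
Proof.
apply: prodr_ge0 => i _; case: ifP => _; first by rewrite le_max lexx.
by rewrite indicE.
Qed.

Lemma part_vol0 l u x : part_vol l u x 0 = \1_(box l u) x.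
Proof.
rewrite /part_vol indicE; have [xb|xb] := boolP (x \in box l u).
  rewrite big1// => i _ /=; rewrite indicE mem_set//=.
  by move: xb; rewrite inE /box/= => /(_ i); rewrite in_itv.
have [i xi] : exists i, ~ (l 0 i <= x 0 i < u 0 i).
  by apply/existsNP => h; move/negP: xb; apply; rewrite inE.
rewrite (bigD1 i)//= indicE memNset ?mul0r//=.
Qed.

Lemma part_vold l u x : part_vol l u x d = boxvol l u.
Proof. by apply: eq_bigr => i _; rewrite ltn_ord. Qed.

Lemma part_volS l u x (j : 'I_d) :
  (\int[lebesgue_measure]_t (part_vol l u (set_coord x j t) j)%:E)%E
  = (part_vol l u x j.+1)%:E.
Proof.
pose c := \prod_(i < d | i != j) (if (i < j)%N then Num.max 0 (u 0 i - l 0 i)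
                 else \1_(`[l 0 i, u 0 i[ : set R) (x 0 i)).
have c0 : 0 <= c.
  apply: prodr_ge0 => i _; case: ifP => _; first by rewrite le_max lexx.
  by rewrite indicE.
have E t : part_vol l u (set_coord x j t) j = c * \1_(`[l 0 j, u 0 j[ : set R) t.
  rewrite /part_vol (bigD1 j)//= ltnn mxE eqxx mulrC; congr (_ * _).
  by apply: eq_bigr => i ij; rewrite mxE (negbTE ij).
under eq_integral do rewrite E EFinM.
rewrite ge0_integralZl//; last exact/measurable_EFinP/measurable_indic.
rewrite integral_indic//= setIT.
rewrite (lebesgue_measure_itv `[l 0 j, u 0 j[)/= lte_fin.
have -> : (if (l 0 j < u 0 j)%R then (u 0 j)%:E - (l 0 j)%:E else 0)%E
          = (Num.max 0 (u 0 j - l 0 j))%:E.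
  case: ltP => lu; first by rewrite -EFinB max_r// subr_ge0 ltW.
  by rewrite max_l// subr_le0.
rewrite -EFinM; congr EFin.
rewrite /part_vol [RHS](bigD1 j)//= ltnS leqnn mulrC; congr (_ * _).
apply: eq_bigr => i ij; rewrite ltnS [in RHS]leq_eqVlt.
by have /negbTE -> : (i : nat) != j by [].
Qed.

Lemma measurable_part_vol l u x (j : 'I_d) :
  measurable_fun setT (fun t => (part_vol l u (set_coord x j t) j)%:E).
Proof.
apply/measurable_EFinP.
apply: (@measurable_prod _ _ _ _ _ (index_enum 'I_d)) => i _.
case: ltnP => ij; first exact: measurable_cst.
under eq_fun do rewrite mxE.
case: eqP => _; last exact: measurable_cst.
exact/measurable_indic.
Qed.

Variable nu : {measure set R -> \bar R}.

(** Fubini by hand: the inequality between sums of indicators is integrated over one real coordinate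
    after another, then against [nu]. It yields all the lower bounds on the weight of a cover, both
    for [intensity] and for the count of lattice points. *)
Lemma box_cover_le (l u l' u' : nat -> 'rV[R]_d) (B B' : nat -> set R) :
  (forall n, measurable (B n)) -> (forall n, measurable (B' n)) ->
  (forall x r, \sum_(0 <= n <oo) ((\1_(box (l n) (u n)) x : R) * \1_(B n) r)%:E <=
     \sum_(0 <= n <oo) ((\1_(box (l' n) (u' n)) x : R) * \1_(B' n) r)%:E)%E ->
  (\sum_(0 <= n <oo) (boxvol (l n) (u n))%:E * nu (B n) <=
   \sum_(0 <= n <oo) (boxvol (l' n) (u' n))%:E * nu (B' n))%E.
Proof.
move=> mB mB' H.
have ge0 l0 u0 x j (C : set R) r : (0 <= (part_vol l0 u0 x j * \1_C r)%:E)%E.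
  by rewrite lee_fin mulr_ge0 ?part_vol_ge0// indicE.
(* [j] is the number of coordinates already integrated. *)
have K j x r : (j <= d)%N ->
    (\sum_(0 <= n <oo) (part_vol (l n) (u n) x j * \1_(B n) r)%:E <=
     \sum_(0 <= n <oo) (part_vol (l' n) (u' n) x j * \1_(B' n) r)%:E)%E.
  elim: j x => [|j IH] x jd.
    have := H x r.
    by under eq_eseriesr do rewrite -part_vol0;
       under [X in (_ <= X)%E]eq_eseriesr do rewrite -part_vol0.
  pose J := Ordinal jd.
  have step (l0 u0 : nat -> 'rV[R]_d) (C : nat -> set R) :
      (\sum_(0 <= n <oo) (part_vol (l0 n) (u0 n) x j.+1 * \1_(C n) r)%:E)%E =
      (\int[lebesgue_measure]_t \sum_(0 <= n <oo)
         (part_vol (l0 n) (u0 n) (set_coord x J t) j * \1_(C n) r)%:E)%E.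
    rewrite integral_nneseries//; last first.
      move=> n; under eq_fun do rewrite EFinM.
      apply: emeasurable_funM; last exact: measurable_cst.
      exact: (measurable_part_vol _ _ _ J).
    apply: eq_eseriesr => n _; under eq_integral do rewrite EFinM.
    rewrite ge0_integralZr//.
    - by rewrite (part_volS (l0 n) (u0 n) x J) EFinM.
    - exact: (measurable_part_vol _ _ _ J).
    - by move=> t _; rewrite lee_fin part_vol_ge0.
  have mpv (l0 u0 : nat -> 'rV[R]_d) (C : nat -> set R) :
    measurable_fun setT (fun t => \sum_(0 <= n <oo)
      (part_vol (l0 n) (u0 n) (set_coord x J t) j * \1_(C n) r)%:E)%E.
    apply: ge0_emeasurable_sum => // n _.
    under eq_fun do rewrite EFinM.
    by apply: emeasurable_funM; [exact: (measurable_part_vol _ _ _ J)|exact: measurable_cst].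
  rewrite !step; apply: ge0_le_integral => //; last by move=> t _; apply: IH; exact: ltnW.
  - by move=> t _; exact: nneseries_ge0.
  - exact: mpv.
  - exact: mpv.
have mI (C : nat -> set R) n (c : R) : measurable (C n) ->
    measurable_fun setT (fun r : R => (c * \1_(C n) r)%:E).
  by move=> mC; apply/measurable_EFinP; apply: measurable_funM => //; exact: measurable_indic.
have bv0 l0 u0 : 0 <= boxvol l0 u0 :> R.
  by apply: prodr_ge0 => i _; rewrite le_max lexx.
have last (l0 u0 : nat -> 'rV[R]_d) (C : nat -> set R) : (forall n, measurable (C n)) ->
   (\sum_(0 <= n <oo) (boxvol (l0 n) (u0 n))%:E * nu (C n))%E =
   (\int[nu]_r \sum_(0 <= n <oo) (boxvol (l0 n) (u0 n) * \1_(C n) r)%:E)%E.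
  move=> mC; rewrite integral_nneseries//; first last.
  - by move=> n r _; rewrite lee_fin mulr_ge0// ?bv0// indicE.
  - by move=> n; exact: mI.
  apply: eq_eseriesr => n _; under eq_integral do rewrite EFinM.
  rewrite ge0_integralZl//.
  - by rewrite integral_indic// setIT.
  - exact/measurable_EFinP/measurable_indic.
  - by rewrite lee_fin bv0.
rewrite !last//; apply: ge0_le_integral => //.
- by move=> r _; apply: nneseries_ge0 => n _ _; rewrite lee_fin mulr_ge0// indicE.
- apply: ge0_emeasurable_sum => [n r _ _|n _]; last exact: mI.
  by rewrite lee_fin mulr_ge0// indicE.
- apply: ge0_emeasurable_sum => [n r _ _|n _]; last exact: mI.
  by rewrite lee_fin mulr_ge0// indicE.
- move=> r _; have := K d 0 r (leqnn _).
  by under eq_eseriesr do rewrite part_vold;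
     under [X in (_ <= X)%E]eq_eseriesr do rewrite part_vold.
Qed.

End BoxIntegration.

(** * Outer measures defined by weighted covers *)

Section CoverOuterMeasure.
Variables (R : realType) (T : Type) (I : Type).
Variables (adm : set I) (S : I -> set T) (w : I -> \bar R) (i0 : I).
Hypotheses (w_ge0 : forall i, adm i -> (0 <= w i)%E)
  (adm0 : adm i0) (w0 : w i0 = 0%E).

Definition cover_outer (A : set T) : \bar R :=
  ereal_inf [set s | exists f : nat -> I, [/\ forall n, adm (f n),
     A `<=` \bigcup_n S (f n) & s = (\sum_(0 <= n <oo) w (f n))%E]].

Lemma cover_outer_ge0 A : (0 <= cover_outer A)%E.
Proof.
by apply: le_ereal_inf_tmp => _ [f [af _ ->]]; apply: nneseries_ge0 => n _ _; exact: w_ge0.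
Qed.

Lemma cover_outer0 : cover_outer set0 = 0%E.
Proof.
apply/eqP; rewrite eq_le cover_outer_ge0 andbT.
apply: ereal_inf_lbound; exists (fun=> i0); split => //.
by rewrite eseries0.
Qed.

Lemma cover_outer_le A B : A `<=` B -> (cover_outer A <= cover_outer B)%E.
Proof.
move=> AB; apply: ereal_inf_le_tmp => _ [f [af Bf ->]].
by exists f; split => //; exact: subset_trans Bf.
Qed.

Lemma cover_outer_sigma_subadditive : sigma_subadditive cover_outer.
Proof.
move=> A; have [[i ioo]|] := pselect (exists i, cover_outer (A i) = +oo%E).
  rewrite (eseries_pinfty _ _ ioo) ?leey// => n _.
  by rewrite -ltNye (lt_le_trans _ (cover_outer_ge0 _)).
rewrite -forallNE => Aoo.
suff add2e (e : {posnum R}) : (cover_outer (\bigcup_n A n) <=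
    \sum_(i <oo) cover_outer (A i) + e%:num%:E)%E.
  by apply/lee_addgt0Pr => _/posnumP[].
rewrite (le_trans _ (epsilon_trick _ _ _))//; last first.
  by move=> n; exact: cover_outer_ge0.
pose P n (B : nat -> I) := [/\ forall k, adm (B k), A n `<=` \bigcup_k S (B k) &
  (\sum_(0 <= k <oo) w (B k) <= cover_outer (A n) + (e%:num / (2 ^ n.+1)%:R)%:E)%E].
have [G PG] : {G : nat -> nat -> I & forall n, P n (G n)}.
  apply: (@choice _ _ P) => n; rewrite /P /cover_outer.
  set X := (X in ereal_inf X); move infX : (ereal_inf X) => iX.
  case: iX infX => [r Xr|Xoo|Xoo].
  - have en1 : 0 < e%:num / (2 ^ n.+1)%:R by [].
    have /(lb_ereal_inf_adherent en1) : ereal_inf X \is a fin_num by rewrite Xr.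
    move=> [_ [B [aB AnB ->]] xX].
    by exists B; split => //; rewrite -Xr; exact/ltW.
  - by have := Aoo n; rewrite /cover_outer Xoo.
  - by have := cover_outer_ge0 (A n); rewrite /cover_outer Xoo.
have aG n m : adm (G n m) by have [+ _ _] := PG n; apply.
have wG k : (0 <= w (uncurry G k))%E by apply: w_ge0; case: k.
apply: (@le_trans _ _ (\esum_(i in setT) w (uncurry G i))).
  (* The double sequence of covers is reindexed by a bijection between the integers and the
     pairs. *)
  have /card_esym/ppcard_eqP[f] := card_nat2.
  apply: ereal_inf_lbound => /=; exists (uncurry G \o f); split.
  - by move=> n /=; case: (f n).
  - move=> t [i _ /= Ai]; have [_ /(_ _ Ai)[j _ Sij] _] := PG i.
    by exists (f^-1%FUN (i, j)) => //=; rewrite invK ?inE.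
  rewrite -(esum_pred_image (w \o uncurry G) _ xpredT)//.
    congr esum; apply/seteqP; split=> // z _.
    by exists (f^-1%FUN z) => //; rewrite invK ?inE.
  - by move=> n _; exact: wG.
  - by move=> x y _ _; exact: (@injT _ _ f).
have -> : (\esum_(i in [set: nat * nat]) w (uncurry G i) =
    \sum_(i <oo) \sum_(j <oo) w (G i j))%E.
  rewrite nneseries_esumT; last by move=> n; apply: nneseries_ge0 => m _ _; exact: (wG (n, m)).
  transitivity (\esum_(i in [set: nat]) \esum_(j in [set: nat]) w (G i j))%E; last first.
    by apply: eq_esum => i _; rewrite nneseries_esumT// => m; exact: (wG (i, m)).
  rewrite esum_esum; last by move=> i j _ _; exact: (wG (i, j)).
  rewrite (_ : [set: nat] `*`` _ = setT); last by apply/seteqP; split=> -[].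
  by apply: eq_esum => -[].
apply: lee_nneseries => [i _ _|i _]; last by have [] := PG i.
by apply: nneseries_ge0 => m _ _; exact: (wG (i, m)).
Qed.

Definition cover_outer_measure : {outer_measure set T -> \bar R} :=
  HB.pack cover_outer (isOuterMeasure.Build R T cover_outer
    cover_outer0 cover_outer_ge0 cover_outer_le cover_outer_sigma_subadditive).

(** Cutting each piece of a cover of [X] along [H] gives a cover of each of the two parts of [X], so
    measurability has only to be tested on the covering sets. *)
Lemma cover_outer_caratheodory (H : set T) :
  (forall i, adm i -> exists i1 i2, [/\ adm i1, adm i2, S i `&` H `<=` S i1,
     S i `&` ~` H `<=` S i2 & (w i1 + w i2 <= w i)%E]) ->
  cover_outer_measure.-caratheodory H.
Proof.
move=> split_H; apply: le_caratheodory_measurable => X.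
apply: le_ereal_inf_tmp => _ [f [af Xf ->]].
have [g1 Hg1] := choice (fun n => split_H (f n) (af n)).
have [g2 Hg2] := choice Hg1.
apply: (@le_trans _ _ (\sum_(0 <= n <oo) w (g1 n) + \sum_(0 <= n <oo) w (g2 n))%E).
  apply: leeD; apply: ereal_inf_lbound.
    exists g1; split => [n||//]; first by have [] := Hg2 n.
    move=> t [/Xf[n _ tn] Ht]; exists n => //.
    by have [_ _ + _ _] := Hg2 n; apply.
  exists g2; split => [n||//]; first by have [] := Hg2 n.
  move=> t [/Xf[n _ tn] Ht]; exists n => //.
  by have [_ _ _ + _] := Hg2 n; apply.
rewrite -nneseriesD; first last.
- by move=> n _ _; apply: w_ge0; have [] := Hg2 n.
- by move=> n _ _; apply: w_ge0; have [] := Hg2 n.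
apply: lee_nneseries => [n _ _|n _]; last by have [] := Hg2 n.
by apply: adde_ge0; apply: w_ge0; have [] := Hg2 n.
Qed.

End CoverOuterMeasure.

(** * Measurability of Borel sets and measure of boxes *)

Section Intensity.
Variables (R : realType) (d : nat) (lam : R) (nu : {measure set R -> \bar R}).
Hypothesis lam_ge0 : 0 <= lam.
Local Notation T := ('rV[R]_d * R)%type.
Let I : Type := ('rV[R]_d * 'rV[R]_d * set R)%type.
Let adm : set I := [set i | measurable i.2].
Let S (i : I) : set T := box i.1.1 i.1.2 `*` i.2.
Let w (i : I) : \bar R := ((boxvol i.1.1 i.1.2 * lam)%:E * nu i.2)%E.
Let i0 : I := (0, 0, set0).

Lemma boxvol_ge0 (l u : 'rV[R]_d) : 0 <= boxvol l u.
Proof. by apply: prodr_ge0 => i _; rewrite le_max lexx. Qed.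

Lemma intensity_weight_ge0 i : adm i -> (0 <= w i)%E.
Proof. by move=> _; apply: mule_ge0 => //; rewrite lee_fin mulr_ge0// boxvol_ge0. Qed.

Lemma intensityE : intensity lam nu = cover_outer adm S w.
Proof.
apply/funext => A; congr ereal_inf; apply/seteqP; split => [s|s].
  move=> [l [u [B [mB [AB ->]]]]].
  by exists (fun n => (l n, u n, B n)); split.
move=> [f [af Af ->]].
by exists (fun n => (f n).1.1), (fun n => (f n).1.2), (fun n => (f n).2).
Qed.

Let w0 : w i0 = 0%E. Proof. by rewrite /w/= measure0 mule0. Qed.

Definition intensity_outer : {outer_measure set T -> \bar R} :=
  @cover_outer_measure R T I adm S w i0 (@intensity_weight_ge0)
    (measurable0 : adm i0) w0.

Lemma intensity_outerE A : intensity_outer A = intensity lam nu A.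
Proof. by rewrite intensityE. Qed.

Definition half_space (j : 'I_d) (c : R) : set T := [set z : T | z.1 0 j < c].

(** The hyperplane cuts a box into two boxes: the upper corner is lowered to [c] for one, the lower
    corner is raised to [c] for the other. *)
Lemma caratheodory_half_space j c : intensity_outer.-caratheodory (half_space j c).
Proof.
apply: cover_outer_caratheodory => -[[l u] B] mB.
pose u1 : 'rV[R]_d := \row_i (if i == j then Num.min (u 0 i) c else u 0 i).
pose l2 : 'rV[R]_d := \row_i (if i == j then Num.max (l 0 i) c else l 0 i).
exists (l, u1, B), (l2, u, B); split => //.
- move=> [x r] [[/= xb Br] xc]; split => //= i; rewrite mxE.
  have /andP[-> xu] /= := xb i; case: eqP => [->|_//].
  by rewrite lt_min xc andbT; have /andP[] := xb j.
- move=> [x r] [[/= xb Br] /negP xc]; split => //= i; rewrite mxE.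
  have /andP[xl ->] /= := xb i; rewrite andbT; case: eqP => [->|_//].
  by rewrite ge_max; have /andP[-> _] := xb j; rewrite leNgt.
rewrite /w/= -ge0_muleDl ?lee_fin ?mulr_ge0 ?boxvol_ge0//.
rewrite -EFinD; apply: lee_wpmul2r; first exact: measure_ge0.
rewrite lee_fin -mulrDl ler_wpM2r//.
have bvE (l0 u0 : 'rV[R]_d) : boxvol l0 u0 = Num.max 0 (u0 0 j - l0 0 j) *
    \prod_(i < d | i != j) Num.max 0 (u0 0 i - l0 0 i) by rewrite /boxvol (bigD1 j).
rewrite !bvE.
have E1 : \prod_(i < d | i != j) Num.max 0 (u1 0 i - l 0 i) =
    \prod_(i < d | i != j) Num.max 0 (u 0 i - l 0 i).
  by apply: eq_bigr => i ij; rewrite mxE (negbTE ij).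
have E2 : \prod_(i < d | i != j) Num.max 0 (u 0 i - l2 0 i) =
    \prod_(i < d | i != j) Num.max 0 (u 0 i - l 0 i).
  by apply: eq_bigr => i ij; rewrite mxE (negbTE ij).
rewrite E1 E2 -mulrDl ler_wpM2r ?prodr_ge0// => [i _|]; first by rewrite le_max lexx.
rewrite !mxE eqxx; move: (u 0 j) (l 0 j) => p q.
have [pc|cp] := leP p c; have [qc|cq] := leP q c.
- by rewrite [Num.max 0 (p - c)]max_l ?addr0// subr_le0.
- rewrite ![Num.max 0 _]max_l ?addr0// subr_le0 ?(le_trans pc (ltW cq))//.
- rewrite !max_r ?subr_ge0 ?(ltW cp)//; last exact: le_trans (ltW cp).
  by rewrite addrC addrA subrK.
- by rewrite [Num.max 0 (c - q)]max_l ?add0r// subr_le0 ltW.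
Qed.

Lemma caratheodory_cylinder (C : set R) : measurable C ->
  intensity_outer.-caratheodory (setT `*` C).
Proof.
move=> mC; apply: cover_outer_caratheodory => -[[l u] B] mB.
exists (l, u, B `&` C), (l, u, B `&` ~` C); split.
- exact: measurableI.
- by apply: measurableI => //; exact: measurableC.
- by move=> [x r] [[/= ? ?] [_ ?]].
- by move=> [x r] [[/= ? ?] nC]; split => //; split => // Cr; apply: nC.
rewrite /w/= -ge0_muleDr// -measureU//; first by rewrite -setIUr setUv setIT.
- exact: measurableI.
- by apply: measurableI => //; exact: measurableC.
- by rewrite setIACA setICr setI0.
Qed.

Lemma caratheodory_box (l u : 'rV[R]_d) (B : set R) : measurable B ->
  intensity_outer.-caratheodory (box l u `*` B).
Proof.
move=> mB.
have -> : box l u `*` B = (\bigcap_(i in [set: 'I_d])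
    (~` half_space i (l 0 i) `&` half_space i (u 0 i))) `&` (setT `*` B).
  apply/seteqP; split => [[x r] [/= xb Br]|[x r] [/= xb [_ Br]]]; split => //.
    move=> i _; have /andP[li ui] := xb i; split => //=.
    by apply/negP; rewrite -leNgt.
  by move=> i; have [/negP] := xb i Logic.I; rewrite -leNgt => -> ->.
apply: caratheodory_measurable_setI; last exact: caratheodory_cylinder.
apply: (@fin_bigcap_measurable _ (caratheodory_type intensity_outer)) => // i _.
apply: (@measurableI _ (caratheodory_type intensity_outer)).
  apply: (@measurableC _ (caratheodory_type intensity_outer)).
  exact: caratheodory_half_space.
exact: caratheodory_half_space.
Qed.

Lemma open_countable_box (B : set T) : open B ->
  exists (l u : nat -> 'rV[R]_d) (C : nat -> set R),
    (forall n, measurable (C n)) /\ B = \bigcup_n (box (l n) (u n) `*` C n).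
Proof.
move=> oB.
pose J : countType := ('rV[rat]_d * 'rV[rat]_d * (rat * rat))%type.
pose lj (j : J) : 'rV[R]_d := map_mx ratr j.1.1.
pose uj (j : J) : 'rV[R]_d := map_mx ratr j.1.2.
pose cj (j : J) : set R := [set` `[ratr j.2.1 : R, ratr j.2.2[].
(* Codes that decode to nothing, or to a box that leaves [B], will contribute a product with the
   empty set. *)
pose ok (n : nat) : option J := if unpickle n is Some j then
  (if `[< box (lj j) (uj j) `*` cj j `<=` B >] then Some j else None) else None.
exists (fun n => if ok n is Some j then lj j else 0).
exists (fun n => if ok n is Some j then uj j else 0).
exists (fun n => if ok n is Some j then cj j else set0).
split.
  by move=> n; case: (ok n) => [j|//]; exact: measurable_itv.
apply/seteqP; split => [[x r] Bz|[x r] [n _]]; last first.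
  rewrite /ok; case: unpickle => [j|]; last by case.
  by case: asboolP => [sub /sub//|_ []].
have [e /= e0 eB] : exists2 e : R, 0 < e & ball (x, r) e `<=` B.
  by have /nbhs_ballP := open_nbhs_nbhs (conj oB Bz).
have rat_near (y : R) : exists p : rat * rat, [/\ y - e < ratr p.1 <= y & y < ratr p.2 < y + e].
  have [q /[!in_itv]/= /andP[q1 q2]] := @rat_in_itvoo R (y - e) y ltac:(by rewrite gtrBl).
  have [q' /[!in_itv]/= q'1] := @rat_in_itvoo R y (y + e) ltac:(by rewrite ltrDl).
  by exists (q, q'); rewrite /= q1 (ltW q2).
have [p Hp] := choice (fun i : 'I_d => rat_near (x 0 i)).
have [s [/andP[s1 s2] /andP[s3 s4]]] := rat_near r.
pose j : J := (\row_i (p i).1, \row_i (p i).2, s).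
exists (pickle j) => //; rewrite /ok pickleK; case: asboolP => [_|nsub].
  split; last by rewrite /cj/= in_itv/= s2 s3.
  by move=> i; rewrite !mxE; have [/andP[_ ->] /andP[-> _]] := Hp i.
exfalso; apply: nsub => -[y t] [/= yb]; rewrite /cj/= in_itv/= => /andP[t1 t2].
apply: eB; split => /=; last first.
  rewrite /ball/= ltr_distlC; apply/andP; split.
    by apply: lt_le_trans t1.
  exact: lt_trans s4.
split => // i' i; rewrite (ord1 i') /ball/= ltr_distlC.
have := yb i; rewrite !mxE => /andP[y1 y2].
have [/andP[h1 h2] /andP[h3 h4]] := Hp i.
by rewrite (lt_le_trans h1 y1) (lt_trans y2 h4).
Qed.

Lemma Borel_caratheodory (A : set T) : Borel A -> intensity_outer.-caratheodory A.
Proof.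
apply: smallest_sub => [|B /open_countable_box[l [u [C [mC ->]]]]].
  split => [|D mD|F mF].
  - exact: (@measurable0 _ (caratheodory_type intensity_outer)).
  - rewrite setTD; exact: (@measurableC _ (caratheodory_type intensity_outer)).
  - exact: (@bigcupT_measurable _ (caratheodory_type intensity_outer)).
apply: (@bigcupT_measurable _ (caratheodory_type intensity_outer)) => n.
exact: caratheodory_box.
Qed.

(** The lower bound is the substantial half: the indicator of the box is dominated by the sum of
    those of any cover, which [box_cover_le] turns into weights. *)
Lemma intensity_box (l u : 'rV[R]_d) (B : set R) : measurable B ->
  intensity lam nu (box l u `*` B) = ((boxvol l u * lam)%:E * nu B)%E.
Proof.
move=> mB; apply/eqP; rewrite eq_le; apply/andP; split.
  apply: ereal_inf_lbound; exists (fun=> l), (fun=> u), (fun n => if n is 0 then B else set0).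
  split; first by case.
  split; first by move=> z Az; exists 0%N.
  rewrite nneseries_recl//; last first.
    by move=> k _; apply: mule_ge0 => //; rewrite lee_fin mulr_ge0// boxvol_ge0.
  rewrite eseries_cond eseries0 ?adde0// => -[|k]//= _ _.
  by rewrite measure0 mule0.
apply: le_ereal_inf_tmp => _ [l' [u' [B' [mB' [AB' ->]]]]].
under eq_eseriesr do rewrite mulrC EFinM -muleA.
rewrite nneseriesZl; last first.
  by move=> n _; rewrite mule_ge0// lee_fin boxvol_ge0.
rewrite mulrC EFinM -muleA; apply: lee_wpmul2l => //.
pose B1 n := if n is 0 then B else set0.
have -> : ((boxvol l u)%:E * nu B = \sum_(0 <= n <oo) (boxvol l u)%:E * nu (B1 n))%E.
  rewrite nneseries_recl//; last first.
    by move=> k _; apply: mule_ge0 => //; rewrite lee_fin boxvol_ge0.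
  rewrite eseries_cond eseries0 ?adde0// => -[|k]//= _ _.
  by rewrite measure0 mule0.
apply: (@box_cover_le _ _ _ (fun=> l) (fun=> u)) => //; first by case=> [|n]; rewrite /B1.
move=> x r.
have ind0 (l0 u0 : 'rV[R]_d) (C : set R) : (0 <= ((\1_(box l0 u0) x : R) * \1_C r)%:E)%E.
  by rewrite lee_fin mulr_ge0// indicE.
rewrite nneseries_recl// eseries_cond eseries0 ?adde0; last first.
  by move=> -[|k]//= _ _; rewrite indic0 mulr0.
have [[xb rB]|nA] := pselect ((box l u `*` B) (x, r)); last first.
  rewrite [X in (X <= _)%E](_ : _ = 0%E); last first.
    rewrite !indicE; case: (boolP (x \in _)) => [/[!inE] xb|]; last by rewrite mul0r.
    case: (boolP (r \in _)) => [/[!inE] rB|]; last by rewrite mulr0.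
    by exfalso; apply: nA.
  exact: nneseries_ge0.
have [m _ [/= xm rm]] := AB' (x, r) (conj xb rB).
apply: (@le_trans _ _ ((\1_(box (l' m) (u' m)) x : R) * \1_(B' m) r)%:E).
  by rewrite !indicE !mem_set.
rewrite (nneseriesD1 (n := m))//.
by rewrite leeDl// nneseries_ge0.
Qed.

End Intensity.

(** * Lattice points in balls *)

Section Enorm.
Variables (R : realType) (d : nat).
Implicit Types (x y z : 'rV[R]_d) (c : R).

Definition dot x y : R := \sum_(i < d) x 0 i * y 0 i.

Lemma dotC x y : dot x y = dot y x.
Proof. by apply: eq_bigr => i _; rewrite mulrC. Qed.

Lemma dotDl x y z : dot (x + y) z = dot x z + dot y z.
Proof. by rewrite -big_split; apply: eq_bigr => i _; rewrite mxE mulrDl. Qed.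

Lemma dotZl c x y : dot (c *: x) y = c * dot x y.
Proof. by rewrite mulr_sumr; apply: eq_bigr => i _; rewrite mxE mulrA. Qed.

Lemma dotDr x y z : dot z (x + y) = dot z x + dot z y.
Proof. by rewrite dotC dotDl !(dotC z). Qed.

Lemma dotZr c x y : dot x (c *: y) = c * dot x y.
Proof. by rewrite dotC dotZl dotC. Qed.

Lemma dotNl x y : dot (- x) y = - dot x y.
Proof. by rewrite -scaleN1r dotZl mulN1r. Qed.

Lemma dotNr x y : dot x (- y) = - dot x y.
Proof. by rewrite dotC dotNl dotC. Qed.

Lemma dot_ge0 x : 0 <= dot x x.
Proof. by apply: sumr_ge0 => i _; rewrite -expr2 sqr_ge0. Qed.

Lemma enormE x : enorm x = Num.sqrt (dot x x).
Proof. by congr Num.sqrt; apply: eq_bigr => i _; rewrite expr2. Qed.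

Lemma enorm_ge0 x : 0 <= enorm x. Proof. exact: sqrtr_ge0. Qed.

Lemma sqr_enorm x : enorm x ^+ 2 = dot x x.
Proof. by rewrite enormE sqr_sqrtr ?dot_ge0. Qed.

Lemma dot_eq0 x : dot x x = 0 -> x = 0.
Proof.
move=> /eqP; rewrite psumr_eq0 => [/allP h|i _]; last by rewrite -expr2 sqr_ge0.
apply/rowP => i; rewrite mxE.
by have := h i (mem_index_enum _); rewrite mulf_eq0 orbb => /eqP.
Qed.

Lemma cauchy_schwarz x y : dot x y <= enorm x * enorm y.
Proof.
apply: le_trans (ler_norm _) _.
rewrite -(@ler_pXn2r _ 2)// ?nnegrE ?mulr_ge0 ?enorm_ge0 ?normr_ge0//.
rewrite exprMn !sqr_enorm real_normK ?num_real//.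
have := dot_ge0 (dot y y *: x - dot x y *: y).
rewrite dotDl !dotDr dotNl !dotNr !dotZl !dotZr dotNl !dotZl (dotC y x).
have [y0|y0] := eqVneq (dot y y) 0.
  move=> _; rewrite (dot_eq0 y0); have -> : dot x (0 : 'rV[R]_d) = 0.
    by rewrite -(scale0r (0 : 'rV[R]_d)) dotZr mul0r.
  by rewrite expr0n mulr_ge0 ?dot_ge0.
have yp : 0 < dot y y by rewrite lt0r y0 dot_ge0.
move=> h; rewrite -subr_ge0 -(pmulr_rge0 _ yp); move: h; congr (_ <= _).
by ring.
Qed.

Lemma enormD x y : enorm (x + y) <= enorm x + enorm y.
Proof.
rewrite -(@ler_pXn2r _ 2)// ?nnegrE ?addr_ge0 ?enorm_ge0//.
rewrite sqr_enorm sqrrD !sqr_enorm dotDl !dotDr (dotC y x).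
have := cauchy_schwarz x y; lra.
Qed.

Lemma enormN x : enorm (- x) = enorm x.
Proof. by rewrite !enormE dotNl dotNr opprK. Qed.

Lemma enormZ c x : enorm (c *: x) = `|c| * enorm x.
Proof.
by rewrite !enormE dotZl dotZr mulrA -expr2 sqrtrM ?sqr_ge0// sqrtr_sqr.
Qed.

Lemma enorm0 : enorm (0 : 'rV[R]_d) = 0.
Proof. by rewrite -(scale0r 0) enormZ normr0 mul0r. Qed.

Lemma enormB_sym x y : enorm (x - y) = enorm (y - x).
Proof. by rewrite -enormN opprB. Qed.

Lemma enorm_tri z x y : enorm (x - y) <= enorm (x - z) + enorm (z - y).
Proof. by apply: le_trans (enormD _ _); rewrite addrA subrK. Qed.

Lemma coord_le_enorm x i : `|x 0 i| <= enorm x.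
Proof.
rewrite -(@ler_pXn2r _ 2)// ?nnegrE ?enorm_ge0//.
rewrite sqr_enorm real_normK ?num_real// /dot (bigD1 i)//= -expr2 lerDl.
by apply: sumr_ge0 => j _; rewrite -expr2 sqr_ge0.
Qed.

Lemma enorm_le_const x c : 0 <= c -> (forall i, `|x 0 i| <= c) ->
  enorm x <= c * Num.sqrt d%:R.
Proof.
move=> c0 xc; rewrite -(@ler_pXn2r _ 2)// ?nnegrE ?mulr_ge0 ?sqrtr_ge0 ?enorm_ge0//.
rewrite sqr_enorm exprMn sqr_sqrtr// mulr_natr -[X in _ *+ X]card_ord -sumr_const.
apply: ler_sum => i _; rewrite -expr2 -real_normK ?num_real//.
by rewrite ler_pXn2r// nnegrE.
Qed.

End Enorm.

(** * Counting lattice points by volumes *)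

Section Lattice.
Variables (R : realType) (d : nat).
Implicit Types (x : 'rV[R]_d) (q : 'rV[int]_d) (h r : R).

Definition lat h q : 'rV[R]_d := \row_i (h * (q 0 i)%:~R).
Definition lat_cube h q : set 'rV[R]_d := box (lat h q) (\row_i (h * ((q 0 i)%:~R + 1))).
Definition cell h x : 'rV[int]_d := \row_i Num.floor (x 0 i / h).

Lemma lat_cubeP h q x : 0 < h -> lat_cube h q x <-> cell h x = q.
Proof.
move=> h0; split=> [xq|<- i].
  apply/rowP => i; rewrite mxE; have := xq i; rewrite !mxE => /andP[a b].
  apply/Num.Theory.floor_def; rewrite intrD ler_pdivlMr// ltr_pdivrMr//.
  by rewrite mulrC a mulrC b.
rewrite !mxE; have /andP[a b] := Num.Theory.floor_itv (x 0 i / h).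
by rewrite intrD in b; rewrite mulrC -ler_pdivlMr// a mulrC -ltr_pdivrMr.
Qed.

Lemma boxvol_lat_cube h q : 0 <= h ->
  boxvol (lat h q) (\row_i (h * ((q 0 i)%:~R + 1))) = h ^+ d.
Proof.
move=> h0; rewrite -[X in h ^+ X]card_ord -prodr_const; apply: eq_bigr => i _.
by rewrite !mxE -mulrBr addrAC subrr add0r mulr1 max_r.
Qed.

Lemma lat_cube_dist h q x : 0 < h -> lat_cube h q x ->
  enorm (x - lat h q) <= h * Num.sqrt d%:R.
Proof.
move=> h0 xq; apply: enorm_le_const; first exact: ltW.
move=> i; have := xq i; rewrite !mxE => /andP[a b].
rewrite ger0_norm ?subr_ge0//; move: b; rewrite mulrDr mulr1; lra.
Qed.

Lemma latB h q q' : lat h (q - q') = lat h q - lat h q'.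
Proof. by apply/rowP => i; rewrite !mxE intrB mulrBr. Qed.

Lemma latD h q q' : lat h (q + q') = lat h q + lat h q'.
Proof. by apply/rowP => i; rewrite !mxE intrD mulrDr. Qed.

Definition int_box (M : nat) : seq 'rV[int]_d :=
  [seq (\row_i ((v 0 i : nat)%:Z - M%:Z) : 'rV[int]_d) | v : 'rV['I_(M + M).+1]_d].

Lemma int_box_uniq M : uniq (int_box M).
Proof.
rewrite map_inj_uniq ?enum_uniq// => u v /rowP uv; apply/rowP => i.
by have := uv i; rewrite !mxE => /addIr [] /val_inj.
Qed.

Lemma mem_int_box M q : (forall i, `|q 0 i| <= M%:Z) -> q \in int_box M.
Proof.
move=> qM; apply/mapP; exists (\row_i inord (absz (q 0 i + M%:Z))).
  by rewrite mem_enum.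
apply/rowP => i; rewrite !mxE; have := qM i; rewrite ler_norml => /andP[a b].
have ge0 : 0 <= q 0 i + M%:Z by rewrite -lerBlDr sub0r.
rewrite inordK; first by rewrite gez0_abs// addrK.
by rewrite ltnS -lez_nat gez0_abs// PoszD lerD2r.
Qed.

(** Points of the ball have coordinates at most [enorm x + r] in absolute value, so filtering a box
    of this size loses none of them. *)
Definition ball_bound h x r : nat := (Num.truncn ((enorm x + r) / h)).+1.

Definition ball_pts h x r : seq 'rV[int]_d :=
  [seq q <- int_box (ball_bound h x r) | enorm (lat h q - x) <= r].

Lemma ball_pts_uniq h x r : uniq (ball_pts h x r).
Proof. by rewrite filter_uniq// int_box_uniq. Qed.

Lemma mem_ball_pts h x r q : 0 < h ->
  (q \in ball_pts h x r) = (enorm (lat h q - x) <= r).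
Proof.
move=> h0; rewrite mem_filter; apply: andb_idr => qr; apply: mem_int_box => i.
have r0 : 0 <= r by apply: le_trans qr; exact: enorm_ge0.
have : `|(lat h q) 0 i| <= enorm x + r.
  apply: le_trans (coord_le_enorm _ _) _.
  by rewrite -[X in enorm X](subrK x) addrC (le_trans (enormD _ _))// lerD2l.
rewrite mxE normrM gtr0_norm// mulrC -ler_pdivlMr// => qx.
rewrite -(ler_int R) intr_norm; apply: le_trans qx _; apply: ltW.
by have := Num.Theory.truncnS_gt ((enorm x + r) / h).
Qed.

Lemma lebesgue_d_affine (A B : set 'rV[R]_d) (c : R) (t : 'rV[R]_d) : 0 < c ->
  (forall x, B x -> A (c^-1 *: (x - t))) ->
  (lebesgue_d B <= (c ^+ d)%:E * lebesgue_d A)%E.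
Proof.
move=> c0 BA; rewrite [X in (_ <= _ * X)%E]/lebesgue_d -lee_pdivrMl ?exprn_gt0//.
apply: le_ereal_inf_tmp => _ [l [u [AC ->]]].
rewrite lee_pdivrMl ?exprn_gt0// -nneseriesZl; last first.
  by move=> n _; rewrite lee_fin boxvol_ge0.
apply: ereal_inf_lbound; exists (fun n => c *: l n + t), (fun n => c *: u n + t); split.
  move=> x /BA/AC[n _ bx]; exists n => // i; have := bx i.
  rewrite !mxE => /andP[a b].
  move: a b; rewrite [_^-1 * _]mulrC ler_pdivlMr// ltr_pdivrMr// lerBrDr ltrBlDr.
  by rewrite ![_ * c]mulrC => -> ->.
apply: eq_eseriesr => n _; rewrite -EFinM; congr EFin.
rewrite -[X in c ^+ X]card_ord -prodr_const -big_split/=; apply: eq_bigr => i _.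
rewrite !mxE opprD addrACA subrr addr0 -mulrBr maxr_pMr ?(ltW c0)//.
by rewrite mulr0.
Qed.

Lemma lebesgue_d_le_seq (A : set 'rV[R]_d) (s : seq ('rV[R]_d * 'rV[R]_d)) :
  (0 < d)%N -> (forall x, A x -> exists2 b, b \in s & box b.1 b.2 x) ->
  (lebesgue_d A <= (\sum_(b <- s) boxvol b.1 b.2)%:E)%E.
Proof.
move=> d0 As; apply: ereal_inf_lbound.
exists (fun n => (nth (0, 0) s n).1), (fun n => (nth (0, 0) s n).2); split.
  move=> x /As[b bs bx]; exists (index b s) => //.
  by rewrite nth_index.
(* Past the end of [s] the default box has volume 0 because [d > 0]; in dimension 0 its empty
   product would be 1. *)
rewrite (nneseries_split _ (size s)); last by move=> k _; rewrite lee_fin boxvol_ge0.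
rewrite add0n [X in (_ + X)%E]eseries0; last first.
  move=> n /= sn _; rewrite nth_default//= /boxvol (bigD1 (Ordinal d0))//=.
  by rewrite !mxE subrr maxxx mul0r.
by rewrite adde0 sumEFin (big_nth (0, 0)).
Qed.

Lemma lebesgue_ball_lty : (0 < d)%N ->
  (lebesgue_d (eball (0 : 'rV[R]_d) 1) < +oo)%E.
Proof.
move=> d0.
apply: (@le_lt_trans _ _ (\sum_(b <- [:: (const_mx (-1) : 'rV[R]_d, const_mx 1)])
    boxvol b.1 b.2)%:E); last exact: ltry.
apply: lebesgue_d_le_seq => // x; rewrite /eball/= subr0 => x1.
eexists; first exact: mem_head.
move=> i /=; rewrite !mxE; have := le_lt_trans (coord_le_enorm x i) x1.
by rewrite ltr_norml => /andP[/ltW -> ->].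
Qed.

Lemma lebesgue_d_ge0 (A : set 'rV[R]_d) : (0 <= lebesgue_d A)%E.
Proof.
apply: le_ereal_inf_tmp => _ [l [u [_ ->]]]; apply: nneseries_ge0 => n _ _.
by rewrite lee_fin boxvol_ge0.
Qed.

Lemma vol_ballE : (0 < d)%N -> (vol_ball R d)%:E = lebesgue_d (eball (0 : 'rV[R]_d) 1).
Proof.
move=> d0; rewrite fineK// ge0_fin_numE ?lebesgue_d_ge0//.
exact: lebesgue_ball_lty.
Qed.

Lemma lebesgue_eball x r : (0 < d)%N -> 0 < r ->
  lebesgue_d (eball x r) = (r ^+ d * vol_ball R d)%:E.
Proof.
move=> d0 r0; rewrite EFinM vol_ballE//; apply/eqP; rewrite eq_le; apply/andP; split.
  apply: (@lebesgue_d_affine _ _ _ x) => // y; rewrite /eball/= subr0 => yx.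
  by rewrite enormZ gtr0_norm ?invr_gt0// mulrC ltr_pdivrMr// mul1r.
have : (lebesgue_d (eball (0 : 'rV[R]_d) 1) <= (r^-1 ^+ d)%:E * lebesgue_d (eball x r))%E.
  apply: (@lebesgue_d_affine _ _ _ (- (r^-1 *: x))); first by rewrite invr_gt0.
  move=> y; rewrite /eball/= subr0 => y1.
  rewrite opprK scalerDr scalerA invrK divff ?gt_eqF// scale1r addrK.
  by rewrite enormZ gtr0_norm// gtr_pMr.
by rewrite exprVn lee_pdivlMl ?exprn_gt0.
Qed.

(** The cubes attached to the lattice points are disjoint and lie in the ball of radius [r'], so
    every cover of that ball dominates the sum of their indicators. *)
Lemma ball_pts_le h x r r' : (0 < d)%N -> 0 < h -> 0 <= r ->
  r + h * Num.sqrt d%:R < r' ->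
  (size (ball_pts h x r))%:R * h ^+ d <= r' ^+ d * vol_ball R d.
Proof.
move=> d0 h0 r0 rr'; have r'0 : 0 < r'.
  by apply: le_lt_trans rr'; rewrite addr_ge0// mulr_ge0 ?sqrtr_ge0// ltW.
rewrite -lee_fin -(@lebesgue_eball x)//.
apply: le_ereal_inf_tmp => _ [l' [u' [sub ->]]].
set s := ball_pts h x r; pose N := size s; pose q n : 'rV[int]_d := nth 0 s n.
(* [B] switches off the terms after the last lattice point; with a Dirac mass for [nu] the weights
   reduce to volumes. *)
pose B n : set R := if (n < N)%N then setT else set0.
pose nu : {measure set R -> \bar R} := \d_(0 : R).
have ln : (\sum_(0 <= n <oo) (boxvol (l' n) (u' n))%:E =
    \sum_(0 <= n <oo) (boxvol (l' n) (u' n))%:E * nu setT)%E.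
  by apply: eq_eseriesr => n _; rewrite /nu/= diracE in_setT mule1.
rewrite ln.
have -> : (N%:R * h ^+ d)%:E = (\sum_(0 <= n <oo)
    (boxvol (lat h (q n)) (\row_i (h * ((q n 0 i)%:~R + 1))))%:E * nu (B n))%E.
  rewrite (nneseries_split _ N); last first.
    by move=> k _; rewrite mule_ge0// lee_fin boxvol_ge0.
  rewrite add0n [X in (_ + X)%E]eseries0; last first.
    by move=> n /= Nn _; rewrite /B ltnNge Nn/= measure0 mule0.
  rewrite adde0 (eq_big_nat _ _ (F2 := fun=> (h ^+ d)%:E)); last first.
    move=> n /andP[_ nN]; rewrite boxvol_lat_cube ?(ltW h0)//.
    by rewrite /B nN /nu/= diracE in_setT mule1.
  by rewrite sumEFin sumr_const_nat subn0 mulr_natl.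
apply: (@box_cover_le R d nu (fun n => lat h (q n))
  (fun n => \row_i (h * ((q n 0 i)%:~R + 1))) l' u' B (fun=> setT)) => //.
  by move=> n; rewrite /B; case: ifP.
move=> y t; have ind0 (l0 u0 : 'rV[R]_d) (C : set R) :
    (0 <= ((\1_(box l0 u0) y : R) * \1_C t)%:E)%E.
  by rewrite lee_fin mulr_ge0// indicE.
have Z n : (B n t /\ lat_cube h (q n) y) \/
    ((\1_(lat_cube h (q n)) y : R) * \1_(B n) t)%:E = 0%E.
  rewrite !indicE; case: (boolP (t \in _)) => [/[!inE] tB|]; last by right; rewrite mulr0.
  by case: (boolP (y \in _)) => [/[!inE] yB|]; [left|right; rewrite mul0r].
have [[n [nN yn]]|none] := pselect (exists n, (n < N)%N /\ lat_cube h (q n) y); last first.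
  rewrite eseries0; first exact: nneseries_ge0.
  move=> n _ _; have [[Bn yn]|//] := Z n; exfalso; apply: none; exists n; split => //.
  by move: Bn; rewrite /B; case: ifP.
rewrite (nneseriesD1 (n := n))// eseries0 ?adde0; last first.
  move=> m _ /andP[_ mn]; have [[Bm ym]|//] := Z m; exfalso.
  have mN : (m < N)%N by move: Bm; rewrite /B; case: ifP.
  move/(lat_cubeP _ _ h0) : ym; move/(lat_cubeP _ _ h0) : yn => ->.
  move=> /eqP; rewrite nth_uniq ?ball_pts_uniq// => /eqP nm.
  by rewrite nm eqxx in mn.
have : eball x r' y.
  rewrite /eball/=; apply: le_lt_trans rr'; rewrite [leRHS]addrC.
  apply: le_trans (enorm_tri (lat h (q n)) _ _) _.
  apply: lerD; first exact: lat_cube_dist.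
  have : q n \in s by rewrite mem_nth.
  by rewrite mem_ball_pts.
move=> /sub[m _ ym].
rewrite [X in (_ <= X)%E](nneseriesD1 (n := m))//.
apply: (@le_trans _ _ 1%E).
  by rewrite lee_fin !indicE; do 2 case: (_ \in _); rewrite ?mulr0 ?mul0r ?mulr1.
by rewrite !indicE !mem_set// mulr1 leeDl// nneseries_ge0.
Qed.

(** Each point of the smaller ball lies in the cube of a lattice point of the larger one, so these
    cubes cover it. *)
Lemma ball_pts_ge h x r r' : (0 < d)%N -> 0 < h -> 0 < r' ->
  r' + h * Num.sqrt d%:R <= r ->
  r' ^+ d * vol_ball R d <= (size (ball_pts h x r))%:R * h ^+ d.
Proof.
move=> d0 h0 r'0 rr'; rewrite -lee_fin -(@lebesgue_eball x)//.
pose s := [seq (lat h q, \row_i (h * ((q 0 i)%:~R + 1))) | q <- ball_pts h x r].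
have -> : (size (ball_pts h x r))%:R * h ^+ d = \sum_(b <- s) boxvol b.1 b.2.
  rewrite big_map; under eq_bigr do rewrite boxvol_lat_cube ?(ltW h0)//.
  by rewrite big_const_seq count_predT iter_addr_0 mulr_natl.
apply: lebesgue_d_le_seq => // y yx.
have yc : lat_cube h (cell h y) y by apply/lat_cubeP.
exists (lat h (cell h y), \row_i (h * ((cell h y 0 i)%:~R + 1))); last exact: yc.
apply: (map_f (fun q => (lat h q, \row_i (h * ((q 0 i)%:~R + 1))))).
rewrite mem_ball_pts//; apply: le_trans rr'.
apply: le_trans (enorm_tri y _ _) _; rewrite [leRHS]addrC; apply: lerD; last exact: ltW.
by rewrite enormB_sym; exact: lat_cube_dist.
Qed.

(** The ball of radius [Num.sqrt d%:R + 1] contains the unit cube attached to the origin. *)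
Lemma vol_ball_gt0 : (0 < d)%N -> 0 < vol_ball R d.
Proof.
move=> d0; have := @ball_pts_le 1 0 0 (Num.sqrt d%:R + 1) d0 ltr01 (lexx _).
rewrite add0r mul1r ltrDl ltr01 expr1n mulr1 => /(_ isT) h.
have : (0 : R) < (size (ball_pts 1 (0 : 'rV[R]_d) 0))%:R.
  rewrite ltr0n; case E : (ball_pts _ _ _) => [|//].
  have : (0 : 'rV[int]_d) \in ball_pts 1 (0 : 'rV[R]_d) 0.
    rewrite mem_ball_pts//.
    have -> : lat 1 (0 : 'rV[int]_d) - 0 = 0 :> 'rV[R]_d.
      by apply/rowP => i; rewrite !mxE mulr0 subr0.
    by rewrite enorm0.
  by rewrite E.
move=> /lt_le_trans/(_ h); by rewrite pmulr_rgt0// exprn_gt0// ltr_wpDl ?sqrtr_ge0.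
Qed.

End Lattice.

(** * Comparison of balls in two dimensions *)

Section Dimensions.
Variables (R : realType) (m d : nat).

Lemma dot_row_mx (p p' : 'rV[R]_m) (x x' : 'rV[R]_d) :
  dot (row_mx p x) (row_mx p' x') = dot p p' + dot x x'.
Proof.
rewrite /dot big_split_ord/=; congr (_ + _); apply: eq_bigr => i _.
  by rewrite !row_mxEl.
by rewrite !row_mxEr.
Qed.

Lemma enorm_row_mx (p : 'rV[R]_m) (x : 'rV[R]_d) :
  enorm (row_mx p x) <= enorm p + enorm x.
Proof.
rewrite -(@ler_pXn2r _ 2)// ?nnegrE ?addr_ge0 ?enorm_ge0//.
rewrite sqr_enorm dot_row_mx sqrrD !sqr_enorm -addrAC lerDl mulrn_wge0//.
by rewrite mulr_ge0 ?enorm_ge0.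
Qed.

Lemma lat_row_mx (h : R) (p : 'rV[int]_m) (x : 'rV[int]_d) :
  lat h (row_mx p x) = row_mx (lat h p) (lat h x).
Proof.
apply/rowP => i; rewrite mxE; case: (split_ordP i) => j ->.
  by rewrite !row_mxEl mxE.
by rewrite !row_mxEr mxE.
Qed.

(** Chains use only part of the coordinates while the intensity is normalized by the volume in all
    of them; this brings counts of the former under the latter. *)
Lemma size_ball_pts_pad (h r : R) (x : 'rV[R]_d) : 0 < h ->
  (size (ball_pts h x r) <= size (ball_pts h (row_mx (0 : 'rV[R]_m) x) r))%N.
Proof.
move=> h0; rewrite -(size_map (fun q => row_mx (0 : 'rV[int]_m) q)).
apply: uniq_leq_size.
  by rewrite map_inj_uniq ?ball_pts_uniq// => p q /eq_row_mx[].
move=> _ /mapP[q + ->]; rewrite !mem_ball_pts// lat_row_mx; apply: le_trans.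
rewrite opp_row_mx add_row_mx subr0 (le_trans (enorm_row_mx _ _))//.
have -> : lat h (0 : 'rV[int]_m) = 0 by apply/rowP => i; rewrite !mxE mulr0.
by rewrite enorm0 add0r.
Qed.

(** The ball lies in the product of the cube [-1, 1]^m and the lower-dimensional ball. The factor is
    harmless, [m] being 17 in the sequel. *)
Lemma vol_ball_cylinder : (0 < d)%N -> vol_ball R (m + d) <= 2 ^+ m * vol_ball R d.
Proof.
move=> d0; rewrite -lee_fin vol_ballE ?ltn_addl// EFinM vol_ballE//.
rewrite [X in (_ <= _ * X)%E]/lebesgue_d -lee_pdivrMl ?exprn_gt0//.
apply: le_ereal_inf_tmp => _ [l [u [sub ->]]].
rewrite lee_pdivrMl ?exprn_gt0// -nneseriesZl; last first.
  by move=> n _; rewrite lee_fin boxvol_ge0.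
apply: ereal_inf_lbound.
exists (fun n => row_mx (const_mx (-1)) (l n)), (fun n => row_mx (const_mx 1) (u n)); split.
  move=> x; rewrite /eball/= subr0 -[x]hsubmxK => x1.
  have : eball 0 1 (rsubmx x).
    rewrite /eball/= subr0; apply: le_lt_trans x1.
    rewrite -(@ler_pXn2r _ 2)// ?nnegrE ?enorm_ge0//.
    by rewrite !sqr_enorm dot_row_mx lerDr dot_ge0.
  move=> /sub[n _ bx]; exists n => // i.
  case: (split_ordP i) => j ->.
    rewrite !row_mxEl !mxE.
    have := le_lt_trans (coord_le_enorm _ (lshift d j)) x1.
    by rewrite row_mxEl mxE ltr_norml => /andP[/ltW -> ->].
  by rewrite !row_mxEr; have := bx j.
apply: eq_eseriesr => n _; rewrite -EFinM; congr EFin.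
rewrite /boxvol big_split_ord/=; congr (_ * _).
  rewrite -[X in 2 ^+ X]card_ord -prodr_const; apply: eq_bigr => i _.
  by rewrite !row_mxEl !mxE opprK max_r//; lra.
by apply: eq_bigr => i _; rewrite !row_mxEr.
Qed.

End Dimensions.

Lemma bigsetIP (T : Type) (I : eqType) (s : seq I) (F : I -> set T) w :
  (\big[setI/setT]_(x <- s) F x) w <-> forall x, x \in s -> F x w.
Proof.
elim: s => [|y s IH]; first by rewrite big_nil.
rewrite big_cons; split=> [[Fy /IH Fs] x|H]; first by rewrite inE => /predU1P[->|/Fs].
split; first by apply: H; rewrite mem_head.
by apply/IH => x xs; apply: H; rewrite inE xs orbT.
Qed.

(** * Second moments and occupied cells *)

Section SecondMoment.
Context (R : realType) dO (Omega : measurableType dO) (P : probability Omega R).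

(** If N counts the events that occur, then 2 t N <= t^2 N^2 + 1_U pointwise, as N vanishes off the
    union U. Integrate with t = 1 / (K m), the best choice. *)
Lemma second_moment (I : Type) (r : seq I) (E : I -> set Omega) (K : R) :
  0 < K -> (forall i, measurable (E i)) -> 0 < \sum_(i <- r) fine (P (E i)) ->
  \sum_(i <- r) \sum_(j <- r) fine (P (E i `&` E j)) <=
    K * (\sum_(i <- r) fine (P (E i))) ^+ 2 ->
  (K^-1%:E <= P (\big[setU/set0]_(i <- r) E i))%E.
Proof.
move=> K0 mE; set m := \sum_(i <- r) fine (P (E i)) => m0 H.
set U := \big[setU/set0]_(i <- r) E i.
have mU : measurable U by apply: bigsetU_measurable => i _.
have EP A : measurable A -> P A = (fine (P A))%:E by move=> mA; rewrite fineK// fin_num_measure.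
pose t := (K * m)^-1; have t0 : 0 < t by rewrite invr_gt0 mulr_gt0.
have int1 (A : set Omega) c : 0 <= c -> measurable A ->
    (\int[P]_w (c * \1_A w)%:E = (c * fine (P A))%:E)%E.
  move=> c0 mA; under eq_integral do rewrite EFinM.
  rewrite ge0_integralZl//; last exact/measurable_EFinP/measurable_indic.
  by rewrite integral_indic// setIT EFinM -EP.
have mI (A : set Omega) c : measurable A -> measurable_fun setT (fun w => (c * \1_A w)%:E).
  move=> mA; apply/measurable_EFinP; apply: measurable_funM => //; exact: measurable_indic.
have L : (\int[P]_w (\sum_(i <- r) (2 * t * \1_(E i) w)%:E)%E = (2 * t * m)%:E)%E.
  rewrite ge0_integral_sum//; first last.
  - by move=> i w _; rewrite lee_fin mulr_ge0 ?indicE// mulr_ge0// ltW.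
  - by move=> i; exact: mI.
  under eq_bigr do rewrite int1 ?mulr_ge0 ?(ltW t0)//.
  by rewrite sumEFin -mulr_sumr.
have Q : (\int[P]_w (\sum_(i <- r) \sum_(j <- r) (t ^+ 2 * \1_(E i `&` E j) w)%:E +
     (1 * \1_U w)%:E)%E =
   (t ^+ 2 * (\sum_(i <- r) \sum_(j <- r) fine (P (E i `&` E j))) + fine (P U))%:E)%E.
  rewrite ge0_integralD//; first last.
  - exact: mI.
  - by apply: emeasurable_sum => i; apply: emeasurable_sum => j; apply: mI; exact: measurableI.
  - move=> w _; apply: sume_ge0 => i _; apply: sume_ge0 => j _.
    by rewrite lee_fin mulr_ge0 ?indicE// exprn_ge0// ltW.
  rewrite int1// mul1r EFinD; congr (_ + _)%E.
  rewrite ge0_integral_sum//; first last.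
  - move=> i w _; apply: sume_ge0 => j _.
    by rewrite lee_fin mulr_ge0 ?indicE// exprn_ge0// ltW.
  - by move=> i; apply: emeasurable_sum => j; apply: mI; exact: measurableI.
  rewrite mulr_sumr -sumEFin; apply: eq_bigr => i _.
  rewrite ge0_integral_sum//; first last.
  - by move=> j w _; rewrite lee_fin mulr_ge0 ?indicE// exprn_ge0// ltW.
  - by move=> j; apply: mI; exact: measurableI.
  rewrite mulr_sumr -sumEFin; apply: eq_bigr => j _.
  by rewrite int1 ?exprn_ge0 ?(ltW t0)//; exact: measurableI.
have : ((2 * t * m)%:E <=
   (t ^+ 2 * (\sum_(i <- r) \sum_(j <- r) fine (P (E i `&` E j))) + fine (P U))%:E)%E.
  rewrite -L -Q; apply: ge0_le_integral => //.
  - move=> w _; apply: sume_ge0 => i _.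
    by rewrite lee_fin mulr_ge0 ?indicE// mulr_ge0// ltW.
  - by apply: emeasurable_sum => i; exact: mI.
  - apply: emeasurable_funD; last exact: mI.
    by apply: emeasurable_sum => i; apply: emeasurable_sum => j; apply: mI; exact: measurableI.
  move=> w _; rewrite sumEFin.
  under [X in (_ <= X + _)%E]eq_bigr do rewrite sumEFin.
  rewrite sumEFin -EFinD lee_fin mul1r -mulr_sumr.
  set N := \sum_(i <- r) \1_(E i) w : R.
  have -> : \sum_(i <- r) \sum_(j <- r) t ^+ 2 * \1_(E i `&` E j) w = t ^+ 2 * N ^+ 2 :> R.
    rewrite [N ^+ 2]expr2 {1}/N mulr_suml mulr_sumr; apply: eq_bigr => i _.
    rewrite /N !mulr_sumr; apply: eq_bigr => j _.
    by rewrite indicI.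
  have [wU|wU] := boolP (w \in U); rewrite indicE ?wU ?(negbTE wU)/=.
    rewrite -subr_ge0.
    have -> : t ^+ 2 * N ^+ 2 + 1 - 2 * t * N = (t * N - 1) ^+ 2 by ring.
    exact: sqr_ge0.
  rewrite addr0.
  suff -> : N = 0 by rewrite expr0n !mulr0.
  move: wU; rewrite /N /U; elim: (r) => [|i s IH]; first by rewrite !big_nil.
  rewrite !big_cons in_setU negb_or => /andP[/negbTE wi /IH ->].
  by rewrite indicE wi addr0.
rewrite lee_fin [P U]EP// lee_fin => le.
have : t ^+ 2 * (K * m ^+ 2) + fine (P U) >= 2 * t * m.
  by apply: le_trans le _; rewrite lerD2r ler_pM2l ?exprn_gt0.
have -> : 2 * t * m = 2 * K^-1 by rewrite /t; field; rewrite !gt_eqF.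
have -> : t ^+ 2 * (K * m ^+ 2) = K^-1 by rewrite /t; field; rewrite !gt_eqF.
lra.
Qed.

(** Induction on the list of complements, with a list of plain events carried along: subtracting
    [V y] trades one complement for one plain event. *)
Lemma indep_complements (S : eqType) (V : S -> set Omega) (v : S -> R) :
  (forall x, measurable (V x)) ->
  (forall s, uniq s -> P (\big[setI/setT]_(x <- s) V x) = (\prod_(x <- s) v x)%:E) ->
  forall s, uniq s ->
  P (\big[setI/setT]_(x <- s) (~` V x)) = (\prod_(x <- s) (1 - v x))%:E.
Proof.
move=> mV HV.
suff G t s : uniq (s ++ t) ->
    P (\big[setI/setT]_(x <- s) V x `&` \big[setI/setT]_(x <- t) (~` V x)) =
    (\prod_(x <- s) v x * \prod_(x <- t) (1 - v x))%:E.
  by move=> s us; have := G s [::]; rewrite !big_nil setTI mul1r; apply.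
have mB (f : S -> set Omega) (l : seq S) : (forall x, measurable (f x)) ->
    measurable (\big[setI/setT]_(x <- l) f x).
  by move=> mf; apply: bigsetI_measurable => i _.
elim: t s => [|y t IH] s ust.
  by rewrite !big_nil setIT mulr1 HV//; move: ust; rewrite cats0.
rewrite !big_cons.
have usy : uniq ((y :: s) ++ t).
  rewrite (perm_uniq (s2 := s ++ y :: t))//.
  by rewrite -[y :: t]cat1s perm_sym perm_catCA.
have us : uniq (s ++ t) by move: usy; rewrite /= => /andP[].
set A := \big[setI/setT]_(x <- s) V x; set B := \big[setI/setT]_(x <- t) ~` V x.
have -> : A `&` (~` V y `&` B) = (A `&` B) `\` V y.
  by rewrite setDE -!setIA; congr (_ `&` _); rewrite setIC.
have mA : measurable A by exact: mB.
have mBB : measurable B by apply: mB => x; exact: measurableC.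
have mAB : measurable (A `&` B) by exact: measurableI.
rewrite measureD//; last by rewrite ltey_eq fin_num_measure.
have -> : A `&` B `&` V y = \big[setI/setT]_(x <- y :: s) V x `&` B.
  by rewrite big_cons -/A setIC setIA.
apply: etrans (congr2 (fun a b : \bar R => (a - b)%E) (IH s us) (IH (y :: s) usy)) _.
by rewrite big_cons -EFinB; congr EFin; ring.
Qed.

End SecondMoment.

(** * Independence of occupied cells *)

Section Occupancy.
Variables (R : realType) (d : nat) (nu : {measure set R -> \bar R}) (lam : R).
Hypothesis lam_ge0 : 0 <= lam.
Local Notation T := ('rV[R]_d * R)%type.

Lemma Borel_open (A : set T) : open A -> Borel A.
Proof. by move=> oA; exact: sub_sigma_algebra. Qed.

Lemma Borel_setC (A : set T) : Borel A -> Borel (~` A).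
Proof.
exact: (@measurableC _ (g_sigma_algebraType [set B : set T | open B])).
Qed.

Lemma Borel_closed (A : set T) : closed A -> Borel A.
Proof.
move=> cA; rewrite -[A]setCK.
by apply: Borel_setC; apply: Borel_open; exact: closed_openC.
Qed.

Lemma Borel_setI (A B : set T) : Borel A -> Borel B -> Borel (A `&` B).
Proof.
exact: (@measurableI _ (g_sigma_algebraType [set B : set T | open B])).
Qed.

Lemma open_half_space (j : 'I_d) (c : R) : open (half_space j c).
Proof.
have -> : half_space j c = (fun z : T => z.1 0 j) @^-1` [set t | t < c] by [].
apply: open_comp; last exact: open_lt.
move=> z _; apply: (@continuous_comp _ _ _ (fst : T -> 'rV[R]_d) (fun x : 'rV[R]_d => x 0 j));
  first exact: cvg_fst.
exact: coord_continuous.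
Qed.

Lemma Borel_box (l u : 'rV[R]_d) (r : R) : Borel (box l u `*` [set r]).
Proof.
have -> : box l u `*` [set r] = (\bigcap_(i in [set: 'I_d])
    (~` half_space i (l 0 i) `&` half_space i (u 0 i))) `&` (snd @^-1` [set r]).
  apply/seteqP; split => [[x s] [/= xb Br]|[x s] [/= xb Br]]; split => //.
    move=> i _; have /andP[li ui] := xb i; split => //=.
    by apply/negP; rewrite -leNgt.
  by move=> i; have [/negP] := xb i Logic.I; rewrite -leNgt => -> ->.
apply: Borel_setI; last first.
  apply: Borel_closed; apply: closed_comp; last exact: closed_eq.
  by move=> z _; exact: cvg_snd.
apply: (@fin_bigcap_measurable _ (g_sigma_algebraType [set B : set T | open B])) => // i _.
have bh (c : R) : Borel (half_space i c) by exact: (Borel_open (@open_half_space i c)).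
exact: (Borel_setI (Borel_setC (bh _)) (bh _)).
Qed.

Variables (I : eqType) (A : I -> set T) (m : I -> R).
Hypotheses (bA : forall x, Borel (A x))
  (LA : forall x, intensity lam nu (A x) = (m x)%:E)
  (disjA : forall x y, x != y -> A x `&` A y = set0).
Context dO (Omega : measurableType dO) (P : probability Omega R)
  (xi : Omega -> set T).
Hypothesis pp : is_poisson_pp P xi (intensity lam nu).

Definition occupied (x : I) : set Omega := [set w | xi w `&` A x !=set0].

Lemma occupiedE x : occupied x = ~` [set w | count_eq (xi w) (A x) 0].
Proof.
apply/seteqP; split => w /=; rewrite /occupied /count_eq/= II0 card_eq0.
  by move/set0P/negP.
by move/negP/set0P.
Qed.

Lemma measurable_occupied x : measurable (occupied x).
Proof. by rewrite occupiedE; apply: measurableC; have [+ _ _ _] := pp; apply. Qed.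

(** The axioms of the process give independence and probability exp(-m) for empty cells; occupation
    is the complementary event. *)
Lemma occupied_indep s : uniq s ->
  P (\big[setI/setT]_(x <- s) occupied x) = (\prod_(x <- s) (1 - expR (- m x)))%:E.
Proof.
move=> us; under eq_bigr do rewrite occupiedE.
apply: (@indep_complements _ _ _ P _ (fun x => [set w | count_eq (xi w) (A x) 0])) => //.
  by move=> x; have [+ _ _ _] := pp; apply.
move=> {us}s us; have [_ law _ ind] := pp.
have [->|] := eqVneq s [::]; first by rewrite !big_nil probability_setT.
case: s us => // x0 s' us _; set s := x0 :: s'.
have := ind (size s) (fun i => A (nth x0 s i)) (fun=> 0%N).
rewrite (_ : \bigcap_(i in _) _ = \big[setI/setT]_(x <- s) [set w | count_eq (xi w) (A x) 0]); last first.
  apply/seteqP; split => w /=.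
    move=> H; apply/bigsetIP => x xs.
    have ix : (index x s < size s)%N by rewrite index_mem.
    by have := H (Ordinal ix) Logic.I; rewrite /= nth_index.
  by move=> /bigsetIP H i _; apply: H; exact: mem_nth.
move=> ->.
- rewrite (big_nth x0) big_mkord -prodEFin; apply: eq_bigr => i _.
  rewrite law// ?LA ?ltry//= /poisson_e expr0 fact0 mulr1 divr1//.
- by move=> i; exact: bA.
- move=> i j ij; apply: disjA; by rewrite nth_uniq.
Qed.

End Occupancy.

(** * Pairs of open paths *)

Section Lyapunov.
Variable R : realType.
Local Notation m := 16%N.
Implicit Type x : 'rV[int]_m.

Definition sqn x : R := \sum_(i < m) (x 0 i)%:~R ^+ 2.
(* A supersolution for the difference of two independent walks in Z^16 with uniform unit steps; the
   strict decrease near the origin pays for the factor [1 + eps] of a coincidence. *)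
Definition lyap x : R := 1 + (64 + sqn x)^-1.
Definition unit_vec (g : 'I_m) : 'rV[int]_m := delta_mx 0 g.

Lemma sqn_ge0 x : 0 <= sqn x.
Proof. by apply: sumr_ge0 => i _; exact: sqr_ge0. Qed.

Lemma lyap_ge1 x : 1 <= lyap x.
Proof. by rewrite /lyap lerDl invr_ge0 addr_ge0 ?sqn_ge0. Qed.

Lemma sqn_step x g g' : sqn (x + unit_vec g - unit_vec g') =
  sqn x + (2 * ((x 0 g)%:~R - (x 0 g')%:~R) + 2 * (g != g')%:R).
Proof.
rewrite /sqn.
have E i : ((x + unit_vec g - unit_vec g') 0 i)%:~R ^+ 2 = ((x 0 i)%:~R ^+ 2 +
   ((i == g)%:R * (2 * (x 0 i)%:~R + 1 - 2 * (g == g')%:R) -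
    (i == g')%:R * (2 * (x 0 i)%:~R - 1)) : R).
  rewrite !mxE eqxx/= !intrD intrN.
  have bi (b : bool) : (b%:R : int)%:~R = b%:R :> R by case: b.
  rewrite !bi.
  have [ig|ig] := eqVneq i g; have [ig'|ig'] := eqVneq i g' => /=.
  - by rewrite -ig -ig' eqxx /=; ring.
  - by rewrite -ig (negbTE ig') /=; ring.
  - by ring.
  - by ring.
under eq_bigr do rewrite E.
rewrite big_split/=; congr (_ + _); rewrite sumrB.
have pick (j : 'I_m) (F : 'I_m -> R) : \sum_(i < m) (i == j)%:R * F i = F j.
  rewrite (bigD1 j)//= eqxx mul1r big1 ?addr0// => i /negbTE ->; exact: mul0r.
rewrite !pick; case: eqP => _ /=; ring.
Qed.

(** Expand 1 / (q + s) to second order in the increment s. Over the 256 pairs, s sums to 2 * 240 and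
    s^2 to at most 128 q + 1024. The gain 480 / q^2 exceeds the loss 256 / q^2 + 2048 / q^3 by at
    least 192 / q^2 once q >= 64, which is the reason for the 64 in [lyap]. In dimension m the main
    terms are 2 m (m - 1) and 16 m, so that m has to be fairly large. *)
Lemma lyap_step_sum x :
  \sum_(g < m) \sum_(g' < m) (64 + sqn (x + unit_vec g - unit_vec g'))^-1 <=
  256 / (64 + sqn x) - 192 / (64 + sqn x) ^+ 2.
Proof.
set q := 64 + sqn x; pose v i : R := (x 0 i)%:~R.
have q64 : 64 <= q by rewrite lerDl sqn_ge0.
have q0 : 0 < q by apply: lt_le_trans q64.
pose s g g' : R := 2 * (v g - v g') + 2 * (g != g')%:R.
have lin g g' : (64 + sqn (x + unit_vec g - unit_vec g'))^-1 <=
    q^-1 - s g g' / q ^+ 2 + 2 * (s g g') ^+ 2 / q ^+ 3.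
  rewrite sqn_step addrA -/q -/(v g) -/(v g') -/(s g g').
  (* This keeps q + s positive and gives the remainder its sign; it comes from (a + 2)^2 + (b - 2)^2
     >= 0. *)
  have sq : - (q / 2) <= s g g'.
    have [gg|gg] := eqVneq g g'.
      by rewrite /s gg subrr eqxx !mulr0 addr0 lerNl oppr0 divr_ge0// ltW.
    have : v g ^+ 2 + v g' ^+ 2 <= sqn x.
      rewrite /sqn (bigD1 g)//= (bigD1 g')/=; last by rewrite eq_sym.
      rewrite addrA lerDl; apply: sumr_ge0 => i _; exact: sqr_ge0.
    rewrite /s gg/= /q; move: (v g) (v g') (sqn x) => a b N H.
    have := sqr_ge0 (a + 2); have := sqr_ge0 (b - 2); rewrite !expr2 in H *; nra.
  have qs : 0 < q + s g g' by lra.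
  move: (s g g') sq qs => t sq qs.
  rewrite -subr_ge0.
  have -> : q^-1 - t / q ^+ 2 + 2 * t ^+ 2 / q ^+ 3 - (q + t)^-1 =
     t ^+ 2 * (q + 2 * t) / (q ^+ 3 * (q + t)).
    by field; rewrite !gt_eqF.
  apply: divr_ge0; last by rewrite mulr_ge0 ?exprn_ge0 ?(ltW q0) ?(ltW qs).
  by rewrite mulr_ge0 ?sqr_ge0//; lra.
have S0 : \sum_(g < m) \sum_(g' < m) (q^-1 : R) = 256 / q.
  by rewrite !sumr_const card_ord; ring.
have S1 : \sum_(g < m) \sum_(g' < m) s g g' = 480.
  under eq_bigr do rewrite /s big_split/= -!mulr_sumr sumrB sumr_const card_ord.
  rewrite big_split/= -mulr_sumr sumrB sumr_const card_ord -sumrMnl subrr mulr0 add0r.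
  rewrite -mulr_sumr.
  have -> : \sum_(i < m) \sum_(g' < m) ((i != g')%:R : R) = 240.
    under eq_bigr => i _.
      under eq_bigr => g' _.
        have -> : ((i != g')%:R : R) = 1 - (g' == i)%:R * 1.
          by rewrite eq_sym; case: (g' == i); rewrite /= ?mul1r ?mul0r ?subrr ?subr0.
      over.
      rewrite sumrB sumr_const card_ord (bigD1 i)//= eqxx mul1r big1 ?addr0; last first.
        by move=> j /negbTE ->; rewrite mul0r.
      over.
    by rewrite sumr_const card_ord; lra.
  lra.
have S2 : \sum_(g < m) \sum_(g' < m) (s g g') ^+ 2 <= 128 * q + 1024.
  have D g g' : s g g' ^+ 2 <= 4 * v g ^+ 2 + 4 * v g' ^+ 2 - 8 * v g * v g' + 8 * v g - 8 * v g' + 4.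
    rewrite /s; have [->|_] := eqVneq g g'; rewrite /=.
      rewrite -subr_ge0; apply: (@le_trans _ _ 4) => //.
      by rewrite le_eqVlt; apply/orP; left; apply/eqP; ring.
    by rewrite le_eqVlt; apply/orP; left; apply/eqP; ring.
  apply: (@le_trans _ _ (\sum_(g < m) \sum_(g' < m)
    (4 * v g ^+ 2 + 4 * v g' ^+ 2 - 8 * v g * v g' + 8 * v g - 8 * v g' + 4))).
    by apply: ler_sum => g _; apply: ler_sum => g' _; exact: D.
  pose N := \sum_(g < m) v g ^+ 2; pose Z := \sum_(g < m) v g.
  have inner g : \sum_(g' < m)
    (4 * v g ^+ 2 + 4 * v g' ^+ 2 - 8 * v g * v g' + 8 * v g - 8 * v g' + 4) =
    64 * v g ^+ 2 + 4 * N - 8 * Z * v g + 128 * v g - 8 * Z + 64.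
    rewrite big_split/= sumrB big_split/= sumrB big_split/= -!mulr_sumr !sumr_const card_ord.
    rewrite -/N -/Z; ring.
  under eq_bigr do rewrite inner.
  rewrite big_split/= sumrB big_split/= sumrB big_split/= -!mulr_sumr !sumr_const card_ord.
  rewrite -/N -/Z.
  have -> : q = 64 + N by [].
  have := sqr_ge0 Z; rewrite expr2; lra.
apply: (@le_trans _ _ (256 / q - 480 / q ^+ 2 + 2 * (128 * q + 1024) / q ^+ 3)).
  apply: (@le_trans _ _ (\sum_(g < m) \sum_(g' < m)
     (q^-1 - s g g' / q ^+ 2 + 2 * (s g g') ^+ 2 / q ^+ 3))).
    by apply: ler_sum => g _; apply: ler_sum => g' _; exact: lin.
  under eq_bigr do rewrite big_split/= sumrB -!mulr_suml -mulr_sumr.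
  rewrite big_split/= sumrB -!mulr_suml -mulr_sumr S0 S1.
  rewrite lerD2l ler_pM2r ?invr_gt0 ?exprn_gt0// ler_pM2l//.
rewrite -subr_ge0.
have -> : 256 / q - 192 / q ^+ 2 - (256 / q - 480 / q ^+ 2 + 2 * (128 * q + 1024) / q ^+ 3)
   = (32 * q - 2048) / q ^+ 3 by field; rewrite gt_eqF.
by apply: divr_ge0; [lra|rewrite exprn_ge0// ltW].
Qed.

(** At the origin the sum of inverses is at most 4 - 3/64 where 4 is allowed, and the gain 3/64
    covers [eps] times a total below 260. *)
Lemma lyap_supersolution x (eps : R) : 0 <= eps -> eps <= 16384^-1 ->
  (1 + eps * (x == 0)%:R) *
   \sum_(g < m) \sum_(g' < m) lyap (x + unit_vec g - unit_vec g') <= 256 * lyap x.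
Proof.
move=> e0 e1; rewrite /lyap.
have -> : \sum_(g < m) \sum_(g' < m) (1 + (64 + sqn (x + unit_vec g - unit_vec g'))^-1) =
   256 + \sum_(g < m) \sum_(g' < m) (64 + sqn (x + unit_vec g - unit_vec g'))^-1.
  under eq_bigr do rewrite big_split/= sumr_const card_ord.
  by rewrite big_split/= sumr_const card_ord; congr (_ + _); ring.
have := lyap_step_sum x; set X := \sum_(g < m) _ => HX.
have [x0|x0] := eqVneq x 0; rewrite /= ?mulr1 ?mulr0 ?addr0 ?mul1r; last first.
  rewrite mulrDr mulr1 lerD2l; apply: le_trans HX _.
  rewrite gerBl divr_ge0// exprn_ge0// addr_ge0 ?sqn_ge0//.
have q0 : sqn x = 0.
  by rewrite x0 /sqn big1// => i _; rewrite mxE expr0n.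
move: HX; rewrite q0 addr0 => HX.
have : X <= 256 / 64 - 192 / 64 ^+ 2 by [].
nra.
Qed.

End Lyapunov.

Lemma sumr_const_seq (R : pzRingType) (T : Type) (s : seq T) (a : R) :
  \sum_(i <- s) a = (size s)%:R * a.
Proof. by rewrite big_const_seq count_predT iter_addr_0 mulr_natl. Qed.

(** * Overlap of the chains with a fixed sequence *)

Section Chains.
Variables (R : realType) (V : zmodType) (next : nat -> V -> seq V) (p : nat -> R).

Fixpoint chains (l : nat) : seq (seq V) :=
  if l is l'.+1 then [seq rcons c y | c <- chains l', y <- next l' (last 0 c)]
  else [:: [::]].

Lemma sum_chainsS (F : seq V -> R) l : \sum_(c <- chains l.+1) F c =
  \sum_(c <- chains l) \sum_(y <- next l (last 0 c)) F (rcons c y).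
Proof. exact: big_allpairs_dep. Qed.

Lemma chainsSP c l : reflect
  (exists c' y, [/\ c' \in chains l, y \in next l (last 0 c') & c = rcons c' y])
  (c \in chains l.+1).
Proof.
apply: (iffP allpairsPdep) => [[c' [y [c'l yn ->]]]|[c' [y [c'l yn ->]]]];
  by exists c', y.
Qed.

Lemma size_chain c l : c \in chains l -> size c = l.
Proof.
elim: l c => [|l IH] c; first by rewrite inE => /eqP ->.
by move=> /chainsSP[c' [y [/IH <- _ ->]]]; rewrite size_rcons.
Qed.

Definition end_count l z : R := \sum_(c <- chains l) (last 0 c == z)%:R.

(** The ratio of the probability that [c] and [z] are both open to the product of their
    probabilities, when only entries of equal rank can be the same site. *)
Definition coinc (z : nat -> V) (c : seq V) : R :=
  \prod_(i < size c) (if nth 0 c i == z i then (p i)^-1 else 1).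

Lemma coinc_rcons z c y : coinc z (rcons c y) =
  coinc z c * (if y == z (size c) then (p (size c))^-1 else 1).
Proof.
rewrite /coinc size_rcons big_ord_recr/= nth_rcons ltnn eqxx; congr (_ * _).
by apply: eq_bigr => i _; rewrite nth_rcons ltn_ord.
Qed.

Hypothesis next_uniq : forall l x, uniq (next l x).

Lemma sum_pick l x z (c : R) : \sum_(y <- next l x) (y == z)%:R * c =
  (z \in next l x)%:R * c.
Proof.
rewrite -mulr_suml; congr (_ * _); have := next_uniq l x.
elim: (next l x) => [|y s IH]; first by rewrite big_nil.
rewrite big_cons inE /= => /andP[ys /IH ->]; have [<-|yz] := eqVneq y z.
  by rewrite (negbTE ys) addr0.
by rewrite add0r.
Qed.

Lemma end_countS l z : end_count l.+1 z = \sum_(c <- chains l) (z \in next l (last 0 c))%:R.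
Proof.
rewrite /end_count sum_chainsS; apply: eq_bigr => c _.
have := sum_pick l (last 0 c) z 1; rewrite !mulr1 => <-.
by apply: eq_bigr => y _; rewrite last_rcons mulr1.
Qed.

Variable L : nat.
Hypotheses (p_gt0 : forall i, 0 < p i) (p_le1 : forall i, p i <= 1)
  (next_le : forall l x, (0 < l < L.+1)%N -> (size (next l x))%:R * p l <= 1)
  (back_le : forall l z, (l < L)%N -> end_count l.+1 z * \prod_(i < l) p i <= 1).

Lemma coinc_ge1 z c : 1 <= coinc z c.
Proof.
apply: (big_ind (fun x => 1 <= x)) => // [x y x1 y1|i _]; first by rewrite mulr_ege1.
by case: ifP => _ //; rewrite invf_ge1.
Qed.

(** Continuations that avoid [z l] keep the weight u; since there are at most 1 / p of them, they
    preserve u - 1 in mean. The one equal to [z l] adds u (1 - p) <= (u - 1) + 1, and [end_count]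
    bounds how often it occurs. At stage 0 no bound on [next] is assumed, because a big ball may
    have many small neighbours, but there u = 1. *)
Lemma coinc_step l z : (l < L.+1)%N ->
  (\sum_(c <- chains l.+1) (coinc z c - 1)) * p l <=
  2 * (\sum_(c <- chains l) (coinc z c - 1)) + end_count l.+1 (z l).
Proof.
move=> lL.
rewrite sum_chainsS mulr_suml end_countS mulr_sumr -big_split/=.
rewrite [leLHS]big_seq_cond [leRHS]big_seq_cond; apply: ler_sum => c; rewrite andbT => cl.
have sc := size_chain cl; set x := last 0 c.
have := coinc_ge1 z c; set u := coinc z c => u1.
have -> : \sum_(y <- next l x) (coinc z (rcons c y) - 1) =
   (size (next l x))%:R * (u - 1) + (z l \in next l x)%:R * (u * ((p l)^-1 - 1)).
  rewrite -sum_pick -sumr_const_seq -big_split/=; apply: eq_bigr => y _.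
  rewrite coinc_rcons sc -/u; case: eqP => _; rewrite /=; ring.
have pl := p_gt0 l; have pl1 := p_le1 l.
have np : (size (next l x))%:R * p l * (u - 1) <= u - 1.
  have [l0|l0] := posnP l; last by rewrite ler_piMl ?subr_ge0// next_le// l0.
  by rewrite /u /coinc sc l0 big_ord0 subrr mulr0.
have -> : ((size (next l x))%:R * (u - 1) + (z l \in next l x)%:R * (u * ((p l)^-1 - 1))) * p l
  = (size (next l x))%:R * p l * (u - 1) + (z l \in next l x)%:R * (u * (1 - p l)).
  by field; rewrite gt_eqF.
move: np; set n := _ * p l * _ => np.
by case: (z l \in _) => /=; nra.
Qed.

(** Each stage doubles the excess and adds at most 1. *)
Lemma coinc_partial l z : (l <= L)%N ->
  (\sum_(c <- chains l) (coinc z c - 1)) * \prod_(i < l) p i <= 2 ^+ l - 1.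
Proof.
elim: l => [_|l IH lL].
  by rewrite big_seq1 /coinc /= !big_ord0 subrr mul0r.
have st := coinc_step z (leq_trans lL (leqnSn L)).
move: st; set X := \sum_(c <- chains l.+1) _ => st.
have P0 : 0 < \prod_(i < l) p i by apply: prodr_gt0.
rewrite big_ord_recr/= mulrCA mulrC.
apply: (@le_trans _ _ ((2 * (\sum_(c <- chains l) (coinc z c - 1)) + end_count l.+1 (z l))
   * \prod_(i < l) p i)); first by rewrite ler_pM2r.
have := IH (ltnW lL); have := back_le (z l) lL.
rewrite mulrDl -mulrA exprS; set A := _ * \prod_(i < l) p i; set B := _ * \prod_(i < l) p i; lra.
Qed.

(** The excess has two sources: coincidences before the last ball, negligible when the mean number
    of open chains is large ([eps1]), and a coincidence at the last ball, rare when few chains share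
    their end ([eps2]). *)
Lemma coinc_total z (eps1 eps2 : R) :
  2 ^+ L.+1 <= eps1 * (size (chains L.+1))%:R * \prod_(i < L.+1) p i ->
  end_count L.+1 (z L) <= eps2 * (size (chains L.+1))%:R * p L ->
  \sum_(c <- chains L.+1) coinc z c <= (size (chains L.+1))%:R * (1 + (eps1 + eps2)).
Proof.
move=> H1 H2.
have P0 : 0 < \prod_(i < L) p i by apply: prodr_gt0.
have -> : \sum_(c <- chains L.+1) coinc z c =
   \sum_(c <- chains L.+1) (coinc z c - 1) + (size (chains L.+1))%:R.
  by rewrite sumrB sumr_const_seq mulr1 subrK.
rewrite mulrDr mulr1 addrC lerD2l -(ler_pM2r (p_gt0 L)) -(ler_pM2r P0).
apply: (@le_trans _ _ ((2 * (\sum_(c <- chains L) (coinc z c - 1)) + end_count L.+1 (z L))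
   * \prod_(i < L) p i)).
  by rewrite ler_pM2r// coinc_step.
have := coinc_partial z (leqnn L); move: H1; rewrite big_ord_recr/= exprS => H1 H3.
rewrite mulrDl -mulrA; apply: (@le_trans _ _ (2 * 2 ^+ L +
   eps2 * (size (chains L.+1))%:R * p L * \prod_(i < L) p i)).
  apply: lerD; last by rewrite ler_pM2r.
  by rewrite ler_pM2l//; apply: le_trans H3 _; rewrite gerBl.
have -> : (size (chains L.+1))%:R * (eps1 + eps2) * p L * \prod_(i < L) p i =
  eps1 * (size (chains L.+1))%:R * (\prod_(i < L) p i * p L) +
  eps2 * (size (chains L.+1))%:R * p L * \prod_(i < L) p i by ring.
by rewrite lerD2r.
Qed.

End Chains.

Section Overlap.
Variables (R : realType) (S : eqType) (w : S -> R) (time : S -> nat).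
Hypothesis w_gt0 : forall x, 0 < w x.

Definition overlap (s s' : seq S) : R :=
  \prod_(xy <- zip s s') (if xy.1 == xy.2 then (w xy.1)^-1 else 1).

Lemma overlap_cat s1 s2 t1 t2 : size s1 = size t1 ->
  overlap (s1 ++ s2) (t1 ++ t2) = overlap s1 t1 * overlap s2 t2.
Proof. by move=> st; rewrite /overlap zip_cat// big_cat. Qed.

(** A site determines its time, so a site common to both lists has the same rank in both. *)
Lemma overlapP s s' n : map time s = iota 0 n -> map time s' = iota 0 n ->
  \prod_(x <- undup (s ++ s')) w x =
  (\prod_(x <- s) w x) * (\prod_(x <- s') w x) * overlap s s'.
Proof.
move=> ts ts'.
have us : uniq s by apply: (@map_uniq _ _ time); rewrite ts iota_uniq.
have us' : uniq s' by apply: (@map_uniq _ _ time); rewrite ts' iota_uniq.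
have zs : size s = n by rewrite -(size_map time) ts size_iota.
have zs' : size s' = n by rewrite -(size_map time) ts' size_iota.
rewrite undup_cat big_cat/= (undup_id us').
rewrite big_filter (undup_id us) mulrAC; congr (_ * _).
have [x0|] := pselect (inhabited S); last first.
  move=> noS; have -> : s = [::] by case: (s) => // x; case: noS.
  by rewrite !big_nil /overlap; case: (s') => [|//]; rewrite /= big_nil mulr1.
case: x0 => x0.
rewrite /overlap.
rewrite big_mkcond (big_nth x0) [X in _ * X](big_nth (x0, x0)) [X in X * _](big_nth x0).
rewrite size_zip zs zs' minnn -big_split/= !big_mkord; apply: eq_bigr => i _.
rewrite nth_zip ?zs ?zs'//=.
have -> : (nth x0 s i \in s') = (nth x0 s i == nth x0 s' i).
  apply/idP/eqP => [|->]; last by rewrite mem_nth// zs'.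
  move=> /(nthP x0)[j]; rewrite zs' => jn E.
  have := congr1 time E; rewrite -!(nth_map x0 0%N time) ?zs ?zs'// ts ts'.
  by rewrite !nth_iota// !add0n => ji; rewrite -E ji.
by case: eqP => _ /=; rewrite ?mulr1// divff// gt_eqF.
Qed.

End Overlap.

(** * Second moment for concatenations of chains *)

Section Paths.
Variables (R : realType) (V : zmodType) (next : nat -> V -> seq V) (p : nat -> R) (L : nat).
Hypotheses (p_gt0 : forall i, 0 < p i) (L_gt0 : (0 < L)%N).
Local Notation site := (nat * 'rV[int]_16 * V)%type.
Local Notation chain_set := (chains next L).

(* With d = 17 + e, a site is a time in Z, a layer in Z^16 and a position in Z^e. Each ball of a path
   has its own time, and the layer moves by one unit vector per chain of [L] balls, so that two
   paths seldom meet. *)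
Definition site_prob (x : site) : R := if x.1.1 is t.+1 then p (t %% L)%N else p L.-1.

Record macro := Macro { sites : seq site; layer : 'rV[int]_16; end_pt : V }.

Definition new_sites n (S : 'rV[int]_16) (X : V) (c : seq V) : seq site :=
  [seq (((n * L + i).+1, S, X + nth 0 c i) : site) | i <- iota 0 L].

Definition extend n (q : macro) (gc : 'I_16 * seq V) : macro :=
  Macro (sites q ++ new_sites n (layer q) (end_pt q) gc.2)
    (layer q + unit_vec gc.1) (end_pt q + last 0 gc.2).

Definition steps : seq ('I_16 * seq V) :=
  [seq (g, c) | g <- enum 'I_16, c <- chain_set].

Fixpoint paths n : seq macro :=
  if n is n'.+1 then [seq extend n' q gc | q <- paths n', gc <- steps]
  else [:: Macro [:: (0%N, 0, 0)] 0 0].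

Lemma sum_pathsS (F : macro -> R) n : \sum_(q <- paths n.+1) F q =
  \sum_(q <- paths n) \sum_(gc <- steps) F (extend n q gc).
Proof. exact: big_allpairs_dep. Qed.

Lemma sum_steps (F : 'I_16 * seq V -> R) : \sum_(gc <- steps) F gc =
  \sum_(g < 16) \sum_(c <- chain_set) F (g, c).
Proof. by rewrite /steps big_allpairs_dep big_enum. Qed.

Definition time (x : site) := x.1.1.

(** It stands for membership in [paths n]: [macro] is a plain record, without the decidable equality
    that membership in a sequence uses. *)
Fixpoint good_path n (q : macro) : Prop :=
  if n is n'.+1 then exists q' g c, [/\ good_path n' q', c \in chain_set & q = extend n' q' (g, c)]
  else q = Macro [:: (0%N, 0, 0)] 0 0.

Lemma time_good n q : good_path n q -> map time (sites q) = iota 0 (n * L).+1.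
Proof.
elim: n q => [|n IH] q; first by move=> /= ->.
move=> [q' [g [c [/IH H cL ->]]]].
have -> : (n.+1 * L).+1 = ((n * L).+1 + L)%N by rewrite mulSn addSn addnC.
rewrite iotaD map_cat H; congr (_ ++ _).
rewrite add0n -[in RHS](addn0 (n * L).+1) iotaDl -map_comp.
by apply: eq_map => i; rewrite /time/= addSn.
Qed.

Lemma sum_good (F F' : macro -> R) n :
  (forall q, good_path n q -> F q <= F' q) ->
  \sum_(q <- paths n) F q <= \sum_(q <- paths n) F' q.
Proof.
elim: n F F' => [|n IH] F F' H; first by rewrite !big_seq1 H.
rewrite !sum_pathsS; apply: IH => q gq; rewrite !sum_steps.
apply: ler_sum => g _; rewrite [leLHS]big_seq_cond [leRHS]big_seq_cond.
by apply: ler_sum => c; rewrite andbT => cL; apply: H; exists q, g, c.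
Qed.

(** Distinct layers exclude common sites; in a common layer the offset of the two starting points is
    absorbed in the reference sequence. *)
Lemma overlap_new n S S' X X' c c' : c \in chain_set -> c' \in chain_set ->
  overlap site_prob (new_sites n S X c) (new_sites n S' X' c') =
  if S == S' then coinc p (fun i => X - X' + nth 0 c i) c' else 1.
Proof.
move=> cL c'L; rewrite /overlap /new_sites zip_map.
rewrite big_map -val_enum_ord big_map big_enum/=.
have [<-|SS] := eqVneq S S'; last first.
  by rewrite big1// => i _; rewrite /= !xpair_eqE (negbTE SS) andbF.
rewrite /coinc (size_chain c'L); apply: eq_bigr => i _ /=.
rewrite !xpair_eqE !eqxx/= /site_prob/= modnMDl modn_small//.
by rewrite [c'`_i == _]eq_sym addrAC subr_eq [c'`_i + _]addrC.
Qed.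

Variables (eps : R).
Hypothesis eps_small : 0 <= eps <= 16384^-1.
Hypothesis coinc_le : forall z, \sum_(c <- chain_set) coinc p z c <=
  (size chain_set)%:R * (1 + eps).

Lemma size_paths n : (size (paths n))%:R = (16 * (size chain_set)%:R) ^+ n :> R.
Proof.
elim: n => [|n IH]; first by rewrite expr0.
have -> : (size (paths n.+1))%:R = \sum_(q <- paths n.+1) 1 :> R by rewrite sumr_const_seq mulr1.
rewrite sum_pathsS; under eq_bigr do rewrite sum_steps.
rewrite sumr_const_seq IH exprSr; congr (_ * _).
under eq_bigr do rewrite sumr_const_seq mulr1.
by rewrite sumr_const card_ord mulr_natl.
Qed.

(** With the weight [lyap] on the difference of layers the recursion closes: one more chain on each
    side costs 1 + eps only if the layers agree, and the supersolution pays exactly there. The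
    initial factor 1 / p comes from the site shared at time 0. *)
Lemma overlap_sum n :
  \sum_(q <- paths n) \sum_(q' <- paths n)
     overlap site_prob (sites q) (sites q') * lyap R (layer q - layer q') <=
  (lyap R 0 / p L.-1) * (16 * (size chain_set)%:R) ^+ n ^+ 2.
Proof.
elim: n => [|n IH].
  rewrite !big_seq1 /= /overlap big_seq1 /= eqxx subrr /site_prob/= expr0 expr1n mulr1.
  by rewrite mulrC.
set N := 16 * _.
rewrite sum_pathsS.
have E q : \sum_(gc <- steps) \sum_(q' <- paths n.+1)
     overlap site_prob (sites (extend n q gc)) (sites q') *
       lyap R (layer (extend n q gc) - layer q') =
   \sum_(q' <- paths n) \sum_(gc <- steps) \sum_(gc' <- steps)
     overlap site_prob (sites (extend n q gc)) (sites (extend n q' gc')) *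
       lyap R (layer (extend n q gc) - layer (extend n q' gc')).
  by rewrite exchange_big/= sum_pathsS; apply: eq_bigr => q' _; rewrite exchange_big.
under eq_bigr do rewrite E.
apply: (@le_trans _ _ (\sum_(q <- paths n) \sum_(q' <- paths n)
     overlap site_prob (sites q) (sites q') * (N ^+ 2 * lyap R (layer q - layer q')))); last first.
  have -> : \sum_(q <- paths n) \sum_(q' <- paths n)
     overlap site_prob (sites q) (sites q') * (N ^+ 2 * lyap R (layer q - layer q')) =
    N ^+ 2 * \sum_(q <- paths n) \sum_(q' <- paths n)
     overlap site_prob (sites q) (sites q') * lyap R (layer q - layer q').
    rewrite mulr_sumr; apply: eq_bigr => q _; rewrite mulr_sumr; apply: eq_bigr => q' _.
    by rewrite mulrCA.
  have -> : lyap R 0 / p L.-1 * N ^+ n.+1 ^+ 2 = N ^+ 2 * (lyap R 0 / p L.-1 * N ^+ n ^+ 2).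
    by rewrite [N ^+ n.+1]exprS; move: (N ^+ n) => Y; ring.
  by apply: ler_wpM2l; first exact: sqr_ge0.
apply: sum_good => q gq; apply: sum_good => q' gq'.
have ss : size (sites q) = size (sites q').
  by rewrite -!(size_map time) (time_good gq) (time_good gq').
have O0 s s' : 0 <= overlap site_prob s s'.
  apply: prodr_ge0 => -[x y] _ /=; case: ifP => // _.
  by rewrite invr_ge0 /site_prob; case: x.1.1 => *; exact: ltW.
rewrite sum_steps; under eq_bigr do under eq_bigr do rewrite sum_steps.
set x := layer q - layer q'; set O := overlap _ _ _.
pose Z (c c' : seq V) := if x == 0 then coinc p (fun i => end_pt q - end_pt q' + nth 0 c i) c' else 1.
have -> : \sum_(g < 16) \sum_(c <- chain_set) \sum_(g' < 16) \sum_(c' <- chain_set)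
    overlap site_prob (sites (extend n q (g, c))) (sites (extend n q' (g', c'))) *
      lyap R (layer (extend n q (g, c)) - layer (extend n q' (g', c'))) =
  O * ((\sum_(c <- chain_set) \sum_(c' <- chain_set) Z c c') *
   \sum_(g < 16) \sum_(g' < 16) lyap R (x + unit_vec g - unit_vec g')).
  rewrite mulr_sumr mulr_sumr; apply: eq_bigr => g _.
  rewrite mulr_sumr exchange_big/= mulr_sumr; apply: eq_bigr => g' _.
  rewrite mulr_suml mulr_sumr; apply: eq_big_seq => c cL.
  rewrite mulr_suml mulr_sumr; apply: eq_big_seq => c' c'L.
  rewrite /extend/= overlap_cat// overlap_new// -mulrA /Z /x subr_eq0; congr (_ * (_ * lyap R _)).
  by rewrite opprD addrACA addrA.
apply: ler_wpM2l; first exact: O0.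
have Zle : \sum_(c <- chain_set) \sum_(c' <- chain_set) Z c c' <=
   (size chain_set)%:R ^+ 2 * (1 + eps * (x == 0)%:R).
  rewrite expr2 -mulrA -sumr_const_seq; apply: ler_sum => c _.
  rewrite /Z; case: eqP => _; rewrite ?mulr1 ?mulr0; first exact: coinc_le.
  by rewrite sumr_const_seq mulr1 addr0 mulr1.
have Lge0 : 0 <= \sum_(g < 16) \sum_(g' < 16) lyap R (x + unit_vec g - unit_vec g').
  by apply: sumr_ge0 => g _; apply: sumr_ge0 => g' _; apply: le_trans (lyap_ge1 _ _).
apply: le_trans (ler_wpM2r Lge0 Zle) _.
rewrite -mulrA; have -> : N ^+ 2 * lyap R x = (size chain_set)%:R ^+ 2 * (256 * lyap R x).
  by rewrite /N exprMn; ring.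
apply: ler_wpM2l; first exact: sqr_ge0.
by have /andP[e0 e1] := eps_small; exact: lyap_supersolution.
Qed.

Context dO (Omega : measurableType dO) (P : probability Omega R) (occ : site -> set Omega).
Hypotheses (mocc : forall x, measurable (occ x))
  (occ_indep : forall s, uniq s ->
     P (\big[setI/setT]_(x <- s) occ x) = (\prod_(x <- s) site_prob x)%:E)
  (chain_neq0 : (0 < size chain_set)%N).

Definition open_path (q : macro) : set Omega := \big[setI/setT]_(x <- sites q) occ x.

Lemma site_prob_gt0 x : 0 < site_prob x.
Proof. by rewrite /site_prob; case: x.1.1. Qed.

Lemma prob_open_path n q : good_path n q ->
  fine (P (open_path q)) = p L.-1 * (\prod_(i < L) p i) ^+ n.
Proof.
move=> gq; rewrite /open_path occ_indep/=; last first.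
  by apply: (@map_uniq _ _ time); rewrite (time_good gq) iota_uniq.
elim: n q gq => [|n IH] q /=; first by move=> ->; rewrite big_seq1 expr0 mulr1.
move=> [q' [g [c [/IH H cL ->]]]]; rewrite /= big_cat H exprSr mulrA; congr (_ * _).
rewrite big_map -[iota 0 L]val_enum_ord big_map big_enum/=; apply: eq_bigr => i _.
by rewrite /site_prob/= modnMDl modn_small.
Qed.

Lemma sum_good_eq (F F' : macro -> R) n :
  (forall q, good_path n q -> F q = F' q) ->
  \sum_(q <- paths n) F q = \sum_(q <- paths n) F' q.
Proof.
move=> H; apply/eqP; rewrite eq_le; apply/andP; split; apply: sum_good => q gq.
  by rewrite H.
by rewrite H.
Qed.

(** The constant of the second moment bound does not depend on [n]; as [lyap >= 1], the weight may
    be inserted in the sum of overlaps. *)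
Lemma exists_open_path n :
  ((p L.-1 / lyap R 0)%:E <= P (\big[setU/set0]_(q <- paths n) open_path q))%E.
Proof.
set W := p L.-1 * (\prod_(i < L) p i) ^+ n.
have W0 : 0 < W by rewrite mulr_gt0// exprn_gt0//; apply: prodr_gt0.
have l0 : 0 < lyap R 0 by apply: lt_le_trans (lyap_ge1 _ _).
have c0 : (0 : R) < (size chain_set)%:R by rewrite ltr0n.
have -> : p L.-1 / lyap R 0 = (lyap R 0 / p L.-1)^-1 by rewrite invf_div.
have mo q : measurable (open_path q) by apply: bigsetI_measurable => x _.
apply: second_moment => //; first by rewrite divr_gt0.
  rewrite (@sum_good_eq _ (fun=> W)); last by move=> q /prob_open_path.
  by rewrite sumr_const_seq size_paths mulr_gt0// exprn_gt0// mulr_gt0.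
rewrite (@sum_good_eq (fun q => fine (P (open_path q))) (fun=> W)); last first.
  by move=> q /prob_open_path.
rewrite sumr_const_seq size_paths exprMn mulrA.
apply: (@le_trans _ _ (W ^+ 2 * \sum_(q <- paths n) \sum_(q' <- paths n)
     overlap site_prob (sites q) (sites q') * lyap R (layer q - layer q'))); last first.
  by rewrite mulrC ler_pM2r ?exprn_gt0//; exact: overlap_sum.
rewrite mulr_sumr; apply: sum_good => q gq.
rewrite mulr_sumr; apply: sum_good => q' gq'.
have -> : open_path q `&` open_path q' =
    \big[setI/setT]_(x <- undup (sites q ++ sites q')) occ x.
  apply/seteqP; split => w.
    move=> [/bigsetIP H /bigsetIP H']; apply/bigsetIP => x.
    by rewrite mem_undup mem_cat => /orP[/H|/H'].
  by move=> /bigsetIP H; split; apply/bigsetIP => x xs; apply: H;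
    rewrite mem_undup mem_cat xs ?orbT.
rewrite occ_indep ?undup_uniq//=.
rewrite (overlapP site_prob_gt0 (time_good gq) (time_good gq')).
have := prob_open_path gq; rewrite /open_path occ_indep/=; last first.
  by apply: (@map_uniq _ _ time); rewrite (time_good gq) iota_uniq.
have := prob_open_path gq'; rewrite /open_path occ_indep/=; last first.
  by apply: (@map_uniq _ _ time); rewrite (time_good gq') iota_uniq.
move=> -> ->; rewrite -/W -expr2 ler_pM2l ?exprn_gt0// ler_peMr ?lyap_ge1//.
apply: prodr_ge0 => -[x y] _ /=; case: ifP => // _.
by rewrite invr_ge0 ltW// site_prob_gt0.
Qed.

End Paths.

(** * Chains of balls *)

Section PowerBounds.
Variable R : realType.

Lemma expr_ge_bernoulli (x : R) n : 0 <= x -> 1 + n%:R * x <= (1 + x) ^+ n.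
Proof.
move=> x0; elim: n => [|n IH]; first by rewrite mul0r addr0 expr0.
rewrite exprS; apply: (@le_trans _ _ ((1 + x) * (1 + n%:R * x))); last first.
  by rewrite ler_pM2l// ltr_pwDl.
have : 0 <= n%:R * x * x by rewrite !mulr_ge0.
by rewrite -natr1; nra.
Qed.

Lemma poly_le_exp (th C : R) m : 1 < th -> 0 < C ->
  exists N, forall n, (N <= n)%N -> n%:R ^+ m <= C * th ^+ n.
Proof.
elim: m th C => [|m IH] th C th1 C0.
  pose x := th - 1; have x0 : 0 < x by rewrite subr_gt0.
  exists (Num.truncn ((C * x)^-1)).+1 => n Nn; rewrite expr0.
  have -> : th = 1 + x by rewrite /x addrC subrK.
  apply: (@le_trans _ _ (C * (1 + n%:R * x))); last by rewrite ler_pM2l// expr_ge_bernoulli// ltW.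
  have : 1 <= n%:R * (C * x).
    rewrite -ler_pdivrMr ?mulr_gt0// div1r; apply: ltW.
    by apply: lt_le_trans (truncnS_gt _) _; rewrite ler_nat.
  lra.
pose s := Num.sqrt th; have s1 : 1 < s by rewrite -sqrtr1 ltr_sqrt// (lt_trans ltr01).
have ss : s * s = th by rewrite -expr2 sqr_sqrtr// ltW// (lt_trans ltr01).
pose x := s - 1; have x0 : 0 < x by rewrite subr_gt0.
have [N HN] := IH s (C * x) s1 (mulr_gt0 C0 x0).
exists N => n /HN H; rewrite exprS.
have b : n%:R <= s ^+ n / x.
  rewrite ler_pdivlMr//; have := expr_ge_bernoulli n (ltW x0).
  have -> : 1 + x = s by rewrite /x addrC subrK.
  by lra.
apply: (@le_trans _ _ ((s ^+ n / x) * (C * x * s ^+ n))).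
  by apply: ler_pM => //; rewrite exprn_ge0.
rewrite -ss exprMn le_eqVlt; apply/orP; left; apply/eqP; field.
by rewrite gt_eqF.
Qed.

Lemma expr_lt1_small (q c : R) : 0 <= q < 1 -> 0 < c ->
  exists N, forall n, (N <= n)%N -> q ^+ n <= c.
Proof.
move=> /andP[q0 q1] c0; have [->|qn0] := eqVneq q 0.
  by exists 1%N => -[|n]// _; rewrite expr0n ltW.
have qp : 0 < q by rewrite lt0r qn0.
have [N HN] := @poly_le_exp q^-1 c 0 (ltac:(by rewrite invf_gt1)) c0.
by exists N => n /HN; rewrite expr0 exprVn ler_pdivlMr ?exprn_gt0// mul1r.
Qed.

End PowerBounds.

Lemma size_le_filter3 (T : Type) (s : seq T) (P1 P2 P3 : pred T) :
  (size s <= size [seq x <- s | P1 x] + size [seq x <- s | P2 x] +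
    size [seq x <- s | P3 x] + size [seq x <- s | ~~ [|| P1 x, P2 x | P3 x]])%N.
Proof.
by elim: s => //= b s IH; case: (P1 b); case: (P2 b); case: (P3 b) => /=; lia.
Qed.

Lemma sub_shift (V : zmodType) (p q r : V) : p - q = r + (p - (q + r)).
Proof. by rewrite opprD addrCA [r + _]addrCA subrr addr0. Qed.

(** * Choices for one step of a chain, forwards and backwards *)

Section Steps.
Variable R : realType.

Lemma shell_arith (n m p T h th A : R) : 0 <= n <= A -> 0 <= m <= A ->
  `|n - m| <= th -> `|p| <= th -> (h - 2 * th) ^+ 2 <= T <= h ^+ 2 -> 0 <= th ->
  `|n ^+ 2 + 2 * n * p + T - (m ^+ 2 + h ^+ 2)| <= th * (4 * A + 4 * h).
Proof.
move=> /andP[n0 nA] /andP[m0 mA] nm pth /andP[T1 T2] th0.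
have -> : n ^+ 2 + 2 * n * p + T - (m ^+ 2 + h ^+ 2) =
  (n - m) * (n + m) + (2 * n * p + (T - h ^+ 2)) by ring.
have k1 : `|(n - m) * (n + m)| <= th * (2 * A).
  by rewrite normrM ler_pM//; rewrite ger0_norm; lra.
have k2 : `|2 * n * p| <= 2 * A * th.
  by rewrite normrM ler_pM//; rewrite ger0_norm; lra.
have k3 : `|T - h ^+ 2| <= 4 * h * th.
  have tt := mulr_ge0 th0 th0; rewrite ler_norml.
  have E : (h - 2 * th) ^+ 2 = h ^+ 2 - 4 * (h * th) + 4 * (th * th) by ring.
  have -> : 4 * h * th = 4 * (h * th) by ring.
  rewrite E in T1; move: T1 T2 tt; move: (h ^+ 2) (h * th) (th * th) => H1 H2 H3 *.
  by apply/andP; split; lra.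
apply: le_trans (ler_normD _ _) _; apply: le_trans (lerD k1 (ler_normD _ _)) _.
move: (`|2 * n * p|) (`|T - h ^+ 2|) k2 k3 => x y *; lra.
Qed.

Lemma radius_arith (a r p T h th sig : R) : h ^+ 2 = r ^+ 2 * (1 - a ^+ 2) ->
  0 <= a * r -> 0 <= th -> p <= th ^+ 2 -> T <= (h - th) ^+ 2 ->
  th * (2 * a * r + 1) <= h -> sig * (2 * r) <= h * th ->
  (a * r) ^+ 2 + 2 * (a * r) * p + T <= (r - sig) ^+ 2.
Proof.
move=> h2 ar0 th0 pth Tth tha sr.
have k1 := ler_wpM2l ar0 pth; have k2 := ler_wpM2l th0 tha.
have E1 : (h - th) ^+ 2 = h ^+ 2 - 2 * (h * th) + th ^+ 2 by ring.
have E2 : (r - sig) ^+ 2 = r ^+ 2 - sig * (2 * r) + sig ^+ 2 by ring.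
have E3 : (a * r) ^+ 2 + h ^+ 2 = r ^+ 2 by rewrite h2; ring.
have E4 : th * (th * (2 * a * r + 1)) = 2 * (a * r * th ^+ 2) + th ^+ 2 by ring.
have s2 := sqr_ge0 sig; rewrite E1 in Tth; rewrite E4 [th * h]mulrC in k2; rewrite E2.
have -> : 2 * (a * r) * p = 2 * (a * r * p) by ring.
move: k1 k2 E3 Tth sr s2; move: (a * r * p) (a * r * th ^+ 2) (th ^+ 2) ((a * r) ^+ 2)
  (h ^+ 2) (r ^+ 2) (sig ^+ 2) (h * th) (sig * (2 * r)) => *; lra.
Qed.

(** Moving the center of a ball by [s] towards a cap brings it closer, by a definite amount, to
    every point of the cap. *)
Lemma cap_arith (T p w s g Rr : R) : T <= Rr ^+ 2 -> s < p -> w <= 1 -> 0 < s ->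
  g * (8 * Rr) <= s * s -> T + 2 * (- s) * p + (- s) ^+ 2 * w <= (Rr - 4 * g) ^+ 2.
Proof.
move=> TR sp w1 s0 gR.
have k1 := ler_wpM2l (ltW s0) (ltW sp); have k2 := ler_wpM2l (sqr_ge0 s) w1.
have E : (Rr - 4 * g) ^+ 2 = Rr ^+ 2 - g * (8 * Rr) + 16 * g ^+ 2 by ring.
have g2 := sqr_ge0 g; rewrite E.
have -> : T + 2 * (- s) * p + (- s) ^+ 2 * w = T - 2 * (s * p) + s ^+ 2 * w by ring.
have E2 : s ^+ 2 = s * s by rewrite expr2.
rewrite E2 in k2 *; move: k1 k2 g2 gR TR; rewrite mulr1.
move: (s * p) (s * s * w) (s * s) (g ^+ 2) (g * (8 * Rr)) (Rr ^+ 2) => *; lra.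
Qed.

Lemma ball_filter_le d (h : R) (c c' : 'rV[R]_d) (r r1 r' : R) (P : pred 'rV[int]_d) :
  (0 < d)%N -> 0 < h -> 0 <= r1 -> r1 + h * Num.sqrt d%:R < r' ->
  (forall q, enorm (lat h q - c) <= r -> P q -> enorm (lat h q - c') <= r1) ->
  (size [seq q <- ball_pts h c r | P q])%:R * h ^+ d <= r' ^+ d * vol_ball R d.
Proof.
move=> d0 h0 r10 rr' HP; apply: le_trans (ball_pts_le c' d0 h0 r10 rr').
rewrite ler_pM2r ?exprn_gt0// ler_nat; apply: uniq_leq_size.
  by rewrite filter_uniq// ball_pts_uniq.
by move=> q; rewrite mem_filter !mem_ball_pts// => /andP[Pq qr]; exact: HP.
Qed.

Lemma sqr_enormDZ d (x w : 'rV[R]_d) (s : R) :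
  enorm (x + s *: w) ^+ 2 = enorm x ^+ 2 + 2 * s * dot x w + s ^+ 2 * dot w w.
Proof.
rewrite !sqr_enorm dotDl !dotDr !dotZl !dotZr (dotC w); ring.
Qed.

Definition unitv d (x : 'rV[R]_d) : 'rV[R]_d := (enorm x)^-1 *: x.

Lemma unitvE d (x : 'rV[R]_d) : x = enorm x *: unitv x.
Proof.
rewrite /unitv scalerA; have [x0|x0] := eqVneq (enorm x) 0; last by rewrite divff// scale1r.
rewrite x0 mul0r scale0r; apply: dot_eq0.
by rewrite -sqr_enorm x0 expr0n.
Qed.

Lemma dot_unitv d (x : 'rV[R]_d) : x != 0 -> dot (unitv x) (unitv x) = 1.
Proof.
move=> x0; have e0 : enorm x != 0.
  by apply: contra x0 => /eqP e; apply/eqP/dot_eq0; rewrite -sqr_enorm e expr0n.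
by rewrite /unitv dotZl dotZr -sqr_enorm; field.
Qed.

(* Around the point of the ray through [x] at distance [a r] from [x], most
   lattice points of a ball of radius almost [r sqrt(1-a^2)] are nearly
   orthogonal to [x]: they are at distance < r of [x] and their norm is close to
   the third side of the triangle. *)
Lemma step_lower (a r D tau delta : R) :
  0 <= a < 1 -> 0 < r -> 0 <= D -> (D = 0 -> a = 0) -> 0 < tau ->
  0 < delta < r * Num.sqrt (1 - a ^+ 2) ->
  exists2 eps, 0 < eps & exists N, forall (e : nat) (eta t' sig : R) (x : 'rV[R]_e),
    (N < e)%N -> 0 < eta -> eta * Num.sqrt e%:R <= eps -> t' <= eps -> 0 < sig <= eps ->
    `|enorm x - D| <= t' ->
    2^-1 * ((r * Num.sqrt (1 - a ^+ 2) - delta) ^+ e * vol_ball R e) <=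
    (size [seq y <- ball_pts eta x (r - sig) |
       `|enorm (lat eta y) - Num.sqrt (D ^+ 2 + 2 * r * a * D + r ^+ 2)| <= tau])%:R * eta ^+ e.
Proof.
move=> /andP[a0 a1] r0 D0 Da tau0 /andP[de0 deh].
set h := r * Num.sqrt (1 - a ^+ 2) in deh *.
have a2 : 0 < 1 - a ^+ 2 by rewrite expr2; nra.
have h0 : 0 < h by rewrite mulr_gt0// sqrtr_gt0.
have h2 : h ^+ 2 = r ^+ 2 * (1 - a ^+ 2) by rewrite exprMn sqr_sqrtr// ltW.
clearbody h.
set D' := Num.sqrt (D ^+ 2 + _ + _).
have D'2 : D' ^+ 2 = D ^+ 2 + 2 * r * a * D + r ^+ 2.
  by rewrite sqr_sqrtr// !addr_ge0 ?sqr_ge0// !mulr_ge0// ltW.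
have ar0 : 0 <= a * r by rewrite mulr_ge0// ltW.
have D'r : r <= D'.
  rewrite -(@ler_pXn2r _ 2)// ?nnegrE ?sqrtr_ge0 ?(ltW r0)// D'2 lerDr.
  by rewrite addr_ge0 ?sqr_ge0// !mulr_ge0// ltW.
have D'0 : 0 < D' by apply: lt_le_trans D'r.
pose A := D + a * r + 1; have A1 : 1 <= A by rewrite /A; lra.
pose C := 4 * A + 4 * h; have C0 : 0 < C by rewrite /C; lra.
(* [th] is the tolerance on lengths: small against [tau * D'], so that the new norm is close to
   [D'], and small against [h], so that the points stay within [r] of [x]. *)
pose th := Num.min (Num.min 1 (delta / 2))
             (Num.min (Num.min (h / 4) (h / (2 * a * r + 1))) (tau * D' / C)).
have ar1 : 0 < 2 * a * r + 1 by rewrite -mulrA; lra.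
have th0 : 0 < th.
  by rewrite !lt_min ltr01 !divr_gt0// mulr_gt0.
have [th1 [thd [thh [tha thC]]]] : th <= 1 /\ th <= delta / 2 /\ th <= h / 4 /\
    th * (2 * a * r + 1) <= h /\ th * C <= tau * D'.
  rewrite -!ler_pdivlMr// /th; do !split; by rewrite !ge_min lexx ?orbT.
clearbody th.
pose Rr := h - th; have Rr0 : 0 < Rr by rewrite /Rr; lra.
have Rrh : Rr <= h by rewrite /Rr gerBl ltW.
have h2t : 0 <= h - 2 * th by lra.
(* The points whose component along the ray exceeds [th ^+ 2] lie in a ball of radius
   [Rr - 4 * gam], a negligible part of the whole in high dimension. *)
pose gam := Num.min (th / 4) (th ^+ 4 / (8 * Rr)).
have gam0 : 0 < gam by rewrite lt_min !divr_gt0 ?exprn_gt0// mulr_gt0.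
have [gamth gamR] : gam <= th / 4 /\ gam * (8 * Rr) <= th ^+ 4.
  by rewrite -ler_pdivlMr ?mulr_gt0// /gam; split; rewrite ge_min lexx ?orbT.
clearbody gam.
have R4 : 0 < Rr - 4 * gam by rewrite /Rr; lra.
(* Three exceptional sets, each at most a sixth of the total, leave one half. *)
have [N HN] := @expr_lt1_small R ((Rr - 2 * gam) / (Rr - gam)) (6^-1)
  ltac:(apply/andP; split; [apply: divr_ge0; clear -R4 gam0; lra|rewrite ltr_pdivrMr; clear -R4 gam0; lra]) ltac:(clear; lra).
pose eps := Num.min (Num.min th gam) (Num.min (Num.min r (h * th / (2 * r))) (if D == 0 then 1 else D / 2)).
have eps0 : 0 < eps.
  rewrite !lt_min th0 gam0 r0 divr_gt0 ?mulr_gt0//=; have [//|Dn] := eqVneq D 0.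
  by rewrite divr_gt0// lt0r Dn.
exists eps => //; exists N => e eta t' sig x Ne eta0 He Ht /andP[sig0 Hsig] Hx.
have e0 : (0 < e)%N by apply: leq_ltn_trans Ne.
have epsth : eps <= th by rewrite /eps !ge_min lexx.
have epsgam : eps <= gam by rewrite /eps !ge_min lexx !orbT.
have epsh : eps * (2 * r) <= h * th.
  by rewrite -ler_pdivlMr ?mulr_gt0// /eps !ge_min lexx !orbT.
have xa : x = 0 -> a = 0.
  move=> x0; apply: Da; apply/eqP; apply: contraT => Dn.
  have : D <= eps by apply: le_trans Ht; move: Hx; rewrite x0 enorm0 sub0r normrN ger0_norm.
  have : eps <= D / 2 by rewrite /eps !ge_min (negbTE Dn) lexx !orbT.
  have : 0 < D by rewrite lt0r Dn.
  lra.
set u := unitv x; pose c := x + (a * r) *: u.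
have uu : x != 0 -> dot u u = 1 by exact: dot_unitv.
pose n := enorm x + a * r.
have cE : c = n *: u by rewrite /c {1}(unitvE x) -scalerDl.
have ndot : n ^+ 2 * dot u u = n ^+ 2.
  have [x0|/uu ->] := eqVneq x 0; last by rewrite mulr1.
  by rewrite /n x0 enorm0 (xa x0) mul0r addr0 expr0n mul0r.
have adot : (a * r) ^+ 2 * dot u u = (a * r) ^+ 2.
  have [x0|/uu ->] := eqVneq x 0; last by rewrite mulr1.
  by rewrite (xa x0) mul0r expr0n mul0r.
have u1 : dot u u <= 1.
  have [x0|/uu ->//] := eqVneq x 0.
  have -> : u = 0 by rewrite /u /unitv x0 scaler0.
  by rewrite -(scale0r (0 : 'rV[R]_e)) dotZl mul0r.
pose t (q : 'rV[int]_e) := lat eta q - c.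
pose P1 q := dot (t q) u > th ^+ 2.
pose P2 q := dot (t q) u < - th ^+ 2.
pose P3 q := enorm (t q) < h - 2 * th.
set B := ball_pts eta c Rr.
have lowB : (Rr - gam) ^+ e * vol_ball R e <= (size B)%:R * eta ^+ e.
  apply: ball_pts_ge => //; first by clear -R4 gam0; lra.
  by have := le_trans He epsgam; clear; lra.
have capgen (w : 'rV[R]_e) q : dot w w <= 1 -> enorm (t q) <= Rr -> th ^+ 2 < dot (t q) w ->
    enorm (lat eta q - (c + th ^+ 2 *: w)) <= Rr - 4 * gam.
  move=> ww tR tw; rewrite opprD addrA -/(t q).
  rewrite -(@ler_pXn2r _ 2)// ?nnegrE ?enorm_ge0 ?(ltW R4)//.
  rewrite -scaleNr sqr_enormDZ.
  have T2 : enorm (t q) ^+ 2 <= Rr ^+ 2 by rewrite ler_pXn2r// ?nnegrE ?enorm_ge0// ltW.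
  apply: cap_arith => //; first by rewrite exprn_gt0.
  by rewrite -exprD.
have He2 : Rr - 4 * gam + eta * Num.sqrt e%:R < Rr - 2 * gam.
  by have := le_trans He epsgam; clear -gam0; lra.
have bad1 : (size [seq q <- B | P1 q])%:R * eta ^+ e <= (Rr - 2 * gam) ^+ e * vol_ball R e.
  apply: (ball_filter_le (c' := c + th ^+ 2 *: u) e0 eta0 (ltW R4) He2) => q tR Pq.
  exact: capgen.
have bad2 : (size [seq q <- B | P2 q])%:R * eta ^+ e <= (Rr - 2 * gam) ^+ e * vol_ball R e.
  apply: (ball_filter_le (c' := c + th ^+ 2 *: (- u)) e0 eta0 (ltW R4) He2) => q tR Pq.
  by apply: capgen => //; rewrite ?dotNl dotNr ?opprK// ltrNr.
have bad3 : (size [seq q <- B | P3 q])%:R * eta ^+ e <= (Rr - 2 * gam) ^+ e * vol_ball R e.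
  apply: (ball_filter_le (c' := c) e0 eta0 (ltW R4) He2) => q tR Pq.
  by apply: le_trans (ltW Pq) _; clear -gamth th0; rewrite /Rr; lra.
have good_sub : leq (size [seq q <- B | ~~ [|| P1 q, P2 q | P3 q]])
   (size [seq y <- ball_pts eta x (r - sig) | `|enorm (lat eta y) - D'| <= tau]).
  apply: uniq_leq_size; first by rewrite filter_uniq// ball_pts_uniq.
  move=> q; rewrite mem_filter mem_ball_pts// -/(t q) => /andP[+ tR].
  rewrite mem_filter mem_ball_pts//.
  rewrite !negb_or -!leNgt => /and3P[p1 p2 p3].
  have T2 : enorm (t q) ^+ 2 <= Rr ^+ 2 by rewrite ler_pXn2r// ?nnegrE ?enorm_ge0// ltW.
  have T3 : (h - 2 * th) ^+ 2 <= enorm (t q) ^+ 2 by rewrite ler_pXn2r// ?nnegrE ?enorm_ge0.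
  have latE : lat eta q = c + t q by rewrite /t addrC subrK.
  apply/andP; split.
    have Y2 : enorm (lat eta q) ^+ 2 = n ^+ 2 + 2 * n * dot (t q) u + enorm (t q) ^+ 2.
      by rewrite latE cE addrC sqr_enormDZ ndot; ring.
    have nA : n <= A by move: Hx; rewrite ler_norml /n /A => /andP[_ H]; clear -H Ht epsth th1; lra.
    have n0 : 0 <= n by rewrite addr_ge0 ?enorm_ge0.
    have nD : `|n - (D + a * r)| <= th.
      have -> : n - (D + a * r) = enorm x - D by rewrite /n; ring.
      by apply: le_trans Hx (le_trans Ht _).
    have key : `|enorm (lat eta q) ^+ 2 - D' ^+ 2| <= tau * D'.
      apply: le_trans thC.
      have -> : D' ^+ 2 = (D + a * r) ^+ 2 + h ^+ 2 by rewrite D'2 h2; ring.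
      rewrite Y2; apply: shell_arith; rewrite ?n0 ?nA ?(ltW th0)//.
      - by rewrite addr_ge0//= /A lerDl.
      - have th2 : th ^+ 2 <= th by rewrite expr2 ler_piMl// ltW.
        by rewrite ler_norml (le_trans p1 th2) (le_trans _ p2)// lerN2.
      - by rewrite T3 (le_trans T2)// ler_pXn2r ?nnegrE// ltW.
    have Y0 : 0 < enorm (lat eta q) + D' by rewrite ltr_wpDl ?enorm_ge0.
    rewrite -(ler_pM2r Y0).
    have -> : `|enorm (lat eta q) - D'| * (enorm (lat eta q) + D') =
       `|enorm (lat eta q) ^+ 2 - D' ^+ 2|.
      by rewrite -[X in _ * X]gtr0_norm// -normrM; congr (`|_|); ring.
    apply: le_trans key _; rewrite ler_pM2l// lerDr enorm_ge0//.
  have rs : 0 <= r - sig.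
    by rewrite subr_ge0 (le_trans Hsig)// /eps !ge_min lexx !orbT.
  rewrite -(@ler_pXn2r _ 2)// ?nnegrE ?enorm_ge0//.
  have -> : lat eta q - x = (a * r) *: u + t q by rewrite /t /c; exact: sub_shift.
  have -> : enorm ((a * r) *: u + t q) ^+ 2 =
     (a * r) ^+ 2 + 2 * (a * r) * dot (t q) u + enorm (t q) ^+ 2.
    by rewrite addrC sqr_enormDZ adot; ring.
  apply: (@radius_arith _ _ _ _ h th) => //; first exact: ltW.
  by apply: le_trans epsh; rewrite ler_pM2r ?mulr_gt0.
have tot : (size B)%:R <= (size [seq q <- B | P1 q])%:R + (size [seq q <- B | P2 q])%:R
   + (size [seq q <- B | P3 q])%:R + (size [seq q <- B | ~~ [|| P1 q, P2 q | P3 q]])%:R :> R.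
  by rewrite -!natrD ler_nat size_le_filter3.
set G := (size [seq q <- B | ~~ _])%:R in tot.
have q6 := HN e (ltnW Ne).
have v0 := vol_ball_gt0 R e0.
have Rg : 0 < Rr - gam by clear -R4 gam0; lra.
have small : (Rr - 2 * gam) ^+ e <= 6^-1 * (Rr - gam) ^+ e.
  by rewrite -ler_pdivrMr ?exprn_gt0// -expr_div_n.
have hd : (h - delta) ^+ e <= (Rr - gam) ^+ e.
  by rewrite lerXn2r// ?nnegrE ?subr_ge0 ?(ltW deh) ?(ltW Rg)//; clear -gamth thd th0 R4 gam0 deh; rewrite /Rr in R4 *; lra.
apply: (@le_trans _ _ (G * eta ^+ e)); last first.
  by rewrite ler_pM2r ?exprn_gt0// ler_nat.
have etae : 0 < eta ^+ e by rewrite exprn_gt0.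
have tot' := ler_wpM2r (ltW etae) tot; rewrite !mulrDl in tot'.
have hdv := ler_wpM2r (ltW v0) hd.
have smv := ler_wpM2r (ltW v0) small.
move: bad1 bad2 bad3 lowB tot' hdv smv; rewrite -!mulrA.
set X := (h - delta) ^+ e * _; set Y := (Rr - gam) ^+ e * _.
set Z := (Rr - 2 * gam) ^+ e * _; clearbody X Y Z; clear; lra.
Qed.

(* Stewart's formula: the points at distance at most [X] of the origin and at
   most [r] of [y] lie in a ball centered on the segment from the origin to [y]. *)
Lemma lens_subset d (x y : 'rV[R]_d) (X r g : R) : 0 <= g <= 1 ->
  enorm x <= X -> enorm (x - y) <= r ->
  enorm (x - g *: y) ^+ 2 <= (1 - g) * X ^+ 2 + g * r ^+ 2 - g * (1 - g) * enorm y ^+ 2.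
Proof.
move=> /andP[g0 g1] xX xyr.
have X2 : enorm x ^+ 2 <= X ^+ 2.
  by rewrite ler_pXn2r// nnegrE ?enorm_ge0// (le_trans _ xX)// enorm_ge0.
have r2 : enorm (x - y) ^+ 2 <= r ^+ 2.
  by rewrite ler_pXn2r// nnegrE ?enorm_ge0// (le_trans _ xyr)// enorm_ge0.
have g1' : 0 <= 1 - g by rewrite subr_ge0.
have := lerD (ler_wpM2l g1' X2) (ler_wpM2l g0 r2).
move: r2; rewrite -[x - y](_ : x + (-1) *: y = _); last by rewrite scaleN1r.
rewrite -scaleNr !sqr_enormDZ (sqr_enorm y) => _ H.
apply: le_trans (lerB H (lexx (g * (1 - g) * dot y y))).
by rewrite le_eqVlt; apply/orP; left; apply/eqP; ring.
Qed.

(** In the triangle with sides [D], [r] and [D'], the altitude on the third side has its foot at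
    [g *: y] and its length is [H]. The possible predecessors of [y] lie in a ball of about that
    radius, centered at the foot. *)
Lemma lens_upper (a r D delta : R) : 0 <= a < 1 -> 0 < r -> 0 < D -> 0 < delta ->
  exists2 eps, 0 < eps & forall (e : nat) (eta t t' : R) (y : 'rV[R]_e),
    (0 < e)%N -> 0 < eta -> eta * Num.sqrt e%:R <= eps ->
    0 <= t <= eps -> 0 <= t' <= eps ->
    Num.sqrt (D ^+ 2 + 2 * r * a * D + r ^+ 2) - t <= enorm y ->
    (size [seq x <- ball_pts eta y r | enorm (lat eta x) <= D + t'])%:R * eta ^+ e <=
    (D * r * Num.sqrt (1 - a ^+ 2) / Num.sqrt (D ^+ 2 + 2 * r * a * D + r ^+ 2) + delta) ^+ e
      * vol_ball R e.
Proof.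
move=> /andP[a0 a1] r0 D0 de0.
set D' := Num.sqrt (_ + _ + _).
have D'2 : D' ^+ 2 = D ^+ 2 + 2 * r * a * D + r ^+ 2.
  by rewrite sqr_sqrtr// !addr_ge0 ?sqr_ge0// !mulr_ge0// ltW.
have D'0 : 0 < D'.
  by rewrite sqrtr_gt0 ltr_wpDl ?exprn_gt0// addr_ge0 ?sqr_ge0// !mulr_ge0// ltW.
pose g := D * (D + a * r) / D' ^+ 2.
have Dar : 0 < D + a * r by rewrite ltr_wpDr// mulr_ge0// ltW.
have g0 : 0 <= g by rewrite divr_ge0 ?sqr_ge0// mulr_ge0// ltW.
have g1 : g <= 1.
  rewrite ler_pdivrMr ?exprn_gt0// mul1r D'2.
  have : 0 <= r * a * D by rewrite !mulr_ge0// ltW.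
  by have := sqr_ge0 r; rewrite mulrDr -expr2; lra.
set H := D * r * Num.sqrt (1 - a ^+ 2) / D'.
have a2 : 0 < 1 - a ^+ 2 by rewrite expr2; nra.
have H0 : 0 <= H by rewrite divr_ge0 ?(ltW D'0)// !mulr_ge0 ?sqrtr_ge0// ltW.
have HE : H ^+ 2 = (1 - g) * D ^+ 2 + g * r ^+ 2 - g * (1 - g) * D' ^+ 2.
  rewrite /H expr_div_n !exprMn sqr_sqrtr ?(ltW a2)// /g D'2; field.
  by rewrite -D'2 gt_eqF// exprn_gt0.
pose C := 2 * D + 1 + 2 * D'; have C0 : 0 < C by rewrite /C; lra.
pose eps := Num.min (Num.min 1 D') (Num.min (delta / 4) ((delta / 2) ^+ 2 / C)).
have eps0 : 0 < eps by rewrite !lt_min ltr01 D'0 !divr_gt0// exprn_gt0// divr_gt0.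
have e1 : eps <= 1 by rewrite /eps !ge_min lexx.
have eD' : eps <= D' by rewrite /eps !ge_min lexx !orbT.
have ed : eps <= delta / 4 by rewrite /eps !ge_min lexx !orbT.
have eC : eps * C <= (delta / 2) ^+ 2 by rewrite -ler_pdivlMr// /eps !ge_min lexx !orbT.
exists eps => // e eta t t' y en eta0 He /andP[t0 te] /andP[t'0 t'e] Hy.
apply: (@ball_filter_le _ _ _ (g *: y) _ (H + delta / 2)) => //.
- by rewrite addr_ge0// divr_ge0// ltW.
- lra.
move=> q qy qD; rewrite -(@ler_pXn2r _ 2)// ?nnegrE ?enorm_ge0//; last first.
  by rewrite addr_ge0// divr_ge0// ltW.
apply: le_trans (lens_subset _ qD qy) _; first by rewrite g0.
have y2 : (D' - t) ^+ 2 <= enorm y ^+ 2.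
  by rewrite ler_pXn2r// nnegrE ?enorm_ge0// subr_ge0 (le_trans te).
have g1' : 0 <= 1 - g by rewrite subr_ge0.
have gg0 : 0 <= g * (1 - g) by rewrite mulr_ge0.
have gg1 : g * (1 - g) <= 1 by rewrite mulr_ile1// gerBl.
have k1 := ler_wpM2l gg0 y2.
have E1 : (D + t') ^+ 2 = D ^+ 2 + (2 * D * t' + t' ^+ 2) by ring.
have E2 : (D' - t) ^+ 2 = D' ^+ 2 - (2 * D' * t - t ^+ 2) by ring.
have b1 : 2 * D * t' + t' ^+ 2 <= (2 * D + 1) * eps.
  have : t' ^+ 2 <= t' by rewrite expr2 ler_piMl// (le_trans t'e).
  have := ler_wpM2l (ltW D0) t'e; lra.
have b2 : 2 * D' * t - t ^+ 2 <= 2 * D' * eps.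
  by have := ler_wpM2l (ltW D'0) te; have := sqr_ge0 t; lra.
have b1' : 0 <= 2 * D * t' + t' ^+ 2 by rewrite addr_ge0 ?sqr_ge0// !mulr_ge0// ltW.
have b2' : 0 <= 2 * D' * t - t ^+ 2.
  have : t * t <= t * (2 * D') by apply: ler_wpM2l => //; lra.
  by rewrite expr2; lra.
have c1 : (1 - g) * (2 * D * t' + t' ^+ 2) <= (2 * D + 1) * eps.
  by apply: le_trans b1; apply: ler_piMl => //; rewrite gerBl.
have c2 : g * (1 - g) * (2 * D' * t - t ^+ 2) <= 2 * D' * eps.
  by apply: le_trans b2; apply: ler_piMl.
have E3 : (H + delta / 2) ^+ 2 = H ^+ 2 + 2 * (H * (delta / 2)) + (delta / 2) ^+ 2 by ring.
have Hd : 0 <= H * (delta / 2) by rewrite mulr_ge0// divr_ge0// ltW.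
rewrite E3 E1; rewrite E2 in k1; rewrite HE.
clear E1 E2 E3 b1 b2 b1' b2' y2 He Hy te t'e t0 t'0 ed eD' e1 HE D'2.
move: k1 c1 c2 eC Hd; rewrite /C.
by move: (enorm y ^+ 2) (H * (delta / 2)) => Y Hd *; lra.
Qed.

End Steps.

Lemma finite_min (R : realType) (f : nat -> R) n : (forall l, 0 < f l) ->
  exists2 m, 0 < m & forall l, (l <= n)%N -> m <= f l.
Proof.
move=> f0; elim: n => [|n [m m0 Hm]].
  by exists (f 0%N) => // l; rewrite leqn0 => /eqP ->.
exists (Num.min m (f n.+1)); first by rewrite lt_min m0 f0.
move=> l; rewrite leq_eqVlt => /predU1P[->|]; first by rewrite ge_min lexx orbT.
by rewrite ltnS => /Hm h; rewrite ge_min h.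
Qed.

Lemma cvg_prod_ord (R : realType) (f : nat -> R -> R) n (t : R) :
  (forall i, (i < n)%N -> f i x @[x --> t] --> f i t) ->
  \prod_(i < n) f i x @[x --> t] --> \prod_(i < n) f i t.
Proof.
elim: n => [|n IH] H.
  rewrite big_ord0; under eq_fun do rewrite big_ord0; exact: cvg_cst.
rewrite big_ord_recr/=; under eq_fun do rewrite big_ord_recr/=.
by apply: cvgM; [apply: IH => i /ltnW; exact: H | exact: H].
Qed.

Lemma filter_subset_size (T : eqType) (s t : seq T) (P : pred T) :
  uniq s -> (forall x, x \in s -> P x -> x \in t) -> (size [seq x <- s | P x] <= size t)%N.
Proof.
move=> us H; apply: uniq_leq_size; first by rewrite filter_uniq.
by move=> x; rewrite mem_filter => /andP[Px /H]; apply.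
Qed.

(** * Distances and heights along a chain *)

Section ChainGeometry.
Variables (R : realType) (rho : R) (k : nat) (a : nat -> R).
Hypotheses (rho1 : 1 < rho) (k1 : (1 <= k)%N)
  (a01 : forall i, (2 <= i <= k.+1)%N -> 0 <= a i < 1).

(** Stage [l] is the step to ball [l + 1] of a chain, the starting ball being the big end of the
    preceding chain. Its length is r_{l+1}, its cosine a_{l+1}, and it ends at distance d_{l+1};
    stage 0 has cosine 0. *)
Definition stage_rad (l : nat) : R := if (l == 0%N) || (l == k) then 1 + rho else 2.
Definition stage_cos (l : nat) : R := if (l == 0%N) || (k < l)%N then 0 else a l.+1.
Definition stage_dist (l : nat) : R := Dseq rho k a l.
Definition prev_dist (l : nat) : R := if l is l'.+1 then stage_dist l' else 0.
(** Exponential growth rate of the number of successors, up to normalization; [back_height], the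
    altitude of the triangle, is that of the number of predecessors. *)
Definition stage_height (l : nat) : R := stage_rad l * Num.sqrt (1 - stage_cos l ^+ 2).
Definition back_height (l : nat) : R := prev_dist l * stage_height l / stage_dist l.

Lemma stage_rad_gt0 l : 0 < stage_rad l.
Proof. by rewrite /stage_rad; case: ifP => _ //; move: rho1; lra. Qed.

Lemma stage_cos01 l : 0 <= stage_cos l < 1.
Proof.
rewrite /stage_cos; case: ifP => [_|]; first by rewrite lexx ltr01.
by move=> /negbT; rewrite negb_or -leqNgt => /andP[l0 lk]; apply: a01; lia.
Qed.

Lemma stage_sin_gt0 l : 0 < 1 - stage_cos l ^+ 2.
Proof. by have /andP[c0 c1] := stage_cos01 l; rewrite expr2; nra. Qed.

Lemma stage_height_gt0 l : 0 < stage_height l.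
Proof. by rewrite mulr_gt0 ?stage_rad_gt0// sqrtr_gt0 stage_sin_gt0. Qed.

Lemma Dseq_gt0 l : (l <= k)%N -> 0 < Dseq rho k a l.
Proof.
elim: l => [_|l IH lk] /=; first by move: rho1; lra.
have Dp := IH (ltnW lk).
have r0 : 0 < Defs.rad rho k l.+2 by rewrite /Defs.rad; case: ifP => _ //; move: rho1; lra.
rewrite sqrtr_gt0 ltr_wpDl ?exprn_gt0// addr_ge0 ?sqr_ge0// mulr_ge0 ?(ltW Dp)//.
rewrite mulr_ge0 ?mulr_ge0 ?(ltW r0)//.
by have /andP[] : 0 <= a l.+2 < 1 by apply: a01; lia.
Qed.

Lemma stage_distE l : (l <= k)%N -> stage_dist l =
  Num.sqrt (prev_dist l ^+ 2 + 2 * stage_rad l * stage_cos l * prev_dist l + stage_rad l ^+ 2).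
Proof.
case: l => [_|l lk]; rewrite /stage_dist /stage_rad /stage_cos /=.
  rewrite expr0n mulr0 addr0 add0r sqrtr_sqr ger0_norm//; move: rho1; lra.
rewrite ltnNge lk /= /Defs.rad eqSS.
by case: eqP => [->|].
Qed.

Lemma prev_dist_ge0 l : (l <= k)%N -> 0 <= prev_dist l.
Proof. by case: l => [|l lk] //=; apply/ltW/Dseq_gt0/ltnW. Qed.

Definition step_count (delta tau : R) (l e : nat) (eta t' sig : R) (x : 'rV[R]_e) : Prop :=
  2^-1 * ((stage_height l - delta) ^+ e * vol_ball R e) <=
    (size [seq y <- ball_pts eta x (stage_rad l - sig) |
       `|enorm (lat eta y) - stage_dist l| <= tau])%:R * eta ^+ e.

(** The accuracy at which a stage ends must suit the start of the next one, so accuracies are chosen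
    backwards from stage [k]; [eps] and [N] are then common to all stages. *)
Lemma tolerances (delta : R) : 0 < delta -> (forall l, delta < stage_height l) ->
  exists (tau : nat -> R) (eps : R) (N : nat),
    [/\ 0 < eps <= 1, forall l, 0 < tau l,
    (forall l e eta (x : 'rV[R]_e), (l <= k)%N -> (N < e)%N -> 0 < eta ->
       eta * Num.sqrt e%:R <= eps ->
       `|enorm x - prev_dist l| <= (if l is l'.+1 then tau l' else 0) ->
       step_count delta (tau l) l eta 0 eps x) &
    (forall l e eta (y : 'rV[R]_e), (0 < l <= k)%N -> (N < e)%N -> 0 < eta ->
       eta * Num.sqrt e%:R <= eps ->
       stage_dist l - tau l <= enorm y ->
       (size [seq x <- ball_pts eta y (stage_rad l) |
          enorm (lat eta x) <= prev_dist l + tau l.-1])%:R * eta ^+ e <=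
       (back_height l + delta) ^+ e * vol_ball R e)].
Proof.
move=> de0 deh.
have HU l : exists eps : R, 0 < eps /\ ((0 < l <= k)%N ->
    forall (e : nat) (eta t t' : R) (y : 'rV[R]_e),
    (0 < e)%N -> 0 < eta -> eta * Num.sqrt e%:R <= eps ->
    0 <= t <= eps -> 0 <= t' <= eps -> stage_dist l - t <= enorm y ->
    (size [seq x <- ball_pts eta y (stage_rad l) | enorm (lat eta x) <= prev_dist l + t'])%:R
       * eta ^+ e <= (back_height l + delta) ^+ e * vol_ball R e).
  have [lk|lk] := boolP (0 < l <= k)%N; last by exists 1.
  have /andP[l0 lk'] := lk.
  have D0 : 0 < prev_dist l by case: l l0 {lk} lk' => [//|l _ lk] /=; apply/Dseq_gt0/ltnW.
  have [eps eps0 H] := lens_upper (stage_cos01 l) (stage_rad_gt0 l) D0 de0.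
  exists eps; split => // _ e eta t t' y e0 eta0 He Ht Ht'.
  rewrite (stage_distE lk') => Hy; have := H e eta t t' y e0 eta0 He Ht Ht' Hy.
  by rewrite /back_height (stage_distE lk') /stage_height !mulrA.
have [EU HEU] := choice HU.
have HS l : exists f : R -> R * nat, forall t : R, (l <= k)%N -> 0 < t -> 0 < (f t).1 /\
    forall (e : nat) (eta t' sig : R) (x : 'rV[R]_e),
    ((f t).2 < e)%N -> 0 < eta -> eta * Num.sqrt e%:R <= (f t).1 -> t' <= (f t).1 ->
    0 < sig <= (f t).1 -> `|enorm x - prev_dist l| <= t' -> step_count delta t l eta t' sig x.
  suff /choice[f Hf] : forall t : R, exists q : R * nat, (l <= k)%N -> 0 < t -> 0 < q.1 /\
    forall (e : nat) (eta t' sig : R) (x : 'rV[R]_e),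
    (q.2 < e)%N -> 0 < eta -> eta * Num.sqrt e%:R <= q.1 -> t' <= q.1 ->
    0 < sig <= q.1 -> `|enorm x - prev_dist l| <= t' -> step_count delta t l eta t' sig x by exists f.
  move=> t.
  have [lk|lk] := boolP (l <= k)%N; last by exists (1, 0%N).
  have [t0|t0] := boolP (0 < t); last by exists (1, 0%N).
  have Da : prev_dist l = 0 -> stage_cos l = 0.
    case: l lk => [//|l lk] /= D0.
    by have := Dseq_gt0 (ltnW lk); rewrite -/(stage_dist l) D0 ltxx.
  have de : 0 < delta < stage_rad l * Num.sqrt (1 - stage_cos l ^+ 2) by rewrite de0 deh.
  have [eps eps0 [N H]] := step_lower (stage_cos01 l) (stage_rad_gt0 l) (prev_dist_ge0 lk) Da t0 de.
  exists (eps, N) => _ _ /=; split => // e eta t' sig x Ne eta0 He Ht Hs Hx.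
  by rewrite /step_count (stage_distE lk); exact: (H e eta t' sig x).
have [ES HES] := choice HS.
have [m m0 Hm] := @finite_min R (fun l => Num.min 1 (EU l)) k
  (fun l => ltac:(by rewrite lt_min ltr01; have [] := HEU l)).
(* [t j] is the accuracy at stage [k - j]; the value at [j.+1] is what stage [k - j] requires of its
   starting point. *)
pose fix t (j : nat) : R := if j is j'.+1 then
  (if (k - j' <= k)%N then Num.min m (ES (k - j')%N (t j')).1 else m) else m.
have t0 j : 0 < t j.
  elim: j => [|j IH] //=; rewrite leq_subr lt_min m0.
  by have [] := HES (k - j)%N (t j) (leq_subr _ _) IH.
have tm j : t j <= m by case: j => [//|j] /=; rewrite leq_subr ge_min lexx.
pose tau l := t (k - l)%N.
pose E l : R := if (l <= k)%N then Num.min m (ES l (tau l)).1 else 1.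
have E0 l : 0 < E l.
  rewrite /E; case: (boolP (l <= k)%N) => // lk; rewrite lt_min m0.
  by have [] := HES l (tau l) lk (t0 _).
have [eps eps0 Heps] := finite_min k E0.
pose N := \max_(l < k.+1) (ES l (tau l)).2.
exists tau, eps, N; split => //.
- rewrite eps0 /=; have := Heps 0%N (leq0n _); rewrite /E leq0n le_min => /andP[+ _].
  by move/le_trans; apply; apply: le_trans (Hm 0%N (leq0n _)) _; rewrite ge_min lexx.
- by move=> l; exact: t0.
- move=> l e eta x lk Ne eta0 He Hx.
  have [e1 H] := HES l (tau l) lk (t0 _).
  have := Heps l lk; rewrite /E lk le_min => /andP[em eE].
  apply: (H e eta (if l is l'.+1 then tau l' else 0)) => //.
  + apply: leq_ltn_trans Ne.
    by have := @leq_bigmax _ (fun l : 'I_k.+1 => (ES l (tau l)).2) (Ordinal (lk : (l < k.+1)%N)).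
  + exact: le_trans eE.
  + case: l lk {Hx H e1 em eE} => [|l] lk; first by apply/ltW; have [] := HES 0%N (tau 0%N) (leq0n _) (t0 _).
    rewrite /tau (_ : (k - l)%N = (k - l.+1).+1) /=; last by lia.
    rewrite leq_subr ge_min (_ : (k - (k - l.+1))%N = l.+1) ?lexx ?orbT//; lia.
  + by rewrite eps0.
- move=> l e eta y lk Ne eta0 He Hy; have /andP[l0 lk'] := lk.
  have [e1 H] := HEU l; have := Hm l lk'; rewrite le_min => /andP[_ mE].
  apply: (H lk e eta (tau l)) => //.
  + exact: leq_ltn_trans Ne.
  + apply: le_trans He _; apply: le_trans mE; have := Heps 0%N (leq0n _).
    by rewrite /E leq0n le_min => /andP[].
  + by rewrite (ltW (t0 _)) (le_trans (tm _)).
  + by rewrite (ltW (t0 _)) (le_trans (tm _)).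
Qed.

End ChainGeometry.

(** * Number of chains, in all and with a given end *)

Section ChainCounts.
Variables (R : realType) (rho : R) (k : nat) (a : nat -> R).
Hypotheses (rho1 : 1 < rho) (k1 : (1 <= k)%N)
  (a01 : forall i, (2 <= i <= k.+1)%N -> 0 <= a i < 1).
Variables (delta eps : R) (tau : nat -> R) (e : nat) (eta : R).
Local Notation V := 'rV[int]_e.
Hypotheses (eta0 : 0 < eta) (tau0 : forall l, 0 < tau l) (eps0 : 0 < eps).

(** The shells keep every chain close to the ideal distances. The margin [eps] on the length pays
    for the cubes and for the steps of time and layer. *)
Definition nxt (l : nat) (x : V) : seq V :=
  [seq y <- ball_pts eta (lat eta x) (stage_rad rho k l - eps) |
     `|enorm (lat eta y) - stage_dist rho k a l| <= tau l].

Lemma nxt_uniq l x : uniq (nxt l x).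
Proof. by rewrite filter_uniq// ball_pts_uniq. Qed.

Lemma mem_nxt l x y : y \in nxt l x =
  (`|enorm (lat eta y) - stage_dist rho k a l| <= tau l) &&
  (enorm (lat eta y - lat eta x) <= stage_rad rho k l - eps).
Proof. by rewrite mem_filter mem_ball_pts. Qed.

Hypothesis lower : forall l (x : 'rV[R]_e), (l <= k)%N ->
  `|enorm x - prev_dist rho k a l| <= (if l is l'.+1 then tau l' else 0) ->
  step_count rho k a delta (tau l) l eta 0 eps x.
Hypothesis upper : forall l (y : 'rV[R]_e), (0 < l <= k)%N ->
  stage_dist rho k a l - tau l <= enorm y ->
  (size [seq x <- ball_pts eta y (stage_rad rho k l) |
     enorm (lat eta x) <= prev_dist rho k a l + tau l.-1])%:R * eta ^+ e <=
  (back_height rho k a l + delta) ^+ e * vol_ball R e.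

Let vol := vol_ball R e / eta ^+ e.
Definition low_count l : R := 2^-1 * (stage_height rho k a l - delta) ^+ e * vol.
Definition up_count l : R := (back_height rho k a l + delta) ^+ e * vol.

Lemma end_in_shell l c : c \in chains nxt l ->
  `|enorm (lat eta (last 0 c)) - prev_dist rho k a l| <= (if l is l'.+1 then tau l' else 0).
Proof.
case: l => [|l].
  rewrite inE => /eqP -> /=.
  have -> : lat eta (0 : V) = 0 by apply/rowP => i; rewrite !mxE mulr0.
  by rewrite enorm0 subrr normr0.
move=> /chainsSP[c' [y [_ yn ->]]]; rewrite last_rcons.
by move: yn; rewrite mem_nxt => /andP[].
Qed.

Lemma size_chains_ge l : (l <= k.+1)%N -> (forall i, 0 <= low_count i) ->
  \prod_(i < l) low_count i <= (size (chains nxt l))%:R.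
Proof.
move=> + lc0; elim: l => [_|l IH lk]; first by rewrite big_ord0.
rewrite big_ord_recr/= -[X in _ <= X%:R]/(size (chains nxt l.+1)).
rewrite -[X in _ <= X]mulr1 -sumr_const_seq sum_chainsS.
apply: (@le_trans _ _ (\sum_(c <- chains nxt l) low_count l)).
  by rewrite sumr_const_seq; apply: ler_wpM2r => //; apply: IH; exact: ltnW.
rewrite [leLHS]big_seq_cond [leRHS]big_seq_cond; apply: ler_sum => c; rewrite andbT => cl.
rewrite sumr_const_seq mulr1.
have := lower lk (end_in_shell cl); rewrite /step_count -ler_pdivrMr ?exprn_gt0//.
by rewrite /low_count /vol !mulrA.
Qed.

(** Chains with end [z] are grouped by their last but one point, which lies in [B]. *)
Lemma end_count_split (l : nat) (z : V) (B : seq V) (M : R) :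
  (forall c, c \in chains nxt l -> z \in nxt l (last 0 c) -> last 0 c \in B) ->
  (forall x, end_count R nxt l x <= M) -> end_count R nxt l.+1 z <= (size B)%:R * M.
Proof.
move=> HB HM; rewrite (end_countS _ nxt_uniq).
apply: (@le_trans _ _ (\sum_(x <- B) end_count R nxt l x)); last first.
  by rewrite -sumr_const_seq; apply: ler_sum => x _.
rewrite /end_count exchange_big/=.
rewrite [leLHS]big_seq_cond [leRHS]big_seq_cond; apply: ler_sum => c; rewrite andbT => cl.
case: (boolP (z \in _)) => zn; last by rewrite sumr_ge0.
have lB := HB c cl zn; rewrite (big_rem _ lB)/= eqxx lerDl sumr_ge0//.
Qed.

Lemma end_count1 z : end_count R nxt 1 z <= 1.
Proof. by rewrite (end_countS _ nxt_uniq) big_seq1; case: (_ \in _). Qed.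

(** Both ends of a step lie in known shells, so the predecessors fill only a lens, counted by
    [upper]. *)
Lemma end_count_le l z : (l <= k)%N -> (forall i, (i < k)%N -> 0 <= up_count i.+1) ->
  end_count R nxt l.+1 z <= \prod_(i < l) up_count i.+1.
Proof.
move=> + uc0; elim: l z => [|l IH] z lk; first by rewrite big_ord0 end_count1.
have P0 n : (n <= k)%N -> 0 <= \prod_(i < n) up_count i.+1.
  by move=> nk; apply: prodr_ge0 => i _; apply/uc0/(leq_trans (ltn_ord i)).
have [zs|zs] := boolP (`|enorm (lat eta z) - stage_dist rho k a l.+1| <= tau l.+1); last first.
  rewrite (end_countS _ nxt_uniq) big1; first exact: P0.
  by move=> c _; rewrite mem_nxt (negbTE zs).
pose B := [seq x <- ball_pts eta (lat eta z) (stage_rad rho k l.+1) |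
     enorm (lat eta x) <= prev_dist rho k a l.+1 + tau l].
rewrite big_ord_recr/= mulrC.
apply: (@le_trans _ _ ((size B)%:R * \prod_(i < l) up_count i.+1)).
  apply: end_count_split => [c cl zn|x]; last by apply: IH; exact: ltnW.
  rewrite mem_filter mem_ball_pts//; move: zn; rewrite mem_nxt => /andP[_ zc].
  rewrite enormB_sym (le_trans zc) ?gerBl ?(ltW eps0)// andbT.
  have := end_in_shell cl; rewrite ler_norml => /andP[_].
  by rewrite lerBlDl.
rewrite ler_wpM2r//; first by apply/P0/ltnW.
have : stage_dist rho k a l.+1 - tau l.+1 <= enorm (lat eta z).
  by move: zs; rewrite ler_norml lerBrDr => /andP[+ _]; rewrite addrC.
move/(@upper l.+1 _ lk); rewrite -/B -ler_pdivlMr ?exprn_gt0//.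
by rewrite /up_count /vol mulrA.
Qed.

(** A cruder bound for the stages before the last: going backwards, each step offers at most 1 / q
    neighbours, wherever the shells are. *)
Lemma end_count_back l (q : R) z : 0 <= q -> (l < k)%N ->
  (forall i (x : V), (0 < i < k)%N ->
     (size (ball_pts eta (lat eta x) (stage_rad rho k i - eps)))%:R * q <= 1) ->
  end_count R nxt l.+1 z * q ^+ l <= 1.
Proof.
move=> q0 + Hq; elim: l z => [|l IH] z lk; first by rewrite expr0 mulr1 end_count1.
have [->|qn0] := eqVneq q 0; first by rewrite expr0n mulr0.
have qp : 0 < q by rewrite lt0r qn0.
pose B := ball_pts eta (lat eta z) (stage_rad rho k l.+1 - eps).
have H : end_count R nxt l.+2 z <= (size B)%:R * (q ^+ l)^-1.
  apply: end_count_split => [c cl zn|x].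
    rewrite mem_ball_pts//; move: zn; rewrite mem_nxt => /andP[_].
    by rewrite enormB_sym.
  by rewrite -div1r ler_pdivlMr ?exprn_gt0// IH// ltnW.
rewrite exprS mulrA; apply: le_trans (ler_wpM2r _ (ler_wpM2r q0 H)) _; first by rewrite exprn_ge0.
rewrite -mulrA mulrACA mulVf ?mulr1; last by rewrite expf_neq0.
by apply: Hq; rewrite lk.
Qed.

End ChainCounts.

Ltac pos := repeat (first [done | match goal with
  | |- is_true (0 < _ ^+ _) => apply: exprn_gt0
  | |- is_true (0 < _ * _) => apply: mulr_gt0
  | |- is_true (0 < _^-1) => rewrite invr_gt0
  | |- is_true (0 < _ - _) => rewrite subr_gt0
  | |- is_true (0 < _ + _) => apply: addr_gt0
  | |- is_true (0 < bigop _ _ _) => apply: prodr_gt0 => ? ?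
  | |- is_true (0 <= ?x) => lazymatch x with 0 => fail | _ => apply/ltW end
  | H : forall l, is_true (0 < _) |- is_true (0 < _) => apply: H
  | H : forall l, is_true (_ < _) |- is_true (_ < _) => apply: H
  end]).

(** * Choice of the parameters above the threshold *)

Section ChainNumerics.
Variable R : realType.

(** Confining chains to [e] of the 17 + e coordinates costs a factor (17 + e)^17 per ball; any
    exponential margin covers it. *)
Lemma poly17_le_exp (th C : R) m : 1 < th -> 0 < C ->
  exists N, forall e, (N <= e)%N -> 1 <= C * ((17 + e)%:R^-1) ^+ m * th ^+ e.
Proof.
move=> th1 C0.
have [N HN] := @poly_le_exp R th (C / 18 ^+ m) m th1 ltac:(by rewrite divr_gt0// exprn_gt0).
exists N.+1 => e Ne; have e0 : (0 < e)%N by exact: leq_ltn_trans Ne.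
have d0 : (0 : R) < (17 + e)%:R by rewrite ltr0n addn_gt0 e0 orbT.
rewrite exprVn mulrAC ler_pdivlMr ?exprn_gt0// mul1r.
apply: (@le_trans _ _ ((18 * e%:R) ^+ m)).
  rewrite lerXn2r ?nnegrE ?mulr_ge0//.
  by rewrite -natrM ler_nat; lia.
rewrite exprMn; apply: (@le_trans _ _ (18 ^+ m * (C / 18 ^+ m * th ^+ e))).
  by rewrite ler_pM2l ?exprn_gt0//; apply: HN; exact: ltnW.
rewrite le_eqVlt; apply/orP; left; apply/eqP; field.
by rewrite expf_neq0.
Qed.

Lemma one_sub_exp_bounds (m : R) : 0 <= m <= 1 -> m / 2 <= 1 - expR (- m) <= m.
Proof.
move=> /andP[m0 m1]; have := expR_ge1Dx (- m); have := expR_ge1Dx m => h1 h2.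
apply/andP; split; last by move: h2; lra.
have e0 : 0 < expR m by exact: expR_gt0.
rewrite expRN; have : (expR m)^-1 <= (1 + m)^-1.
  by rewrite lef_pV2 ?posrE//; lra.
have : (1 + m)^-1 <= 1 - m / 2.
  rewrite -div1r ler_pdivrMr; last lra.
  have := mulr_ge0 m0 m0; have : m * m <= m by rewrite ler_piMl.
  lra.
lra.
Qed.

(** The square root is the diameter of a cube in units of its side, and the 2 pays for the moves of
    the time and of the layer. *)
Lemma eta_small (eps : R) : 0 < eps -> exists N, forall d, (N < d)%N ->
  d%:R^-1 * (Num.sqrt d%:R + 2) < eps.
Proof.
move=> e0; exists (Num.truncn ((3 / eps) ^+ 2)).+1 => d Nd.
have d1 : (0 < d)%N by apply: leq_ltn_trans Nd.
set s := Num.sqrt d%:R; have s2 : s ^+ 2 = d%:R :> R by rewrite sqr_sqrtr.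
have s1 : 1 <= s by rewrite -sqrtr1 ler_sqrt// ler1n.
have sd : 3 / eps < s.
  rewrite -(@ltr_pXn2r _ 2)// ?nnegrE ?sqrtr_ge0 ?divr_ge0 ?(ltW e0)// s2.
  by apply: lt_le_trans (truncnS_gt _) _; rewrite ler_nat ltnW.
rewrite -s2 mulrC ltr_pdivrMr ?exprn_gt0 ?(lt_le_trans ltr01)//.
rewrite ltr_pdivrMr// in sd; rewrite expr2 mulrA.
have : 3 * s < s * eps * s by rewrite ltr_pM2r// (lt_le_trans ltr01).
lra.
Qed.

Lemma lattice_cell_le_vol d (eta : R) : (0 < d)%N -> 0 < eta ->
  eta * Num.sqrt d%:R < 1 -> eta ^+ d <= vol_ball R d.
Proof.
move=> d0 eta0 H.
have := @ball_pts_le R d eta 0 0 1 d0 eta0 (lexx _); rewrite add0r expr1n mul1r => /(_ H).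
apply: le_trans; rewrite ler_peMl ?exprn_ge0 ?(ltW eta0)// ler1n.
have : (0 : 'rV[int]_d) \in ball_pts eta (0 : 'rV[R]_d) 0.
  rewrite mem_ball_pts//.
  have -> : lat eta (0 : 'rV[int]_d) - 0 = 0 :> 'rV[R]_d.
    by apply/rowP => i; rewrite !mxE mulr0 subr0.
  by rewrite enorm0.
by case: ball_pts.
Qed.

Variables (rho kap alpha beta : R) (k : nat) (a : nat -> R).
Hypotheses (rho1 : 1 < rho) (k1 : (1 <= k)%N) (kap01 : 0 < kap < 1)
  (alpha0 : 0 < alpha) (beta0 : 0 < beta)
  (a01 : forall i, (2 <= i <= k.+1)%N -> 0 <= a i < 1).

Definition type_rad (l : nat) : R := if l == k then rho else 1.
Definition type_weight (l : nat) : R := if l == k then beta else alpha.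
(* At this intensity the normalized quantity [lambda_tilde] is [kap ^+ d * (alpha + beta)]. *)
Definition crit_intensity (d : nat) : R := kap ^+ d / (vol_ball R d * 2 ^+ d).
Definition site_mean (d l : nat) : R :=
  crit_intensity d * type_weight l * (d%:R^-1 / type_rad l) ^+ d.
Definition stage_prob (d l : nat) : R := 1 - expR (- site_mean d l).

Local Notation sh := (stage_height rho k a).
Local Notation bh := (back_height rho k a).

(** The first rate is that of the mean number of open chains. The second says that the proportion of
    chains with a given end is exponentially smaller than the probability of the last ball. *)
Hypotheses
  (chain_cond : 1 < \prod_(l < k.+1) (sh l * (kap / (2 * type_rad l))))
  (dist_cond : 1 < sh 0 * (kap / (2 * rho)) * \prod_(l < k) (sh l.+1 / bh l.+1)).

Lemma type_rad_gt0 l : 0 < type_rad l.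
Proof. by rewrite /type_rad; case: ifP => _ //; move: rho1; lra. Qed.

Lemma type_weight_gt0 l : 0 < type_weight l.
Proof. by rewrite /type_weight; case: ifP. Qed.

Lemma site_meanE d l : (0 < d)%N -> site_mean d l =
  type_weight l * (kap / (2 * type_rad l)) ^+ d * d%:R^-1 ^+ d / vol_ball R d.
Proof.
move=> d0; have v0 := vol_ball_gt0 R d0; have t0 := type_rad_gt0 l.
rewrite /site_mean /crit_intensity !expr_div_n !exprMn; field.
by rewrite !expf_neq0 ?gt_eqF.
Qed.

Lemma back_height_gt0 l : (l < k)%N -> 0 < bh l.+1.
Proof.
move=> lk; apply: divr_gt0; last exact: (Dseq_gt0 rho1 k1 a01 lk).
apply: mulr_gt0; first exact: (Dseq_gt0 rho1 k1 a01 (ltnW lk)).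
exact: stage_height_gt0.
Qed.

(** Both conditions are open, hence persist for slightly smaller forward and larger backward
    heights. Beyond stage [k] all heights equal 2, so a finite minimum bounds them all. *)
Lemma choose_delta : exists delta : R, [/\ 0 < delta, forall l, delta < sh l,
  1 < \prod_(l < k.+1) ((sh l - delta) * (kap / (2 * type_rad l))) &
  1 < (sh 0 - delta) * (kap / (2 * rho)) * \prod_(l < k) ((sh l.+1 - delta) / (bh l.+1 + delta))].
Proof.
have c1 : \prod_(l < k.+1) ((sh l - x) * (kap / (2 * type_rad l))) @[x --> (0 : R)] -->
   \prod_(l < k.+1) ((sh l - 0) * (kap / (2 * type_rad l))).
  apply: (@cvg_prod_ord _ (fun l x => (sh l - x) * (kap / (2 * type_rad l)))) => i _.
  by apply: cvgMl; apply: cvgB; [exact: cvg_cst|exact: cvg_id].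
have c2 : (sh 0 - x) * (kap / (2 * rho)) * \prod_(l < k) ((sh l.+1 - x) / (bh l.+1 + x)) @[x --> (0 : R)]
  --> (sh 0 - 0) * (kap / (2 * rho)) * \prod_(l < k) ((sh l.+1 - 0) / (bh l.+1 + 0)).
  apply: cvgM.
    by apply: cvgMl; apply: cvgB; [exact: cvg_cst|exact: cvg_id].
  apply: (@cvg_prod_ord _ (fun l x => (sh l.+1 - x) / (bh l.+1 + x))) => i ik.
  apply: cvgM; first by apply: cvgB; [exact: cvg_cst|exact: cvg_id].
  apply: cvgV; first by rewrite addr0 gt_eqF// back_height_gt0.
  by apply: cvgD; [exact: cvg_cst|exact: cvg_id].
have n1 : \forall x \near (0 : R), 1 < \prod_(l < k.+1) ((sh l - x) * (kap / (2 * type_rad l))).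
  by apply: (cvgr_gt _ c1); under eq_bigr do rewrite subr0.
have n2 : \forall x \near (0 : R), 1 < (sh 0 - x) * (kap / (2 * rho)) *
    \prod_(l < k) ((sh l.+1 - x) / (bh l.+1 + x)).
  by apply: (cvgr_gt _ c2); rewrite subr0; under eq_bigr do rewrite subr0 addr0.
have [m m0 Hm] := finite_min k.+1 (stage_height_gt0 rho1 k1 a01).
have shk l : (k < l)%N -> sh l = 2.
  move=> kl; rewrite /stage_height /stage_rad /stage_cos kl orbT.
  by rewrite !gtn_eqF//= ?expr0n/= ?subr0 ?sqrtr1 ?mulr1//; lia.
have /nbhs_ballP[e /= e0 He] : \forall x \near (0 : R),
   1 < \prod_(l < k.+1) ((sh l - x) * (kap / (2 * type_rad l))) /\
   1 < (sh 0 - x) * (kap / (2 * rho)) * \prod_(l < k) ((sh l.+1 - x) / (bh l.+1 + x)).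
  by near=> x; split; near: x.
pose delta := Num.min (e / 2) (Num.min 1 (m / 2)).
have de0 : 0 < delta by rewrite !lt_min ltr01 !divr_gt0.
have [h1 h2] : 1 < \prod_(l < k.+1) ((sh l - delta) * (kap / (2 * type_rad l))) /\
   1 < (sh 0 - delta) * (kap / (2 * rho)) * \prod_(l < k) ((sh l.+1 - delta) / (bh l.+1 + delta)).
  apply: He; rewrite /ball/= sub0r normrN gtr0_norm//.
  apply: (@le_lt_trans _ _ (e / 2)); first by rewrite /delta ge_min lexx.
  by rewrite ltr_pdivrMr// mulr2n mulrDr mulr1 ltrDl.
exists delta; split => // l; have [lk|lk] := leqP l k.+1.
  apply: lt_le_trans (Hm l lk); apply: (@le_lt_trans _ _ (m / 2)).
    by rewrite /delta !ge_min lexx !orbT.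
  by rewrite ltr_pdivrMr// mulr2n mulrDr mulr1 ltrDl.
rewrite shk ?(ltn_trans _ lk)//; apply: (@le_lt_trans _ _ 1); last by lra.
by rewrite /delta !ge_min lexx !orbT.
Unshelve. all: by end_near. Qed.

Definition chain_weights_ok (tau : nat -> R) (eps E : R) (e : nat) : Prop :=
  let d := (17 + e)%N in let eta : R := d%:R^-1 in let nx := @nxt R rho k a eps tau e eta in
  [/\ forall l, 0 < stage_prob d l <= 1, eta * (Num.sqrt d%:R + 2) < eps,
    (0 < size (chains nx k.+1))%N &
    forall z, \sum_(c <- chains nx k.+1) coinc (stage_prob d) z c <=
       (size (chains nx k.+1))%:R * (1 + E)].

Lemma pad_ball_pts_le e d (eta r r' : R) (x : 'rV[R]_e) : d = (17 + e)%N ->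
  (0 < d)%N -> 0 < eta -> 0 <= r -> r + eta * Num.sqrt d%:R < r' ->
  (size (ball_pts eta x r))%:R * eta ^+ d <= r' ^+ d * vol_ball R d.
Proof.
move=> dE d0 eta0 r0 H; subst d.
apply: (@le_trans _ _ ((size (ball_pts eta (row_mx (0 : 'rV[R]_17) x) r))%:R * eta ^+ (17 + e))).
  by rewrite ler_pM2r ?exprn_gt0// ler_nat; exact: size_ball_pts_pad.
exact: ball_pts_le.
Qed.

Lemma low_count_arith (s q w v vd eta : R) e : eta != 0 -> vd != 0 ->
  2^-1 * s ^+ e * (v / eta ^+ e) * (w * (q ^+ 17 * q ^+ e) * (eta ^+ 17 * eta ^+ e) / vd / 2) =
  4^-1 * w * (q / 2) ^+ 17 * eta ^+ 17 * (s * q) ^+ e * (2 ^+ 17 * v / vd).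
Proof.
move=> eta0 vd0; have -> : (s * q) ^+ e = s ^+ e * q ^+ e by rewrite exprMn.
have : eta ^+ e != 0 by rewrite expf_neq0.
move: (s ^+ e) (q ^+ e) (eta ^+ e) => se qe ee ee0; field.
by rewrite vd0.
Qed.

Lemma prod_const_pow (n e : nat) (t : R) (f u : nat -> R) :
  \prod_(i < n) (u i * t * f i ^+ e) = (\prod_(i < n) u i) * t ^+ n * (\prod_(i < n) f i) ^+ e.
Proof. by rewrite !big_split/= prodr_const card_ord prodrXl. Qed.

Lemma mulr_divK4 (x y z t w : R) : x != 0 -> x * (y * z / x * t * w) = y * (z * t * w).
Proof. by move=> x0; field. Qed.

Lemma divr_regroup5 (y z x t u v w : R) :
  y * z / x * t * (u * v) * w = y * (z * t * u * (x^-1 * v * w)).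
Proof. by ring. Qed.

Lemma lt_sum6 (x0 x1 x2 x3 x4 x5 e d : nat) :
  (x0 + x1 + x2 + x3 + x4 + x5 < e)%N -> (e <= d)%N ->
  [/\ (x0 < e)%N, (x1 <= d)%N, (x2 <= d)%N & [/\ (x3 < d)%N, (x4 <= e)%N & (x5 <= e)%N]].
Proof. by move=> *; split; [lia..|split; lia]. Qed.

Lemma chain_weights (E1 : R) : 0 < E1 -> exists (tau : nat -> R) (eps : R), 0 < eps <= 1 /\
  exists N, forall e, (N < e)%N -> chain_weights_ok tau eps E1 e.
Proof.
move=> E10; have [delta [de0 deh th1 th2]] := choose_delta.
have [tau [eps [N0 [eps01 tau0 lower upper]]]] := tolerances rho1 k1 a01 de0 deh.
have /andP[eps0 eps1] := eps01.
exists tau, eps; split => //.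
have /andP[kp0 kp1] := kap01.
(* One half for coincidences before the last ball, the other for the last ball. *)
have [E [E0 EE]] : exists E : R, 0 < E /\ E1 = E + E by exists (E1 / 2); split; lra.
have rho0 : 0 < rho by move: rho1; lra.
pose q l := kap / (2 * type_rad l); pose c l := 4^-1 * type_weight l * (q l / 2) ^+ 17.
have q0 l : 0 < q l by rewrite divr_gt0// mulr_gt0// type_rad_gt0.
have wt0 := type_weight_gt0.
have c0 l : 0 < c l by rewrite /c; pos.
have small (x w : R) : 0 <= x < 1 -> 0 < w -> exists N, forall d, (N <= d)%N -> w * x ^+ d <= 1.
  move=> x01 w0; have [N H] := @expr_lt1_small R x w^-1 x01 ltac:(by rewrite invr_gt0).
  by exists N => d /H; rewrite -div1r ler_pdivlMr// mulrC.
have [N1 H1] : exists N, forall d, (N <= d)%N -> alpha * kap ^+ d <= 1.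
  by apply: small; rewrite // kp1 ltW.
have [N2 H2] : exists N, forall d, (N <= d)%N -> beta * (kap * (1 + rho) / (2 * rho)) ^+ d <= 1.
  apply: small => //; apply/andP; split.
    by rewrite divr_ge0// ?mulr_ge0// ?(ltW kp0) ?(ltW rho0)// addr_ge0// ltW.
  rewrite ltr_pdivrMr ?mulr_gt0// mul1r; apply: (@le_lt_trans _ _ (1 + rho)); last by move: rho1; lra.
  by rewrite ler_piMl ?(ltW kp1)// addr_ge0// ltW.
have [N3 H3] := eta_small eps0.
have [N4 H4] := @poly17_le_exp _ (E * (\prod_(l < k.+1) c l) / 2 ^+ k.+1) (17 * k.+1) th1
ltac:(pos).
have [N5 H5] := @poly17_le_exp _ (E * c k / 2 ^+ k) 17 th2
ltac:(pos).
exists (N0 + N1 + N2 + N3 + N4 + N5)%N => e Ne; rewrite /chain_weights_ok.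
set d := (17 + e)%N; have dE : d = (17 + e)%N by []; clearbody d.
set eta : R := d%:R^-1; have etaE : eta = d%:R^-1 by []; clearbody eta.
have e0 : (0 < e)%N by exact: leq_ltn_trans Ne.
have d0 : (0 < d)%N by rewrite dE addn_gt0 e0 orbT.
have ed : (e <= d)%N by rewrite dE leq_addl.
have [Ne0 Nd1 Nd2 [Nd3 Ne4 Ne5]] := lt_sum6 Ne ed.
have eta0 : 0 < eta by rewrite etaE invr_gt0 ltr0n.
have F1 : eta * (Num.sqrt d%:R + 2) < eps by rewrite etaE; exact: (H3 d).
have Fd : eta * Num.sqrt d%:R < eps.
  by apply: le_lt_trans F1; rewrite ler_pM2l// lerDl.
have Fe : eta * Num.sqrt e%:R < eps.
  by apply: le_lt_trans Fd; rewrite ler_pM2l// ler_sqrt// ler_nat.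
have v0 := vol_ball_gt0 R e0; have vd0 := vol_ball_gt0 R d0.
have cyl : vol_ball R d <= 2 ^+ 17 * vol_ball R e by rewrite dE; exact: vol_ball_cylinder.
have cellv : eta ^+ d <= vol_ball R d.
  by apply: lattice_cell_le_vol => //; apply: lt_le_trans Fd _.
have mean_gt0 l : 0 < site_mean d l.
  rewrite site_meanE// -?etaE -/(q l); pos.
have qk l : type_weight l * q l ^+ d <= 1.
  rewrite /type_weight /q /type_rad; case: (l == k).
    apply: le_trans (H2 d Nd2).
    rewrite ler_pM2l// lerXn2r// ?nnegrE ?divr_ge0 ?mulr_ge0 ?(ltW kp0) ?(ltW rho0)//.
      by rewrite addr_ge0// ltW.
    by rewrite ler_pM2r ?invr_gt0 ?mulr_gt0// ler_peMr ?(ltW kp0)// lerDl ltW.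
  apply: le_trans (H1 d Nd1).
  rewrite ler_pM2l// lerXn2r// ?nnegrE ?mulr1 ?divr_ge0 ?(ltW kp0)//.
  by rewrite ler_pdivrMr// ler_peMr ?(ltW kp0)//; lra.
have mean_le1 l : site_mean d l <= 1.
  rewrite site_meanE// -?etaE ler_pdivrMr// mul1r -[leRHS]mul1r.
  by apply: ler_pM => //; rewrite -/(q l); pos.
have pb l : site_mean d l / 2 <= stage_prob d l <= site_mean d l.
  by apply: one_sub_exp_bounds; rewrite (ltW (mean_gt0 l)) mean_le1.
have p0 l : 0 < stage_prob d l.
  by have /andP[h _] := pb l; apply: lt_le_trans h; rewrite divr_gt0.
have p1 l : stage_prob d l <= 1 by have /andP[_ h] := pb l; apply: le_trans h _.
set nx := nxt rho k a eps tau eta.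
(* After stage 0 a ball has at most one open neighbour in mean: up to constants, [kap ^+ d] between
   small balls and (kap (1 + rho) / (2 rho))^d for the final big ball, and both bases are below
   1. *)
have nextb l (x : 'rV[int]_e) : (0 < l <= k)%N ->
   (size (ball_pts eta (lat eta x) (stage_rad rho k l - eps)))%:R * stage_prob d l <= 1.
  move=> /andP[l0 lk]; set B := ball_pts _ _ _.
  have r2 : 2 <= stage_rad rho k l.
    by rewrite /stage_rad; case: ifP => _ //; move: rho1; lra.
  have Bd : (size B)%:R * eta ^+ d <= stage_rad rho k l ^+ d * vol_ball R d.
    apply: pad_ball_pts_le => //; first by rewrite subr_ge0 (le_trans eps1)// (le_trans _ r2)// ler1n.
    by rewrite -[ltRHS](subrK eps) ltrD2l.
  have /andP[_ pm] := pb l.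
  apply: (@le_trans _ _ ((size B)%:R * site_mean d l)); first by rewrite ler_wpM2l.
  rewrite site_meanE// -?etaE.
  have -> : (size B)%:R * (type_weight l * q l ^+ d * eta ^+ d / vol_ball R d) =
     type_weight l * q l ^+ d * ((size B)%:R * eta ^+ d / vol_ball R d) by ring.
  apply: (@le_trans _ _ (type_weight l * q l ^+ d * stage_rad rho k l ^+ d)).
    rewrite ler_pM2l; last by pos.
    by rewrite ler_pdivrMr.
  rewrite -mulrA -exprMn /type_weight /q /type_rad /stage_rad (gtn_eqF l0)/=.
  case: (l == k).
    have -> : kap / (2 * rho) * (1 + rho) = kap * (1 + rho) / (2 * rho) by ring.
    exact: H2.
  have -> : kap / (2 * 1) * 2 = kap by field.
  exact: H1.
have low l j : c j * eta ^+ 17 * ((sh l - delta) * q j) ^+ e <=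
    low_count rho k a delta e eta l * stage_prob d j.
  have shd : 0 < sh l - delta by rewrite subr_gt0.
  have /andP[pm _] := pb j.
  have lc0 : 0 < low_count rho k a delta e eta l.
    by rewrite /low_count; pos.
  apply: (@le_trans _ _ (low_count rho k a delta e eta l * (site_mean d j / 2))); last first.
    by rewrite ler_pM2l.
  rewrite site_meanE// -?etaE /low_count -/(q j).
  have ex (x : R) : x ^+ d = x ^+ 17 * x ^+ e by rewrite dE exprD.
  rewrite !ex.
  have vv : 1 <= 2 ^+ 17 * vol_ball R e / vol_ball R d by rewrite ler_pdivlMr// mul1r.
  have -> : 2^-1 * (sh l - delta) ^+ e * (vol_ball R e / eta ^+ e) *
     (type_weight j * (q j ^+ 17 * q j ^+ e) * (eta ^+ 17 * eta ^+ e) / vol_ball R d / 2) =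
    c j * eta ^+ 17 * ((sh l - delta) * q j) ^+ e * (2 ^+ 17 * vol_ball R e / vol_ball R d).
    by rewrite low_count_arith ?gt_eqF.
  by rewrite ler_peMr//; pos.
have lc0 l : 0 <= low_count rho k a delta e eta l.
  by rewrite /low_count; pos.
have sizeb : \prod_(i < k.+1) low_count rho k a delta e eta i <= (size (chains nx k.+1))%:R.
  apply: size_chains_ge => // l x lk Hx; apply: lower => //; exact: ltW.
have lcgt l : 0 < low_count rho k a delta e eta l.
  by rewrite /low_count; pos.
have size0 : (0 < size (chains nx k.+1))%N.
  rewrite -(ltr0n R); apply: lt_le_trans sizeb; exact: prodr_gt0.
split => //; first by move=> l; rewrite p0 p1.
move=> z; rewrite EE.
apply: coinc_total => //.
- by move=> l x; exact: nxt_uniq.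
- move=> l x lk; apply: le_trans (nextb l x lk).
  rewrite ler_pM2r// ler_nat; apply: filter_subset_size => //; exact: ball_pts_uniq.
(* All the balls before the last are small; [k.+1], a number beyond the chain, has the small type by
   default and serves as their common value. *)
- move=> l y lk; have -> : \prod_(i < l) stage_prob d i = stage_prob d k.+1 ^+ l.
    rewrite -[X in _ ^+ X]card_ord -prodr_const; apply: eq_bigr => i _.
    rewrite /stage_prob /site_mean /type_weight /type_rad.
    by rewrite !(ltn_eqF (ltn_trans (ltn_ord i) lk)) (gtn_eqF (ltnSn k)).
  apply: end_count_back => //; first exact: ltW.
  move=> i x /andP[i0 ik]; apply: le_trans (nextb i x _); last by rewrite i0 ltnW.
  rewrite le_eqVlt; apply/orP; left; apply/eqP; congr (_ * _).
  rewrite /stage_prob /site_mean /type_weight /type_rad.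
  by rewrite (ltn_eqF ik) (gtn_eqF (ltnSn k)).
- apply: (@le_trans _ _ (E * \prod_(i < k.+1) (c i * eta ^+ 17 * ((sh i - delta) * q i) ^+ e))).
    rewrite (prod_const_pow k.+1 e (eta ^+ 17) (fun i => (sh i - delta) * q i) c) -exprM.
    have := H4 e _; rewrite -dE -etaE => /(_ Ne4).
    rewrite -(ler_pM2l (_ : 0 < 2 ^+ k.+1 :> R)) ?exprn_gt0// mulr1 => h.
    apply: le_trans h _; rewrite le_eqVlt; apply/orP; left; apply/eqP.
    by apply: mulr_divK4; rewrite expf_neq0// pnatr_eq0.
  rewrite -mulrA ler_pM2l //.
  apply: (@le_trans _ _ ((\prod_(i < k.+1) low_count rho k a delta e eta i) * \prod_(i < k.+1) stage_prob d i)).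
    rewrite -big_split/=; apply: ler_prod => i _; rewrite low andbT.
    by pos.
  by rewrite ler_wpM2r//; apply: prodr_ge0 => i _; exact: ltW.
- have uc0 i : (i < k)%N -> 0 < up_count rho k a delta e eta i.+1.
    move=> ik; rewrite /up_count mulr_gt0 ?exprn_gt0// ?addr_gt0 ?back_height_gt0//.
    by rewrite divr_gt0 ?exprn_gt0.
  apply: (@le_trans _ _ (\prod_(i < k) up_count rho k a delta e eta i.+1)).
    apply: end_count_le => // [l y lk|i ik]; last by apply/ltW/uc0.
    by apply: upper => //; exact: ltW.
  set U := \prod_(i < k) _.
  have U0 : 0 <= U by apply: prodr_ge0 => i _; apply/ltW/uc0.
  apply: (@le_trans _ _ (E * ((\prod_(i < k.+1) low_count rho k a delta e eta i) * stage_prob d k))); last first.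
    by rewrite -mulrA ler_pM2l // ler_pM2r.
  (* Stage 0 has no backward counterpart: its count is paired with the probability of the last ball,
     the others are compared to [up_count] stage by stage. *)
  rewrite big_ord_recl /= mulrAC.
  have -> : \prod_(i < k) low_count rho k a delta e eta (bump 0 i) =
     (2 ^+ k)^-1 * (\prod_(i < k) ((sh i.+1 - delta) / (bh i.+1 + delta))) ^+ e * U.
    have -> : \prod_(i < k) low_count rho k a delta e eta (bump 0 i) =
        \prod_(i < k) (up_count rho k a delta e eta i.+1 * 2^-1 *
          ((sh i.+1 - delta) / (bh i.+1 + delta)) ^+ e).
      apply: eq_bigr => i _; rewrite /low_count /up_count /bump /= add1n.
      have b0 : (bh i.+1 + delta) ^+ e != 0.
        by rewrite expf_neq0// gt_eqF// addr_gt0// back_height_gt0.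
      by rewrite expr_div_n; field; rewrite b0 expf_neq0// gt_eqF.
    rewrite (prod_const_pow k e 2^-1 (fun i => (sh i.+1 - delta) / (bh i.+1 + delta))
      (fun i => up_count rho k a delta e eta i.+1)) exprVn -/U.
    by ring.
  have h := low 0%N k; rewrite /q /type_rad eqxx -/(q k) in h.
  have W0 : 0 <= (2 ^+ k)^-1 * (\prod_(i < k) ((sh i.+1 - delta) / (bh i.+1 + delta))) ^+ e * U.
    apply: mulr_ge0 => //; apply: mulr_ge0; first by rewrite invr_ge0 exprn_ge0.
    apply/exprn_ge0/prodr_ge0 => i _; rewrite divr_ge0 ?subr_ge0 ?(ltW (deh _))//.
    by rewrite addr_ge0// ltW// back_height_gt0.
  apply: (@le_trans _ _ (E * (c k * eta ^+ 17 * ((sh 0 - delta) * (kap / (2 * rho))) ^+ e *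
     ((2 ^+ k)^-1 * (\prod_(i < k) ((sh i.+1 - delta) / (bh i.+1 + delta))) ^+ e * U)))).
    have := H5 e _; rewrite -dE -etaE => /(_ Ne5) H.
    have := ler_wpM2r U0 H; rewrite mul1r => {}H; apply: le_trans H _.
    rewrite le_eqVlt; apply/orP; left; apply/eqP; rewrite (exprMn e).
    exact: divr_regroup5.
  rewrite ler_pM2l//; apply: ler_wpM2r => //.
Qed.

End ChainNumerics.

(** * Percolation above the threshold *)

Section Connectivity.
Variables (R : realType) (d : nat).
Implicit Types (x y c : 'rV[R]_d) (S : set ('rV[R]_d * R)).

Lemma segment_component (A : set 'rV[R]_d) x y z :
  (forall t, 0 <= t <= 1 -> A (x + t *: (y - x))) ->
  connected_component A z x -> connected_component A z y.
Proof.
move=> H zx; apply: connected_component_trans zx _.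
pose f (t : R) := x + t *: (y - x).
have f0 : (f @` `[0, 1]) x.
  by exists 0; [rewrite /= in_itv/= lexx ler01|rewrite /f scale0r addr0].
have f1 : (f @` `[0, 1]) y.
  by exists 1; [rewrite /= in_itv/= lexx ler01|rewrite /f scale1r addrC subrK].
exists (f @` `[0, 1]) => //; split => //.
- by move=> _ [t + <-]; rewrite /= in_itv/=; exact: H.
- apply: connected_continuous_connected; first exact: segment_connected.
  apply: continuous_subspaceT => t; apply: cvgD; first exact: cvg_cst.
  by apply: cvgZr_tmp; exact: cvg_id.
Qed.

(** The segment between the centers stays in the first ball up to distance [r], and in the second
    one from there on. *)
Lemma overlap_component S c r c' r' z :
  S (c, r) -> S (c', r') -> 0 < r -> 0 < r' -> enorm (c' - c) < r + r' ->
  connected_component (Sigma S) z c -> connected_component (Sigma S) z c'.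
Proof.
move=> Sc Sc' r0 r'0 H; apply: segment_component => t /andP[t0 t1].
have [tr|tr] := ltP (t * enorm (c' - c)) r.
  exists (c, r) => //; rewrite /eball/= addrC addKr enormZ ger0_norm//.
exists (c', r') => //; rewrite /eball/=.
have -> : c + t *: (c' - c) - c' = (1 - t) *: (c - c').
  by apply/rowP => i; rewrite !mxE; ring.
rewrite enormZ ger0_norm ?subr_ge0// enormB_sym; move: H tr; nra.
Qed.

End Connectivity.

(** * From occupied sites to a connected set of balls *)

Section Percolation.
Variables (R : realType) (e k : nat) (a0 eta eps : R) (tr : nat -> R) (sr : nat -> R).
Variables (nx : nat -> 'rV[int]_e -> seq 'rV[int]_e).
Local Notation d := (17 + e)%N.
Local Notation V := 'rV[int]_e.
Local Notation L := k.+1.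
Local Notation site := (nat * 'rV[int]_16 * V)%type.
Local Notation h := (eta * a0).
Hypotheses (a00 : 0 < a0) (eta0 : 0 < eta) (eps1 : eps <= 1) (eta_eps : eta * (Num.sqrt d%:R + 2) < eps)
  (tr1 : forall l, 1 <= tr l)
  (srE : forall l, (l <= k)%N -> sr l = tr (if l is l'.+1 then l' else k) + tr l)
  (nxP : forall l x y, y \in nx l x -> enorm (lat eta y - lat eta x) <= sr l - eps).

Definition site_idx (x : site) : 'rV[int]_(1 + 16 + e) :=
  row_mx (row_mx (const_mx (x.1.1%:Z)) x.1.2) x.2.
Definition site_stage (x : site) : nat := if x.1.1 is t.+1 then (t %% L)%N else k.
Definition site_set (x : site) : set ('rV[R]_(1 + 16 + e) * R) :=
  lat_cube h (site_idx x) `*` [set a0 * tr (site_stage x)].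

Lemma site_idx_inj : injective site_idx.
Proof.
move=> [[t S] x] [[t' S'] x']; rewrite /site_idx/= => /eq_row_mx[/eq_row_mx[tt -> ->]].
by have /rowP/(_ 0) := tt; rewrite !mxE => -[->].
Qed.

Lemma site_set_disj x y : x != y -> site_set x `&` site_set y = set0.
Proof.
move=> xy; apply/seteqP; split => // -[c r] [[/= cx _] [/= cy _]].
have h0 : 0 < h by rewrite mulr_gt0.
have E : site_idx x = site_idx y.
  by rewrite -(proj1 (lat_cubeP _ _ h0) cx) -(proj1 (lat_cubeP _ _ h0) cy).
by rewrite (site_idx_inj E) eqxx in xy.
Qed.

Variables (X : set ('rV[R]_(1 + 16 + e) * R)).
Definition hit (x : site) : Prop := X `&` site_set x !=set0.
Definition reached (x : site) : Prop := exists c, [/\ X (c, a0 * tr (site_stage x)),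
  lat_cube h (site_idx x) c & connected_component (Sigma X) 0 c].

Lemma hit_reached x y : reached x -> hit y ->
  enorm (lat h (site_idx y) - lat h (site_idx x)) + h * Num.sqrt d%:R <
    a0 * (tr (site_stage x) + tr (site_stage y)) -> reached y.
Proof.
have h0 : 0 < h by rewrite mulr_gt0.
have tr0 l : 0 < a0 * tr l by rewrite mulr_gt0// (lt_le_trans ltr01).
move=> [c [Xc cx Cc]] [[c' r'] [Xc' [/= cy r'E]]] H; exists c'; split => //.
  by rewrite -r'E.
rewrite r'E in Xc'.
apply: (overlap_component Xc Xc') => //.
apply: le_lt_trans (_ : _ <= enorm (lat h (site_idx y) - lat h (site_idx x)) + h * Num.sqrt d%:R) _; last first.
  by rewrite -mulrDr.
have -> : c' - c = (lat h (site_idx y) - lat h (site_idx x)) +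
    ((c' - lat h (site_idx y)) - (c - lat h (site_idx x))).
  by apply/rowP => i; rewrite !mxE; ring.
(* Both offsets lie in the same half-open cube, so the coordinates of their difference are bounded
   by [h]: one diameter is lost and not two. *)
apply: le_trans (enormD _ _) _; rewrite lerD2l; apply: enorm_le_const; first exact: ltW.
move=> i; rewrite !mxE; have := cx i; have := cy i; rewrite !mxE.
move: (c 0 i) (c' 0 i) ((site_idx x 0 i)%:~R : R) ((site_idx y 0 i)%:~R : R) => u v p q.
by rewrite ler_norml => /andP[? ?] /andP[? ?]; apply/andP; split; lra.
Qed.

Lemma hit_step t S S' x x' : reached (t, S, x) -> hit (t.+1, S', x') ->
  enorm (lat eta (S' - S)) <= eta ->
  enorm (lat eta x' - lat eta x) <= sr (t %% L)%N - eps ->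
  site_stage (t, S, x) = (if (t %% L)%N is l.+1 then l else k) ->
  reached (t.+1, S', x').
Proof.
move=> Rx Hy HS Hx st; apply: hit_reached Rx Hy _; rewrite st.
have tL : (t %% L <= k)%N by rewrite -ltnS ltn_pmod.
rewrite [site_stage (t.+1, _, _)]/= -srE//.
have hl n (v : 'rV[int]_n) : lat h v = a0 *: lat eta v.
  by apply/rowP => i; rewrite !mxE mulrA (mulrC a0).
rewrite !hl -scalerBr enormZ gtr0_norm// -mulrA [eta * (a0 * _)]mulrCA -mulrDr ltr_pM2l//.
rewrite /site_idx/= !lat_row_mx !opp_row_mx !add_row_mx.
apply: le_lt_trans (lerD (le_trans (enorm_row_mx _ _) (lerD (enorm_row_mx _ _) Hx)) (lexx _)) _.
have -> : lat eta S' - lat eta S = lat eta (S' - S) by rewrite latB.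
have : enorm (lat eta (const_mx (Posz t.+1) : 'rV[int]_1) - lat eta (const_mx (Posz t) : 'rV[int]_1)) <= eta.
  rewrite -latB; apply: le_trans (@enorm_le_const _ _ _ eta _ _) _; rewrite ?(ltW eta0)//.
    by move=> i; rewrite !mxE -addn1 PoszD addrC addKr mulr1 gtr0_norm.
  by rewrite sqrtr1 mulr1.
move: eta_eps HS; rewrite mulrDr; lra.
Qed.

(** The balls of a chain all have layer [S], while its starting point still has the layer [S0] of
    the preceding chain; the change of layer takes place at the first step. *)
Lemma chain_reached n l S0 S x c : c \in chains nx l -> (l <= L)%N ->
  reached ((n * L)%N, S0, x) -> enorm (lat eta (S - S0)) <= eta ->
  (forall i, (i < l)%N -> hit ((n * L + i).+1, S, x + nth 0 c i)) ->
  reached ((n * L + l)%N, (if l is 0 then S0 else S), x + last 0 c).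
Proof.
elim: l c => [|l IH] c.
  by rewrite inE => /eqP -> /= _ H _ _; rewrite addn0 addr0.
move=> /chainsSP[c' [y [cc yn ->]]] lL RR HS HH.
have sc := size_chain cc.
have R' : reached ((n * L + l)%N, (if l is 0 then S0 else S), x + last 0 c').
  apply: IH => //; first exact: ltnW.
  by move=> i il; have := HH i (ltnW il); rewrite nth_rcons sc il.
rewrite last_rcons addnS; apply: (hit_step R').
- by have := HH l (ltnSn l); rewrite nth_rcons sc ltnn eqxx.
- case: (l) => [//|_]; rewrite subrr; have -> : lat eta (0 : 'rV[int]_16) = 0 :> 'rV[R]_16.
    by apply/rowP => i; rewrite !mxE mulr0.
  by rewrite enorm0 ltW.
- rewrite !latD opprD addrACA subrr add0r modnMDl modn_small//; exact: nxP.
- rewrite modnMDl modn_small//= /site_stage/=.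
  case: l {IH yn HH R' cc sc} lL => [|l] lL; last first.
    by rewrite addnS modnMDl modn_small// ltnW.
  rewrite addn0; case: n {RR} => [//|n]; rewrite mulSn addnC.
  by rewrite addnS modnMDl modn_small.
Qed.

(** [layer q] is already the layer of the next chain; the last site has the preceding one, whence
    [S0]. *)
Lemma path_reached n q : good_path nx L n q -> (forall x, x \in sites q -> hit x) ->
  exists2 S0, reached ((n * L)%N, S0, end_pt q) & enorm (lat eta (layer q - S0)) <= eta.
Proof.
have lat0 : lat eta (0 : 'rV[int]_16) = 0 :> 'rV[R]_16 by apply/rowP => i; rewrite !mxE mulr0.
elim: n q => [|n IH] q.
  move=> /= -> H; exists 0; last by rewrite subrr lat0 enorm0 ltW.
  have [[c r] [Xc [/= cc rE]]] := H _ (mem_head _ _).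
  rewrite rE in Xc; exists c; split => //.
  have h0 : 0 < h by rewrite mulr_gt0.
  have cn : enorm c < a0 * tr k.
    have := lat_cube_dist h0 cc.
    have -> : lat h (site_idx (0%N, 0, 0)) = 0 :> 'rV[R]_(1 + 16 + e).
      apply/rowP => i; rewrite !mxE; case: splitP => j _; rewrite !mxE ?mulr0//.
      by case: splitP => j' _; rewrite !mxE mulr0.
    rewrite subr0 => /le_lt_trans; apply; rewrite -mulrA mulrCA ltr_pM2l//.
    apply: lt_le_trans (tr1 k); move: eta_eps eps1; rewrite mulrDr.
    by have := eta0; lra.
  apply: (@segment_component _ _ _ 0) => [t /andP[t0 t1]|].
    exists (c, a0 * tr k) => //; rewrite /eball/= subr0 add0r.
    have -> : t *: c - c = (t - 1) *: c by rewrite scalerBl scale1r.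
    rewrite enormZ ler0_norm ?subr_le0// opprB; apply: le_lt_trans cn.
    by rewrite ler_piMl ?enorm_ge0// gerBl.
  apply: connected_component_refl; exists (c, a0 * tr k) => //.
  by rewrite /eball/= sub0r enormN.
move=> [q' [g [c [gq' cL ->]]]] H.
have [x xq|S0 RR HS] := IH q' gq'; first by apply: H; rewrite /= mem_cat xq.
exists (layer q').
  have := chain_reached cL (leqnn _) RR HS; rewrite mulSn addnC; apply => i iL.
  apply: H; rewrite /= mem_cat; apply/orP; right; apply/mapP; exists i => //.
  by rewrite mem_iota.
rewrite /= addrC addKr; apply: le_trans (_ : enorm (eta *: delta_mx 0 g : 'rV[R]_16) <= _).
  by rewrite le_eqVlt; apply/orP; left; apply/eqP; congr enorm; apply/rowP => i;
    rewrite !mxE; case: (_ && _).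
rewrite enormZ gtr0_norm// ger_pMr// /enorm (bigD1 g)//= big1; last first.
  by move=> i ig; rewrite !mxE eqxx (negbTE ig) expr0n.
by rewrite !mxE !eqxx expr1n addr0 sqrtr1.
Qed.

Lemma reached_far n S x : reached (n, S, x) ->
  exists2 c, connected_component (Sigma X) 0 c & exists i, h * n%:R <= `|c 0 i|.
Proof.
move=> [c [_ cc Cc]]; exists c => //; exists (lshift e (lshift 16 0)).
have := cc (lshift e (lshift 16 0)); rewrite mxE /site_idx row_mxEl row_mxEl mxE /=.
by move=> /andP[H _]; apply: le_trans H (ler_norm _).
Qed.

End Percolation.

Lemma bounded_coordP (R : realType) d (A : set 'rV[R]_d) :
  bounded_set A <-> exists M, forall c, A c -> forall i, `|c 0 i| <= M.
Proof.
split=> [[M [Mr H]]|[M H]].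
  exists (M + 1) => c Ac i.
  have : `|c| <= M + 1 by apply: (H (M + 1) _ c Ac); rewrite ltrDl.
  rewrite /Num.norm/= mx_normrE => /bigmax_leP[_ /(_ (0, i) isT)]; exact.
exists (Num.max M 0); split; first exact: num_real.
move=> x xM c Ac /=; rewrite /Num.norm/= mx_normrE; apply/bigmax_leP; split => [|[j i] _ /=].
  by apply: le_trans (ltW xM); rewrite le_max lexx orbT.
apply: le_trans (ltW xM); rewrite le_max; apply/orP; left.
by rewrite [j]ord1; exact: H.
Qed.

Lemma bigsetUP (T : Type) (I : eqType) (s : seq I) (F : I -> set T) w :
  (\big[setU/set0]_(x <- s) F x) w -> exists2 x, x \in s & F x w.
Proof.
elim: s => [|x s IH]; first by rewrite big_nil.
rewrite big_cons => -[Fx|/IH[y ys Fy]]; first by exists x; rewrite ?mem_head.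
by exists y; rewrite // in_cons ys orbT.
Qed.

Section PathUnion.
Variables (V : zmodType) (next : nat -> V -> seq V) (L : nat) (T : Type).
Local Notation paths := (paths next L).

Lemma bigU_good n (F : macro V -> set T) w :
  (\big[setU/set0]_(q <- paths n) F q) w -> exists2 q, good_path next L n q & F q w.
Proof.
elim: n F => [|n IH] F; first by rewrite big_seq1 => Fw; eexists; last exact: Fw.
rewrite /= big_allpairs_dep => /IH[q gq].
rewrite /steps big_allpairs_dep => H.
have [g _ Hg] := bigsetUP H; have [c cL Fw] := bigsetUP Hg.
by exists (extend L n q (g, c)) => //; exists q, g, c.
Qed.

Lemma bigU_pathsS n (F : macro V -> set T) :
  (forall q gc, F (extend L n q gc) `<=` F q) ->
  \big[setU/set0]_(q <- paths n.+1) F q `<=` \big[setU/set0]_(q <- paths n) F q.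
Proof.
move=> H; rewrite /= big_allpairs_dep.
apply: (big_ind2 (fun A B : set T => A `<=` B)) => // [A B C D|q _]; first exact: setUSS.
apply: (big_ind (fun A : set T => A `<=` F q)) => [|A B AF BF|gc _]; last exact: H.
  exact: sub0set.
by rewrite subUset.
Qed.

End PathUnion.

(** The weight r^-d makes the mean number of points in a rescaled cube independent of the scale
    [a0]. *)
Lemma rescaled_mean (R : fieldType) (eta a0 lam w t : R) n : a0 != 0 -> t != 0 ->
  (eta * a0) ^+ n * lam * (w / (a0 * t) ^+ n) = lam * w * (eta / t) ^+ n.
Proof.
move=> a0n tn; rewrite expr_div_n !exprMn.
have : a0 ^+ n != 0 by rewrite expf_neq0.
have : t ^+ n != 0 by rewrite expf_neq0.
by move: (a0 ^+ n) (t ^+ n) (eta ^+ n) => x y z y0 x0; field; rewrite y0 x0.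
Qed.

Section Percolates.
Variables (R : realType) (rho kap alpha beta a0 : R) (k : nat) (a : nat -> R).
Hypotheses (rho1 : 1 < rho) (k1 : (1 <= k)%N) (kap0 : 0 < kap) (a00 : 0 < a0)
  (alpha0 : 0 < alpha) (beta0 : 0 < beta).
Variables (tau : nat -> R) (eps E : R) (e : nat).
Hypotheses (eps01 : 0 < eps <= 1) (E01 : 0 <= E <= 16384^-1) 
  (ok : chain_weights_ok rho kap alpha beta k a tau eps E e).
Local Notation d := (17 + e)%N.
Variable nu : {measure set R -> \bar R}.
Hypothesis nuE : forall l, nu [set a0 * type_rad rho k l] =
  (type_weight alpha beta k l * (a0 * type_rad rho k l) ^- d)%:E.

Lemma crit_intensity_ge0 : 0 <= crit_intensity kap d.
Proof.
apply: divr_ge0; first exact/exprn_ge0/ltW.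
by apply: mulr_ge0; [exact/ltW/vol_ball_gt0 | exact: exprn_ge0].
Qed.

Lemma chain_percolates : percolates d (crit_intensity kap d) nu.
Proof.
move=> dO Omega P xi pp.
have [pb eta_eps ch0 cw] := ok.
pose eta : R := d%:R^-1.
have eta0 : 0 < eta by rewrite invr_gt0 ltr0n addn_gt0.
pose p := stage_prob rho kap alpha beta k d.
pose nx := nxt rho k a eps tau eta (e := e).
pose A := site_set (e := e) k a0 eta (type_rad rho k).
pose m (x : nat * 'rV[int]_16 * 'rV[int]_e) := site_mean rho kap alpha beta k d (site_stage k x).
have bA x : Borel (A x) by exact: Borel_box.
have LA x : intensity (crit_intensity kap d) nu (A x) = (m x)%:E.
  rewrite /A /site_set intensity_box ?crit_intensity_ge0//.
  rewrite boxvol_lat_cube ?mulr_ge0 ?(ltW eta0) ?(ltW a00)// nuE -EFinM; congr EFin.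
  by rewrite /m /site_mean -/eta rescaled_mean ?gt_eqF// type_rad_gt0.
have disjA x y : x != y -> A x `&` A y = set0 by apply: site_set_disj.
have indep := occupied_indep bA LA disjA pp.
have occm := measurable_occupied bA pp.
have mE x : 1 - expR (- m x) = site_prob p k.+1 x.
  by rewrite /m /site_prob /site_stage; case: x.1.1.
pose F n := \big[setU/set0]_(q <- paths nx k.+1 n) open_path (occupied A xi) q.
have occi s : uniq s -> P (\big[setI/setT]_(x <- s) occupied A xi x) =
    (\prod_(x <- s) site_prob p k.+1 x)%:E.
  by move=> us; rewrite indep//; congr EFin; apply: eq_bigr => x _; exact: mE.
have p0 l : 0 < p l by have /andP[] := pb l.
have PF n : ((p k / lyap R 0)%:E <= P (F n))%E.
  have := (@exists_open_path R _ nx p k.+1 p0 E E01 cw _ Omega P _ occm occi ch0 n).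
  by rewrite /F.
have mF n : measurable (F n).
  by apply: bigsetU_measurable => q _; apply: bigsetI_measurable => x _; exact: occm.
have Fni : nonincreasing_seq F.
  apply/nonincreasing_seqP => n; rewrite subsetEset; apply: bigU_pathsS => q gc w.
  by rewrite /open_path /= big_cat /= => -[].
have mFI : measurable (\bigcap_n F n) by exact: bigcapT_measurable.
(* The percolation event itself may not be measurable; the decreasing limit of the [F n] is a
   measurable part of it and inherits their uniform lower bound. *)
exists (\bigcap_n F n); split => //.
- move=> w Fw; rewrite /percolation_event /= => /bounded_coordP[M HM].
  have h0 : 0 < eta * a0 by rewrite mulr_gt0.
  have [q gq qw] := bigU_good (Fw (Num.truncn (M / (eta * a0))).+1 I).
  have srE l : (l <= k)%N -> stage_rad rho k l =
      type_rad rho k (if l is l'.+1 then l' else k) + type_rad rho k l.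
    rewrite /stage_rad /type_rad; case: l => [_|l lk] /=.
      by rewrite eqxx ltn_eqF// addrC.
    by rewrite (ltn_eqF lk); case: ifP.
  have tr1 l : 1 <= type_rad rho k l by rewrite /type_rad; case: ifP => // _; exact: ltW.
  have [S0 RR _] := @path_reached R e k a0 eta eps (type_rad rho k) (stage_rad rho k) nx
    a00 eta0 (proj2 (andP eps01)) eta_eps tr1 srE
    (fun l x y => ltac:(by rewrite mem_nxt// => /andP[])) (xi w) _ q gq
    (proj1 (bigsetIP _ _ _) qw).
  have [c Cc [i ci]] := reached_far RR.
  have := le_trans ci (HM c Cc i); rewrite -ler_pdivlMl// mulrC.
  apply/negP; rewrite -ltNge; apply: lt_le_trans (truncnS_gt _) _.
  by rewrite ler_nat leq_pmulr.
- have cv := nonincreasing_cvg_mu (le_lt_trans (probability_le1 P (mF 0%N)) (ltry 1)) mF mFI Fni.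
  apply: lt_le_trans (_ : (p k / lyap R 0)%:E <= _)%E.
    by rewrite lte_fin divr_gt0// (lt_le_trans ltr01)// lyap_ge1.
  rewrite -(cvg_lim _ cv)//; apply: lime_ge; first by apply/cvg_ex; eexists; exact: cv.
  by apply: nearW => n; exact: PF.
Qed.
End Percolates.

Section Supercritical.
Variables (R : realType) (rho kap : R).
Hypotheses (rho1 : 1 < rho) (kap01 : 0 < kap < 1).

Lemma prod_bigOS (f : nat -> R) k : \prod_(2 <= i < k.+2) f i = \prod_(l < k) f l.+2.
Proof.
by rewrite !big_add1 big_mkord. Qed.

Lemma sqrt_prod (f : nat -> R) n : (forall i, (i < n)%N -> 0 <= f i) ->
  Num.sqrt (\prod_(i < n) f i) = \prod_(i < n) Num.sqrt (f i).
Proof.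
elim: n => [|n IH] H; first by rewrite !big_ord0 sqrtr1.
rewrite !big_ord_recr/= sqrtrM ?IH// => [i ni|]; first by rewrite H// ltnW.
by apply: prodr_ge0 => i _; apply/H/ltnW/ltn_ord.
Qed.

Lemma powR_inv_lt (x y : R) n : 0 <= x -> 0 <= y -> x `^ (n.+1%:R^-1) < y -> x < y ^+ n.+1.
Proof.
move=> x0 y0 H; have -> : x = (x `^ (n.+1%:R^-1)) ^+ n.+1.
  by rewrite -powR_mulrn ?powR_ge0// -powRrM mulVf ?pnatr_eq0// powRr1.
by rewrite ltrXn2r//= ?nnegrE ?powR_ge0//.
Qed.

(** The two rates correspond to the two terms of the maximum. In the second, a forward height over a
    backward one is the ratio of two consecutive distances, and the product telescopes to D(a) / (1
    + rho). *)
Lemma kappa_term_conds k (a : nat -> R) : (1 <= k)%N ->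
  (forall i, (2 <= i <= k.+1)%N -> 0 <= a i < 1) -> kappa_term rho k a < kap ->
  1 < \prod_(l < k.+1) (stage_height rho k a l * (kap / (2 * type_rad rho k l))) /\
  1 < stage_height rho k a 0 * (kap / (2 * rho)) *
     \prod_(l < k) (stage_height rho k a l.+1 / back_height rho k a l.+1).
Proof.
move=> k1 a01; rewrite /kappa_term gt_max => /andP[S1 S2].
have /andP[kp0 kp1] := kap01.
have rho0 : 0 < rho by move: rho1; lra.
have D0 l : (l <= k)%N -> 0 < Dseq rho k a l := fun lk => Dseq_gt0 rho1 k1 a01 lk.
have sh0 l : 0 < stage_height rho k a l := stage_height_gt0 rho1 k1 a01 l.
have sh00 : stage_height rho k a 0 = 1 + rho.
  by rewrite /stage_height /stage_rad /stage_cos /= expr0n subr0 sqrtr1 mulr1.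
split; last first.
  have -> : \prod_(l < k) (stage_height rho k a l.+1 / back_height rho k a l.+1) =
      Dseq rho k a k / (1 + rho).
    have : forall n, (n <= k)%N ->
      \prod_(l < n) (stage_height rho k a l.+1 / back_height rho k a l.+1) = Dseq rho k a n / (1 + rho).
      elim=> [_|n IH nk]; first by rewrite big_ord0 divff// gt_eqF// addr_gt0.
      have -> : \prod_(l < n.+1) (stage_height rho k a l.+1 / back_height rho k a l.+1) =
        \prod_(l < n) (stage_height rho k a l.+1 / back_height rho k a l.+1) *
        (stage_height rho k a n.+1 / (Dseq rho k a n * stage_height rho k a n.+1 / Dseq rho k a n.+1)).
        by rewrite big_ord_recr.
      rewrite IH ?(ltnW nk)//; have := D0 _ nk; have := D0 _ (ltnW nk); have := sh0 n.+1.
      move: (stage_height _ _ _ _) (Dseq rho k a n) (Dseq rho k a n.+1) => x y z x0 y0 z0.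
      have r1 : 1 + rho != 0 by rewrite gt_eqF// addr_gt0.
      by field; rewrite r1 !gt_eqF.
    by apply.
  move: S2; rewrite ltr_pdivrMr ?D0// => S2.
  have -> : stage_height rho k a 0 * (kap / (2 * rho)) * (Dseq rho k a k / (1 + rho)) =
      kap * Dseq rho k a k / (2 * rho).
    by rewrite sh00; field; rewrite !gt_eqF// addr_gt0.
  by rewrite ltr_pdivlMr ?mul1r// mulr_gt0.
pose s i := Num.sqrt (1 - a i.+2 ^+ 2).
have s0 i : (i < k)%N -> 0 < 1 - a i.+2 ^+ 2.
  by move=> ik; have /andP[] := a01 i.+2 ik; rewrite expr2 => *; nra.
have P0 : 0 < \prod_(i < k) s i by apply: prodr_gt0 => i _; rewrite sqrtr_gt0 s0.
move: S1; rewrite prod_bigOS (@sqrt_prod (fun i => 1 - a i.+2 ^+ 2)) => [|i ik]; last exact/ltW/s0.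
move/powR_inv_lt => /(_ _ (ltW kp0)); move=> S1.
have {}S1 : 4 * rho / ((1 + rho) ^+ 2 * \prod_(i < k) s i) < kap ^+ k.+1.
  apply: S1; apply: divr_ge0; first by rewrite mulr_ge0// ltW.
  by apply: mulr_ge0; [exact: sqr_ge0|exact: ltW P0].
have -> : \prod_(l < k.+1) (stage_height rho k a l * (kap / (2 * type_rad rho k l))) =
   kap ^+ k.+1 * ((1 + rho) ^+ 2 * \prod_(i < k) s i) / (4 * rho).
  case: k k1 a01 s0 sh00 @s P0 {S1 D0 sh0 S2} => [//|k _] a01 s0 sh00 s P0.
  rewrite big_ord_recl sh00 big_ord_recr /=.
  rewrite [in RHS]big_ord_recr /= /stage_height.
  have -> : stage_rad rho k.+1 (bump 0 k) = 1 + rho by rewrite /stage_rad /bump leq0n add1n eqxx orbT.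
  have -> : type_rad rho k.+1 (bump 0 k) = rho by rewrite /type_rad /bump leq0n add1n eqxx.
  have -> : stage_cos k.+1 a (bump 0 k) = a k.+2 by rewrite /stage_cos /bump leq0n add1n ltnn.
  rewrite -/(s k) /=.
  have -> : \prod_(i < k) (stage_rad rho k.+1 (bump 0 i) * Num.sqrt (1 - stage_cos k.+1 a (bump 0 i) ^+ 2) *
     (kap / (2 * type_rad rho k.+1 (bump 0 i)))) = kap ^+ k * \prod_(i < k) s i.
    rewrite -[X in kap ^+ X]card_ord -prodr_const -big_split/=; apply: eq_bigr => i _.
    rewrite /stage_rad /type_rad /stage_cos /bump leq0n add1n eqSS (ltn_eqF (ltn_ord i)).
    by rewrite ltnS ltnNge (ltnW (ltn_ord i)) /= -/(s i); field.
  have -> : type_rad rho k.+1 0 = 1 by [].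
  by rewrite !exprS; field; rewrite gt_eqF.
rewrite ltr_pdivlMr ?mulr_gt0// mul1r -ltr_pdivrMr// mulr_gt0// exprn_gt0// addr_gt0//.
Qed.

Lemma kappa_c_lt_ex : kappa_c rho < kap -> exists k (a : nat -> R),
  [/\ (1 <= k)%N, forall i, (2 <= i <= k.+1)%N -> 0 <= a i < 1 & kappa_term rho k a < kap].
Proof.
move=> H.
have [|_ [k /= k1 <-] Hk] := inf_lt _ H; first by exists (kappa_k rho 1), 1%N.
have [|_ [a /= a01 <-] Ha] := inf_lt _ Hk; last by exists k, a.
by exists (kappa_term rho k (fun=> 0)), (fun=> 0) => // i _; rewrite lexx ltr01.
Qed.

Theorem percolates_above (a0 alpha beta : R) : 0 < a0 -> 0 < alpha -> 0 < beta ->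
  kappa_c rho < kap ->
  \forall d \near \oo, forall nu : {measure set R -> \bar R},
    nu [set a0] = (alpha * a0 ^- d)%:E -> nu [set a0 * rho] = (beta * (a0 * rho) ^- d)%:E ->
    percolates d (crit_intensity kap d) nu.
Proof.
move=> a00 al0 be0 /kappa_c_lt_ex[k [a [k1 a01 kt]]].
have [c1 c2] := kappa_term_conds k1 a01 kt.
(* The largest excess that [lyap_supersolution] tolerates. *)
have [E E01] : exists E : R, 0 < E <= 16384^-1 by exists 16384^-1; rewrite lexx invr_gt0 ltr0n.
have /andP[E0 E1] := E01.
have [tau [eps [eps01 [N H]]]] := chain_weights rho1 k1 kap01 al0 be0 a01 c1 c2 E0.
exists (17 + N.+1)%N => // d /= Nd nu nua nub.
have [e dE eN] : exists2 e, d = (17 + e)%N & (N < e)%N.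
  by exists (d - 17)%N; [rewrite subnKC// (leq_trans _ Nd)// leq_addr|rewrite ltn_subRL].
subst d; apply: (@chain_percolates R rho kap alpha beta a0 k a rho1 k1
  (proj1 (andP kap01)) a00 tau eps E e eps01 _ (H e eN)); first by rewrite (ltW E0).
by move=> l; rewrite /type_rad /type_weight; case: (l == k); rewrite ?mulr1.
Qed.

End Supercritical.

(** * Absence of percolation below the threshold *)

Section ReducedPaths.
Variables (V : eqType) (bb sb ss : rel V) (K : nat).
Local Notation site := (bool * V)%type.
Local Notation state := (site * nat * V)%type.

Definition adj (z z' : site) : bool :=
  if z.1 then (if z'.1 then bb z.2 z'.2 else sb z.2 z'.2)
  else if z'.1 then sb z.2 z'.2 else ss z.2 z'.2.

(* A site is (is it big?, position). A state is (last site, m, y), where [y] is the position of the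
   last big site and [m] counts down from [K] along the small sites that follow it. A short run of
   small sites between two close big sites can be deleted; hence, as long as [m] is positive, the
   next big site may be assumed far from [y], at the price of direct steps between close big sites. *)
Definition step_ok (st : state) (z' : site) : bool :=
  adj st.1.1 z' && (st.1.1.1 || ~~ z'.1 || (st.1.2 == 0%N) || ~~ bb st.2 z'.2) ||
  [&& st.1.1.1, z'.1 & bb st.1.1.2 z'.2].

Definition next_state (st : state) (z' : site) : state :=
  (z', if st.1.1.1 then K else st.1.2.-1, if st.1.1.1 then st.1.1.2 else st.2).

Fixpoint allowed (st : state) (l : seq site) : bool :=
  if l is z' :: l' then step_ok st z' && allowed (next_state st z') l' else true.

Fixpoint far_return (m : nat) (y : V) (l : seq site) : bool :=
  if m isn't m'.+1 then true else
  if l is z :: l' then (if z.1 then ~~ bb y z.2 else far_return m' y l') else true.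

Lemma near_return m y l : ~~ far_return m y l -> exists s w l',
  [/\ l = s ++ (true, w) :: l', (size s < m)%N & bb y w].
Proof.
elim: m l => [//|m IH] [//|[[] w] l] /=.
  by rewrite negbK => yw; exists [::], w, l.
by move=> /IH[s [w' [l' [-> sm yw]]]]; exists ((false, w) :: s), w', l'.
Qed.

(** A run of at most [K] small sites between two close big sites is skipped by a direct step, so
    each kept site stands for at most [K.+1] sites. Being a subsequence, the result keeps its sites
    open and distinct when the path has them so. *)
Lemma reduce_path l z m y : path adj z l -> (z.1 = false -> far_return m y l) ->
  exists r, [/\ allowed (z, m, y) r, subseq r l & (size l <= K.+1 * size r)%N].
Proof.
move: {2}(size l) (leqnn (size l)) => N; elim: N l z m y => [|N IH] [|z' l] z m y //=.
- by exists [::].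
- by exists [::].
rewrite ltnS => lN /andP[zz' pl] far.
have keep r : step_ok (z, m, y) z' -> allowed (next_state (z, m, y) z') r -> subseq r l ->
    (size l <= K.+1 * size r)%N -> exists r0, [/\ allowed (z, m, y) r0, subseq r0 (z' :: l) &
    (size l < K.+1 * size r0)%N].
  move=> so al sl sz; exists (z' :: r); split => /=; first by rewrite so.
    by rewrite eqxx.
  by rewrite mulnS; lia.
case: z zz' far keep => -[] x /= zz' far keep.
- case: z' zz' pl keep {far} => -[] x' zz' pl keep.
    have [r [al sl sz]] := IH l (true, x') K x lN pl ltac:(by []).
    by apply: (keep r) => //; rewrite /step_ok /= zz'.
  have [fr|/near_return[s [w [l' [E sK xw]]]]] := boolP (far_return K x l).
    have [r [al sl sz]] := IH l (false, x') K x lN pl (fun=> fr).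
    by apply: (keep r) => //; rewrite /step_ok /= zz'.
  move: pl lN; rewrite E cat_path size_cat /= => /and3P[_ _ pl'] lN.
  have [r [al sl sz]] := IH l' (true, w) K x ltac:(lia) pl' ltac:(by []).
  exists ((true, w) :: r); split => /=.
  + by rewrite /step_ok /= xw orbT.
  + apply: (@subseq_trans _ ((true, w) :: l')); first by rewrite /= eqxx.
    exact: suffix_subseq.
  + by rewrite mulnS; lia.
- have {}far := far erefl.
  have fr : z'.1 = false -> far_return m.-1 y l.
    by move=> z'f; case: m far {keep} => [|m] //=; rewrite z'f.
  have [r [al sl sz]] := IH l z' m.-1 y lN pl fr.
  apply: (keep r) => //; rewrite /step_ok /= zz' /=.
  case: z' {pl fr al keep zz'} far => -[] //= w.
  by case: m => //= m ->.
Qed.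

Variables (R : realType) (nbrs : state -> seq site) (p : bool -> R) (h : state -> R) (c : R).
Hypotheses (nbrsP : forall st z, step_ok st z -> z \in nbrs st) (p0 : forall t, 0 <= p t)
  (c0 : 0 < c) (hc : forall st, (st.1.2 <= K)%N -> c <= h st)
  (hsuper : forall st, \sum_(z <- nbrs st | step_ok st z) p z.1 * h (next_state st z) <= h st / 2).

Fixpoint seqs n (st : state) : seq (seq site) :=
  if n is n'.+1 then [seq z :: l | z <- [seq z <- nbrs st | step_ok st z], l <- seqs n' (next_state st z)]
  else [:: [::]].

Lemma mem_seqs st l : allowed st l -> l \in seqs (size l) st.
Proof.
elim: l st => [//|z l IH] st /= /andP[so al]; apply: allpairs_f_dep.
  by rewrite mem_filter so nbrsP.
exact: IH.
Qed.

Lemma allowed_take st l n : allowed st l -> allowed st (take n l).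
Proof.
elim: l st n => [//|z l IH] st [//|n] /= /andP[-> al].
exact: IH.
Qed.

(** Iterate the supersolution inequality; [c] bounds from below the potential of the final state. *)
Lemma seqs_weight n st : (st.1.2 <= K)%N -> \sum_(l <- seqs n st) \prod_(z <- l) p z.1 <= h st / c / 2 ^+ n.
Proof.
elim: n st => [|n IH] st stK.
  by rewrite big_seq1 big_nil expr0 divr1 ler_pdivlMr// mul1r hc.
rewrite big_allpairs_dep big_filter.
apply: (@le_trans _ _ (\sum_(z <- nbrs st | step_ok st z) p z.1 * (h (next_state st z) / c / 2 ^+ n))).
  apply: ler_sum => z _; under eq_bigr do rewrite big_cons.
  rewrite -mulr_sumr ler_wpM2l// IH//= /next_state /=; case: ifP => // _.
  exact: leq_trans (leq_pred _) stK.
under eq_bigr do rewrite !mulrA.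
rewrite -!mulr_suml exprSr invfM !mulrA [X in _ <= X]mulrAC ler_pM2r ?invr_gt0 ?exprn_gt0//.
by rewrite [X in _ <= X]mulrAC ler_pM2r ?invr_gt0.
Qed.

End ReducedPaths.

(** * Counting neighbours by classes of angles *)

Section CapCounting.
Variables (R : realType) (d : nat) (eta eps : R) (M : nat).
Hypotheses (d0 : (0 < d)%N) (eta0 : 0 < eta) (eta_eps : eta * Num.sqrt d%:R < eps)
  (eps0 : 0 < eps) (M0 : (0 < M)%N) (M_eps : 2 / M%:R <= eps ^+ 2).
Local Notation V := 'rV[int]_d.
Implicit Types (x s : 'rV[R]_d).

Lemma dot_unitv_le1 x : dot (unitv x) (unitv x) <= 1.
Proof.
have [->|/dot_unitv ->//] := eqVneq x 0.
have -> : unitv 0 = 0 :> 'rV[R]_d by rewrite /unitv scaler0.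
by rewrite -sqr_enorm enorm0 expr0n.
Qed.

Lemma cap_subset (a r : R) x s : 0 <= a <= 1 -> 0 <= r -> enorm s <= r ->
  a * r <= dot s (unitv x) -> enorm (s - (a * r) *: unitv x) <= r * Num.sqrt (1 - a ^+ 2).
Proof.
move=> /andP[a0 a1] r0 sr H; have a2 : 0 <= 1 - a ^+ 2 by rewrite expr2; nra.
rewrite -(@ler_pXn2r _ 2)// ?nnegrE ?enorm_ge0// ?mulr_ge0 ?sqrtr_ge0//.
rewrite [leRHS]exprMn (sqr_sqrtr a2) -scaleNr sqr_enormDZ.
have s2 : enorm s ^+ 2 <= r ^+ 2 by rewrite ler_pXn2r// ?nnegrE ?enorm_ge0.
have := dot_unitv_le1 x; set w := dot (unitv x) _; move=> w1.
have h1 : a * r * (a * r) <= a * r * dot s (unitv x) by rewrite ler_wpM2l// mulr_ge0.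
have h2 : (a * r) ^+ 2 * w <= (a * r) ^+ 2 by rewrite ler_piMr ?sqr_ge0.
move: s2 h1 h2; rewrite sqrrN !expr2; lra.
Qed.

Definition grid (j : nat) : R := j%:R / M%:R.

Lemma grid_ge0 j : 0 <= grid j. Proof. by rewrite divr_ge0. Qed.

Lemma grid_le1 j : (j <= M)%N -> grid j <= 1.
Proof. by move=> jM; rewrite ler_pdivrMr ?ltr0n// mul1r ler_nat. Qed.

(** Class 0 also takes in all the negative cosines; it is counted by the full ball, at no loss on
    the exponential scale. *)
Definition band (j : nat) (r : R) x s : bool :=
  ((j == 0%N) || (grid j * r <= dot s (unitv x))) && (dot s (unitv x) <= grid j.+1 * r).

Lemma band_cover (r : R) x s : 0 < r -> enorm s <= r -> exists2 j, (j < M)%N & band j r x s.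
Proof.
move=> r0 sr; have M0' : (0 : R) < M%:R by rewrite ltr0n.
have u1 : enorm (unitv x) <= 1.
  rewrite -(@ler_pXn2r _ 2)// ?nnegrE ?enorm_ge0// sqr_enorm expr1n; exact: dot_unitv_le1.
have c1 : dot s (unitv x) <= r.
  apply: le_trans (cauchy_schwarz _ _) _; rewrite -[leRHS]mulr1.
  by apply: ler_pM => //; exact: enorm_ge0.
have ind n : dot s (unitv x) <= grid n.+1 * r -> exists2 j, (j <= n)%N & band j r x s.
  elim: n => [|n IH] H; first by exists 0%N; rewrite // /band.
  have [Hn|Hn] := leP (dot s (unitv x)) (grid n.+1 * r).
    by have [j jn bj] := IH Hn; exists j => //; exact: leqW.
  by exists n.+1 => //; rewrite /band (ltW Hn) orbT H.
have [|j jM bj] := ind M.-1; last by exists j; rewrite // -(prednK M0).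
by rewrite prednK// /grid divff ?gt_eqF// mul1r.
Qed.

Lemma band_norm (r t a : R) x s : 0 <= t -> 0 <= a -> 0 <= r -> enorm x <= t -> enorm s <= r ->
  dot s (unitv x) <= a * r ->
  enorm (x + s) <= Num.sqrt (t ^+ 2 + 2 * r * a * t + r ^+ 2).
Proof.
move=> t0 a0 r0 xt sr H.
rewrite -(@ler_pXn2r _ 2)// ?nnegrE ?enorm_ge0 ?sqrtr_ge0//.
have pos : 0 <= t ^+ 2 + 2 * r * a * t + r ^+ 2.
  by apply: addr_ge0; [apply: addr_ge0; [exact: sqr_ge0|rewrite !mulr_ge0]|exact: sqr_ge0].
rewrite (sqr_sqrtr pos).
rewrite -[s]scale1r sqr_enormDZ mulr1 expr1n mul1r -(sqr_enorm s).
have x2 : enorm x ^+ 2 <= t ^+ 2 by rewrite ler_pXn2r// ?nnegrE ?enorm_ge0.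
have s2 : enorm s ^+ 2 <= r ^+ 2 by rewrite ler_pXn2r// ?nnegrE ?enorm_ge0.
have : dot x s <= r * a * t.
  rewrite {1}(unitvE x) dotZl dotC.
  apply: le_trans (ler_wpM2l (enorm_ge0 _) H) _.
  by rewrite mulrC (mulrC a) ler_wpM2l// mulr_ge0.
by move: x2 s2; lra.
Qed.

(** A mesh 1/M changes the squared sine by at most 2/M <= eps^2, hence the sine by at most [eps]. *)
Lemma grid_sqrt j : (j < M)%N ->
  Num.sqrt (1 - grid j ^+ 2) <= Num.sqrt (1 - grid j.+1 ^+ 2) + eps.
Proof.
move=> jM; have g0 := grid_ge0 j; have g1 := grid_le1 jM.
have gS : grid j.+1 = grid j + M%:R^-1 by rewrite /grid -natr1 mulrDl mul1r.
have Mi : 0 < M%:R^-1 :> R by rewrite invr_gt0 ltr0n.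
have b0 : 0 <= 1 - grid j.+1 ^+ 2 by have := grid_ge0 j.+1; rewrite expr2; nra.
have b1 : 0 <= 1 - grid j ^+ 2 by rewrite expr2; move: gS; nra.
rewrite -(@ler_pXn2r _ 2)// ?nnegrE ?sqrtr_ge0// ?addr_ge0 ?sqrtr_ge0 ?(ltW eps0)//.
rewrite sqrrD !sqr_sqrtr//.
have : 0 <= Num.sqrt (1 - grid j.+1 ^+ 2) * eps by rewrite mulr_ge0 ?sqrtr_ge0// ltW.
rewrite -mulr_natr; move: M_eps gS g0 g1 Mi; rewrite !expr2.
move: (M%:R^-1) (grid j) (grid j.+1) => m g g'; nra.
Qed.

Lemma band_count j (r : R) (c : 'rV[R]_d) x : (j < M)%N -> 1 <= r ->
  (size [seq q <- ball_pts eta c r | band j r x (lat eta q - c)])%:R * eta ^+ d <=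
  (r * (Num.sqrt (1 - grid j.+1 ^+ 2) + 2 * eps)) ^+ d * vol_ball R d.
Proof.
move=> jM r1; have r0 : 0 < r by apply: lt_le_trans r1.
apply: (ball_filter_le (c' := c + (grid j * r) *: unitv x)
  (r1 := r * Num.sqrt (1 - grid j ^+ 2)) d0 eta0).
- by rewrite mulr_ge0 ?sqrtr_ge0// ltW.
- have h1 : r * Num.sqrt (1 - grid j ^+ 2) <= r * (Num.sqrt (1 - grid j.+1 ^+ 2) + eps).
    by rewrite ler_pM2l// grid_sqrt.
  have h2 : eps <= r * eps by rewrite ler_peMl// ltW.
  by move: h1 h2 eta_eps; rewrite !mulrDr; lra.
- move=> q qr /andP[/orP[/eqP ->|H] _].
    rewrite /grid !mul0r expr0n subr0 sqrtr1 mulr1 scale0r addr0//.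
  rewrite opprD addrA; apply: cap_subset => //; last exact: ltW.
  by rewrite grid_ge0 grid_le1// ltnW.
Qed.

(** The lower end of a class of cosines bounds the number of its points and the upper end bounds
    their distance to [y]; thanks to [grid_sqrt] both bounds use the same cosine. *)
Lemma sum_grid_le (u y : V) (t r : R) (F : V -> R) (B : nat -> R) :
  0 <= t -> 1 <= r -> enorm (lat eta u - lat eta y) <= t -> (forall q, 0 <= F q) ->
  (forall j, (j < M)%N -> 0 <= B j) ->
  (forall j q, (j < M)%N -> enorm (lat eta q - lat eta u) <= r ->
     enorm (lat eta q - lat eta y) <= Num.sqrt (t ^+ 2 + 2 * r * grid j.+1 * t + r ^+ 2) ->
     F q <= B j) ->
  \sum_(q <- ball_pts eta (lat eta u) r) F q <=
  \sum_(j < M) (r * (Num.sqrt (1 - grid j.+1 ^+ 2) + 2 * eps)) ^+ d *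
     (vol_ball R d / eta ^+ d) * B j.
Proof.
move=> t0 r1 ut F0 B0 FB; have r0 : 0 < r by apply: lt_le_trans r1.
set x := lat eta u - lat eta y.
apply: (@le_trans _ _ (\sum_(j < M) \sum_(q <- ball_pts eta (lat eta u) r |
    band j r x (lat eta q - lat eta u)) F q)).
  rewrite (exchange_big_dep predT)//= [leLHS]big_seq_cond [leRHS]big_seq_cond.
  apply: ler_sum => q; rewrite andbT mem_ball_pts// => qr.
  have [j jM bj] := band_cover x r0 qr.
  rewrite (bigD1 (Ordinal jM))//= lerDl; exact: sumr_ge0.
apply: ler_sum => -[j jM] _ /=.
apply: (@le_trans _ _ (\sum_(q <- ball_pts eta (lat eta u) r |
    band j r x (lat eta q - lat eta u)) B j)).
  rewrite [leLHS]big_seq_cond [leRHS]big_seq_cond; apply: ler_sum => q /andP[].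
  rewrite mem_ball_pts// => qr /andP[_ bq]; apply: FB => //.
  have -> : lat eta q - lat eta y = x + (lat eta q - lat eta u) by apply/rowP => i; rewrite !mxE; ring.
  by apply: band_norm => //; [exact: grid_ge0|exact: ltW].
rewrite -big_filter sumr_const_seq; apply: ler_wpM2r; first exact: B0.
by rewrite mulrA ler_pdivlMr ?exprn_gt0// band_count.
Qed.

End CapCounting.

Section ReturnWeights.
Variables (R : realType) (d : nat) (eta eps : R) (M : nat).
Hypotheses (d0 : (0 < d)%N) (eta0 : 0 < eta) (eta_eps : eta * Num.sqrt d%:R < eps)
  (eps0 : 0 < eps) (M0 : (0 < M)%N) (M_eps : 2 / M%:R <= eps ^+ 2).
Local Notation V := 'rV[int]_d.
Variables (R1 R2 D0 pS pB qS qB cS cB : R).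
Hypotheses (R11 : 1 <= R1) (R21 : 1 <= R2) (pS0 : 0 <= pS) (pB0 : 0 <= pB)
  (qS0 : 0 < qS) (qB0 : 0 < qB) (cS0 : 0 <= cS) (cB0 : 0 <= cB)
  (small_step : pS * (vol_ball R d / eta ^+ d) * R2 ^+ d <= cS * qS ^+ d)
  (big_step : pB * (vol_ball R d / eta ^+ d) * R1 ^+ d <= cB * qB ^+ d).

(* [w] lists the cosines of the angles between the steps and the ray from the origin, as in [Dseq];
   [cap_prod] multiplies the radii of the caps to which the steps are then confined. *)
Fixpoint dist_end (t : R) (w : seq R) : R :=
  if w is a :: w' then
    dist_end (Num.sqrt (t ^+ 2 + 2 * (if w' is [::] then R1 else R2) * a * t +
      (if w' is [::] then R1 else R2) ^+ 2)) w'
  else t.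

Fixpoint cap_prod (w : seq R) : R :=
  if w is a :: w' then
    (if w' is [::] then qB else qS) * (Num.sqrt (1 - a ^+ 2) + 2 * eps) * cap_prod w'
  else 1.

(* The expected number of open paths from [u] made of [n] small sites and a final big site at distance
   more than [D0] of [y]. *)
Fixpoint return_weight (y : V) (n : nat) (u : V) : R :=
  if n is n'.+1 then pS * \sum_(v <- ball_pts eta (lat eta u) R2) return_weight y n' v
  else pB * \sum_(w <- ball_pts eta (lat eta u) R1) (D0 < enorm (lat eta w - lat eta y))%R%:R.

Lemma return_weight_ge0 y n u : 0 <= return_weight y n u.
Proof. by elim: n u => [|n IH] u /=; rewrite mulr_ge0// sumr_ge0. Qed.

(** Each step has [M] classes, so the number of words does not depend on [d], and each word ending
    beyond [D0] contributes at most [T ^+ d]. In the induction the first cosine is fixed and [T] is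
    divided by its factor. *)
Lemma return_weight_le n T t (y u : V) : 0 <= T -> 0 <= t ->
  enorm (lat eta u - lat eta y) <= t ->
  (forall w, size w = n.+1 -> all (fun a => 0 <= a <= 1) w -> D0 < dist_end t w -> cap_prod w <= T) ->
  return_weight y n u <= (M%:R * cS) ^+ n * (M%:R * cB) * T ^+ d.
Proof.
have sq0 j : 0 < Num.sqrt (1 - grid R M j ^+ 2) + 2 * eps.
  by rewrite ltr_wpDl ?sqrtr_ge0// mulr_gt0.
have vol0 := vol_ball_gt0 R d0.
elim: n T t u => [|n IH] T t u T0 t0 ut H /=.
- rewrite expr0 mul1r.
  apply: le_trans (_ : pB * \sum_(j < M) (R1 * (Num.sqrt (1 - grid R M j.+1 ^+ 2) + 2 * eps)) ^+ d *
     (vol_ball R d / eta ^+ d) *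
     (D0 < Num.sqrt (t ^+ 2 + 2 * R1 * grid R M j.+1 * t + R1 ^+ 2))%R%:R <= _).
    rewrite ler_wpM2l//.
    apply: (@sum_grid_le R d eta eps M d0 eta0 eta_eps eps0 M0 M_eps u y t R1 _
      (fun j => (D0 < Num.sqrt (t ^+ 2 + 2 * R1 * grid R M j.+1 * t + R1 ^+ 2))%R%:R)) => //.
    move=> j q jM _ qy; case: ltP => Dq //; by rewrite (lt_le_trans Dq qy).
  rewrite mulr_sumr -mulrA [leRHS](_ : _ = \sum_(j < M) cB * T ^+ d); last first.
    by rewrite sumr_const card_ord mulr_natl.
  apply: ler_sum => -[j jM] _ /=.
  case: ltP => Dj; last by rewrite !mulr0 mulr_ge0// exprn_ge0.
  rewrite mulr1; have := H [:: grid R M j.+1] erefl.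
  rewrite /= grid_ge0 grid_le1// mulr1 => /(_ isT Dj) Hj.
  have -> : pB * ((R1 * (Num.sqrt (1 - grid R M j.+1 ^+ 2) + 2 * eps)) ^+ d * (vol_ball R d / eta ^+ d)) =
    pB * (vol_ball R d / eta ^+ d) * R1 ^+ d * (Num.sqrt (1 - grid R M j.+1 ^+ 2) + 2 * eps) ^+ d.
    by rewrite exprMn; ring.
  apply: le_trans (ler_wpM2r _ big_step) _; first by rewrite exprn_ge0// ltW.
  rewrite -mulrA ler_wpM2l// -exprMn lerXn2r// nnegrE// mulr_ge0// ?(ltW qB0)// ltW//.
- pose st j := Num.sqrt (t ^+ 2 + 2 * R2 * grid R M j.+1 * t + R2 ^+ 2).
  pose T' j := T / (qS * (Num.sqrt (1 - grid R M j.+1 ^+ 2) + 2 * eps)).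
  have q0 j : 0 < qS * (Num.sqrt (1 - grid R M j.+1 ^+ 2) + 2 * eps) by rewrite mulr_gt0.
  have T'0 j : 0 <= T' j by rewrite divr_ge0// ltW.
  have C0 m : 0 <= (M%:R * cS) ^+ m * (M%:R * cB) by rewrite mulr_ge0 ?exprn_ge0// mulr_ge0.
  apply: le_trans (_ : pS * \sum_(j < M) (R2 * (Num.sqrt (1 - grid R M j.+1 ^+ 2) + 2 * eps)) ^+ d *
     (vol_ball R d / eta ^+ d) * ((M%:R * cS) ^+ n * (M%:R * cB) * T' j ^+ d) <= _).
    rewrite ler_wpM2l//.
    apply: (@sum_grid_le R d eta eps M d0 eta0 eta_eps eps0 M0 M_eps u y t R2 _
      (fun j => (M%:R * cS) ^+ n * (M%:R * cB) * T' j ^+ d)) => //.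
    + by move=> q; exact: return_weight_ge0.
    + by move=> j _; rewrite mulr_ge0 ?exprn_ge0.
    + move=> j q jM _ qy; apply: (IH (T' j) (st j)) => //; first exact: sqrtr_ge0.
      move=> w sw aw Dw; rewrite ler_pdivlMr// mulrC.
      have := H (grid R M j.+1 :: w); rewrite /= sw aw grid_ge0 grid_le1//.
      case: w sw {aw} Dw => [//|a w] sw Dw.
      by move=> /(_ erefl isT Dw).
  rewrite mulr_sumr [leRHS](_ : _ = \sum_(j < M) cS * ((M%:R * cS) ^+ n * (M%:R * cB) * T ^+ d)); last first.
    by rewrite sumr_const card_ord -mulr_natl exprS; ring.
  apply: ler_sum => -[j jM] _ /=.
  have -> : T ^+ d = (qS * (Num.sqrt (1 - grid R M j.+1 ^+ 2) + 2 * eps)) ^+ d * T' j ^+ d.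
    by rewrite -exprMn /T' mulrC divfK// gt_eqF.
  have -> : pS * ((R2 * (Num.sqrt (1 - grid R M j.+1 ^+ 2) + 2 * eps)) ^+ d * (vol_ball R d / eta ^+ d) *
      ((M%:R * cS) ^+ n * (M%:R * cB) * T' j ^+ d)) =
    pS * (vol_ball R d / eta ^+ d) * R2 ^+ d * ((Num.sqrt (1 - grid R M j.+1 ^+ 2) + 2 * eps) ^+ d *
      ((M%:R * cS) ^+ n * (M%:R * cB) * T' j ^+ d)).
    by rewrite exprMn; ring.
  apply: le_trans (ler_wpM2r _ small_step) _.
    by rewrite mulr_ge0 ?exprn_ge0 ?(ltW (sq0 _))// mulr_ge0// exprn_ge0.
  by rewrite (exprMn d qS) le_eqVlt; apply/orP; left; apply/eqP; ring.
Qed.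

End ReturnWeights.

Lemma ler_sum_sub (R : realType) (T : eqType) (s t : seq T) (P : pred T) (F : T -> R) :
  uniq s -> (forall x, 0 <= F x) -> (forall x, x \in s -> P x -> x \in t) ->
  \sum_(x <- s | P x) F x <= \sum_(x <- t) F x.
Proof.
move=> us F0 st; rewrite -big_filter.
elim: s us t st => [|x s IH] /= us t st; first by rewrite big_nil sumr_ge0.
case/andP: us => xs us; case: ifP => Px; last first.
  by apply: IH => // y ys; apply: st; rewrite in_cons ys orbT.
have xt : x \in t by apply: st; rewrite ?mem_head.
rewrite big_cons (big_rem _ xt)/= lerD2l; apply: IH => // y ys Py.
have yt : y \in t by apply: st; rewrite // in_cons ys orbT.
apply: contraR xs; rewrite -(perm_mem (_ : perm_eq (x :: rem x t) t)) in yt.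
  by move: yt; rewrite in_cons => /orP[/eqP <-|->].
by rewrite perm_sym perm_to_rem.
Qed.

(** * A potential that decreases along reduced paths *)

Section Supersolution.
Variables (R : realType) (d : nat) (eta eps : R) (M K : nat) (rho kap kap1 alpha beta th : R).
Hypotheses (d0 : (0 < d)%N) (eta0 : 0 < eta) (eta_eps : eta * Num.sqrt d%:R < eps)
  (eps0 : 0 < eps) (M0 : (0 < M)%N) (M_eps : 2 / M%:R <= eps ^+ 2)
  (rho1 : 1 < rho) (kap0 : 0 < kap) (kap11 : 0 < kap1 <= 1) (alpha0 : 0 < alpha) (beta0 : 0 < beta)
  (th0 : 0 < th).
Local Notation V := 'rV[int]_d.
Definition mixed_reach : R := (1 + rho) * (1 + eps).
Definition small_reach : R := 2 * (1 + eps).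
Definition return_radius : R := 2 * rho / kap1.
Local Notation R1 := mixed_reach.
Local Notation R2 := small_reach.
Local Notation D0 := return_radius.
Local Notation qS := (kap / 2 * R2).
Local Notation qB := (kap / (2 * rho) * R1).

Definition within_dist (r : R) : rel V := fun x y => enorm (lat eta y - lat eta x) <= r.

Variables (pS pB : R).
Hypotheses (pS0 : 0 <= pS) (pB0 : 0 <= pB)
  (pS_le : pS * (vol_ball R d / eta ^+ d) <= alpha * (kap / 2) ^+ d)
  (pB_le : pB * (vol_ball R d / eta ^+ d) <= beta * (kap / (2 * rho)) ^+ d).

Lemma count_weight (p c q r : R) (x : V) : 0 <= p -> 1 <= r ->
  p * (vol_ball R d / eta ^+ d) <= c * q ^+ d ->
  p * (size (ball_pts eta (lat eta x) r))%:R <= c * (q * r * (1 + eps)) ^+ d.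
Proof.
move=> p0 r1 H; have r0 : 0 < r by apply: lt_le_trans r1.
have := @ball_pts_le R d eta (lat eta x) r (r * (1 + eps)) d0 eta0 (ltW r0).
have : r + eta * Num.sqrt d%:R < r * (1 + eps).
  rewrite mulrDr mulr1 ltrD2l; apply: lt_le_trans eta_eps _.
  by rewrite ler_peMl// ltW.
move=> h /(_ h) {h}; rewrite -ler_pdivlMr ?exprn_gt0// => h.
apply: le_trans (ler_wpM2l p0 h) _.
have -> : p * ((r * (1 + eps)) ^+ d * vol_ball R d / eta ^+ d) =
  p * (vol_ball R d / eta ^+ d) * (r * (1 + eps)) ^+ d by ring.
have e1 : 0 <= r * (1 + eps) by rewrite mulr_ge0// ?(ltW r0)// addr_ge0// ltW.
apply: le_trans (ler_wpM2r (exprn_ge0 _ e1) H) _.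
by rewrite -[q * r * _]mulrA (exprMn d q) mulrA.
Qed.

Local Notation S := (alpha * (qS * (1 + eps)) ^+ d).
Local Notation Sb := (beta * (qB * (1 + eps)) ^+ d).
Local Notation rw := (@return_weight R d eta R1 R2 D0 pS pB).

(* The expected potential of an open reduced path is at least halved by each further step. *)
Definition small_potential (m : nat) (y u : V) : R :=
  \sum_(n < m) 2 ^+ n.+1 * rw y n u + (2 * S) ^+ m * (4 * Sb).

Definition potential (st : (bool * V) * nat * V) : R :=
  if st.1.1.1 then 1 else small_potential st.1.2 st.2 st.1.1.2.

Definition reach_bound : R := Num.max D0 (Num.max R1 R2).
Definition nbr_sites (st : (bool * V) * nat * V) : seq (bool * V) :=
  [seq (true, w) | w <- ball_pts eta (lat eta st.1.1.2) reach_bound] ++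
  [seq (false, w) | w <- ball_pts eta (lat eta st.1.1.2) reach_bound].

Definition wt (t : bool) : R := if t then pB else pS.

Local Notation step_ok := (step_ok (within_dist D0) (within_dist R1) (within_dist R2)).

Lemma step_near st z : step_ok st z -> within_dist reach_bound st.1.1.2 z.2.
Proof.
rewrite /within_dist /reach_bound !le_max /step_ok /adj /within_dist.
case: st => [[[[] x] m] y] /=; case: z => -[] w /=; rewrite ?andbT ?orbF.
- by case/orP => [->|->].
- by move=> ->; rewrite !orbT.
- by case/andP => ->; rewrite !orbT.
- by move=> ->; rewrite !orbT.
Qed.

Lemma nbr_sitesP st z : step_ok st z -> z \in nbr_sites st.
Proof.
move=> /step_near; rewrite /within_dist -(mem_ball_pts (lat eta st.1.1.2) _ z.2 eta0) mem_cat.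
by case: z => -[] w /= H; apply/orP; [left|right]; apply: map_f.
Qed.

Lemma R1_ge1 : 1 <= R1.
Proof. by rewrite /mixed_reach; have := rho1; have := eps0; nra. Qed.
Lemma R2_ge1 : 1 <= R2.
Proof. by rewrite /small_reach; have := eps0; lra. Qed.
Lemma D0_ge1 : 1 <= D0.
Proof.
have /andP[k0 k1] := kap11; rewrite /return_radius ler_pdivlMr// mul1r.
by apply: le_trans k1 _; have := rho1; lra.
Qed.

Lemma R1_gt0 : 0 < R1. Proof. exact: lt_le_trans R1_ge1. Qed.
Lemma R2_gt0 : 0 < R2. Proof. exact: lt_le_trans R2_ge1. Qed.
Lemma rho_gt0 : 0 < rho. Proof. exact: lt_trans rho1. Qed.

Lemma S_gt0 : 0 < S.
Proof. by have h1_ := R2_gt0; pos. Qed.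
Lemma Sb_gt0 : 0 < Sb.
Proof. by have h2_ := R1_gt0; have h3_ := rho_gt0; pos. Qed.

Lemma tail_ge0 m : 0 <= (2 * S) ^+ m * (4 * Sb).
Proof. by have h4_ := R1_gt0; have h5_ := R2_gt0; have h6_ := rho_gt0; pos. Qed.

Lemma rw_ge0 y n u : 0 <= rw y n u.
Proof. exact: return_weight_ge0. Qed.

Lemma small_potential_ge0 m y u : 0 <= small_potential m y u.
Proof.
apply: addr_ge0; last exact: tail_ge0.
by apply: sumr_ge0 => n _; apply: mulr_ge0; [exact: exprn_ge0|exact: rw_ge0].
Qed.

Lemma sum_nbr st (F : bool * V -> R) :
  \sum_(z <- nbr_sites st | step_ok st z) F z =
  \sum_(w <- ball_pts eta (lat eta st.1.1.2) reach_bound | step_ok st (true, w)) F (true, w) +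
  \sum_(w <- ball_pts eta (lat eta st.1.1.2) reach_bound | step_ok st (false, w)) F (false, w).
Proof. by rewrite big_cat !big_map. Qed.

Hypotheses (condA : S <= 4^-1) (condB : beta * (kap / (2 * rho) * D0 * (1 + eps)) ^+ d <= 8^-1).

(** A small step turns the term of index n into that of index n + 1, at half its weight: hence the
    factors 2^(n+1). Once the countdown is over the value is 4 Sb: a big step costs Sb and a small
    one at most a quarter of 4 Sb, in all 2 Sb. *)
Lemma potential_small m (x y : V) :
  \sum_(z <- nbr_sites (false, x, m, y) | step_ok (false, x, m, y) z)
     wt z.1 * potential (next_state K (false, x, m, y) z) <= potential (false, x, m, y) / 2.
Proof.
rewrite sum_nbr /potential /next_state /wt /=.
have small_le m' (F : V -> R) : (forall v, 0 <= F v) ->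
  \sum_(w <- ball_pts eta (lat eta x) reach_bound | step_ok (false, x, m', y) (false, w)) pS * F w <=
  pS * \sum_(w <- ball_pts eta (lat eta x) R2) F w.
  move=> F0; rewrite -mulr_sumr ler_wpM2l//; apply: ler_sum_sub => //; first exact: ball_pts_uniq.
  by move=> w _; rewrite mem_ball_pts// /step_ok /adj /within_dist /= andbT orbF.
case: m => [|m].
  apply: le_trans (lerD _ (small_le _ _ (fun v => small_potential_ge0 0 y v))) _.
    apply: (@ler_sum_sub _ _ _ (ball_pts eta (lat eta x) R1)) => //; first exact: ball_pts_uniq.
      by move=> w; rewrite mulr1.
    by move=> w _; rewrite mem_ball_pts// /step_ok /adj /within_dist /= andbT orbF.
  have E0 v : small_potential 0 y v = 4 * Sb by rewrite /small_potential big_ord0 expr0 add0r mul1r.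
  under [X in _ + pS * X]eq_bigr do rewrite E0.
  rewrite E0 !sumr_const_seq.
  have h1 := count_weight x pB0 R1_ge1 pB_le; have h2 := count_weight x pS0 R2_ge1 pS_le.
  have h3 : pS * (size (ball_pts eta (lat eta x) R2))%:R * (4 * Sb) <= 4^-1 * (4 * Sb).
    by apply: ler_wpM2r; [apply: mulr_ge0 => //; exact/ltW/Sb_gt0|exact: le_trans condA].
  move: h1 h3; lra.
apply: le_trans (lerD _ (small_le _ _ (fun v => small_potential_ge0 m y v))) _.
  apply: (_ : _ <= rw y 0 x); rewrite /= mulr_sumr.
  rewrite [leRHS](_ : _ = \sum_(w <- ball_pts eta (lat eta x) R1 | D0 < enorm (lat eta w - lat eta y)) pB * 1); last first.
    by rewrite [RHS]big_mkcond; apply: eq_bigr => w _; case: ifP; rewrite ?mulr1 ?mulr0.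
  rewrite -[leRHS]big_filter; apply: ler_sum_sub => //; first exact: ball_pts_uniq.
    by move=> w; rewrite mulr1.
  move=> w _; rewrite mem_filter mem_ball_pts// /step_ok /adj /within_dist /= orbF ltNge.
  by case/andP => -> ->.
have -> : \sum_(w <- ball_pts eta (lat eta x) R2) small_potential m y w =
   \sum_(n < m) 2 ^+ n.+1 * \sum_(w <- ball_pts eta (lat eta x) R2) rw y n w +
   (size (ball_pts eta (lat eta x) R2))%:R * ((2 * S) ^+ m * (4 * Sb)).
  rewrite /small_potential big_split/= sumr_const_seq exchange_big/=; congr (_ + _).
  by apply: eq_bigr => n _; rewrite mulr_sumr.
rewrite mulrDr mulr_sumr /small_potential big_ord_recl /=.
have -> : \sum_(i < m) pS * (2 ^+ i.+1 * \sum_(w <- ball_pts eta (lat eta x) R2) rw y i w) =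
   \sum_(i < m) 2 ^+ i.+1 * rw y i.+1 x.
  by apply: eq_bigr => n _; rewrite mulrCA.
have -> : \sum_(i < m) 2 ^+ (bump 0 i).+1 * rw y (bump 0 i) x =
    2 * \sum_(i < m) 2 ^+ i.+1 * rw y i.+1 x.
  by rewrite mulr_sumr; apply: eq_bigr => i _; rewrite /bump leq0n add1n exprS mulrA.
have h2 := count_weight x pS0 R2_ge1 pS_le.
have W0 := tail_ge0 m.
have := ler_wpM2r W0 h2; rewrite (exprS _ m) expr1.
set A := rw y 0 x; set B := \sum_(i < m) _; set C := (2 * S) ^+ m.
have -> : pS * ((size (ball_pts eta (lat eta x) R2))%:R * (C * (4 * Sb))) =
  pS * (size (ball_pts eta (lat eta x) R2))%:R * (C * (4 * Sb)) by rewrite mulrA.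
by lra.
Qed.

Hypothesis theta_cond : forall w : seq R, (0 < size w <= K)%N -> all (fun a => 0 <= a <= 1) w ->
  D0 < dist_end R1 R2 R1 w -> kap / 2 * R1 * (1 + eps) * cap_prod eps qS qB w <= th.
Hypotheses
  (condC : alpha * (\sum_(n < K) 2 ^+ n.+1 * ((M%:R * alpha) ^+ n * (M%:R * beta))) * th ^+ d <= 4^-1)
  (condD : alpha * (kap / 2 * R1 * (1 + eps)) ^+ d * ((2 * S) ^+ K * (4 * Sb)) <= 8^-1).

(** The half splits into 1/8 for direct steps to close big sites, 1/4 for far returns through at
    most [K] small sites and 1/8 for longer runs. The step leaving the big site is counted with its
    full reach, the later ones through their cosines. *)
Lemma potential_big m (x y : V) :
  \sum_(z <- nbr_sites (true, x, m, y) | step_ok (true, x, m, y) z)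
     wt z.1 * potential (next_state K (true, x, m, y) z) <= potential (true, x, m, y) / 2.
Proof.
rewrite sum_nbr /potential /next_state /wt /=.
have q0 : 0 < kap / 2 * R1 * (1 + eps).
  by have h7_ := R1_gt0; pos.
have big_le : \sum_(w <- ball_pts eta (lat eta x) reach_bound | step_ok (true, x, m, y) (true, w)) pB * 1 <= 8^-1.
  apply: le_trans condB; apply: le_trans (count_weight x pB0 D0_ge1 pB_le).
  have -> : pB * (size (ball_pts eta (lat eta x) D0))%:R =
      \sum_(w <- ball_pts eta (lat eta x) D0) pB * 1 by rewrite sumr_const_seq mulr1 mulrC.
  apply: ler_sum_sub => //; first exact: ball_pts_uniq.
    by move=> w; rewrite mulr1.
  by move=> w _; rewrite mem_ball_pts// /step_ok /adj /within_dist /= => /orP[/andP[]|].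
pose B := \sum_(n < K) 2 ^+ n.+1 * ((M%:R * alpha) ^+ n * (M%:R * beta) * (th / (kap / 2 * R1 * (1 + eps))) ^+ d)
  + (2 * S) ^+ K * (4 * Sb).
have small_le : \sum_(w <- ball_pts eta (lat eta x) reach_bound | step_ok (true, x, m, y) (false, w))
    pS * small_potential K x w <= pS * \sum_(w <- ball_pts eta (lat eta x) R1) B.
  rewrite -mulr_sumr ler_wpM2l//.
  apply: le_trans (_ : \sum_(w <- ball_pts eta (lat eta x) R1) small_potential K x w <= _).
    apply: ler_sum_sub; [exact: ball_pts_uniq|by move=> w; exact: small_potential_ge0|].
    by move=> w _; rewrite mem_ball_pts// /step_ok /adj /within_dist /= andbT orbF.
  rewrite [leLHS]big_seq_cond [leRHS]big_seq_cond; apply: ler_sum => w; rewrite andbT mem_ball_pts// => wR.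
  rewrite /small_potential lerD2r; apply: ler_sum => n _; rewrite ler_wpM2l ?exprn_ge0//.
  apply: (@return_weight_le R d eta eps M d0 eta0 eta_eps eps0 M0 M_eps R1 R2 D0 pS pB qS qB alpha beta
    R1_ge1 R2_ge1 pS0 pB0 _ _ _ _ _ _ n (th / (kap / 2 * R1 * (1 + eps))) R1) => //.
  - by have h8_ := R2_gt0; pos.
  - by have h9_ := R1_gt0; have h10_ := rho_gt0; pos.
  - exact: ltW.
  - exact: ltW.
  - by rewrite (exprMn d (kap / 2) R2) [leRHS]mulrA; apply: ler_wpM2r => //; exact/exprn_ge0/ltW/R2_gt0.
  - by rewrite (exprMn d (kap / (2 * rho)) R1) [leRHS]mulrA; apply: ler_wpM2r => //; exact/exprn_ge0/ltW/R1_gt0.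
  - by rewrite divr_ge0// ltW.
  - by rewrite (le_trans _ R1_ge1).
  - by move=> v sv av Dv; rewrite ler_pdivlMr// mulrC; apply: theta_cond => //; rewrite sv ltn_ord.
apply: le_trans (lerD big_le small_le) _.
rewrite sumr_const_seq mulrA.
have S0 := S_gt0; have Sb0 := Sb_gt0.
have B0 : 0 <= B.
  apply: addr_ge0; last exact: tail_ge0.
  apply: sumr_ge0 => n _; apply: mulr_ge0; first exact: exprn_ge0.
  apply: mulr_ge0; last by apply/exprn_ge0/divr_ge0; exact: ltW.
  by apply: mulr_ge0; rewrite ?exprn_ge0// mulr_ge0// ltW.
have h := ler_wpM2r B0 (count_weight x pS0 R1_ge1 pS_le).
apply: le_trans (lerD (lexx _) h) _; rewrite /B mulrDr.
have -> : alpha * (kap / 2 * R1 * (1 + eps)) ^+ d *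
   (\sum_(n < K) 2 ^+ n.+1 * ((M%:R * alpha) ^+ n * (M%:R * beta) * (th / (kap / 2 * R1 * (1 + eps))) ^+ d)) =
   alpha * (\sum_(n < K) 2 ^+ n.+1 * ((M%:R * alpha) ^+ n * (M%:R * beta))) * th ^+ d.
  have -> : th ^+ d = (kap / 2 * R1 * (1 + eps)) ^+ d * (th / (kap / 2 * R1 * (1 + eps))) ^+ d.
    by rewrite -exprMn mulrC divfK// gt_eqF.
  rewrite !mulr_sumr mulr_suml; apply: eq_bigr => n _; ring.
move: condC condD; lra.
Qed.

Lemma potential_super st :
  \sum_(z <- nbr_sites st | step_ok st z) wt z.1 * potential (next_state K st z) <= potential st / 2.
Proof.
by case: st => [[[[] x] m] y]; [exact: potential_big|exact: potential_small].
Qed.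

End Supersolution.

(** * Words of cosines and the definition of kappa *)

Section KappaWords.
Variables (R : realType) (rho : R).
Hypothesis rho1 : 1 < rho.

Lemma Dseq_ge0 k (a : nat -> R) n : 0 <= Dseq rho k a n.
Proof. by case: n => [|n] /=; [rewrite addr_ge0// ltW// (lt_trans ltr01)|exact: sqrtr_ge0]. Qed.

Lemma kappa_term_ge0 k (a : nat -> R) : 0 <= kappa_term rho k a.
Proof.
rewrite /kappa_term le_max; apply/orP; right.
by rewrite divr_ge0 ?Dseq_ge0// mulr_ge0// ltW// (lt_trans ltr01).
Qed.

Lemma kappa_k_le k (a : nat -> R) : (forall i, (2 <= i <= k.+1)%N -> 0 <= a i < 1) ->
  kappa_k rho k <= kappa_term rho k a.
Proof.
move=> a01; apply: ge_inf; last by exists a.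
by exists 0 => _ [b _ <-]; exact: kappa_term_ge0.
Qed.

Lemma kappa_k_ge k x : (forall a, (forall i, (2 <= i <= k.+1)%N -> 0 <= a i < 1) ->
  x <= kappa_term rho k a) -> x <= kappa_k rho k.
Proof.
move=> H; apply: lb_le_inf; last by move=> _ [a a01 <-]; exact: H.
by exists (kappa_term rho k (fun=> 0)), (fun=> 0) => //= i _; rewrite lexx ltr01.
Qed.

Lemma kappa_c_le k (a : nat -> R) : (1 <= k)%N ->
  (forall i, (2 <= i <= k.+1)%N -> 0 <= a i < 1) -> kappa_c rho <= kappa_term rho k a.
Proof.
move=> k1 a01; apply: le_trans (kappa_k_le a01); apply: ge_inf; last by exists k.
by exists 0 => _ [j _ <-]; apply: kappa_k_ge => b _; exact: kappa_term_ge0.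
Qed.

Variable eps : R.
Hypothesis eps0 : 0 < eps.
Local Notation R1 := (mixed_reach eps rho).
Local Notation R2 := (small_reach eps).

(** The enlarged reaches are the exact radii times 1 + eps, so all distances scale by that
    factor. *)
Lemma dist_end_Dseq k (a : nat -> R) (w : seq R) i : (size w + i)%N = k ->
  (forall j, (j < size w)%N -> nth 0 w j = a (i + j).+2) ->
  dist_end R1 R2 ((1 + eps) * Dseq rho k a i) w = (1 + eps) * Dseq rho k a k.
Proof.
have e1 : 0 <= 1 + eps by rewrite addr_ge0// ltW.
elim: w i => [|x w IH] i /=; first by move=> <-.
move=> sk aw; have {}aw0 : x = a i.+2 by have := aw 0%N (ltn0Sn _); rewrite addn0.
have rE : (if w is [::] then R1 else R2) = (1 + eps) * Defs.rad rho k i.+2.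
  rewrite /Defs.rad /mixed_reach /small_reach -sk; case: w {IH aw sk} => [|y w] /=.
    by rewrite add1n eqxx mulrC.
  rewrite eqn_leq [X in _ && X](_ : _ = false) ?andbF 1?mulrC//.
  by apply/negbTE; rewrite -ltnNge /=; lia.
rewrite -(IH i.+1); last 2 first.
- by rewrite -sk addnS addSn.
- by move=> j jw; have := aw j.+1 jw; rewrite /= => ->; rewrite addSnnS.
congr dist_end; rewrite rE /= -aw0.
rewrite -[X in X * Num.sqrt _](ger0_norm e1) -sqrtr_sqr -sqrtrM ?sqr_ge0//.
by congr Num.sqrt; ring.
Qed.

Local Notation G := ((1 + rho) ^+ 2 / (4 * rho)).

(** One of the two terms of the maximum is at least [kappa_c rho], an infimum. Ending beyond the
    return radius excludes the second; the first gives the bound. *)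
Lemma word_kappa (kap1 : R) (w : seq R) : 0 < kap1 -> kap1 * (1 + eps) < kappa_c rho ->
  (0 < size w)%N -> all (fun a => 0 <= a <= 1) w ->
  return_radius rho kap1 < dist_end R1 R2 R1 w ->
  kappa_c rho ^+ (size w).+1 * G * \prod_(i < size w) Num.sqrt (1 - nth 0 w i ^+ 2) <= 1.
Proof.
move=> k0 k1 sw aw Dw; have rho0 : 0 < rho by apply: lt_trans rho1.
have kc0 : 0 < kappa_c rho by apply: lt_trans k1; rewrite mulr_gt0// addr_gt0.
have w01 i : (i < size w)%N -> 0 <= nth 0 w i <= 1 by move=> iw; exact: (all_nthP 0 aw).
(* The infimum ranges over cosines below 1; a cosine 1 makes a factor of the product vanish. *)
have [/existsP[[i iw] /= /eqP w1]|] := boolP [exists i : 'I_(size w), nth 0 w i == 1].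
  rewrite (bigD1 (Ordinal iw))//= w1 expr1n subrr sqrtr0 mul0r mulr0; exact: ler01.
rewrite negb_exists => /forallP wn1.
have wlt i : (i < size w)%N -> 0 <= nth 0 w i < 1.
  by move=> iw; have /andP[-> h] := w01 i iw; rewrite lt_neqAle h andbT; exact: (wn1 (Ordinal iw)).
pose a i := nth 0 w (i - 2).
have a01 i : (2 <= i <= (size w).+1)%N -> 0 <= a i < 1 by move=> H; apply: wlt; lia.
have aw' j : (j < size w)%N -> nth 0 w j = a (0 + j).+2 by move=> _; rewrite /a add0n -addn2 addnK.
have := @dist_end_Dseq (size w) a w 0 (addn0 _) aw'.
rewrite /= [(1 + eps) * (1 + rho)]mulrC => DE.
have D0 := Dseq_gt0 rho1 sw a01 (leqnn _).
have := kappa_c_le sw a01; rewrite /kappa_term le_max => /orP[|]; last first.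
  rewrite leNgt => /negP[]; apply: le_lt_trans k1.
  rewrite ler_pdivrMr// -mulrA -DE; apply: le_trans (ler_wpM2l (ltW k0) (ltW Dw)).
  by rewrite /return_radius [kap1 * _]mulrC divfK// gt_eqF.
rewrite prod_bigOS (@sqrt_prod _ (fun i => 1 - a i.+2 ^+ 2)) => [H|i iw]; last first.
  by have /andP[h1 h2] := wlt i iw; rewrite /a -addn2 addnK subr_ge0 expr_le1// ltW.
have P0 : 0 < \prod_(i < size w) Num.sqrt (1 - a i.+2 ^+ 2).
  apply: prodr_gt0 => i _; rewrite sqrtr_gt0 subr_gt0 /a -addn2 addnK.
  by have /andP[h1 h2] := wlt i (ltn_ord i); rewrite exprn_ilt1.
have PE : \prod_(i < size w) Num.sqrt (1 - a i.+2 ^+ 2) =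
  \prod_(i < size w) Num.sqrt (1 - nth 0 w i ^+ 2).
  by apply: eq_bigr => i _; rewrite /a -addn2 addnK.
rewrite PE in H P0; set P := \prod_(i < size w) _ in H P0 *.
have X0 : 0 <= 4 * rho / ((1 + rho) ^+ 2 * P).
  by apply: divr_ge0; apply: mulr_ge0 => //; rewrite ?(ltW rho0) ?sqr_ge0 ?(ltW P0).
have {}H : kappa_c rho ^+ (size w).+1 <= 4 * rho / ((1 + rho) ^+ 2 * P).
  rewrite leNgt; apply/negP => h; move: H; rewrite leNgt => /negP; apply.
  rewrite -(@ltr_pXn2r _ (size w).+1)// ?nnegrE ?powR_ge0 ?(ltW kc0)//.
  by rewrite -[X in X < _]powR_mulrn ?powR_ge0// -powRrM mulVf ?pnatr_eq0// powRr1.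
have r1 : 0 < 1 + rho by rewrite addr_gt0.
have GP : 0 < G * P by rewrite mulr_gt0// divr_gt0 ?exprn_gt0// mulr_gt0.
rewrite -mulrA -ler_pdivlMr// mul1r; apply: le_trans H _.
rewrite le_eqVlt; apply/orP; left; apply/eqP; field.
by rewrite !gt_eqF.
Qed.

Lemma cap_prodE (qS qB : R) (w : seq R) : (0 < size w)%N -> cap_prod eps qS qB w =
  qS ^+ (size w).-1 * qB * \prod_(i < size w) (Num.sqrt (1 - nth 0 w i ^+ 2) + 2 * eps).
Proof.
elim: w => [//|x [|y w] IH] _.
  by rewrite /= big_ord_recl big_ord0 expr0 !mulr1 mul1r.
have -> : cap_prod eps qS qB (x :: y :: w) =
  qS * (Num.sqrt (1 - x ^+ 2) + 2 * eps) * cap_prod eps qS qB (y :: w) by [].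
rewrite IH// [in RHS]big_ord_recl.
have -> : \prod_(i < size (y :: w)) (Num.sqrt (1 - nth 0 [:: x, y & w] (lift ord0 i) ^+ 2) + 2 * eps) =
  \prod_(i < size (y :: w)) (Num.sqrt (1 - nth 0 (y :: w) i ^+ 2) + 2 * eps).
  by apply: eq_bigr => i _; rewrite lift0.
set Q := \prod_(i < size (y :: w)) _.
transitivity (qS * qS ^+ size w * qB * ((Num.sqrt (1 - x ^+ 2) + 2 * eps) * Q)).
  by rewrite [(size _).-1]/=; move: (qS ^+ size w) => z; ring.
by rewrite -exprS.
Qed.

(** Expanding the product, every term with at least one [x] is at most the same term with all [s i]
    equal to 1. *)
Lemma prod_perturb (s : nat -> R) (x : R) n : 0 <= x -> (forall i, (i < n)%N -> 0 <= s i <= 1) ->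
  \prod_(i < n) (s i + x) <= \prod_(i < n) s i + ((1 + x) ^+ n - 1).
Proof.
move=> x0; elim: n => [|n IH] H; first by rewrite !big_ord0 expr0 subrr addr0.
have {}IH := IH (fun i h => H i (ltnW h)); rewrite !big_ord_recr/=.
have /andP[s0 s1] := H n (ltnSn n).
have P0 : 0 <= \prod_(i < n) s i by apply: prodr_ge0 => i _; have /andP[] := H i (ltnW (ltn_ord i)).
have P1 : \prod_(i < n) s i <= 1.
  by apply: prodr_ile1 => i _; apply: H; apply: ltnW; exact: ltn_ord.
have E0 : 0 <= (1 + x) ^+ n - 1 by rewrite subr_ge0 exprn_ege1// lerDl.
have sx : 0 <= s n + x by rewrite addr_ge0.
apply: le_trans (ler_wpM2r sx IH) _; rewrite exprS.
move: (\prod_(i < n) s i) ((1 + x) ^+ n) P0 P1 E0 => P E; move: (s n) s0 s1 {sx IH H} => t; nra.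
Qed.

End KappaWords.

Lemma exponent_budget n K : (n <= K)%N ->
  [/\ (1 <= 2 * K + 4)%N, (2 <= 2 * K + 4)%N, (n <= 2 * K + 4)%N & (n.+2 <= 2 * K + 4)%N].
Proof. by move=> nK; split; lia. Qed.

(** * Choice of the parameters below the threshold *)

Section SubParameters.
Variables (R : realType) (rho kap kap1 : R).
Hypotheses (rho1 : 1 < rho) (kap0 : 0 < kap) (kapk : kap < kap1) (k11 : kap1 < 1)
  (k1c : kap1 < kappa_c rho).
Local Notation G := ((1 + rho) ^+ 2 / (4 * rho)).

Lemma pow_near1 N (dl : R) : 0 < dl <= 1 -> exists2 e0, 0 < e0 &
  forall eps, 0 < eps <= e0 -> (1 + 2 * eps) ^+ N <= 1 + dl.
Proof.
elim: N dl => [|N IH] dl /andP[d0 d1].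
  by exists 1 => // e _; rewrite expr0 lerDl ltW.
have d3 : 0 < dl / 3 <= 1 by rewrite divr_gt0//= ler_pdivrMr//; lra.
have [e0 e00 H] := IH _ d3; exists (Num.min e0 (dl / 6)).
  by rewrite lt_min e00 divr_gt0.
move=> e /andP[ep]; rewrite le_min => /andP[ee0 ed].
have := H e; rewrite ep ee0 => /(_ isT) h; rewrite exprS.
have h2 : 1 + 2 * e <= 1 + dl / 3 by lra.
apply: le_trans (ler_pM _ _ h2 h) _; [lra|by rewrite exprn_ge0//; lra|nra].
Qed.

Lemma sub_params : exists (eps th : R) (K : nat),
  [/\ 0 < eps, 0 < th < 1, kap1 * (1 + eps) <= 1, kap / 2 * small_reach eps * (1 + eps) < 1 &
  [/\ kap / (2 * rho) * return_radius rho kap1 * (1 + eps) < 1,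
    (kap / 2 * mixed_reach eps rho * (1 + eps)) * (kap / 2 * small_reach eps * (1 + eps)) ^+ K *
      (kap / (2 * rho) * mixed_reach eps rho * (1 + eps)) < 1 &
   forall w : seq R, (0 < size w <= K)%N -> all (fun a => 0 <= a <= 1) w ->
     return_radius rho kap1 < dist_end (mixed_reach eps rho) (small_reach eps) (mixed_reach eps rho) w ->
     kap / 2 * mixed_reach eps rho * (1 + eps) *
       cap_prod eps (kap / 2 * small_reach eps) (kap / (2 * rho) * mixed_reach eps rho) w <= th]].
Proof.
have rho0 : 0 < rho by apply: lt_trans rho1.
have kp1 : kap < 1 by apply: lt_trans k11.
have k10 : 0 < kap1 by apply: lt_trans kapk.
have kc0 : 0 < kappa_c rho by apply: lt_trans k1c.
have G0 : 0 < G by rewrite divr_gt0 ?exprn_gt0 ?mulr_gt0 ?addr_gt0.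
(* After [K] small steps the factor [kap ^+ K] outweighs the gain [G] of the two steps between balls
   of different sizes, whatever the angles. *)
have [K HK] := @expr_lt1_small R kap G^-1 ltac:(by rewrite (ltW kap0)) ltac:(by rewrite invr_gt0).
have {}HK : kap ^+ K * G <= 1 by rewrite -ler_pdivlMr// mul1r; exact: HK.
pose c := kap / kappa_c rho.
have c0 : 0 < c by rewrite divr_gt0.
have c1 : c < 1 by rewrite ltr_pdivrMr// mul1r (lt_trans kapk).
have [dl [dl0 dl1 F1 F2 [F3 F5]]] : exists dl : R, [/\ 0 < dl, dl <= 1, kap1 * (1 + dl) <= 1,
   kap1 * (1 + dl) < kappa_c rho & kap * (1 + dl) < kap1 /\ (1 + dl) * (c + G * dl) < 1].
  pose m := Num.min (Num.min 1 (1 - kap1)) (Num.min (kappa_c rho - kap1) (Num.min (kap1 - kap) ((1 - c) / (2 * G + 1)))).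
  have m0 : 0 < m.
    rewrite !lt_min ltr01 !subr_gt0 k11 k1c kapk /= divr_gt0 ?subr_gt0//.
    by rewrite addr_gt0// mulr_gt0.
  have : m <= m by []; rewrite {2}/m !le_min => /andP[/andP[h1 h2] /andP[h3 /andP[h4 h5]]].
  have G21 : 0 < 2 * G + 1 by apply: addr_gt0 => //; apply: mulr_gt0.
  rewrite (ler_pdivlMr _ _ G21) in h5.
  exists (m / 2).
  clearbody m; split => //; first by rewrite divr_gt0.
  - by lra.
  - by nra.
  - by nra.
  - split; first by nra.
    have : 0 < m * G by rewrite mulr_gt0.
    have : m * G * m <= m * G by rewrite ler_piMr// mulr_ge0 ?ltW.
    have : m * c <= m by rewrite ler_piMr// ltW.
    by move: (G) h5 => g; nra.
have [e0 e00 He] := @pow_near1 (2 * K + 4) dl ltac:(by rewrite dl0).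
pose eps := Num.min e0 1.
have eps0 : 0 < eps by rewrite lt_min e00 ltr01.
have epow j : (j <= 2 * K + 4)%N -> (1 + 2 * eps) ^+ j <= 1 + dl.
  move=> jK; apply: le_trans (He eps _); last by rewrite eps0 ge_min lexx.
  by apply: ler_weXn2l => //; rewrite lerDl mulr_ge0// ltW.
have epow1 j : (j <= 2 * K + 4)%N -> (1 + eps) ^+ j <= 1 + dl.
  move=> jK; apply: le_trans (epow j jK); apply: lerXn2r; rewrite ?nnegrE; have := eps0; lra.
clearbody eps.
have E1 : 1 + eps <= 1 + dl by have := epow1 1%N; rewrite expr1; apply; have [] := exponent_budget (leqnn K).
have e1 : 0 < 1 + eps by rewrite addr_gt0.
exists eps, ((1 + dl) * (c + G * dl)), K; split => //.
- by rewrite F5 andbT mulr_gt0 ?addr_gt0// mulr_gt0.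
- by apply: le_trans F1; rewrite ler_pM2l.
- have -> : kap / 2 * small_reach eps * (1 + eps) = kap * (1 + eps) ^+ 2.
    by rewrite /small_reach; field.
  apply: lt_trans k11; apply: le_lt_trans F3; rewrite ler_pM2l//; by apply: epow1; have [] := exponent_budget (leqnn K).
- split.
  + have -> : kap / (2 * rho) * return_radius rho kap1 * (1 + eps) = kap * (1 + eps) / kap1.
      by rewrite /return_radius; field; rewrite !gt_eqF.
    rewrite ltr_pdivrMr// mul1r; apply: le_lt_trans F3; by rewrite ler_pM2l.
  + have -> : (kap / 2 * mixed_reach eps rho * (1 + eps)) * (kap / 2 * small_reach eps * (1 + eps)) ^+ K *
      (kap / (2 * rho) * mixed_reach eps rho * (1 + eps)) = kap ^+ 2 * (kap ^+ K * G) * (1 + eps) ^+ (2 * K + 4).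
      have -> : kap / 2 * small_reach eps * (1 + eps) = kap * (1 + eps) ^+ 2.
        by rewrite /small_reach; field.
      rewrite exprMn -exprM exprD /mixed_reach; move: (kap ^+ K) ((1 + eps) ^+ (2 * K)) => x y.
      by field; rewrite gt_eqF.
    apply: le_lt_trans (_ : kap ^+ 2 * 1 * (1 + dl) < 1).
      have r1 : 0 < 1 + rho by rewrite addr_gt0.
      apply: ler_pM => //; [by pos|by pos| |].
      - by rewrite ler_wpM2l ?exprn_ge0// ltW.
      - exact: epow1.
    have : kap * (kap * (1 + dl)) < kap * kap1 by rewrite ltr_pM2l.
    have : kap * kap1 < 1 * 1 by apply: ltr_pM => //; exact: ltW.
    rewrite expr2; lra.
  + move=> w /andP[sw swK] aw Dw.
    have kE : kap1 * (1 + eps) < kappa_c rho.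
      by apply: le_lt_trans F2; rewrite ler_pM2l.
    have HW := word_kappa rho1 eps0 k10 kE sw aw Dw.
    rewrite cap_prodE//; set n := size w in sw swK HW *.
    pose s i := Num.sqrt (1 - nth 0 w i ^+ 2).
    have s01 i : (i < n)%N -> 0 <= s i <= 1.
      move=> iw; rewrite sqrtr_ge0 /= -sqrtr1 ler_sqrt// gerBl sqr_ge0//.
    have PP := prod_perturb (x := 2 * eps) ltac:(by rewrite mulr_ge0// ltW) s01.
    have P0 : 0 <= \prod_(i < n) s i by apply: prodr_ge0 => i _; have /andP[] := s01 i (ltn_ord i).
    have P'0 : 0 <= \prod_(i < n) (s i + 2 * eps).
      by apply: prodr_ge0 => i _; rewrite addr_ge0 ?sqrtr_ge0// mulr_ge0// ltW.
    have -> : kap / 2 * mixed_reach eps rho * (1 + eps) * ((kap / 2 * small_reach eps) ^+ n.-1 *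
       (kap / (2 * rho) * mixed_reach eps rho) * \prod_(i < n) (s i + 2 * eps)) =
      (1 + eps) ^+ n.+2 * (kap ^+ n.+1 * G * \prod_(i < n) (s i + 2 * eps)).
      have -> : kap / 2 * small_reach eps = kap * (1 + eps) by rewrite /small_reach; field.
      move: (\prod_(i < n) (s i + 2 * eps)) => Q; rewrite -(prednK sw) [n.-1.+1.-1]/= exprMn !exprS /mixed_reach.
      by move: (kap ^+ n.-1) ((1 + eps) ^+ n.-1) => x y; field; rewrite gt_eqF.
    have k1n : kap ^+ n.+1 <= 1 by apply: exprn_ile1; exact: ltW.
    have kn0 : 0 < kap ^+ n.+1 by rewrite exprn_gt0.
    apply: ler_pM; first by rewrite exprn_ge0// ltW.
    * by apply: mulr_ge0 => //; apply: mulr_ge0; exact: ltW.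
    * by apply: epow1; have [] := exponent_budget swK.
    * apply: le_trans (ler_wpM2l _ PP) _; first by apply: mulr_ge0; exact: ltW.
      rewrite mulrDr; apply: lerD.
        have -> : kap ^+ n.+1 * G * \prod_(i < n) s i = c ^+ n.+1 *
           (kappa_c rho ^+ n.+1 * G * \prod_(i < n) s i).
          rewrite /c expr_div_n; have : kappa_c rho ^+ n.+1 != 0 by rewrite expf_neq0// gt_eqF.
          by move: (kappa_c rho ^+ n.+1) => x x0; field; rewrite x0 gt_eqF.
        apply: le_trans (_ : c ^+ n.+1 * 1 <= _).
          by rewrite ler_wpM2l ?exprn_ge0// ltW.
        by rewrite mulr1 exprS ler_piMr ?(ltW c0)// exprn_ile1 ?ltW.
      have E0 : 0 <= (1 + 2 * eps) ^+ n - 1.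
        by rewrite subr_ge0 exprn_ege1// lerDl mulr_ge0// ltW.
      have E2 : (1 + 2 * eps) ^+ n - 1 <= dl by rewrite lerBlDl epow//; have [] := exponent_budget swK.
      rewrite -[kap ^+ n.+1 * G * _]mulrA -[leRHS]mul1r; apply: ler_pM => //.
      * exact: ltW.
      * by apply: mulr_ge0 => //; exact: ltW.
      * by rewrite ler_wpM2l// ltW.
Qed.

End SubParameters.

Lemma coord_le_norm (R : realType) d (x : 'rV[R]_d) i : `|x 0 i| <= `|x|.
Proof.
have : `|x| <= `|x| by [].
by rewrite {1}/Num.norm/= mx_normrE => /bigmax_leP[_ /(_ (0, i) isT)].
Qed.

Lemma lt_sum5 (x1 x2 x3 x4 x5 d : nat) : (x1 + x2 + x3 + x4 + x5 < d)%N ->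
  [/\ (x1 <= d)%N, (x2 <= d)%N, (x3 <= d)%N, (x4 <= d)%N & (x5 < d)%N].
Proof. by move=> *; split; lia. Qed.

Section SubWeights.
Variables (R : realType) (rho kap kap1 alpha beta : R).
Hypotheses (rho1 : 1 < rho) (kap0 : 0 < kap) (kapk : kap < kap1) (k11 : kap1 < 1)
  (k1c : kap1 < kappa_c rho) (alpha0 : 0 < alpha) (beta0 : 0 < beta).

Lemma pow_small (q w c : R) : 0 < q < 1 -> 0 <= w -> 0 < c ->
  exists N, forall n, (N <= n)%N -> w * q ^+ n <= c.
Proof.
move=> /andP[q0 q1] w0 c0.
have [N H] := @expr_lt1_small R q (c / (w + 1)) ltac:(by rewrite (ltW q0)) ltac:(by rewrite divr_gt0// ltr_wpDl).
exists N => n /H h; apply: le_trans (ler_wpM2l w0 h) _.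
have w1 : 0 < w + 1 by rewrite ltr_wpDl.
by rewrite mulrCA ger_pMr// ler_pdivrMr// mul1r lerDl.
Qed.

Definition decaying_potential d (eta eps : R) K (pS pB : R) : Prop :=
  exists (h : (bool * 'rV[int]_d) * nat * 'rV[int]_d -> R) (c : R),
    [/\ 0 < c, forall st, (st.1.2 <= K)%N -> c <= h st &
    forall st, \sum_(z <- nbr_sites eta eps rho kap1 st |
       step_ok (within_dist eta (return_radius rho kap1)) (within_dist eta (mixed_reach eps rho))
         (within_dist eta (small_reach eps)) st z) wt pS pB z.1 * h (next_state K st z) <= h st / 2].

Lemma subcritical_weights : exists (eps : R) (K : nat), [/\ 0 < eps, kap1 * (1 + eps) <= 1 &
  exists N, forall d (pS pB : R), (N < d)%N -> 0 <= pS -> 0 <= pB ->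
    let eta := d%:R^-1 in
    pS * (vol_ball R d / eta ^+ d) <= alpha * (kap / 2) ^+ d ->
    pB * (vol_ball R d / eta ^+ d) <= beta * (kap / (2 * rho)) ^+ d ->
    eta * (Num.sqrt d%:R + 2) < eps /\ decaying_potential d eta eps K pS pB].
Proof.
have [eps [th [K [eps0 /andP[th0 th1] k1e bA [bB bD thc]]]]] := sub_params rho1 kap0 kapk k11 k1c.
exists eps, K; split => //.
have rho0 : 0 < rho by apply: lt_trans rho1.
have k10 : 0 < kap1 by apply: lt_trans kapk.
have R10 : 0 < mixed_reach eps rho by rewrite mulr_gt0 ?addr_gt0.
have R20 : 0 < small_reach eps by rewrite mulr_gt0 ?addr_gt0.
have D00 : 0 < return_radius rho kap1 by rewrite divr_gt0// mulr_gt0.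
have e1 : 0 < 1 + eps by rewrite addr_gt0.
have [M M0 Me] : exists2 M : nat, (0 < M)%N & 2 / M%:R <= eps ^+ 2.
  exists (Num.truncn (2 / eps ^+ 2)).+1 => //.
  rewrite ler_pdivrMr ?ltr0n// mulrC -ler_pdivrMr ?exprn_gt0//.
  by apply: ltW; exact: truncnS_gt.
set qA := kap / 2 * small_reach eps * (1 + eps) in bA bD.
set qT := kap / 2 * mixed_reach eps rho * (1 + eps) in bD thc.
set qB := kap / (2 * rho) * mixed_reach eps rho * (1 + eps) in bD.
set qD := kap / (2 * rho) * return_radius rho kap1 * (1 + eps) in bB.
have qA0 : 0 < qA by rewrite /qA; pos.
have qT0 : 0 < qT by rewrite /qT; pos.
have qB0 : 0 < qB by rewrite /qB; pos.
have qD0 : 0 < qD by rewrite /qD; pos.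
have [N1 H1] := @pow_small qA alpha 4^-1 ltac:(by rewrite qA0) (ltW alpha0) ltac:(by []).
have [N2 H2] := @pow_small qD beta 8^-1 ltac:(by rewrite qD0) (ltW beta0) ltac:(by []).
have [N3 H3] := @pow_small th (alpha * (\sum_(n < K) 2 ^+ n.+1 * ((M%:R * alpha) ^+ n * (M%:R * beta))))
  4^-1 ltac:(by rewrite th0) ltac:(rewrite mulr_ge0 ?(ltW alpha0)// sumr_ge0// => n _;
    rewrite !mulr_ge0 ?exprn_ge0 ?mulr_ge0 ?(ltW alpha0) ?(ltW beta0)//) ltac:(by []).
have Q0 : 0 < qT * qA ^+ K * qB by pos.
have [N4 H4] := @pow_small (qT * qA ^+ K * qB) (alpha * (2 * alpha) ^+ K * (4 * beta)) 8^-1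
  ltac:(by rewrite Q0) ltac:(by pos) ltac:(by []).
have [N5 H5] := eta_small eps0.
exists (N1 + N2 + N3 + N4 + N5)%N => d pS pB Nd pS0 pB0 eta HS HB.
have [Nd1 Nd2 Nd3 Nd4 Nd5] := lt_sum5 Nd.
have d0 : (0 < d)%N by apply: leq_ltn_trans Nd.
have eta0 : 0 < eta by rewrite invr_gt0 ltr0n.
have F1 : eta * (Num.sqrt d%:R + 2) < eps by exact: H5.
split => //.
have Fd : eta * Num.sqrt d%:R < eps.
  by apply: le_lt_trans F1; rewrite ler_pM2l// lerDl.
have cA := H1 d Nd1; have cB := H2 d Nd2; have cC := H3 d Nd3; have cD := H4 d Nd4.
have S0 : 0 < alpha * qA ^+ d by pos.
have Sb0 : 0 < beta * qB ^+ d by pos.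
have T0 m : 0 < (2 * (alpha * qA ^+ d)) ^+ m * (4 * (beta * qB ^+ d)) by pos.
exists (potential eta eps rho kap kap1 alpha beta pS pB).
(* The tail term decreases with the countdown because 2 S <= 1; its value at [K] is a lower bound
   for all small states. *)
exists (Num.min 1 ((2 * (alpha * qA ^+ d)) ^+ K * (4 * (beta * qB ^+ d)))); split.
- by rewrite lt_min ltr01 T0.
- move=> [[[[] x] m] y] /= mK; rewrite /potential /= ?ge_min ?lexx//.
  apply/orP; right; rewrite /small_potential -/qA -/qB.
  apply: (@le_trans _ _ ((2 * (alpha * qA ^+ d)) ^+ m * (4 * (beta * qB ^+ d)))).
    rewrite ler_pM2r; last by rewrite mulr_gt0.
    apply: ler_wiXn2l => //; first by rewrite mulr_ge0// ltW.
    by move: cA; lra.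
  rewrite lerDr; apply: sumr_ge0 => n _; apply: mulr_ge0; first exact: exprn_ge0.
  exact: return_weight_ge0.
- apply: (@potential_super R d eta eps M K rho kap kap1 alpha beta th) => //.
  + by rewrite k10 ltW.
  + apply: le_trans cD; rewrite -/qT -/qA -/qB le_eqVlt; apply/orP; left; apply/eqP.
    have -> : (2 * (alpha * qA ^+ d)) ^+ K = (2 * alpha) ^+ K * (qA ^+ K) ^+ d.
      by rewrite mulrA exprMn -!exprM mulnC.
    by rewrite !(exprMn d); move: (qT ^+ d) ((qA ^+ K) ^+ d) (qB ^+ d) ((2 * alpha) ^+ K) => u v w z; ring.
Qed.

End SubWeights.

(** * From an unbounded component to long open paths *)

Section Clusters.
Variables (R : realType) (d : nat) (a0 eta eps rho kap1 : R).
Hypotheses (d0 : (0 < d)%N) (a00 : 0 < a0) (eta0 : 0 < eta) (eps0 : 0 < eps)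
  (eta_eps : eta * (Num.sqrt d%:R + 2) < eps) (rho1 : 1 < rho) (k10 : 0 < kap1)
  (k1e : kap1 * (1 + eps) <= 1).
Local Notation V := 'rV[int]_d.
Local Notation site := (bool * V)%type.
Local Notation h := (eta * a0).
Local Notation R1 := (mixed_reach eps rho).
Local Notation R2 := (small_reach eps).
Local Notation D0 := (return_radius rho kap1).
Local Notation adjs := (adj (within_dist eta D0) (within_dist eta R1) (within_dist eta R2)).
Definition site_radius (t : bool) : R := if t then rho else 1.
Definition cube_set (z : site) : set ('rV[R]_d * R) :=
  lat_cube h z.2 `*` [set a0 * site_radius z.1].

Lemma cube_set_disj x y : x != y -> cube_set x `&` cube_set y = set0.
Proof.
move=> xy; apply/seteqP; split => // -[c r] [[/= cx rx] [/= cy ry]].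
have h0 : 0 < h by rewrite mulr_gt0.
have E : x.2 = y.2 by rewrite -(proj1 (lat_cubeP _ _ h0) cx) -(proj1 (lat_cubeP _ _ h0) cy).
have E1 : x.1 = y.1.
  move: rx ry => -> /= /(mulfI (lt0r_neq0 a00)).
  rewrite /site_radius; case: x.1; case: y.1 => // H; move: rho1; rewrite ?H ?ltxx//.
by move: xy; rewrite (surjective_pairing x) (surjective_pairing y) E E1 eqxx.
Qed.

Variable X : set ('rV[R]_d * R).
Hypothesis X_radii : forall p, X p -> exists t, p.2 = a0 * site_radius t.
Definition occ (z : site) : Prop := X `&` cube_set z !=set0.

Lemma site_of p : X p -> exists z, cube_set z p.
Proof.
move=> Xp; have [t pt] := X_radii Xp; have h0 : 0 < h by rewrite mulr_gt0.
by exists (t, cell h p.1); split => //=; apply/lat_cubeP.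
Qed.

(** The reaches exceed the sums of radii by at least 2 eps, more than two cube diameters; between
    big balls this follows from [kap1 * (1 + eps) <= 1]. *)
Lemma balls_meet_adj z z' p p' : cube_set z p -> cube_set z' p' ->
  eball p.1 p.2 `&` eball p'.1 p'.2 !=set0 -> adjs z z'.
Proof.
move=> [pz pr] [pz' pr'] [x [xp xp']]; have h0 : 0 < h by rewrite mulr_gt0.
have H : enorm (lat eta z'.2 - lat eta z.2) <= site_radius z.1 + site_radius z'.1 + 2 * eps.
  have hl (v : V) : lat h v = a0 *: lat eta v by apply/rowP => i; rewrite !mxE mulrA (mulrC a0).
  rewrite -(ler_pM2l a00) -[X in X * enorm _](gtr0_norm a00) -enormZ scalerBr -!hl.
  have b1 := lat_cube_dist h0 pz; have b2 := lat_cube_dist h0 pz'.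
  rewrite enormB_sym in b2.
  have b3 : enorm (p'.1 - x) < a0 * site_radius z'.1.
    by rewrite enormB_sym -pr'.
  have b4 : enorm (x - p.1) < a0 * site_radius z.1 by rewrite -pr.
  apply: le_trans (enorm_tri p'.1 _ _) _.
  have t1 := enorm_tri x p'.1 (lat h z.2); have t2 := enorm_tri p.1 x (lat h z.2).
  have : h * Num.sqrt d%:R <= a0 * eps.
    rewrite mulrAC mulrC ler_pM2l//; apply: ltW; apply: le_lt_trans eta_eps.
    by rewrite ler_pM2l// lerDl.
  rewrite !mulrDr; lra.
rewrite /adj /within_dist; move: H; rewrite /site_radius.
have r0 : 0 < rho by apply: lt_trans rho1.
case: z.1; case: z'.1 => /le_trans; apply; rewrite /mixed_reach /small_reach /return_radius.
- rewrite ler_pdivlMr//; have h1 : rho * (kap1 * (1 + eps)) <= rho by rewrite ger_pMr.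
  have : rho * eps * kap1 >= eps * kap1 by rewrite -mulrA ler_peMl ?mulr_ge0// ltW.
  by move: h1; lra.
- have := ler_peMl (ltW eps0) (ltW rho1).
  lra.
- have := ler_peMl (ltW eps0) (ltW rho1).
  lra.
- by lra.
Qed.

Definition start_site (z : site) : Prop := enorm (lat eta z.2) <= rho + eps.

Lemma zero_covered p z : X p -> cube_set z p -> eball p.1 p.2 0 -> start_site z.
Proof.
move=> Xp [pz pr]; rewrite /eball /= sub0r enormN => p0; have h0 : 0 < h by rewrite mulr_gt0.
have hl (v : V) : lat h v = a0 *: lat eta v by apply/rowP => i; rewrite !mxE mulrA (mulrC a0).
rewrite /start_site -(ler_pM2l a00) -[X in X * enorm _](gtr0_norm a00) -enormZ -hl.
have b1 := lat_cube_dist h0 pz; rewrite enormB_sym in b1.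
have : enorm (lat h z.2) <= enorm (lat h z.2 - p.1) + enorm p.1.
  by apply: le_trans (enormD _ _); rewrite subrK.
have rz : site_radius z.1 <= rho by rewrite /site_radius; case: ifP => // _; exact: ltW.
have : p.2 <= a0 * rho by rewrite pr ler_pM2l.
have : h * Num.sqrt d%:R <= a0 * eps.
  rewrite mulrAC mulrC ler_pM2l//; apply: ltW; apply: le_lt_trans eta_eps.
  by rewrite ler_pM2l// lerDl.
rewrite mulrDr; lra.
Qed.

Definition site_cluster (z : site) : Prop := exists z0 l, [/\ start_site z0, path adjs z0 l,
  z = last z0 l & forall y, y \in z0 :: l -> occ y].

Lemma cluster_step z z' : site_cluster z -> adjs z z' -> occ z' -> site_cluster z'.
Proof.
move=> [z0 [l [s0 pl zE Hl]]] zz' oz'; exists z0, (rcons l z'); split => //.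
- by rewrite rcons_path pl -zE zz'.
- by rewrite last_rcons.
- by move=> y; rewrite -rcons_cons mem_rcons in_cons => /orP[/eqP ->//|]; exact: Hl.
Qed.

Lemma open_eball (c : 'rV[R]_d) r : open (eball c r).
Proof.
rewrite openE => x; rewrite /eball /= => xr.
have s0 : 0 < Num.sqrt d%:R :> R by rewrite sqrtr_gt0 ltr0n.
pose e := (r - enorm (x - c)) / (2 * Num.sqrt d%:R).
have e0 : 0 < e by rewrite divr_gt0 ?subr_gt0// mulr_gt0.
apply/nbhs_ballP; exists e => //= y xy.
have : enorm (y - x) <= e * Num.sqrt d%:R.
  apply: enorm_le_const; first exact: ltW.
  move=> i; apply: ltW; move: xy; rewrite -ball_normE /ball_ /= => xy.
  by apply: le_lt_trans xy; rewrite -[x - y]opprB normrN; exact: coord_le_norm.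
have -> : e * Num.sqrt d%:R = (r - enorm (x - c)) / 2.
  by rewrite /e; field; rewrite gt_eqF.
by move=> H /=; have := enorm_tri x y c; move: xr H; lra.
Qed.

(** The balls whose cube is linked to the origin and the remaining balls have disjoint open unions,
    so the component of 0 lies in the first union; a bounded cluster would bound it. *)
Lemma cluster_unbounded : ~ bounded_set (connected_component (Sigma X) 0) ->
  forall M : R, exists z, site_cluster z /\ M < enorm (lat eta z.2).
Proof.
move=> ub M; apply/not_existsP => HM; apply: ub; apply/bounded_coordP.
pose U := \bigcup_(p in [set p | X p /\ exists z, cube_set z p /\ site_cluster z]) eball p.1 p.2.
pose W := \bigcup_(p in [set p | X p /\ ~ exists z, cube_set z p /\ site_cluster z]) eball p.1 p.2.
have oU : open U by apply: bigcup_open => p _; exact: open_eball.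
have oW : open W by apply: bigcup_open => p _; exact: open_eball.
have UW : U `&` W = set0.
  apply/seteqP; split => // x [[p [Xp [z [zp cz]]] xp] [p' [Xp' np'] xp']]; apply: np'.
  have [z' zp'] := site_of Xp'; exists z'; split => //.
  apply: (cluster_step cz); last by exists p'.
  by apply: (balls_meet_adj zp zp'); exists x.
have SUW : Sigma X `<=` U `|` W.
  move=> x [p Xp xp]; have [H|H] := pselect (exists z, cube_set z p /\ site_cluster z).
    by left; exists p.
  by right; exists p.
have sep : separated U W.
  have dis (A B : set 'rV[R]_d) : open B -> A `&` B = set0 -> closure A `&` B = set0.
    move=> oB AB; apply/seteqP; split => // x [cA Bx].
    have [y [Ay By]] := cA B (open_nbhs_nbhs (conj oB Bx)).
    by have : (A `&` B) y by []; rewrite AB.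
  split; first exact: dis.
  by rewrite setIC; apply: dis => //; rewrite setIC.
exists (a0 * (M + eps + rho)) => c Cc i; apply: le_trans (coord_le_enorm _ _) _.
have S0 : Sigma X 0.
  have [C [C0 CS _] _] := Cc; exact: CS.
have C0 : connected_component (Sigma X) 0 0 by exact: connected_component_refl.
have U0 : U 0.
  case: (S0) => p Xp p0; exists p => //; split => //; have [z zp] := site_of Xp.
  exists z; split => //; exists z, [::]; split => //; first exact: zero_covered zp p0.
  by move=> y; rewrite inE => /eqP ->; exists p.
have CU : connected_component (Sigma X) 0 `<=` U.
  have [//|CW] := connected_subset sep (subset_trans (@connected_component_sub _ _ _) SUW)
    (component_connected (A := Sigma X) (x := 0)).
  have : (U `&` W) 0 by split => //; exact: CW.
  by rewrite UW.
have [p [Xp [z [[pz pr] cz]]] cp] := CU _ Cc.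
have zM : enorm (lat eta z.2) <= M.
  by rewrite leNgt; apply/negP => Mz; apply: (HM z).
have h0 : 0 < h by rewrite mulr_gt0.
have hl (v : V) : lat h v = a0 *: lat eta v by apply/rowP => j; rewrite !mxE mulrA (mulrC a0).
have b1 := lat_cube_dist h0 pz.
have b2 : enorm (lat h z.2) <= a0 * M by rewrite hl enormZ gtr0_norm// ler_pM2l.
have rz : site_radius z.1 <= rho by rewrite /site_radius; case: ifP => // _; exact: ltW.
have b3 : enorm (c - p.1) < a0 * rho by apply: lt_le_trans cp _; rewrite pr ler_pM2l.
have b4 : h * Num.sqrt d%:R <= a0 * eps.
  rewrite mulrAC mulrC ler_pM2l//; apply: ltW; apply: le_lt_trans eta_eps.
  by rewrite ler_pM2l// lerDl.
have -> : c = (c - p.1) + ((p.1 - lat h z.2) + lat h z.2) by rewrite subrK subrK.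
apply: le_trans (enormD _ _) _; apply: le_trans (lerD (lexx _) (enormD _ _)) _.
rewrite !mulrDr; lra.
Qed.

Lemma path_norm (z0 : site) (l : seq site) : path adjs z0 l ->
  enorm (lat eta (last z0 l).2) <= enorm (lat eta z0.2) + (size l)%:R * reach_bound eps rho kap1.
Proof.
elim: l z0 => [|z l IH] z0 /=; first by rewrite mul0r addr0.
move=> /andP[zz pl]; apply: le_trans (IH _ pl) _.
have : enorm (lat eta z.2 - lat eta z0.2) <= reach_bound eps rho kap1.
  move: zz; rewrite /adj /within_dist /reach_bound !le_max.
  by case: z0.1; case: z.1 => ->; rewrite ?orbT.
have := enormD (lat eta z.2 - lat eta z0.2) (lat eta z0.2); rewrite subrK.
rewrite -natr1 mulrDl mul1r; lra.
Qed.

(** Steps have bounded length, so even after removal of its loops a path to a far site is long; it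
    is then cut. *)
Lemma long_path n : ~ bounded_set (connected_component (Sigma X) 0) ->
  exists z0 l, [/\ start_site z0, path adjs z0 l, uniq (z0 :: l), size l = n &
    forall y, y \in z0 :: l -> occ y].
Proof.
move=> /cluster_unbounded /(_ (rho + eps + n%:R * reach_bound eps rho kap1)).
move=> [z [[z0 [l [s0 pl zE Hl]]] far]].
move: far; rewrite zE; case: (shortenP pl) => l' pl' ul' sl' far.
have nl : (n < size l')%N.
  rewrite ltnNge; apply/negP => ln; move: far; apply/negP; rewrite -leNgt.
  apply: le_trans (path_norm pl') _; apply: lerD; first exact: s0.
  rewrite ler_wpM2r ?ler_nat// /reach_bound !le_max.
  by rewrite /return_radius divr_ge0// ?mulr_ge0// ltW// (lt_trans ltr01).
exists z0, (take n l'); split => //.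
- by rewrite take_path.
- by move: ul'; rewrite -{1}(cat_take_drop n l') -cat_cons cat_uniq => /and3P[].
- by rewrite size_takel// ltnW.
- move=> y; rewrite in_cons => /orP[/eqP ->|/mem_take/sl' yl]; apply: Hl; first exact: mem_head.
  by rewrite in_cons yl orbT.
Qed.

End Clusters.

Lemma measure_bigU_le dO (T : measurableType dO) (R : realType) (P : {measure set T -> \bar R})
  (I : Type) (s : seq I) (F : I -> set T) : (forall i, measurable (F i)) ->
  (P (\big[setU/set0]_(i <- s) F i) <= \sum_(i <- s) P (F i))%E.
Proof.
move=> mF; elim: s => [|i s IH]; first by rewrite !big_nil measure0.
rewrite !big_cons; apply: le_trans (measureU2 _ (mF i) _) _.
  by apply: bigsetU_measurable => j _.
by rewrite leeD2l.
Qed.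

Lemma mem_bigU (T : Type) (I : eqType) (s : seq I) (F : I -> set T) x w :
  x \in s -> F x w -> (\big[setU/set0]_(y <- s) F y) w.
Proof.
move=> xs Fx; rewrite (big_rem _ xs)/=; by left.
Qed.

Section SubcriticalNull.
Variables (R : realType) (rho kap kap1 alpha beta a0 : R).
Hypotheses (rho1 : 1 < rho) (kap0 : 0 < kap) (kapk : kap < kap1) (k11 : kap1 < 1)
  (k1c : kap1 < kappa_c rho) (alpha0 : 0 < alpha) (beta0 : 0 < beta) (a00 : 0 < a0).

Theorem subcritical_null : exists N, forall d (nu : {measure set R -> \bar R}) (lam : R)
    dO (Omega : measurableType dO) (P : probability Omega R) (xi : Omega -> set ('rV[R]_d * R)),
  (N < d)%N -> 0 <= lam <= crit_intensity kap d ->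
  nu [set a0] = (alpha * a0 ^- d)%:E -> nu [set a0 * rho] = (beta * (a0 * rho) ^- d)%:E ->
  is_poisson_pp P xi (intensity lam nu) ->
  (forall w p, xi w p -> exists t : bool, p.2 = a0 * site_radius rho t) ->
  forall F, measurable F -> F `<=` percolation_event xi -> P F = 0%E.
Proof.
have [eps [K [eps0 k1e [N HN]]]] := subcritical_weights rho1 kap0 kapk k11 k1c alpha0 beta0.
exists N => d nu lam dO Omega P xi Nd /andP[lam0 lamc] nua nub pp radii F mF FP.
have d0 : (0 < d)%N by apply: leq_ltn_trans Nd.
have rho0 : 0 < rho by apply: lt_trans rho1.
have k10 : 0 < kap1 by apply: lt_trans kapk.
pose eta : R := d%:R^-1; have eta0 : 0 < eta by rewrite invr_gt0 ltr0n.
pose A := @cube_set R d a0 eta rho.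
pose wg (t : bool) := if t then beta else alpha.
pose m (z : bool * 'rV[int]_d) := lam * wg z.1 * (eta / site_radius rho z.1) ^+ d.
have sr0 t : 0 < site_radius rho t by rewrite /site_radius; case: t.
have bA x : Borel (A x) by exact: Borel_box.
have LA x : intensity lam nu (A x) = (m x)%:E.
  rewrite /A /cube_set intensity_box//.
  rewrite boxvol_lat_cube ?mulr_ge0 ?(ltW eta0) ?(ltW a00)//.
  rewrite (_ : nu _ = (wg x.1 / (a0 * site_radius rho x.1) ^+ d)%:E); last first.
    by rewrite /site_radius /wg; case: x.1; rewrite ?mulr1.
  by rewrite -EFinM; congr EFin; rewrite /m rescaled_mean ?gt_eqF.
have disjA x y : x != y -> A x `&` A y = set0 by apply: cube_set_disj.
have indep := occupied_indep bA LA disjA pp.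
have occm := measurable_occupied bA pp.
pose p t := 1 - expR (- m (t, 0)).
have mE x : 1 - expR (- m x) = p x.1 by [].
have wg0 t : 0 < wg t by case: t.
have m0 x : 0 <= m x.
  by rewrite /m mulr_ge0 ?exprn_ge0 ?divr_ge0 ?(ltW eta0) ?(ltW (sr0 _))// mulr_ge0// ltW.
have p0 t : 0 <= p t by rewrite /p subr_ge0 -[leRHS]expR0 ler_expR oppr_le0.
have pm t : p t <= m (t, 0).
  by rewrite /p lerBlDr addrC -lerBlDr; have := expR_ge1Dx (- m (t, 0)); lra.
have v0 := vol_ball_gt0 R d0.
have pw t : p t * (vol_ball R d / eta ^+ d) <= wg t * (kap / (2 * site_radius rho t)) ^+ d.
  have c0 : 0 < vol_ball R d / eta ^+ d by rewrite divr_gt0// exprn_gt0.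
  apply: le_trans (ler_wpM2r (ltW c0) (pm t)) _; rewrite /m /=.
  have -> : lam * wg t * (eta / site_radius rho t) ^+ d * (vol_ball R d / eta ^+ d) =
     lam * (wg t * (site_radius rho t)^-1 ^+ d * vol_ball R d).
    by rewrite exprMn; field; rewrite expf_neq0// gt_eqF.
  apply: le_trans (ler_wpM2r _ lamc) _.
    by rewrite !mulr_ge0 ?exprn_ge0 ?invr_ge0 ?(ltW (sr0 t)) ?(ltW (wg0 t)) ?(ltW v0).
  rewrite /crit_intensity le_eqVlt; apply/orP; left; apply/eqP.
  rewrite expr_div_n !exprMn exprVn; field.
  by rewrite !expf_neq0 ?gt_eqF.
have [] := HN d (p false) (p true) Nd (p0 _) (p0 _).
- by have := pw false; rewrite /site_radius mulr1.
- exact: (pw true).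
rewrite -/eta => eta_eps [h [c [c0 hc hsup]]].
pose start := [seq (t, q) | t <- [:: true; false], q <- ball_pts eta (0 : 'rV[R]_d) (rho + eps)].
pose nx := @nbr_sites R d eta eps rho kap1.
pose bb := within_dist eta (return_radius rho kap1) (d := d).
pose sb := within_dist eta (mixed_reach eps rho) (d := d).
pose ss := within_dist eta (small_reach eps) (d := d).
(* The countdown starts at 0: before the first big site no return is restricted. *)
pose st0 (z : bool * 'rV[int]_d) := (z, 0%N, z.2).
pose Q n := [seq z :: l | z <- start, l <- seqs bb sb ss K nx n (st0 z)].
(* The product formula holds for distinct sites only; sequences with repetitions are discarded. *)
pose E (q : seq (bool * 'rV[int]_d)) := if uniq q then \big[setI/setT]_(z <- q) occupied A xi z else set0.
have mE' q : measurable (E q).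
  by rewrite /E; case: ifP => _ //; apply: bigsetI_measurable => z _; exact: occm.
have PE q : (P (E q) <= (\prod_(z <- q) p z.1)%:E)%E.
  rewrite /E; case: ifP => [uq|_]; last by rewrite measure0 lee_fin prodr_ge0.
  by rewrite indep.
have wtp t : wt (p false) (p true) t = p t by case: t.
have FE n w : F w -> (\big[setU/set0]_(q <- Q n) E q) w.
  move=> /FP /= /(long_path d0 a00 eta0 eps0 eta_eps rho1 k10 k1e (radii w) (K.+1 * n)).
  move=> [z0 [l [s0 pl ul sl Hl]]].
  (* The path has [K.+1 * n] steps so that its reduction has at least [n]. *)
  have [r [al sr szr]] := @reduce_path _ bb sb ss K l z0 0 z0.2 pl ltac:(by []).
  have nr : (n <= size r)%N by move: szr; rewrite sl leq_pmul2l.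
  apply: (@mem_bigU _ _ _ _ (z0 :: take n r)).
    apply: allpairs_f_dep.
      case: z0 s0 {pl ul Hl al} => t q; rewrite /start_site /= => s0.
      apply: (@allpairs_f _ _ _ (fun t q => (t, q))); first by case: t.
      by rewrite mem_ball_pts// subr0.
    rewrite -[X in seqs _ _ _ _ _ X](size_takel nr); apply: mem_seqs.
      by move=> st z; exact: nbr_sitesP.
    exact: allowed_take.
  have sub : subseq (z0 :: take n r) (z0 :: l).
    rewrite /= eqxx; apply: subseq_trans sr; exact: take_subseq.
  rewrite /E (subseq_uniq sub ul); apply/bigsetIP => z zq; apply: Hl.
  exact: (mem_subseq sub).
have PQ n : fine (P F) <= (\sum_(z <- start) p z.1 * (h (st0 z) / c)) * 2^-1 ^+ n.
  have mU : measurable (\big[setU/set0]_(q <- Q n) E q) by apply: bigsetU_measurable => q _.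
  rewrite -lee_fin fineK ?fin_num_measure//.
  apply: le_trans (le_measure P _ _ (FE n)) _; rewrite ?inE//.
  apply: le_trans (measure_bigU_le P _ mE') _.
  apply: le_trans (lee_sum _ (fun q _ => PE q)) _.
  rewrite sumEFin lee_fin /Q big_allpairs_dep mulr_suml; apply: ler_sum => z _.
  under eq_bigr do rewrite big_cons.
  rewrite -mulr_sumr -mulrA ler_wpM2l// exprVn.
  have := @seqs_weight _ bb sb ss K R nx p h c p0 c0 hc _ n (st0 z) (leq0n _).
  apply; move=> st; apply: le_trans (hsup st); rewrite le_eqVlt; apply/orP; left; apply/eqP.
  by apply: eq_bigr => z' _; rewrite wtp.
have [PF0|PF0] := leP (fine (P F)) 0.
  apply/eqP; rewrite eq_le measure_ge0 andbT -[P F]fineK ?fin_num_measure//.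
have h0 z : 0 <= h (st0 z) by apply: le_trans (hc _ _); rewrite ?(ltW c0).
have [n Hn] := @pow_small R 2^-1 (\sum_(z <- start) p z.1 * (h (st0 z) / c)) (fine (P F) / 2)
  ltac:(by rewrite invr_gt0 ltr0n/= invf_lt1// ltr1n)
  ltac:(by apply: sumr_ge0 => z _; rewrite mulr_ge0// divr_ge0// ltW) ltac:(by rewrite divr_gt0).
have := le_trans (PQ n) (Hn n (leqnn n)); rewrite leNgt => /negP[].
by rewrite ltr_pdivrMr// mulr2n mulrDr mulr1 ltrDl.
Qed.

End SubcriticalNull.

(** * Existence of the Poisson process *)

(** Dynkin's argument for the law of [f] restricted to the event [D], a restriction that plays the
    role of conditioning. *)
Lemma law_unique d d' (T' : measurableType d') (T : measurableType d) (R : realType)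
  (G : set (set T)) (P : {measure set T' -> \bar R}) (D : set T') (f : T' -> T)
  (m : {measure set T -> \bar R}) :
  @measurable _ T = <<s G >> -> setI_closed G -> measurable D -> measurable_fun setT f ->
  (P D < +oo)%E -> P D = m setT -> (forall A, G A -> P (D `&` f @^-1` A) = m A) ->
  forall A, measurable A -> P (D `&` f @^-1` A) = m A.
Proof.
move=> TG GI mD mf PD PDm mG A mA.
have mfA B : measurable B -> measurable (f @^-1` B).
  by move=> mB; rewrite -[X in measurable X]setTI; exact: mf.
apply: (@dynkin_induction _ T G (fun A => P (D `&` f @^-1` A) = m A)) => //.
- by rewrite preimage_setT setIT.
- move=> S mS SE.
  have mTo : (m setT < +oo)%E by rewrite -PDm.
  have -> : m (~` S) = (m setT - m S)%E by rewrite -setTD measureD// setTI.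
  by rewrite -PDm -SE preimage_setC -setDE measureD//; exact: mfA.
- move=> F mF tF FE; rewrite preimage_bigcup setI_bigcupr !measure_bigcup//.
  + by apply: eq_eseriesr => n _; exact: FE.
  + by move=> n _; apply: measurableI => //; exact: mfA.
  + apply/trivIsetP => n k _ _ nk; rewrite setIACA -[X in _ `&` X]preimage_setI.
    by move/trivIsetP : tF => /(_ _ _ Logic.I Logic.I nk) ->; rewrite preimage_set0 setI0.
- by rewrite -TG.
Qed.

(** * Two independent uniform variables from one *)

Section Uniform.
Variable R : realType.
Local Notation U := (measurableTypeR R).
Local Notation lam := (@lebesgue_measure R).

Lemma mI01 : measurable (`[0, 1[ : set U). Proof. exact: measurable_itv. Qed.
Definition unif : set U -> \bar R := mrestr lam mI01.
HB.instance Definition _ := Measure.on unif.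

Lemma unif_setT : unif setT = 1%E.
Proof. by rewrite /unif /mrestr setTI lebesgue_measure_itv/= lte01 oppr0 adde0. Qed.

HB.instance Definition _ := @Measure_isProbability.Build _ U R unif unif_setT.

Definition ray (s : R) : set U := [set u | s < u].

Lemma ray_itv s : ray s = `]s, +oo[%classic.
Proof. by apply/seteqP; split => u; rewrite /ray /= in_itv/= andbT. Qed.

Lemma measurable_ray s : measurable (ray s).
Proof. by rewrite ray_itv; exact: measurable_itv. Qed.

Lemma lebesgue_ray (a b c : R) : a <= b ->
  lam (ray c `&` `[a, b[) = (Num.max 0 (b - Num.max a c))%:E.
Proof.
move=> ab; have [ac|ca] := leP a c; last first.
  have -> : ray c `&` `[a, b[ = `[a, b[%classic.
    apply/seteqP; split => [x []//|x xab]; split => //.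
    by move: xab; rewrite /ray /= !in_itv/= => /andP[ax _]; rewrite (lt_le_trans ca).
  rewrite lebesgue_measure_itv/= lte_fin; case: ltP => ab'.
    by rewrite -EFinB; congr EFin; apply/esym/max_idPr; rewrite subr_ge0.
  by congr EFin; apply/esym/max_idPl; rewrite subr_le0.
have -> : ray c `&` `[a, b[ = `]c, b[%classic.
  apply/seteqP; split => [x []|x]; rewrite /ray /= !in_itv/=.
    by move=> -> /andP[].
  by move=> /andP[cx ->]; rewrite cx (le_trans ac (ltW cx)).
rewrite lebesgue_measure_itv/= lte_fin; case: ltP => cb.
  by rewrite -EFinB; congr EFin; apply/esym/max_idPr; rewrite subr_ge0 ltW.
by congr EFin; apply/esym/max_idPl; rewrite subr_le0.
Qed.

Definition tail01 (s : R) : R := if s <= 0 then 1 else if s <= 1 then 1 - s else 0.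

Lemma tail01_max (x : bool) s :
  Num.max 0 ((x%:R + 1) / 2 - Num.max (x%:R / 2) ((s + x%:R) / 2)) = 2^-1 * tail01 s.
Proof.
rewrite /Num.max; case: (ltP (x%:R / 2)) => h1; case: ltP => h2; rewrite /tail01;
  case: leP => h3; try (case: leP => h4); move: h1 h2; case: x => /= h1 h2; lra.
Qed.

Lemma tail01_ge0 s : 0 <= tail01 s.
Proof. by rewrite /tail01; case: (leP s 0) => // _; case: (leP s 1) => // h; rewrite subr_ge0. Qed.

Lemma unif_ray s : unif (ray s) = (tail01 s)%:E.
Proof.
rewrite /unif /mrestr lebesgue_ray//; congr EFin; rewrite /Num.max /tail01.
by case: (ltP 0 s) => h1; case: ltP => h2; case: (leP s 1) => h4; lra.
Qed.

Lemma ray_law_unique d' (T' : measurableType d') (P : {measure set T' -> \bar R}) (D : set T')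
  (f : T' -> U) (c : R) : 0 <= c -> measurable D -> measurable_fun setT f -> P D = c%:E ->
  (forall s, P (D `&` f @^-1` ray s) = (c * tail01 s)%:E) ->
  forall A, measurable A -> P (D `&` f @^-1` A) = (c%:E * unif A)%E.
Proof.
move=> c0 mD mf PD Pr A mA.
pose m : {measure set U -> \bar R} := mscale (NngNum c0) unif.
have mE B : m B = (c%:E * unif B)%E by [].
rewrite -mE; apply: (@law_unique _ _ T' U R (range ray)) => //.
- rewrite (_ : range ray = @RGenOInfty.G R) ?RGenOInfty.measurableE//.
  apply/seteqP; split => [_ [s _ <-]|_ [s ->]]; first by exists s; exact: ray_itv.
  by exists s => //; exact: ray_itv.
- move=> _ _ [x _ <-] [y _ <-]; exists (Num.max x y) => //; apply/seteqP; split => z;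
    rewrite /ray/= gt_max; first by move=> /andP[-> ->].
  by move=> [-> ->].
- by rewrite PD ltry.
- by rewrite PD mE probability_setT mule1.
- by move=> _ [s _ <-]; rewrite Pr mE unif_ray EFinM.
Qed.

(** First binary digit; [shift], the doubling map, deletes it. *)
Definition bit (u : R) : bool := 2^-1 <= u.
Definition shift (u : R) : R := 2 * u - (bit u)%:R.

Lemma measurable_bit x : measurable ([set u | bit u = x] : set U).
Proof.
have -> : [set u | bit u = x] = if x then `[2^-1, +oo[%classic else `]-oo, 2^-1[%classic.
  case: x; apply/seteqP; split => u; rewrite /bit/= in_itv/= ?andbT//.
    by move/negbT; rewrite -ltNge.
  by rewrite ltNge => /negbTE.
by case: x; exact: measurable_itv.
Qed.

Lemma measurable_ray_preimage (f : U -> U) :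
  (forall s, measurable (f @^-1` ray s)) -> measurable_fun setT f.
Proof.
move=> H mD; apply: (measurability _ (RGenOInfty.measurableE R)) => //.
by move=> _ [_ [s ->] <-]; rewrite setTI -ray_itv; exact: H.
Qed.

Lemma measurable_shift : measurable_fun setT (shift : U -> U).
Proof.
apply: measurable_ray_preimage => s.
have -> : shift @^-1` ray s = ([set u | bit u = true] `&` ray ((s + 1) / 2)) `|`
    ([set u | bit u = false] `&` ray (s / 2)).
  apply/seteqP; split => u; rewrite /shift /ray /=.
    by case: (bit u) => /= H; [left|right]; split => //; rewrite ltr_pdivrMr//; lra.
  by case=> -[-> /=]; rewrite ltr_pdivrMr// => H; lra.
by apply: measurableU; apply: measurableI; try exact: measurable_bit; exact: measurable_ray.
Qed.

Lemma shift_ray x s : [set u | bit u = x] `&` shift @^-1` ray s `&` `[0, 1[ =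
  ray ((s + x%:R) / 2) `&` `[x%:R / 2, (x%:R + 1) / 2[.
Proof.
apply/seteqP; split => u; rewrite /shift /bit /ray /= !in_itv/=.
  move=> [[bu]]; rewrite bu => H /andP[u0 u1]; split; first by rewrite ltr_pdivrMr//; lra.
  move: bu; case: x H => /= H; first by move=> u2; apply/andP; split; lra.
  by move/negbT; rewrite -ltNge => u2; apply/andP; split; lra.
move=> [+ /andP[]]; rewrite ltr_pdivrMr// => H h1 h2.
have bu : (2^-1 <= u) = x.
  case: x H h1 h2 => /= H h1 h2; first by apply/idP; lra.
  by apply/negbTE; rewrite -ltNge; lra.
split; first by split => //; rewrite bu; lra.
by case: x H h1 h2 bu => /= H h1 h2 bu; apply/andP; split; lra.
Qed.

Lemma bit_law x : unif [set u | bit u = x] = (2^-1)%:E.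
Proof.
rewrite /unif /mrestr (_ : _ `&` _ = `[x%:R / 2 : R, (x%:R + 1) / 2[%classic).
  rewrite lebesgue_measure_itv/= lte_fin ltr_pM2r ?invr_gt0// ltrDl ltr01 -EFinB.
  by congr EFin; rewrite -mulrBl addrC addKr mul1r.
apply/seteqP; split => u; rewrite /bit /= !in_itv/=.
  move=> [bu /andP[u0 u1]]; move: bu; case: x => /=.
    by move=> h; apply/andP; split; lra.
  by move/negbT; rewrite -ltNge => h; apply/andP; split; lra.
case: x => /= /andP[h1 h2]; split; try by apply/andP; split; lra.
  by lra.
by apply/negbTE; rewrite -ltNge; lra.
Qed.

(** Doubling maps each half of the unit interval affinely onto the whole, so the first digit is
    independent of the others. *)
Lemma shift_law x (A : set U) : measurable A ->
  unif ([set u | bit u = x] `&` shift @^-1` A) = ((2^-1)%:E * unif A)%E.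
Proof.
apply: ray_law_unique; [by rewrite invr_ge0|exact: measurable_bit|exact: measurable_shift| |].
  exact: bit_law.
move=> s; rewrite -[LHS]/(lam ([set u | bit u = x] `&` shift @^-1` ray s `&` `[0, 1[)).
rewrite shift_ray lebesgue_ray; last by rewrite ler_pM2r ?invr_gt0// lerDl.
by rewrite tail01_max.
Qed.

(* The binary digits of even rank of a uniform variable, and those of odd rank, give two independent
   uniform variables: hence a sequence of them, the [seed]s, on a single probability space. *)
Fixpoint trunc_even (m : nat) (u : R) : R :=
  if m is m'.+1 then ((bit u)%:R + trunc_even m' (shift (shift u))) / 2 else 0.

Lemma trunc_even01 m u : 0 <= trunc_even m u <= 1.
Proof.
elim: m u => [|m IH] u /=; first by rewrite lexx ler01.
by have /andP[] := IH (shift (shift u)); case: (bit u) => /= h1 h2; apply/andP; split; lra.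
Qed.

Lemma trunc_even_nondecreasing m u : trunc_even m u <= trunc_even m.+1 u.
Proof.
elim: m u => [|m IH] u; first by have /andP[] := trunc_even01 1 u.
by rewrite [leLHS]/= [leRHS]/= ler_pM2r ?invr_gt0// lerD2l; exact: IH.
Qed.

Lemma measurable_trunc_even m : measurable_fun setT (trunc_even m : U -> U).
Proof.
elim: m => [|m IH]; first exact: measurable_cst.
have mss : measurable_fun setT (trunc_even m \o (shift \o shift) : U -> U).
  by apply: measurableT_comp => //; apply: measurableT_comp; exact: measurable_shift.
apply: measurable_ray_preimage => s.
have -> : trunc_even m.+1 @^-1` ray s =
   ([set u | bit u = true] `&` (trunc_even m \o (shift \o shift)) @^-1` ray (2 * s - 1)) `|`
   ([set u | bit u = false] `&` (trunc_even m \o (shift \o shift)) @^-1` ray (2 * s)).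
  apply/seteqP; split => u; rewrite /ray /=.
    by case: (bit u) => /= H; [left|right]; split => //; lra.
  by case=> -[-> /= H]; lra.
apply: measurableU; apply: measurableI; try exact: measurable_bit;
  by rewrite -[X in measurable X]setTI; apply: mss => //; exact: measurable_ray.
Qed.

(** The mass of [s < trunc_even m u], computed from the first digit. *)
Fixpoint trunc_tail (m : nat) (s : R) : R :=
  if m is m'.+1 then (trunc_tail m' (2 * s - 1) + trunc_tail m' (2 * s)) / 2
  else (s < 0)%R%:R.

Lemma bit_shift_law (x y : bool) (A : set U) : measurable A ->
  unif ([set u | bit u = x /\ bit (shift u) = y] `&` (shift \o shift) @^-1` A) =
  ((4^-1)%:E * unif A)%E.
Proof.
move=> mA.
have -> : [set u | bit u = x /\ bit (shift u) = y] `&` (shift \o shift) @^-1` A =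
  [set u | bit u = x] `&` shift @^-1` ([set u | bit u = y] `&` shift @^-1` A).
  by apply/seteqP; split => u /=; tauto.
have msA : measurable (shift @^-1` A : set U).
  by rewrite -[X in measurable X]setTI; exact: measurable_shift.
rewrite shift_law; last by apply: measurableI => //; exact: measurable_bit.
rewrite shift_law// muleA -EFinM; by congr (_%:E * _)%E; field.
Qed.

Definition trunc_event m s t : set U :=
  [set u | s < trunc_even m u /\ t < trunc_even m (shift u)].

Lemma measurable_trunc_event m s t : measurable (trunc_event m s t).
Proof.
have -> : trunc_event m s t = trunc_even m @^-1` ray s `&` (trunc_even m \o shift) @^-1` ray t by [].
have mc : measurable_fun setT (trunc_even m \o shift : U -> U).
  by apply: measurableT_comp; [exact: measurable_trunc_even|exact: measurable_shift].
apply: measurableI; rewrite -[X in measurable X]setTI.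
  by apply: measurable_trunc_even => //; exact: measurable_ray.
by apply: mc => //; exact: measurable_ray.
Qed.

(** On each of the four events fixing the first two digits, both truncations restart from the point
    shifted twice, with rescaled thresholds. *)
Lemma trunc_law m s t : unif (trunc_event m s t) = (trunc_tail m s * trunc_tail m t)%:E.
Proof.
elim: m s t => [|m IH] s t.
  rewrite /trunc_event /=; case: (ltP s 0) => s0; case: (ltP t 0) => t0; rewrite /= ?mul0r ?mulr0 ?mulr1.
  - rewrite (_ : [set _ | _] = setT) ?probability_setT//.
    by apply/seteqP; split => u //=.
  - by rewrite (_ : [set _ | _] = set0) ?measure0//; apply/seteqP; split => u //= -[].
  - by rewrite (_ : [set _ | _] = set0) ?measure0//; apply/seteqP; split => u //= -[].
  - by rewrite (_ : [set _ | _] = set0) ?measure0//; apply/seteqP; split => u //= -[].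
pose D (x y : bool) := [set u | bit u = x /\ bit (shift u) = y] `&`
  (shift \o shift) @^-1` trunc_event m (2 * s - x%:R) (2 * t - y%:R).
have mD x y : measurable (D x y).
  apply: measurableI.
    have -> : [set u | bit u = x /\ bit (shift u) = y] =
      [set u | bit u = x] `&` shift @^-1` [set u | bit u = y] by [].
    apply: measurableI; first exact: measurable_bit.
    by rewrite -[X in measurable X]setTI; apply: measurable_shift => //; exact: measurable_bit.
  rewrite -[X in measurable X]setTI.
  by apply: (measurableT_comp measurable_shift measurable_shift) => //; exact: measurable_trunc_event.
have -> : trunc_event m.+1 s t = (D true true `|` D true false) `|` (D false true `|` D false false).
  apply/seteqP; split => u; rewrite /trunc_event /D /=.
    move=> [h1 h2]; move: h1 h2.
    by case: (bit u) => /= h1; case: (bit (shift u)) => /= h2;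
      [left; left|left; right|right; left|right; right]; split => //; split; lra.
  by move=> [|] [|] [[-> ->] [h1 h2]]; move: h1 h2 => /= h1 h2; split; lra.
have dis x y x' y' : (x, y) != (x', y') -> D x y `&` D x' y' = set0.
  move=> /eqP n; apply/seteqP; split => // u [[[e1 e2] _] [[e3 e4] _]].
  by apply: n; rewrite -e1 -e2 e3 e4.
have mU x : measurable (D x true `|` D x false) by apply: measurableU.
have dU : (D true true `|` D true false) `&` (D false true `|` D false false) = set0.
  by rewrite setIUl !setIUr !dis// !setU0.
have E2 x : unif (D x true `|` D x false) = (unif (D x true) + unif (D x false))%E.
  by apply: measureU; [exact: mD|exact: mD|by apply: dis; rewrite xpair_eqE andbF].
transitivity (unif (D true true `|` D true false) + unif (D false true `|` D false false))%E.
  by apply: measureU; [exact: mU|exact: mU|exact: dU].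
rewrite !E2.
rewrite /D !bit_shift_law; try exact: measurable_trunc_event.
by rewrite !IH -!EFinM -!EFinD; congr EFin => /=; rewrite !subr0; field.
Qed.

Lemma tail01_le0 s : s <= 0 -> tail01 s = 1.
Proof. by rewrite /tail01 => ->. Qed.

Lemma tail01_ge1 s : 1 <= s -> tail01 s = 0.
Proof. by rewrite /tail01 => s1; case: (leP s 0) => h1; [lra|case: (leP s 1) => h2; lra]. Qed.

Lemma tail01_mid s : 0 <= s <= 1 -> tail01 s = 1 - s.
Proof. by rewrite /tail01 => /andP[s0 ->]; case: (leP s 0) => h1 //; lra. Qed.

Lemma trunc_tail_lt0 m s : s < 0 -> trunc_tail m s = 1.
Proof.
elim: m s => [|m IH] s s0 /=; first by rewrite s0.
by rewrite !IH; lra.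
Qed.

Lemma trunc_tail_ge1 m s : 1 <= s -> trunc_tail m s = 0.
Proof.
elim: m s => [|m IH] s s1 /=; first by rewrite ltNge (le_trans ler01 s1).
by rewrite !IH; lra.
Qed.

Lemma half_close_l (q a c : R) : `|a - c| <= q -> `|(a + 0) / 2 - c / 2| <= 2^-1 * q.
Proof. by rewrite addr0 -mulrBl normrM mulrC (gtr0_norm (_ : 0 < 2^-1))// ler_pM2l. Qed.

Lemma half_close_r (q b c : R) : `|b - c| <= q -> `|(1 + b) / 2 - (1 + c) / 2| <= 2^-1 * q.
Proof.
by rewrite -mulrBl opprD addrACA subrr add0r normrM mulrC (gtr0_norm (_ : 0 < 2^-1))// ler_pM2l.
Qed.

(* Of the two arguments [2s - 1] and [2s] at most one lies in [0, 1[, and outside it the truncated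
   tail is exact, so averaging halves the error. *)
Lemma trunc_tail_close m s : 0 <= s < 1 -> `|trunc_tail m s - tail01 s| <= 2^-1 ^+ m.
Proof.
elim: m s => [|m IH] s /andP[s0 s1].
  have -> : trunc_tail 0 s = 0 by rewrite /= ltNge s0.
  by rewrite expr0 tail01_mid ?s0 ?(ltW s1)// sub0r normrN ger0_norm; lra.
rewrite [trunc_tail m.+1 s]/= exprS (tail01_mid (_ : 0 <= s <= 1)) ?s0 ?(ltW s1)//.
have [h|h] := ltP (2 * s) 1.
  rewrite trunc_tail_lt0; last lra.
  have -> : 1 - s = (1 + tail01 (2 * s)) / 2 by rewrite tail01_mid; [lra|apply/andP; split; lra].
  by apply/half_close_r/IH; apply/andP; split; lra.
rewrite (trunc_tail_ge1 m h).
have -> : 1 - s = tail01 (2 * s - 1) / 2 by rewrite tail01_mid; [lra|apply/andP; split; lra].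
by apply/half_close_l/IH; apply/andP; split; lra.
Qed.

Lemma trunc_tail_cvg s : trunc_tail m s @[m --> \oo] --> tail01 s.
Proof.
apply/cvgrPdist_le => e e0.
have [N _ HN] : \forall m \near \oo, `|(2^-1 : R) ^+ m| <= e.
  have : (2^-1 : R) ^+ m @[m --> \oo] --> (0 : R).
    by apply: cvg_expr; rewrite gtr0_norm ?invr_gt0// invf_lt1// ltr1n.
  by move/cvgrPdist_le => /(_ e e0); apply: filterS => m; rewrite sub0r normrN.
exists N => // m Nm; rewrite distrC.
have [s0|s0] := ltP s 0; first by rewrite trunc_tail_lt0// (tail01_le0 (ltW s0)) subrr normr0 (ltW e0).
have [s1|s1] := ltP s 1; last by rewrite trunc_tail_ge1// tail01_ge1// subrr normr0 (ltW e0).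
apply: le_trans (trunc_tail_close m _) _; first by rewrite s0.
by apply: le_trans (ler_norm _) (HN m Nm).
Qed.

(** As a supremum of nondecreasing truncations it exceeds [s] exactly when one of them does, which
    gives measurability and the law by increasing limits. *)
Definition even_part (u : R) : R := sup (range (trunc_even ^~ u)).
Definition odd_part (u : R) : R := even_part (shift u).

Lemma lt_even_part s u : s < even_part u <-> exists m, s < trunc_even m u.
Proof.
split => [/sup_gt[|_ [m _ <-] H]|[m H]]; [by exists (trunc_even 0 u), 0%N|by exists m|].
apply: lt_le_trans H _; apply: ub_le_sup; last by exists m.
by exists 1 => _ [n _ <-]; have /andP[] := trunc_even01 n u.
Qed.

Lemma measurable_even_part : measurable_fun setT (even_part : U -> U).
Proof.
apply: measurable_ray_preimage => s.
have -> : even_part @^-1` ray s = \bigcup_m (trunc_even m @^-1` ray s).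
  by apply/seteqP; split => u /=; [move=> /lt_even_part[m H]; exists m|
    move=> [m _ H]; apply/lt_even_part; exists m].
apply: bigcupT_measurable => m; rewrite -[X in measurable X]setTI.
by apply: measurable_trunc_even => //; exact: measurable_ray.
Qed.

Lemma measurable_odd_part : measurable_fun setT (odd_part : U -> U).
Proof. by apply: measurableT_comp; [exact: measurable_even_part|exact: measurable_shift]. Qed.

Lemma split_ray s t : unif (even_part @^-1` ray s `&` odd_part @^-1` ray t) =
  (tail01 s * tail01 t)%:E.
Proof.
have nd m n u : (m <= n)%N -> trunc_even m u <= trunc_even n u.
  move=> /subnK <-; elim: (n - m)%N => [//|k IH]; rewrite addSn.
  exact: le_trans IH (trunc_even_nondecreasing _ _).
have -> : even_part @^-1` ray s `&` odd_part @^-1` ray t = \bigcup_m trunc_event m s t.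
  apply/seteqP; split => u /=.
    move=> [/lt_even_part[m H] /lt_even_part[n H']]; exists (maxn m n) => //; split.
      by apply: lt_le_trans H (nd _ _ _ _); rewrite leq_maxl.
    by apply: lt_le_trans H' (nd _ _ _ _); rewrite leq_maxr.
  by move=> [m _ [H H']]; split; apply/lt_even_part; exists m.
have mT m := measurable_trunc_event m s t.
have c := @nondecreasing_cvg_mu _ U R unif (fun m => trunc_event m s t) mT (bigcupT_measurable _ mT).
have {}c := c ltac:(by move=> m n mn; rewrite subsetEset => u [h1 h2]; split;
  [apply: lt_le_trans h1 (nd _ _ _ mn)|apply: lt_le_trans h2 (nd _ _ _ mn)]).
apply: (cvg_unique _ c); first exact: ereal_hausdorff.
have -> : unif \o (fun m => trunc_event m s t) = EFin \o (fun m => trunc_tail m s * trunc_tail m t).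
  by apply: funext => m; rewrite /comp trunc_law.
by apply: cvg_EFin; [exact: nearW|apply: cvgM; exact: trunc_tail_cvg].
Qed.

(** The product formula on pairs of rays is extended to Borel sets in the even variable first, then
    in the odd one. *)
Lemma split_law (A C : set U) : measurable A -> measurable C ->
  unif (even_part @^-1` A `&` odd_part @^-1` C) = (unif A * unif C)%E.
Proof.
move=> mA mC.
have mo B : measurable B -> measurable (odd_part @^-1` B : set U).
  by move=> mB; rewrite -[X in measurable X]setTI; exact: measurable_odd_part.
have me B : measurable B -> measurable (even_part @^-1` B : set U).
  by move=> mB; rewrite -[X in measurable X]setTI; exact: measurable_even_part.
(* The ray from -1 contains all values, so it gives the marginal laws. *)
have t1 : tail01 (-1) = 1 by rewrite /tail01 lerN10.
have even_law B : measurable B -> unif (even_part @^-1` B) = unif B.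
  move=> mB; have := @ray_law_unique _ U unif setT even_part 1 ler01 measurableT measurable_even_part
    (probability_setT unif) _ B mB; rewrite setTI mul1e; apply.
  move=> s; rewrite setTI mul1r; have := split_ray s (-1); rewrite t1 mulr1 => <-.
  congr (unif _); apply/seteqP; split => [u|u []//] H; split => //.
  by apply/lt_even_part; exists 0%N; rewrite /= ltrN10.
have odd_ray t B : measurable B -> unif (odd_part @^-1` ray t `&` even_part @^-1` B) =
    ((tail01 t)%:E * unif B)%E.
  move=> mB; apply: ray_law_unique => //.
  - exact: tail01_ge0.
  - by apply: mo; exact: measurable_ray.
  - exact: measurable_even_part.
  - have := split_ray (-1) t; rewrite t1 mul1r => <-.
    congr (unif _); apply/seteqP; split => [u|u []//] H; split => //.
    by apply/lt_even_part; exists 0%N; rewrite /= ltrN10.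
  - move=> s; rewrite setIC -[LHS]/(unif (even_part @^-1` ray s `&` odd_part @^-1` ray t)).
    by rewrite split_ray mulrC.
have := @ray_law_unique _ U unif (even_part @^-1` A) odd_part (fine (unif A)).
have fA : (fine (unif A))%:E = unif A by rewrite fineK ?fin_num_measure.
rewrite fA; apply => //.
- by rewrite fine_ge0.
- exact: me.
- exact: measurable_odd_part.
- exact: even_law.
- move=> t; rewrite setIC -[LHS]/(unif (odd_part @^-1` ray t `&` even_part @^-1` A)).
  by rewrite odd_ray// EFinM fA muleC.
Qed.

End Uniform.

Section Seeds.
Variable R : realType.
Local Notation U := (measurableTypeR R).
Local Notation P := (@unif R).

Definition seed (k : nat) (u : R) : R := even_part (iter k (@odd_part R) u).

Lemma seedS k u : seed k.+1 u = seed k (odd_part u).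
Proof. by rewrite /seed iterSr. Qed.

Lemma measurable_seed k : measurable_fun setT (seed k : U -> U).
Proof.
elim: k => [|k IH]; first exact: measurable_even_part.
have -> : seed k.+1 = seed k \o (@odd_part R) by apply: funext => u; rewrite /= seedS.
by apply: measurableT_comp => //; exact: measurable_odd_part.
Qed.

Lemma seed_indep n (A : nat -> set U) : (forall k, measurable (A k)) ->
  P [set u | forall k, (k < n)%N -> A k (seed k u)] = (\prod_(k < n) P (A k))%E.
Proof.
elim: n A => [|n IH] A mA.
  rewrite big_ord0 (_ : [set _ | _] = setT) ?probability_setT//.
  by apply/seteqP; split.
have -> : [set u | forall k, (k < n.+1)%N -> A k (seed k u)] =
  (@even_part R) @^-1` A 0%N `&` (@odd_part R) @^-1` [set u | forall k, (k < n)%N -> A k.+1 (seed k u)].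
  apply/seteqP; split => u /=.
    by move=> H; split; [exact: (H 0%N)|move=> k kn; rewrite -seedS; exact: H].
  by move=> [H0 H] [|k] kn //; rewrite seedS; exact: H.
have mI m (B : nat -> set U) : (forall k, measurable (B k)) ->
    measurable ([set u | forall k, (k < m)%N -> B k (seed k u)] : set U).
  move=> mB; have -> : [set u | forall k, (k < m)%N -> B k (seed k u)] =
      \bigcap_(k in `I_m) (seed k @^-1` B k) by [].
  apply: bigcap_measurableType => k _.
  by have := @measurable_seed k measurableT (B k) (mB k); rewrite setTI.
rewrite split_law//; last by apply: (mI n (fun k => A k.+1)) => k; exact: mA.
by rewrite big_ord_recl; congr (_ * _)%E; apply: (IH (fun k => A k.+1)) => k; exact: mA.
Qed.

Lemma seed_law k (A : set U) : measurable A -> P (seed k @^-1` A) = P A.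
Proof.
move=> mA; pose B i := if i == k then A else setT.
have mB i : measurable (B i) by rewrite /B; case: ifP.
have := @seed_indep k.+1 B mB.
rewrite (bigD1 ord_max)//= big1 ?mule1 => [|i ik]; last first.
  by rewrite /B ifF ?probability_setT//; apply: contraNF ik => /eqP ik; apply/eqP/val_inj.
rewrite {2}/B eqxx => <-; congr (P _); apply/seteqP; split => u /=.
  by move=> H i ik; rewrite /B; case: eqP => [->|].
by move=> /(_ k (ltnSn k)); rewrite /B eqxx.
Qed.

Lemma interval_law (a b : R) : a <= b ->
  P [set u | a <= u < b] = (Num.max 0 (Num.min b 1 - Num.max a 0))%:E.
Proof.
move=> ab.
rewrite -[LHS]/(@lebesgue_measure R ([set u | a <= u < b] `&` `[0, 1[)).
have -> : [set u | a <= u < b] `&` `[0, 1[ = `[Num.max a 0, Num.min b 1[%classic.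
  apply/seteqP; split => u; rewrite /= !in_itv/= ge_max lt_min.
    by move=> [/andP[-> ->] /andP[-> ->]].
  by move=> /andP[/andP[-> ->] /andP[-> ->]].
rewrite lebesgue_measure_itv/= lte_fin; case: ltP => h.
  by rewrite -EFinB; congr EFin; apply/esym/max_idPr; rewrite subr_ge0 ltW.
by congr EFin; apply/esym/max_idPl; rewrite subr_le0.
Qed.

End Seeds.

(** * Poisson variables by inversion of the distribution function *)

Section Poisson.
Variable R : realType.
Local Notation U := (measurableTypeR R).
Local Notation P := (@unif R).

Definition pois (m : R) (k : nat) : R := expR (- m) * m ^+ k / k`!%:R.
Definition pois_cdf (m : R) (k : nat) : R := \sum_(i < k) pois m i.

Lemma pois_ge0 m k : 0 <= m -> 0 <= pois m k.
Proof. by move=> m0; rewrite /pois divr_ge0// mulr_ge0 ?expR_ge0 ?exprn_ge0. Qed.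

Lemma pois_series m : pois_cdf m k @[k --> \oo] --> (1 : R).
Proof.
have -> : (1 : R) = expR (- m) * expR m by rewrite expRN mulVf// gt_eqF// expR_gt0.
have -> : pois_cdf m = (fun k => expR (- m) * series (exp_coeff m) k).
  apply: funext => k; rewrite /pois_cdf /series/= big_mkord mulr_sumr; apply: eq_bigr => i _.
  by rewrite /pois /exp_coeff/= mulrA.
by apply: cvgMr; exact: (@is_cvg_series_exp_coeff R m).
Qed.

Lemma pois_cdf_nondecreasing m k l : 0 <= m -> (k <= l)%N -> pois_cdf m k <= pois_cdf m l.
Proof.
move=> m0 kl; rewrite /pois_cdf -(subnKC kl) big_split_ord/= lerDl.
by apply: sumr_ge0 => i _; exact: pois_ge0.
Qed.

Lemma pois_cdf_le1 m k : 0 <= m -> pois_cdf m k <= 1.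
Proof.
move=> m0; have c := @pois_series m; rewrite -(cvg_lim _ c)//.
apply: nondecreasing_cvgn_le; last by apply/cvg_ex; exists 1.
by move=> i j; exact: pois_cdf_nondecreasing.
Qed.

Definition pois_cell m k : set U := [set u | pois_cdf m k <= u < pois_cdf m k.+1].

Lemma measurable_pois_cell m k : measurable (pois_cell m k).
Proof.
have -> : pois_cell m k = `[pois_cdf m k, pois_cdf m k.+1[%classic.
  by apply/seteqP; split => u; rewrite /pois_cell /= in_itv.
exact: measurable_itv.
Qed.

Lemma pois_cell_law m k : 0 <= m -> P (pois_cell m k) = (pois m k)%:E.
Proof.
move=> m0; rewrite interval_law ?pois_cdf_nondecreasing//.
have -> : Num.min (pois_cdf m k.+1) 1 = pois_cdf m k.+1 by apply/min_idPl/pois_cdf_le1.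
have -> : Num.max (pois_cdf m k) 0 = pois_cdf m k.
  by apply/max_idPl; apply: sumr_ge0 => i _; exact: pois_ge0.
rewrite {1}/pois_cdf big_ord_recr/= addrC -/(pois_cdf m k) addrK.
by congr EFin; apply/max_idPr/pois_ge0.
Qed.

Lemma pois_cell_disj m k l (u : R) : 0 <= m -> pois_cell m k u -> pois_cell m l u -> k = l.
Proof.
move=> m0 H1 H2.
have h (i j : nat) : pois_cell m i u -> pois_cell m j u -> (i <= j)%N.
  move=> Hi Hj; rewrite leqNgt; apply/negP => ji.
  have a : u < pois_cdf m j.+1 by have /andP[] : pois_cdf m j <= u < pois_cdf m j.+1 := Hj.
  have b : pois_cdf m i <= u by have /andP[] : pois_cdf m i <= u < pois_cdf m i.+1 := Hi.
  by have := lt_le_trans a (le_trans (pois_cdf_nondecreasing m0 ji) b); rewrite ltxx.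
by apply/eqP; rewrite eqn_leq !h.
Qed.

(** Outside all the cells, a null event when [m >= 0], the value is 0 by default. *)
Definition pois_num (m : R) (u : R) : nat := xget 0%N [set k | pois_cell m k u].

Lemma pois_numP m k u : 0 <= m -> pois_cell m k u -> pois_num m u = k.
Proof.
move=> m0 H; rewrite /pois_num; case: xgetP => [l _ /= Hl|/(_ k)//].
exact: pois_cell_disj Hl H.
Qed.

Definition num_event (m : R) (k : nat) : set U := [set u | pois_num m u = k].

Lemma num_eventE m k : 0 <= m -> num_event m k =
  pois_cell m k `|` (if k == 0%N then ~` \bigcup_l pois_cell m l else set0).
Proof.
move=> m0; apply/seteqP; split => u /=.
  rewrite /num_event /= => nk; have [[l Hl]|nl] := pselect (exists l, pois_cell m l u).
    by left; rewrite -nk (pois_numP m0 Hl).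
  right; have k0 : k = 0%N.
    by rewrite -nk /pois_num; case: xgetP => // l _ Hl; case: nl; exists l.
  by rewrite k0 eqxx => -[l _ Hl]; apply: nl; exists l.
case=> [/(pois_numP m0)//|]; case: eqP => [-> nl|//].
by rewrite /num_event /= /pois_num; case: xgetP => // l _ Hl; case: nl; exists l.
Qed.

Lemma measurable_num_event m k : 0 <= m -> measurable (num_event m k).
Proof.
move=> m0; rewrite num_eventE//; apply: measurableU; first exact: measurable_pois_cell.
case: ifP => // _; apply: measurableC; apply: bigcupT_measurable => l; exact: measurable_pois_cell.
Qed.

Lemma num_event_law m k : 0 <= m -> P (num_event m k) = (pois m k)%:E.
Proof.
move=> m0.
have full : P (\bigcup_l pois_cell m l) = 1%E.
  have -> : \bigcup_l pois_cell m l = \bigcup_n [set u | 0 <= u < pois_cdf m n].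
    apply/seteqP; split => u [n _ /= /andP[h1 h2]].
      exists n.+1 => //=; rewrite h2 (le_trans _ h1)//.
      by apply: sumr_ge0 => i _; exact: pois_ge0.
    elim: n h2 => [|n IH] h2; first by move: h2; rewrite /pois_cdf big_ord0 ltNge h1.
    by have [h|h] := ltP u (pois_cdf m n); [exact: IH|exists n => //=; apply/andP].
  have mE n : measurable ([set u | 0 <= u < pois_cdf m n] : set U).
    have -> : [set u | 0 <= u < pois_cdf m n] = `[0, pois_cdf m n[%classic.
      by apply/seteqP; split => u; rewrite /= in_itv.
    exact: measurable_itv.
  have c := @nondecreasing_cvg_mu _ U R P (fun n => [set u | 0 <= u < pois_cdf m n]) mE
    (bigcupT_measurable _ mE).
  have {}c := c ltac:(by move=> i j ij; rewrite subsetEset => u /= /andP[-> h] /=;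
    apply: lt_le_trans h (pois_cdf_nondecreasing m0 ij)).
  apply: (cvg_unique _ c); first exact: ereal_hausdorff.
  have -> : P \o (fun n => [set u | 0 <= u < pois_cdf m n]) = EFin \o (pois_cdf m).
    apply: funext => n; have p0 : 0 <= pois_cdf m n by apply: sumr_ge0 => i _; exact: pois_ge0.
    rewrite /= -[LHS]/(P [set u | 0 <= u < pois_cdf m n]) interval_law//.
    have -> : Num.min (pois_cdf m n) 1 = pois_cdf m n by apply/min_idPl/pois_cdf_le1.
    by rewrite maxxx subr0; congr EFin; apply/max_idPr.
  by apply: cvg_EFin; [exact: nearW|exact: pois_series].
have mb : measurable (\bigcup_l pois_cell m l).
  by apply: bigcupT_measurable => l; exact: measurable_pois_cell.
rewrite num_eventE//; case: (k == 0%N); last by rewrite setU0 pois_cell_law.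
transitivity (P (pois_cell m k) + P (~` \bigcup_l pois_cell m l))%E.
  apply: measureU; [exact: measurable_pois_cell|exact: measurableC|].
  by apply/seteqP; split => // u [H]; case; exists k.
have -> : P (~` \bigcup_l pois_cell m l) = 0%E.
  transitivity (1 - P (\bigcup_l pois_cell m l))%E; first exact: probability_setC.
  by rewrite full subee.
by rewrite adde0 pois_cell_law.
Qed.

End Poisson.

(** * Joint law of the counts in disjoint sets *)

Section Counts.
Variable R : realType.
Local Notation U := (measurableTypeR R).
Local Notation P := (@unif R).

Lemma measurable_exists_in (I : finType) (F : I -> set U) (s : seq I) :
  (forall i, measurable (F i)) -> measurable ([set u | exists2 i, i \in s & F i u] : set U).
Proof.
move=> mF; elim: s => [|i s IH].
  by rewrite (_ : [set _ | _] = set0) //; apply/seteqP; split => u // -[].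
have -> : [set u | exists2 j, j \in i :: s & F j u] = F i `|` [set u | exists2 j, j \in s & F j u].
  apply/seteqP; split => u /=.
    by move=> [j]; rewrite in_cons => /orP[/eqP->|js] H; [left|right; exists j].
  by move=> [H|[j js H]]; [exists i; rewrite ?mem_head|exists j; rewrite ?in_cons ?js ?orbT].
exact: measurableU.
Qed.

Lemma measure_disjoint_fin (I : finType) (F : I -> set U) :
  (forall i, measurable (F i)) -> (forall i j u, F i u -> F j u -> i = j) ->
  P [set u | exists i, F i u] = (\sum_i P (F i))%E.
Proof.
move=> mF dF.
have H (s : seq I) : uniq s -> P [set u | exists2 i, i \in s & F i u] = (\sum_(i <- s) P (F i))%E.
  elim: s => [_|i s IH /= /andP[nis us]].
    by rewrite big_nil (_ : [set _ | _] = set0) ?measure0//; apply/seteqP; split => u // -[].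
  rewrite big_cons -IH//.
  have -> : [set u | exists2 j, j \in i :: s & F j u] = F i `|` [set u | exists2 j, j \in s & F j u].
    apply/seteqP; split => u /=.
      by move=> [j]; rewrite in_cons => /orP[/eqP->|js] H; [left|right; exists j].
    by move=> [H|[j js H]]; [exists i; rewrite ?mem_head|exists j; rewrite ?in_cons ?js ?orbT].
  apply: measureU; [exact: mF|exact: measurable_exists_in|].
  apply/seteqP; split => // u [Fi [j js Fj]]; move: nis; rewrite (dF _ _ _ Fi Fj) js //.
rewrite -H ?index_enum_uniq//; congr (P _); apply/seteqP; split => u /=.
  by move=> [i Fi]; exists i => //; exact: mem_index_enum.
by move=> [i _ Fi]; exists i.
Qed.

Definition mnat (h : U -> nat) := forall k, measurable [set u | h u = k].

Lemma mnat_comp h (f : U -> U) : measurable_fun setT f -> mnat h -> mnat (h \o f).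
Proof.
move=> mf mh k; rewrite -[X in measurable X]setTI.
by apply: (mf measurableT [set u | h u = k]); exact: mh.
Qed.

Lemma mnatD h g : mnat h -> mnat g -> mnat (fun u => h u + g u)%N.
Proof.
move=> mh mg k.
have -> : [set u | (h u + g u)%N = k] =
    \bigcup_i ([set u | h u = i] `&` (if (i <= k)%N then [set u | g u = (k - i)%N] else set0)).
  apply/seteqP; split => u /=.
    by move=> e; exists (h u) => //; split => //; rewrite -e leq_addr /= addKn.
  by move=> [i _ [/= <-]]; case: ifP => // ik /= ->; rewrite subnKC.
apply: bigcupT_measurable => i; apply: measurableI => //.
by case: ifP.
Qed.

Lemma mnat_sum n (h : nat -> U -> nat) : (forall i, mnat (h i)) ->
  mnat (fun u => \sum_(i < n) h i u)%N.
Proof.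
move=> mh; elim: n => [|n IH].
  move=> k; rewrite (_ : [set _ | _] = if k == 0%N then setT else set0); first by case: ifP.
  by apply/seteqP; split => u; rewrite /= big_ord0; case: k.
have -> : (fun u => \sum_(i < n.+1) h i u)%N = (fun u => \sum_(i < n) h i u + h n u)%N.
  by apply: funext => u; rewrite big_ord_recr.
exact: mnatD.
Qed.

Lemma mnat_in (A : set U) : measurable A -> mnat (fun u => (u \in A) : nat).
Proof.
move=> mA k.
have -> : [set u | (u \in A) = k :> nat] =
    if k == 0%N then ~` A else if k == 1%N then A else set0.
  apply/seteqP; split => u /=.
    case: (boolP (u \in A)) => uA <- /=; first exact: set_mem.
    by move=> Au; move: uA; rewrite mem_set.
  case: eqP => [-> nA|_]; first by rewrite memNset.
  by case: eqP => // -> Au; rewrite mem_set.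
by case: ifP => // _; [exact: measurableC|case: ifP].
Qed.

Lemma measurable_mnat_all (I : finType) (h : I -> U -> nat) (k : I -> nat) :
  (forall i, mnat (h i)) -> measurable ([set u | forall i, h i u = k i] : set U).
Proof.
move=> mh; have -> : [set u | forall i, h i u = k i] =
    \bigcap_(i in [set: I]) [set u | h i u = k i].
  by apply/seteqP; split => u /= H i; [move=> _|]; exact: H.
by apply: fin_bigcap_measurable => [|i _]; [exact: finite_finset|exact: mh].
Qed.

Lemma split_event (A C : set U) (x y : R) : measurable A -> measurable C -> P A = x%:E -> P C = y%:E ->
  P [set u | A (even_part u) /\ C (odd_part u)] = (x * y)%:E.
Proof. by move=> mA mC Ax Cy; rewrite EFinM -Ax -Cy -split_law. Qed.

Lemma measurable_split (A C : set U) : measurable A -> measurable C ->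
  measurable ([set u | A (even_part u) /\ C (odd_part u)] : set U).
Proof.
move=> mA mC.
have -> : [set u | A (even_part u) /\ C (odd_part u)] =
  (@even_part R) @^-1` A `&` (@odd_part R) @^-1` C by [].
apply: measurableI; rewrite -[X in measurable X]setTI.
  exact: measurable_even_part.
exact: measurable_odd_part.
Qed.

(* The space is cut into cells. Cell [c] receives a Poisson number of independent uniform points, all
   built from [seed c u]; [tot] counts the points of the first [n] cells. *)
Definition hits (m : nat) (A : set U) (u : R) : nat := (\sum_(j < m) (seed j u \in A))%N.

Lemma hitsS m A u : hits m.+1 A u = ((even_part u \in A) + hits m A (odd_part u))%N.
Proof. by rewrite /hits big_ord_recl /=; congr addn; apply: eq_bigr => i _; rewrite -seedS. Qed.

Lemma mnat_hits m A : measurable A -> mnat (hits m A).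
Proof.
move=> mA; apply: (@mnat_sum m (fun j u => (seed j u \in A) : nat)) => j.
exact: (@mnat_comp (fun u => (u \in A) : nat) (seed j) (@measurable_seed R j) (mnat_in mA)).
Qed.

Section Partition.
Variables (I : finType) (B : I -> set U).
Hypothesis mB : forall i, measurable (B i).
Hypothesis BP : forall u, exists i, forall j, (u \in B j) = (j == i).
Let q i := fine (P (B i)).

Lemma qE i : P (B i) = (q i)%:E.
Proof. by rewrite /q fineK// fin_num_measure. Qed.

Lemma sum_q : \sum_i q i = 1.
Proof.
apply: EFin_inj; rewrite -(sumEFin _ xpredT).
under eq_bigr do rewrite -qE.
rewrite -measure_disjoint_fin => [|//|i j u Bi Bj].
  rewrite (_ : [set _ | _] = setT) ?probability_setT//.
  apply/seteqP; split => // u _; have [i H] := BP u.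
  by exists i; apply: set_mem; rewrite H.
have [k H] := BP u; apply/eqP; have := H i; have := H j; rewrite !mem_set// => /esym/eqP -> /esym/eqP ->.
by rewrite eqxx.
Qed.

Lemma hits_partition m u : (\sum_i hits m (B i) u = m)%N.
Proof.
rewrite /hits exchange_big /= -[RHS]card_ord -sum1_card; apply: eq_bigr => j _.
have [i H] := BP (seed j u).
rewrite (bigD1 i)//= H eqxx big1 ?addn0// => k ki.
by rewrite H (negbTE ki).
Qed.

Lemma multinomial_step (k : I -> nat) (i : I) (m : nat) : (0 < k i)%N ->
  q i * (m`!%:R * \prod_j (q j ^+ (k j - (j == i)) / (k j - (j == i))`!%:R)) =
  (k i)%:R * (m`!%:R * \prod_j (q j ^+ k j / (k j)`!%:R)).
Proof.
move=> k0; rewrite (bigD1 i)//= [in RHS](bigD1 i)//= eqxx.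
have -> : \prod_(j | j != i) (q j ^+ (k j - (j == i)) / (k j - (j == i))`!%:R) =
    \prod_(j | j != i) (q j ^+ k j / (k j)`!%:R).
  by apply: eq_bigr => j /negbTE ->; rewrite subn0.
set X := \prod_(_ | _) _; case: (k i) k0 => // n _; rewrite subSS subn0 factS exprS.
have n0 : n`!%:R != 0 :> R by rewrite pnatr_eq0 -lt0n fact_gt0.
have n1 : n.+1%:R != 0 :> R by rewrite pnatr_eq0.
rewrite natrM; move: (n.+1%:R : R) (n`!%:R : R) n0 n1 => a b a0 b0.
by field; rewrite a0 b0.
Qed.

(** Multinomial law, by the class [i] of the first point: the other points then have the counts [k]
    lowered by one at [i]. *)
Lemma hits_law m (k : I -> nat) : (\sum_i k i = m)%N ->
  P [set u | forall i, hits m (B i) u = k i] = (m`!%:R * \prod_i (q i ^+ k i / (k i)`!%:R))%:E.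
Proof.
elim: m k => [|m IH] k km.
  have k0 i : k i = 0%N by apply/eqP; rewrite -leqn0 -km (bigD1 i)//= leq_addr.
  rewrite (_ : [set _ | _] = setT).
    by rewrite probability_setT big1 ?mulr1// => i _; rewrite k0 expr0 divr1.
  by apply/seteqP; split => // u _ i; rewrite k0 /hits big_ord0.
pose E i := [set u | forall j, hits m (B j) u = (k j - (j == i))%N] : set U.
have mE i : measurable (E i) by apply: measurable_mnat_all => j; exact: mnat_hits.
pose F i : set U := if k i == 0%N then set0 else
  [set u | B i (even_part u) /\ E i (odd_part u)].
have mF i : measurable (F i).
  by rewrite /F; case: ifP => // _; exact: measurable_split.
have FE : [set u | forall i, hits m.+1 (B i) u = k i] = [set u | exists i, F i u].
  apply/seteqP; split => u /=.
    move=> H; have [i Hi] := BP (even_part u); exists i; rewrite /F.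
    have := H i; rewrite hitsS Hi eqxx => ki; rewrite -ki /=; split.
      by apply: set_mem; rewrite Hi.
    by move=> j; rewrite -H hitsS Hi addKn.
  move=> [i]; rewrite /F; case: eqP => // /eqP ki [/mem_set Bi H] j.
  have [i' Hi] := BP (even_part u); move: Bi; rewrite Hi => /eqP ii'.
  rewrite hitsS Hi -ii' H; case: (eqVneq j i) => [->|_] /=; last by rewrite subn0.
  by rewrite subnKC// lt0n.
rewrite FE measure_disjoint_fin//; last first.
  move=> i j u; rewrite /F; case: ifP => // _; case: ifP => // _ [/mem_set Bi _] [/mem_set Bj _].
  have [l Hl] := BP (even_part u); move: Bi Bj; rewrite !Hl => /eqP -> /eqP ->//.
have PF i : P (F i) = ((k i)%:R * (m`!%:R * \prod_j (q j ^+ k j / (k j)`!%:R)))%:E.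
  rewrite /F; case: (eqVneq (k i) 0%N) => [->|ki]; first by rewrite measure0 mul0r.
  rewrite -multinomial_step ?lt0n//; apply: split_event => //; first exact: qE.
  apply: IH; apply: succn_inj; rewrite -km (bigD1 i)//= [in RHS](bigD1 i)//= eqxx subn1 -addSn.
  rewrite prednK ?lt0n//; congr addn; apply: eq_bigr => j /negbTE ->; exact: subn0.
transitivity (\sum_i ((k i)%:R * (m`!%:R * \prod_j (q j ^+ k j / (k j)`!%:R)))%:E)%E.
  by apply: eq_bigr => i _; exact: PF.
by rewrite sumEFin -mulr_suml -natr_sum km mulrA -natrM -factS.
Qed.

Definition cell_hits (mu : R) (A : set U) (u : R) : nat :=
  hits (pois_num mu (even_part u)) A (odd_part u).

(** Thinning: the multinomial law mixed over a Poisson number of points is a product of Poisson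
    laws, the factorials of the total cancelling. *)
Lemma cell_law mu (k : I -> nat) : 0 <= mu ->
  P [set u | forall i, cell_hits mu (B i) u = k i] = (\prod_i pois (mu * q i) (k i))%:E.
Proof.
move=> mu0; pose s := (\sum_i k i)%N.
have -> : [set u | forall i, cell_hits mu (B i) u = k i] =
    [set u | num_event mu s (even_part u) /\ [set u | forall i, hits s (B i) u = k i] (odd_part u)].
  apply/seteqP; split => u /=; rewrite /cell_hits /num_event /=.
    move=> H; have e : pois_num mu (even_part u) = s.
      by rewrite -(hits_partition (pois_num mu (even_part u)) (odd_part u)); apply: eq_bigr => i _.
    by split => // i; rewrite -e.
  by move=> [-> H] i.
have mA := @measurable_num_event R mu s mu0.
have mC : measurable ([set u | forall i, hits s (B i) u = k i] : set U).
  by apply: measurable_mnat_all => i; exact: mnat_hits.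
rewrite (split_event mA mC (num_event_law _ mu0) (hits_law (erefl s))); congr EFin.
have s0 : s`!%:R != 0 :> R by rewrite pnatr_eq0 -lt0n fact_gt0.
rewrite /pois mulrA -(mulrA _ _^-1) mulVf// mulr1.
have -> : expR (- mu) = \prod_i expR (- (mu * q i)).
  by rewrite -expR_sum sumrN -mulr_sumr sum_q mulr1.
rewrite /s -prodrXr -!big_split /=; apply: eq_bigr => i _.
by rewrite (exprMn (k i) mu (q i)) !mulrA.
Qed.

End Partition.

Lemma pois_conv a b k : \sum_(j < k.+1) pois a j * pois b (k - j) = pois (a + b) k :> R.
Proof.
rewrite /pois opprD expRD addrC exprDn.
rewrite mulr_sumr mulr_suml; apply: eq_bigr => -[j /= jk] _.
have f0 n : n`!%:R != 0 :> R by rewrite pnatr_eq0 -lt0n fact_gt0.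
have -> : k`!%:R = 'C(k, j)%:R * (j`!%:R * (k - j)`!%:R) :> R.
  by rewrite -!natrM bin_fact.
have c0 : 'C(k, j)%:R != 0 :> R by rewrite pnatr_eq0 -lt0n bin_gt0.
by rewrite -mulr_natr; field; rewrite !f0 c0.
Qed.

Definition tot (mu : nat -> R) (A : nat -> set U) (n : nat) (u : R) : nat :=
  (\sum_(c < n) cell_hits (mu c) (A c) (seed c u))%N.

Lemma totS mu A n u : tot mu A n.+1 u =
  (cell_hits (mu 0) (A 0) (even_part u) + tot (mu \o S) (A \o S) n (odd_part u))%N.
Proof. by rewrite /tot big_ord_recl /=; congr addn; apply: eq_bigr => i _; rewrite -seedS. Qed.

Lemma mnat_cell_hits mu A : 0 <= mu -> measurable A -> mnat (cell_hits mu A).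
Proof.
move=> mu0 mA k.
have -> : [set u | cell_hits mu A u = k] =
    \bigcup_m [set u | num_event mu m (even_part u) /\ [set u | hits m A u = k] (odd_part u)].
  apply/seteqP; split => u /=; first by move=> H; exists (pois_num mu (even_part u)).
  by move=> [m _ [/= <-]].
apply: bigcupT_measurable => m; apply: measurable_split; first exact: measurable_num_event.
exact: mnat_hits.
Qed.

Lemma mnat_tot mu A n : (forall c, 0 <= mu c) -> (forall c, measurable (A c)) -> mnat (tot mu A n).
Proof.
move=> mu0 mA; apply: (@mnat_sum n (fun c u => cell_hits (mu c) (A c) (seed c u))) => c.
exact: (@mnat_comp (cell_hits (mu c) (A c)) (seed c) (@measurable_seed R c) (mnat_cell_hits (mu0 c) (mA c))).
Qed.

(** The first cell is independent of the others and Poisson laws convolve; the finite function [j]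
    records the share of the first cell in each count. *)
Lemma tot_law_partition (I : finType) n (mu : nat -> R) (B : nat -> I -> set U) (k : I -> nat) :
  (forall c, 0 <= mu c) -> (forall c i, measurable (B c i)) ->
  (forall c u, exists i, forall j, (u \in B c j) = (j == i)) ->
  P [set u | forall i, tot mu (B ^~ i) n u = k i] =
  (\prod_i pois (\sum_(c < n) mu c * fine (P (B c i))) (k i))%:E.
Proof.
elim: n mu B k => [|n IH] mu B k mu0 mB BP.
  have p0 j : pois (\sum_(c < 0) mu c * fine (P (B c j))) (k j) = (k j == 0%N)%:R.
    rewrite big_ord0 /pois oppr0 expR0 mul1r; case: (k j) => [|l]; first by rewrite expr0 divr1.
    by rewrite exprS !mul0r.
  under eq_bigr do rewrite p0.
  have [/forallP k0|/forallPn[i ki]] := boolP [forall i, k i == 0%N].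
    rewrite big1 => [|i _]; last by rewrite k0.
    rewrite (_ : [set _ | _] = setT) ?probability_setT//.
    by apply/seteqP; split => // u _ i; rewrite /tot big_ord0 (eqP (k0 i)).
  rewrite (bigD1 i)//= (negbTE ki) mul0r (_ : [set _ | _] = set0) ?measure0//.
  apply/seteqP; split => // u /(_ i); rewrite /tot big_ord0 => e.
  by move: ki; rewrite -e.
pose K := (\sum_i k i)%N.
have kK i : (k i < K.+1)%N by rewrite ltnS /K (bigD1 i)//= leq_addr.
pose A1 (j : I -> nat) : set U := [set u | forall i, cell_hits (mu 0) (B 0 i) u = j i].
pose A2 (j : I -> nat) : set U := [set u | forall i, tot (mu \o S) ((B \o S) ^~ i) n u = j i].
have mA1 j : measurable (A1 j) by apply: measurable_mnat_all => i; exact: mnat_cell_hits.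
have mA2 j : measurable (A2 j).
  by apply: measurable_mnat_all => i; apply: mnat_tot => c /=.
pose F (j : {ffun I -> 'I_K.+1}) : set U := if [forall i, (j i <= k i)%N] then
  [set u | A1 (fun i => j i) (even_part u) /\ A2 (fun i => k i - j i)%N (odd_part u)] else set0.
have mF j : measurable (F j) by rewrite /F; case: ifP => // _; exact: measurable_split.
have FE : [set u | forall i, tot mu (B ^~ i) n.+1 u = k i] = [set u | exists j, F j u].
  apply/seteqP; split => u /=.
    move=> H; pose h i := cell_hits (mu 0) (B 0 i) (even_part u).
    have hk i : (h i <= k i)%N by rewrite -H totS leq_addr.
    exists [ffun i => inord (h i)].
    rewrite /F ifT; last by apply/forallP => i; rewrite ffunE inordK// (leq_ltn_trans (hk i) (kK i)).
    split => i; rewrite ffunE inordK ?(leq_ltn_trans (hk i) (kK i))//.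
    by rewrite -H totS addKn.
  move=> [j]; rewrite /F; case: ifP => // /forallP jk [H1 H2] i.
  by rewrite totS H1 H2 subnKC.
rewrite FE measure_disjoint_fin//; last first.
  move=> i j u; rewrite /F; case: ifP => // _; case: ifP => // _ [H1 _] [H2 _].
  by apply/ffunP => l; apply: val_inj; rewrite /= -H1 -H2.
pose G i (j : 'I_K.+1) : R := if (j <= k i)%N then pois (mu 0 * fine (P (B 0 i))) j *
  pois (\sum_(c < n) mu c.+1 * fine (P (B c.+1 i))) (k i - j) else 0.
have PF j : P (F j) = (\prod_i G i (j i))%:E.
  rewrite /F; have [/forallP jk|/forallPn[i ji]] := boolP [forall i, (j i <= k i)%N]; last first.
    by rewrite measure0 (bigD1 i)//= /G (negbTE ji) mul0r.
  have -> : \prod_i G i (j i) = (\prod_i pois (mu 0 * fine (P (B 0 i))) (j i)) *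
      \prod_i pois (\sum_(c < n) mu c.+1 * fine (P (B c.+1 i))) (k i - j i).
    by rewrite -big_split /=; apply: eq_bigr => i _; rewrite /G jk.
  apply: split_event => //; first exact: cell_law.
  by apply: (IH (mu \o S) (B \o S)) => [c|c i|c u]; [exact: mu0|exact: mB|exact: BP].
transitivity (\sum_(j : {ffun I -> 'I_K.+1}) (\prod_i G i (j i))%:E)%E.
  by apply: eq_bigr => j _; exact: PF.
rewrite sumEFin -(bigA_distr_bigA G); congr EFin; apply: eq_bigr => i _.
transitivity (pois (mu 0 * fine (P (B 0 i)) + \sum_(c < n) mu c.+1 * fine (P (B c.+1 i))) (k i));
  last by rewrite big_ord_recl.
rewrite -pois_conv (big_ord_widen _ (fun j => pois _ j * pois _ (k i - j)) (kK i)) [RHS]big_mkcond.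
by apply: eq_bigr => j _; rewrite /G ltnS.
Qed.

(** A remainder class completes the sets to a partition, and its count is summed out. *)
Lemma tot_law (I : finType) n (mu : nat -> R) (A : nat -> I -> set U) (k : I -> nat) :
  (forall c, 0 <= mu c) -> (forall c i, measurable (A c i)) ->
  (forall c i j u, A c i u -> A c j u -> i = j) ->
  P [set u | forall i, tot mu (A ^~ i) n u = k i] =
  (\prod_i pois (\sum_(c < n) mu c * fine (P (A c i))) (k i))%:E.
Proof.
move=> mu0 mA dA.
pose B c (o : option I) : set U := if o is Some i then A c i else ~` [set u | exists i, A c i u].
have mex c : measurable ([set u | exists i, A c i u] : set U).
  have := @measurable_exists_in I (A c) (index_enum I) (mA c).
  congr (measurable _); apply/seteqP; split => u /=; first by move=> [i _ H]; exists i.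
  by move=> [i H]; exists i => //; exact: mem_index_enum.
have mB c o : measurable (B c o) by case: o => [i|]; [exact: mA|exact: measurableC].
have BP c u : exists i, forall j, (u \in B c j) = (j == i).
  have [[i Ai]|nA] := pselect (exists i, A c i u).
    exists (Some i) => -[j|] /=; last by apply: memNset => /= H; apply: H; exists i.
    case: (eqVneq (Some j) (Some i)) => [[->]|ji]; first exact: mem_set.
    by apply: memNset => /= Aj; move: ji; rewrite (dA _ _ _ _ Ai Aj) eqxx.
  exists None => -[j|] /=; last by rewrite eqxx; exact: mem_set.
  by apply: memNset => Aj; apply: nA; exists j.
pose kr r (o : option I) := if o is Some i then k i else r.
pose F r : set U := [set u | forall o, tot mu (B ^~ o) n u = kr r o].
have mF r : measurable (F r) by apply: measurable_mnat_all => o; exact: mnat_tot.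
pose rho : R := \sum_(c < n) mu c * fine (P (B c None)).
set X := \prod_i _.
have PF r : P (F r) = (X * pois rho r)%:E.
  rewrite tot_law_partition//; congr EFin.
  rewrite (bigD1 None)//= mulrC; congr (_ * _).
  rewrite /X (reindex_omap Some id) /=; last by case.
  by apply: eq_bigl => i; rewrite eqxx.
have -> : [set u | forall i, tot mu (A ^~ i) n u = k i] = \bigcup_r F r.
  apply/seteqP; split => u /=.
    by move=> H; exists (tot mu (B ^~ None) n u) => // -[i|]; [exact: H|].
  by move=> [r _ H] i; exact: (H (Some i)).
have tF : trivIset setT F.
  apply/trivIsetP => r s _ _ rs; apply/seteqP; split => // u [Fr Fs].
  by move/eqP: rs; apply; exact: etrans (esym (Fr None)) (Fs None).
have c := @measure_semi_sigma_additive _ U R P F mF tF (bigcupT_measurable _ mF).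
apply: (cvg_unique _ c); first exact: ereal_hausdorff.
have -> : (fun m => \sum_(0 <= r < m) P (F r))%E = EFin \o (fun m => X * pois_cdf rho m).
  apply: funext => m /=; rewrite big_mkord /pois_cdf mulr_sumr -sumEFin.
  by apply: eq_bigr => i _; exact: PF.
apply: cvg_EFin; first exact: nearW.
by rewrite -[X in _ --> X]mulr1; apply: cvgMr; exact: pois_series.
Qed.

End Counts.

Local Open Scope card_scope.

Lemma bounded_nat_eventually_const (h : nat -> nat) K : {homo h : m n / (m <= n)%N} ->
  (forall n, h n <= K)%N -> exists n0, forall n, (n0 <= n)%N -> h n = h n0.
Proof.
move=> hm hK; have H e m : (K - h m <= e)%N -> exists n0, forall n, (n0 <= n)%N -> h n = h n0.
  elim: e m => [|e IH] m me.
    exists m => n mn; apply/eqP; rewrite eqn_leq; apply/andP; split; last exact: hm.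
    by rewrite (leq_trans (hK n))// -subn_eq0 -leqn0.
  have [[n [mn hn]]|H] := pselect (exists n, (m <= n)%N /\ (h m < h n)%N).
    by apply: (IH n); have := hK n; lia.
  exists m => n mn; apply/eqP; rewrite eqn_leq; apply/andP; split; last exact: hm.
  by rewrite leqNgt; apply/negP => hn; apply: H; exists n.
exact: (H _ 0%N (leqnn _)).
Qed.

(** * Almost sure distinctness of the points *)

Section Coincidences.
Variable R : realType.
Local Notation U := (measurableTypeR R).
Local Notation P := (@unif R).

Lemma even_law (A : set U) : measurable A -> P (@even_part R @^-1` A) = P A.
Proof. exact: (@seed_law R 0). Qed.

Lemma odd_law (A : set U) : measurable A -> P (@odd_part R @^-1` A) = P A.
Proof.
move=> mA; have := @split_law R setT A measurableT mA.
by rewrite preimage_setT setTI probability_setT mul1e.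
Qed.

Lemma seed_pair_law i j (A : set U) : i != j -> measurable A ->
  P [set u | A (seed i u) /\ A (seed j u)] = (P A * P A)%E.
Proof.
move=> ij mA; pose B k := if (k == i) || (k == j) then A else setT.
have mB k : measurable (B k) by rewrite /B; case: ifP.
have iN : (i < (maxn i j).+1)%N by rewrite ltnS leq_maxl.
have jN : (j < (maxn i j).+1)%N by rewrite ltnS leq_maxr.
have := @seed_indep R (maxn i j).+1 B mB.
rewrite (bigD1 (Ordinal iN))//= (bigD1 (Ordinal jN))/=; last first.
  by apply/negP => /eqP [] e; rewrite e eqxx in ij.
rewrite big1 => [|k /andP[ki kj]]; last first.
  rewrite /B ifF ?probability_setT//; apply/negbTE; rewrite negb_or.
  by apply/andP; split; [move: ki|move: kj]; apply: contraNN => /eqP e; apply/eqP/val_inj.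
rewrite mule1 /B !eqxx orbT /= => <-; congr (P _); apply/seteqP; split => u /=.
  by move=> [Ai Aj] k kN; case: ifP => // /orP[/eqP->|/eqP->].
by move=> H; split; [have := H i iN; rewrite eqxx|have := H j jN; rewrite eqxx orbT].
Qed.

(* [even_part] takes the value 1, which does not lie in the half-open unit interval. *)
Definition clip (s : R) : R := if s < 1 then s else 0.

Lemma clip01 s : 0 <= s -> 0 <= clip s < 1.
Proof. by rewrite /clip; case: ltP => [-> ->|_ _]; rewrite ?lexx ?ltr01. Qed.

Lemma clip_law (A : set U) : P (clip @^-1` A) = P A.
Proof.
rewrite -[LHS]/(@lebesgue_measure R (clip @^-1` A `&` `[0, 1[)).
rewrite -[RHS]/(@lebesgue_measure R (A `&` `[0, 1[)); congr lebesgue_measure.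
by apply/seteqP; split => u; rewrite /clip /= in_itv /= => -[+ /andP[u0 u1]]; rewrite u1 u0.
Qed.

Lemma measurable_clip : measurable_fun setT (clip : U -> U).
Proof.
apply: measurable_ray_preimage => s.
have -> : clip @^-1` ray s = (ray s `&` `]-oo, 1[%classic) `|`
    (if s < 0 then `[1, +oo[%classic else set0).
  apply/seteqP; split => u; rewrite /clip /ray /= !in_itv /=.
    case: (ltP u 1) => u1 H; [by left|right].
    by rewrite H /= in_itv /= u1.
  case: (ltP u 1) => u1 [[]|] //; first by case: ifP => // _; rewrite /= in_itv /= andbT leNgt u1.
  by case: ifP.
apply: measurableU; first by apply: measurableI; [exact: measurable_ray|exact: measurable_itv].
by case: ifP => // _; exact: measurable_itv.
Qed.

Definition coincide i j : set U :=
  [set u | clip (even_part (seed i u)) = clip (even_part (seed j u))].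

Lemma measurable_coincide i j : measurable (coincide i j).
Proof.
have mf k : measurable_fun setT (clip \o (@even_part R \o seed k) : U -> U).
  apply: measurableT_comp; first exact: measurable_clip.
  by apply: measurableT_comp; [exact: measurable_even_part|exact: measurable_seed].
pose f (u : U) : R := clip (even_part (seed i u)); pose g (u : U) : R := clip (even_part (seed j u)).
have mfg : measurable_fun setT (f \- g) by apply: measurable_funB; exact: mf.
have -> : coincide i j = (f \- g) @^-1` [set 0].
  apply/seteqP; split => u; rewrite /coincide /preimage /mkset -/(f u) -/(g u) => e.
    by apply/eqP; rewrite subr_eq0; apply/eqP.
  by apply/eqP; rewrite -subr_eq0; apply/eqP.
rewrite -[X in measurable X]setTI; apply: mfg => //; exact: measurable_set1.
Qed.

Lemma even_part01 (u : R) : 0 <= even_part u <= 1.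
Proof.
have ub : has_ubound (range (@trunc_even R ^~ u)).
  by exists 1 => _ [n _ <-]; have /andP[] := trunc_even01 n u.
apply/andP; split; first by apply: ub_le_sup => //; exists 0%N.
by apply: ge_sup => [|_ [n _ <-]]; [exists 0, 0%N|have /andP[] := trunc_even01 n u].
Qed.

(** Equal values fall in the same interval of length 1 / (M + 1). Independence gives each interval
    at most the square of its length, and listing M + 2 intervals costs a factor at most 2. *)
Lemma coincide_le i j M : i != j -> (P (coincide i j) <= (2 / M.+1%:R)%:E)%E.
Proof.
move=> ij; pose a : R := M.+1%:R; have a0 : 0 < a by rewrite ltr0n.
pose C m : set U := @even_part R @^-1` (clip @^-1` [set u | m%:R / a <= u < m.+1%:R / a]).
have mI m : measurable ([set u | m%:R / a <= u < m.+1%:R / a] : set U).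
  have -> : [set u | m%:R / a <= u < m.+1%:R / a] = `[m%:R / a, m.+1%:R / a[%classic.
    by apply/seteqP; split => u; rewrite /= in_itv.
  exact: measurable_itv.
have mcl m : measurable (clip @^-1` [set u | m%:R / a <= u < m.+1%:R / a] : set U).
  by rewrite -[X in measurable X]setTI; apply: measurable_clip => //; exact: mI.
have mC m : measurable (C m).
  by rewrite -[X in measurable X]setTI; apply: measurable_even_part => //; exact: mcl.
have PC m : (P (C m) <= (a^-1)%:E)%E.
  rewrite even_law// clip_law.
  have le1 : m%:R / a <= m.+1%:R / a :> R by rewrite ler_pM2r ?invr_gt0// ler_nat.
  rewrite interval_law// lee_fin ge_max invr_ge0 ltW//=.
  apply: (@le_trans _ _ (m.+1%:R / a - m%:R / a)).
    by apply: lerB; [rewrite ge_min lexx|rewrite le_max lexx].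
  by rewrite -mulrBl -natrB// subSnn mul1r.
pose E (m : 'I_M.+2) := [set u | C m (seed i u) /\ C m (seed j u)] : set U.
have mE m : measurable (E m).
  apply: measurableI; rewrite -[X in measurable X]setTI; apply: measurable_seed => //; exact: mC.
have dE (l m : 'I_M.+2) u : E l u -> E m u -> l = m.
  move=> [/andP[h1 h2] _] [/andP[h3 h4] _]; apply: val_inj => /=.
  have := le_lt_trans h1 h4; have := le_lt_trans h3 h2.
  by rewrite !ltr_pM2r ?invr_gt0// !ltr_nat; lia.
have sub : coincide i j `<=` [set u | exists m, E m u].
  move=> u e; have /andP[/clip01 + _] := even_part01 (seed i u); rewrite /coincide /= in e.
  set x := clip (even_part (seed i u)) in e *; move=> /andP[x0 x1].
  have ax0 : 0 <= x * a by rewrite mulr_ge0// ltW.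
  have /andP[t1 t2] := truncn_itv ax0.
  have tM : (Num.truncn (x * a) < M.+2)%N.
    rewrite ltnS -(ler_nat R).
    by apply: le_trans t1 _; rewrite -[leRHS]mul1r ler_pM2r// ltW.
  have xC : (Num.truncn (x * a))%:R / a <= x < (Num.truncn (x * a)).+1%:R / a.
    by rewrite ler_pdivrMr// ltr_pdivlMr// t1 t2.
  by exists (Ordinal tM); split; rewrite /C /=; rewrite -?e.
have mEE : measurable ([set u | exists m, E m u] : set U).
  have := @measurable_exists_in R _ E (index_enum _) mE.
  congr (measurable _); apply/seteqP; split => u /=; first by move=> [m _ H]; exists m.
  by move=> [m H]; exists m => //; exact: mem_index_enum.
apply: le_trans (le_measure P _ _ sub) _; rewrite ?inE//; first exact: measurable_coincide.
rewrite -[X in (X <= _)%E]/(P [set u | exists m, E m u]) measure_disjoint_fin//.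
apply: (@le_trans _ _ (\sum_(m < M.+2) (a^-1 * a^-1)%:E)%E).
  apply: lee_sum => m _; rewrite /E seed_pair_law// EFinM.
  by apply: lee_pmul.
rewrite sumEFin lee_fin big_const_ord iter_addr_0 -[X in X <= _]mulr_natl -/a.
by rewrite mulrA ler_pM2r ?invr_gt0// ler_pdivrMr// /a -natrM ler_nat; lia.
Qed.

Lemma coincide0 i j : i != j -> P (coincide i j) = 0%E.
Proof.
move=> ij; have mc := measurable_coincide i j.
have fx : P (coincide i j) = (fine (P (coincide i j)))%:E by rewrite fineK// fin_num_measure.
apply/eqP; rewrite eq_le measure_ge0 andbT fx lee_fin leNgt; apply/negP => x0.
have [M HM] := ltr_add_invr (divr_gt0 x0 (ltr0n R 2)).
have := coincide_le M ij; rewrite fx lee_fin leNgt => /negP; apply.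
by move: HM; rewrite add0r ltr_pdivlMr// mulrC.
Qed.

(** Two points of one cell having the same first coordinate; this null event contains all cases of
    equal points in distinct active slots. *)
Definition coincidence : set U :=
  [set u | exists c i j, i != j /\ coincide i j (odd_part (seed c u))].

Lemma coincidenceE : coincidence = \bigcup_c \bigcup_i \bigcup_j
  (if i != j then (@odd_part R \o seed c) @^-1` coincide i j else set0).
Proof.
apply/seteqP; split => u /=.
  by move=> [c [i [j [ij H]]]]; exists c => //; exists i => //; exists j => //; rewrite ij.
move=> [c _ [i _ [j _]]]; case: ifP => // ij H; exists c, i, j; split => //.
Qed.

Lemma measurable_coincide_slot c i j :
  measurable ((@odd_part R \o seed c) @^-1` coincide i j : set U).
Proof.
have mf : measurable_fun setT (@odd_part R \o seed c : U -> U).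
  by apply: measurableT_comp; [exact: measurable_odd_part|exact: measurable_seed].
by rewrite -[X in measurable X]setTI; apply: mf => //; exact: measurable_coincide.
Qed.

Lemma measurable_coincidence : measurable coincidence.
Proof.
rewrite coincidenceE; apply: bigcupT_measurable => c; apply: bigcupT_measurable => i.
by apply: bigcupT_measurable => j; case: ifP => // _; exact: measurable_coincide_slot.
Qed.

Lemma coincidence0 : P coincidence = 0%E.
Proof.
have H c i j : i != j -> P ((@odd_part R \o seed c) @^-1` coincide i j) = 0%E.
  move=> ij; rewrite -(coincide0 ij) -(odd_law (measurable_coincide i j)).
  rewrite -[RHS](@seed_law R c)//.
  by rewrite -[X in measurable X]setTI; apply: measurable_odd_part => //; exact: measurable_coincide.
suff : P.-negligible coincidence by move/negligibleP; apply; exact: measurable_coincidence.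
rewrite coincidenceE; apply: negligible_bigcup => c; apply: negligible_bigcup => i.
apply: negligible_bigcup => j; case: ifP => [ij|_]; last exact: negligible_set0.
by apply/negligibleP; [exact: measurable_coincide_slot|exact: H].
Qed.

Lemma pois_num0 (u : R) : pois_num 0 u = 0%N.
Proof.
rewrite /pois_num; case: xgetP => // l _ /=; case: l => // l.
rewrite /pois_cell /= {2}/pois_cdf big_ord_recr /= -/(pois_cdf 0 l.+1).
have -> : pois 0 l.+1 = 0 :> R by rewrite /pois exprS mul0r mulr0 mul0r.
by rewrite addr0 => /andP[h1 h2]; have := le_lt_trans h1 h2; rewrite ltxx.
Qed.

(** With an infinite mean, every finite count has probability 0. *)
Definition pois_lim (L : \bar R) (k : nat) : R := if L is x%:E then pois x k else 0.

Lemma pois_cvg (s : nat -> R) (L : \bar R) k : (forall n, 0 <= s n) ->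
  (0 <= L)%E -> (s n)%:E @[n --> \oo] --> L -> pois (s n) k @[n --> \oo] --> pois_lim L k.
Proof.
move=> s0; case: L => [x| |] // _ sL.
- have sx : s n @[n --> \oo] --> x by move/fine_cvgP : sL => [].
  rewrite /pois_lim /pois; apply: cvgMl; apply: cvgM.
    by apply: (@continuous_cvg _ _ _ _ _ _ expR _ (@continuous_expR R _)); exact: cvgN.
  elim: (k) => [|l IH]; first by under eq_fun do rewrite expr0; exact: cvg_cst.
  by rewrite exprS; under eq_fun do rewrite exprS; exact: cvgM.
- apply/cvgrPdist_le => e e0; move/cvgeyPgt : sL => /(_ (k.+1%:R / e)).
  apply: filterS => n; rewrite lte_fin ltr_pdivrMr// => H.
  have sp : 0 < s n.
    rewrite lt_neqAle s0 andbT; apply/eqP => e1; move: H; rewrite -e1 mul0r ltNge.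
    by rewrite ler0n.
  rewrite sub0r normrN ger0_norm ?pois_ge0//.
  (* As the right-hand side is at most k + 1, the probability tends to 0 when the mean tends to
     infinity. *)
  have h : pois (s n) k * s n = pois (s n) k.+1 * k.+1%:R.
    rewrite /pois factS natrM exprS.
    have n1 : k.+1%:R != 0 :> R by rewrite pnatr_eq0.
    have n2 : k`!%:R != 0 :> R by rewrite pnatr_eq0 -lt0n fact_gt0.
    move: (k.+1%:R : R) (k`!%:R : R) n1 n2 => p q p0 q0.
    by field; rewrite p0 q0.
  have p1 : pois (s n) k.+1 <= 1.
    apply: le_trans (pois_cdf_le1 k.+2 (s0 n)).
    rewrite /pois_cdf [leRHS]big_ord_recr /= lerDr.
    by apply: sumr_ge0 => i _; exact: pois_ge0.
  rewrite -(ler_pM2r sp) h; apply: (@le_trans _ _ k.+1%:R); last by rewrite mulrC ltW.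
  by rewrite -[leRHS]mul1r ler_wpM2r.
Qed.

End Coincidences.

Local Open Scope card_scope.

(** * The point process and its law *)

Section Process.
Variables (R : realType) (d : nat).
Local Notation U := (measurableTypeR R).
Local Notation P := (@unif R).
Local Notation T := ('rV[R]_d * R)%type.
Variables (mu : nat -> R) (pt : nat -> U -> T) (Lam : set T -> \bar R).
Hypothesis mu0 : forall c, 0 <= mu c.
Hypothesis mpt : forall c (A : set T), Borel A -> measurable (pt c @^-1` A).
Hypothesis pt_inj : forall c c' u u', 0 < mu c -> 0 < mu c' -> pt c u = pt c' u' ->
  c = c' /\ clip (even_part u) = clip (even_part u').
Hypothesis LamE : forall A : set T, Borel A ->
  (\sum_(c < n) mu c * fine (P (pt c @^-1` A)))%:E @[n --> \oo] --> Lam A.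

Definition total (A : set T) (n : nat) (u : U) : nat := tot mu (fun c => pt c @^-1` A) n u.
Definition total_limit (A : set T) (k : nat) : set U :=
  [set u | exists n0, forall n, (n0 <= n)%N -> total A n u = k].

Lemma totalS A n u : total A n.+1 u = (total A n u + cell_hits (mu n) (pt n @^-1` A) (seed n u))%N.
Proof. by rewrite /total /tot big_ord_recr. Qed.

Lemma total_le A u : {homo (fun n => total A n u) : m n / (m <= n)%N}.
Proof.
move=> m n /subnK <-; elim: (n - m)%N => // k IH.
by rewrite addSn totalS (leq_trans IH)// leq_addr.
Qed.

Lemma mnat_total A n : Borel A -> mnat (total A n).
Proof. by move=> bA; apply: mnat_tot => // c; exact: mpt. Qed.

Lemma measurable_total_limit A k : Borel A -> measurable (total_limit A k).
Proof.
move=> bA.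
have -> : total_limit A k = \bigcup_n0 \bigcap_(n in [set n | (n0 <= n)%N]) [set u | total A n u = k].
  by apply/seteqP; split => u; [move=> [n0 H]; exists n0|move=> [n0 _ H]; exists n0].
apply: bigcupT_measurable => n0; apply: bigcap_measurableType => n _; exact: mnat_total.
Qed.

Lemma Lam_ge0 A : Borel A -> (0 <= Lam A)%E.
Proof.
move=> bA; have c := LamE bA; rewrite -(cvg_lim _ c)//; apply: lime_ge; first by apply/cvg_ex; exists (Lam A).
apply: nearW => n; rewrite lee_fin; apply: sumr_ge0 => i _.
by rewrite mulr_ge0// fine_ge0.
Qed.

(** The counts over the first cells are nondecreasing, so the indicators of prescribed counts
    converge at every point, and dominated convergence applies. *)
Lemma total_limit_law (I : finType) (A : I -> set T) (k : I -> nat) :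
  (forall i, Borel (A i)) -> (forall i j, i != j -> A i `&` A j = set0) ->
  P [set u | forall i, total_limit (A i) (k i) u] = (\prod_i pois_lim (Lam (A i)) (k i))%:E.
Proof.
move=> bA dA.
pose E n : set U := [set u | forall i, total (A i) n u = k i].
pose L : set U := [set u | forall i, total_limit (A i) (k i) u].
have mE n : measurable (E n) by apply: measurable_mnat_all => i; exact: mnat_total.
have mL : measurable L.
  have -> : L = \bigcap_(i in [set: I]) total_limit (A i) (k i).
    by apply/seteqP; split => u H i; [move=> _|]; exact: H.
  by apply: fin_bigcap_measurable => [|i _]; [exact: finite_finset|exact: measurable_total_limit].
have PE n : P (E n) = (\prod_i pois (\sum_(c < n) mu c * fine (P (pt c @^-1` A i))) (k i))%:E.
  apply: (@tot_law R I n mu (fun c i => pt c @^-1` A i)) => //.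
    by move=> c i; exact: mpt.
  move=> c i j u Ai Aj; apply: contrapT => /eqP/dA e.
  by have : (A i `&` A j) (pt c u) by []; rewrite e.
have pt_cvg u : \1_(E n) u @[n --> \oo] --> (\1_L u : R).
  have [Lu|nLu] := pselect (L u).
    have [f Hf] := choice Lu.
    apply: cvg_near_cst; exists (\max_i f i)%N => // n /= fn.
    rewrite !indicE !mem_set// => i; apply: Hf; apply: leq_trans fn; exact: leq_bigmax.
  have [i Hi] : exists i, ~ total_limit (A i) (k i) u by apply/existsNP => H; exact: nLu.
  have [N HN] : exists N, forall n, (N <= n)%N -> total (A i) n u <> k i.
    have [[N lt]|H1] := pselect (exists N, (k i < total (A i) N u)%N).
      exists N => n Nn e; have := total_le (A i) u Nn; rewrite e leqNgt lt //.
    exists 0%N => N _ e; apply: Hi; exists N => n Nn; apply/eqP; rewrite eqn_leq -{2}e total_le// andbT.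
    by rewrite leqNgt; apply/negP => H; apply: H1; exists n.
  apply: cvg_near_cst; exists N => // n /= Nn.
  rewrite !indicE !memNset// => En; exact: (HN _ Nn (En i)).
have pc : P (E n) @[n --> \oo] --> P L.
  have intE (B : set U) : measurable B -> (\int[P]_(x in setT) (\1_B x)%:E)%E = P B.
    by move=> mB; rewrite integral_indic// setIT.
  have [] := @dominated_convergence _ U R P setT measurableT (fun n u => (\1_(E n) u)%:E)
    (fun u => (\1_L u)%:E) (cst 1%E).
  - by move=> n; apply/measurable_EFinP; exact: measurable_indic.
  - by apply/measurable_EFinP; exact: measurable_indic.
  - by apply: aeW => u _; apply: cvg_EFin; [exact: nearW|exact: pt_cvg].
  - exact: finite_measure_integrable_cst.
  - by apply: aeW => u n _ /=; rewrite indicE lee_fin normr_nat; case: (_ \in _).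
  move=> _ _ c; rewrite -(intE L mL).
  have -> : (fun n => P (E n)) = (fun n => \int[P]_(x in setT) (\1_(E n) x)%:E)%E.
    by apply: funext => n; rewrite intE.
  exact: c.
apply: (cvg_unique _ pc); first exact: ereal_hausdorff.
have -> : (fun n => P (E n)) = EFin \o
  (fun n => \prod_i pois (\sum_(c < n) mu c * fine (P (pt c @^-1` A i))) (k i)).
  by apply: funext => n; exact: PE.
apply: cvg_EFin; first exact: nearW.
elim: (index_enum I) => [|i s IH]; first by under eq_fun do rewrite big_nil; rewrite big_nil; exact: cvg_cst.
rewrite big_cons; under eq_fun do rewrite big_cons.
apply: cvgM => //; apply: pois_cvg => //; [|exact: Lam_ge0|exact: LamE].
by move=> n; apply: sumr_ge0 => c _; rewrite mulr_ge0// fine_ge0.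
Qed.

Definition active (c j : nat) (u : U) : Prop := (j < pois_num (mu c) (even_part (seed c u)))%N.
Definition ppt (s : nat * nat) (u : U) : T := pt s.1 (seed s.2 (odd_part (seed s.1 u))).

(* Emptied on a null event, so that distinct active slots always give distinct points. *)
Definition ppp (u : U) : set T :=
  [set p | ~ coincidence u /\ exists2 s, active s.1 s.2 u & p = ppt s u].

Lemma active_mu c j u : active c j u -> 0 < mu c.
Proof.
rewrite lt_neqAle mu0 andbT /active => h; apply/eqP => e; move: h; rewrite -e pois_num0.
by rewrite ltn0.
Qed.

Lemma ppt_inj u s s' : ~ coincidence u -> active s.1 s.2 u -> active s'.1 s'.2 u ->
  ppt s u = ppt s' u -> s = s'.
Proof.
case: s s' => [c j] [c' j'] /= nu a a' /(pt_inj (active_mu a) (active_mu a')) [cc H].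
subst c'; congr (_, _); apply: contrapT => /eqP jj; apply: nu; exists c, j, j'; split => //.
Qed.

(** A list without repetition of the active slots with point in [A], which links the cardinal of a
    set of points to the sum [total]. *)
Fixpoint slots (A : set T) (u : U) (n : nat) : seq (nat * nat) :=
  if n is m.+1 then slots A u m ++ [seq (m, j) | j <- iota 0 (pois_num (mu m) (even_part (seed m u)))
    & `[< A (ppt (m, j) u) >]] else [::].

Lemma size_slots A u n : size (slots A u n) = total A n u.
Proof.
elim: n => [|n IH]; first by rewrite /total /tot big_ord0.
rewrite /= size_cat IH totalS size_map size_filter; congr addn.
rewrite /cell_hits /hits -sum1_count big_mkcond /= -{1}[pois_num _ _]subn0 -/(index_iota 0 _) big_mkord.
apply: eq_bigr => j _; rewrite /ppt /=.
by have -> : (seed j (odd_part (seed n u)) \in pt n @^-1` A) =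
  `[< A (pt n (seed j (odd_part (seed n u)))) >] by []; case: asbool.
Qed.

Lemma mem_slots A u n s : (s \in slots A u n) = [&& (s.1 < n)%N, `[< active s.1 s.2 u >] & `[< A (ppt s u) >]].
Proof.
elim: n => [|n IH] //; rewrite [slots A u n.+1]/= mem_cat IH ltnS {IH}; case: s => c j /=.
have -> : ((c, j) \in [seq (n, j0) | j0 <- iota 0 (pois_num (mu n) (even_part (seed n u))) &
    `[< A (ppt (n, j0) u) >]]) = [&& c == n, `[< active c j u >] & `[< A (ppt (c, j) u) >]].
  apply/mapP/and3P => [[j' + [-> ->]]|[/eqP -> h1 h2]].
    by rewrite mem_filter mem_iota /= add0n => /andP[-> h]; rewrite eqxx; split => //; apply/asboolP.
  by exists j => //; rewrite mem_filter h2 mem_iota /= add0n; move/asboolP : h1.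
by rewrite (leq_eqVlt c n); case: (c == n); case: (c < n)%N; case: asbool; case: asbool.
Qed.

Lemma uniq_slots A u n : uniq (slots A u n).
Proof.
elim: n => [|n IH] //=; rewrite cat_uniq IH /=; apply/andP; split.
  by apply/hasPn => s /mapP[j _ ->]; rewrite mem_slots /= ltnn.
by rewrite map_inj_uniq ?filter_uniq ?iota_uniq// => x y [].
Qed.

Lemma slots_image A u n : ~ coincidence u ->
  (ppt ^~ u) @` [set` slots A u n] #= `I_(total A n u).
Proof.
move=> nu; rewrite -size_slots; pose f i := ppt (nth (0%N, 0%N) (slots A u n) i) u.
have -> : (ppt ^~ u) @` [set` slots A u n] = f @` `I_(size (slots A u n)).
  apply/seteqP; split => [_ [s /= ss <-]|_ [i /= lti <-]].
    by exists (index s (slots A u n)); rewrite /= ?index_mem// /f nth_index.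
  by exists (nth (0%N, 0%N) (slots A u n) i) => //=; exact: mem_nth.
apply: inj_card_eq => i j /set_mem /= lti /set_mem /= ltj.
have := mem_nth (0%N, 0%N) lti; have := mem_nth (0%N, 0%N) ltj; rewrite !mem_slots.
move=> /and3P[_ /asboolP a1 _] /and3P[_ /asboolP a2 _] /(ppt_inj nu a2 a1) /eqP.
by rewrite nth_uniq ?uniq_slots// => /eqP.
Qed.

Lemma slots_sub A u n : ~ coincidence u -> (ppt ^~ u) @` [set` slots A u n] `<=` ppp u `&` A.
Proof.
move=> nu _ [s /= + <-]; rewrite mem_slots => /and3P[_ /asboolP a /asboolP As].
by split => //; split => //; exists s.
Qed.

Lemma count_total A k u : ~ coincidence u -> total_limit A k u -> count_eq (ppp u) A k.
Proof.
move=> nu [n0 H]; rewrite /count_eq.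
have -> : ppp u `&` A = (ppt ^~ u) @` [set` slots A u n0].
  apply/seteqP; split; last exact: slots_sub.
  move=> p [[_ [s a ->]] Ap]; exists s => //=.
  have : s \in slots A u (maxn s.1.+1 n0).
    by rewrite mem_slots leq_max leqnn /=; apply/andP; split; apply/asboolP.
  have pre : exists t, slots A u (maxn s.1.+1 n0) = slots A u n0 ++ t.
    have : (n0 <= maxn s.1.+1 n0)%N by rewrite leq_maxr.
    move: (maxn _ _) => m /subnK <-; elim: (m - n0)%N => [|l [t IH]]; first by exists [::]; rewrite cats0.
    by rewrite addSn /= IH; eexists; rewrite -catA.
  move: pre => [t e]; have : size t = 0%N.
    have := congr1 size e; rewrite size_cat !size_slots !H ?leq_maxr//; lia.
  by move=> /size0nil t0; rewrite e t0 cats0.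
by rewrite -(H n0 (leqnn _)); exact: slots_image.
Qed.

Lemma count_eq_inj (S : set T) k l : S #= `I_k -> S #= `I_l -> k = l.
Proof. by move=> h1 h2; apply/card_eq_II; apply: card_eq_trans h2; rewrite card_eq_sym. Qed.

(** A finite count bounds the partial totals, which then stabilize; [count_total] identifies the
    limit. *)
Lemma total_count A k u : ~ coincidence u -> count_eq (ppp u) A k -> total_limit A k u.
Proof.
move=> nu Hk.
have le n : (total A n u <= k)%N.
  rewrite -card_le_II; apply: (@card_le_trans _ _ _ ((ppt ^~ u) @` [set` slots A u n])).
    by have /card_eqPle[] := slots_image A n nu.
  apply: card_le_trans (subset_card_le (@slots_sub A u n nu)) _.
  by move/card_eqPle : Hk => [].
have [n0 H] := bounded_nat_eventually_const (total_le A u) le.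
have c := @count_total A (total A n0 u) u nu (ex_intro _ n0 H).
by rewrite (count_eq_inj Hk c); exists n0.
Qed.

Lemma count_event A k : [set u | count_eq (ppp u) A k] =
  (total_limit A k `&` ~` @coincidence R) `|` (if k == 0%N then @coincidence R else set0).
Proof.
have H0 u : coincidence u -> ppp u `&` A = set0.
  by move=> cu; apply/seteqP; split => // p [[nc _] _]; exact: nc.
apply/seteqP; split => u /=.
  move=> H; have [cu|nu] := pselect (coincidence u).
    right; move: H; rewrite /count_eq H0// => h.
    have -> : k = 0%N by apply: (@count_eq_inj set0) => //; rewrite II0.
    by rewrite eqxx.
  by left; split => //; exact: total_count.
case=> [[H nu]|]; first exact: count_total.
by case: eqP => // -> cu; rewrite /count_eq H0// II0.
Qed.

Lemma measurable_count A k : Borel A -> measurable [set u | count_eq (ppp u) A k].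
Proof.
move=> bA; rewrite count_event; apply: measurableU.
  apply: measurableI; [exact: measurable_total_limit|apply: measurableC; exact: measurable_coincidence].
by case: ifP => // _; exact: measurable_coincidence.
Qed.

Lemma measure_mod_coincidence (X Y : set U) : measurable X -> measurable Y ->
  X `&` ~` @coincidence R = Y `&` ~` @coincidence R -> P X = P Y.
Proof.
move=> mX mY e; have mc := @measurable_coincidence R.
have H (Z : set U) : measurable Z -> P Z = P (Z `&` ~` @coincidence R).
  move=> mZ; rewrite -setDE.
  have z : P (Z `&` @coincidence R) = 0%E.
    apply/eqP; rewrite eq_le measure_ge0 andbT -(coincidence0 R).
    by apply: le_measure; rewrite ?inE//; first [exact: measurableI|by move=> u []].
  have E : P Z = (P (Z `\` @coincidence R) + P (Z `&` @coincidence R))%E := measureDI P mZ mc.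
  by rewrite E z adde0.
by rewrite (H X)// (H Y)// e.
Qed.

Lemma count_law_joint (I : finType) (A : I -> set T) (k : I -> nat) :
  (forall i, Borel (A i)) -> (forall i j, i != j -> A i `&` A j = set0) ->
  P (\bigcap_(i in [set: I]) [set u | count_eq (ppp u) (A i) (k i)]) =
  (\prod_i pois_lim (Lam (A i)) (k i))%:E.
Proof.
move=> bA dA; rewrite -total_limit_law//; apply: measure_mod_coincidence.
- by apply: fin_bigcap_measurable => [|i _]; [exact: finite_finset|exact: measurable_count].
- have -> : [set u | forall i, total_limit (A i) (k i) u] =
      \bigcap_(i in [set: I]) total_limit (A i) (k i).
    by apply/seteqP; split => u H i; [move=> _|]; exact: H.
  by apply: fin_bigcap_measurable => [|i _]; [exact: finite_finset|exact: measurable_total_limit].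
- apply/seteqP; split => u [H nu]; split => // i; [|move=> _].
    by apply: total_count => //; exact: H.
  by apply: count_total => //; exact: H.
Qed.

Lemma count_law A k : Borel A -> P [set u | count_eq (ppp u) A k] = (pois_lim (Lam A) k)%:E.
Proof.
move=> bA; have := @count_law_joint 'I_1 (fun=> A) (fun=> k) (fun=> bA).
rewrite big_ord1 => <-; last by move=> i j; rewrite !ord1 eqxx.
by congr (P _); apply/seteqP; split => u /= H; [move=> i _|apply: (H ord0)].
Qed.

Lemma ppp_poisson : is_poisson_pp (@unif R) ppp Lam.
Proof.
split.
- exact: measurable_count.
- move=> A k bA LA; rewrite -[LHS]/(P [set u | count_eq (ppp u) A k]) count_law//.
  by have := Lam_ge0 bA; move: LA; case: (Lam A).
- move=> A bA LA.
  have -> : [set w | ~ finite_set (ppp w `&` A)] = ~` \bigcup_k [set u | count_eq (ppp u) A k].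
    apply/seteqP; split => u /= H.
      by move=> [k _ Hk]; apply: H; apply/finite_setP; exists k.
    by move=> /finite_setP[k Hk]; apply: H; exists k.
  have mU : measurable (\bigcup_k [set u | count_eq (ppp u) A k]).
    by apply: bigcupT_measurable => k; exact: measurable_count.
  transitivity (1 - P (\bigcup_k [set u | count_eq (ppp u) A k]))%E; first exact: probability_setC.
  suff -> : P (\bigcup_k [set u | count_eq (ppp u) A k]) = 0%E by rewrite sube0.
  suff : P.-negligible (\bigcup_k [set u | count_eq (ppp u) A k]) by move/negligibleP; apply.
  apply: negligible_bigcup => k; apply/negligibleP; first exact: measurable_count.
  transitivity (pois_lim (Lam A) k)%:E; first exact: count_law.
  by rewrite LA.
- move=> n A k bA dA; transitivity (\prod_i pois_lim (Lam (A i)) (k i))%:E; first exact: count_law_joint.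
  rewrite -prodEFin; apply: eq_bigr => i _.
  by apply/esym; exact: count_law.
Qed.

End Process.

Local Open Scope card_scope.

Lemma unit_law (R : realType) (a b : R) : unif ([set s | a <= s < b] : set (measurableTypeR R)) =
  (Num.max 0 (Num.min b 1 - Num.max a 0))%:E.
Proof.
have [ab|ba] := leP a b; first exact: interval_law.
rewrite (_ : [set _ | _] = set0); last first.
  by apply/seteqP; split => // u /= /andP[h1 h2]; have := le_lt_trans h1 h2; rewrite ltNge (ltW ba).
rewrite measure0; congr EFin; apply/esym/max_idPl; rewrite subr_le0.
by apply: (@le_trans _ _ b); [rewrite ge_min lexx|apply: (le_trans (ltW ba)); rewrite le_max lexx].
Qed.

(** * Unit cells and the intensity measure *)

Section Cells.
Variables (R : realType) (d : nat) (lam : R) (nu : {measure set R -> \bar R}).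
Variables (r m : bool -> R).
Hypothesis d0 : (0 < d)%N.
Hypothesis lam0 : 0 <= lam.
Hypothesis m0 : forall t, 0 <= m t.
Hypothesis r_inj : injective r.
Hypothesis nur : forall t, nu [set r t] = (m t)%:E.
Hypothesis nuC : nu (~` range r) = 0%E.
Local Notation U := (measurableTypeR R).
Local Notation P := (@unif R).
Local Notation T := ('rV[R]_d * R)%type.
Local Notation Z := (bool * 'rV[int]_d)%type.

Definition unit_cell (z : Z) : set T :=
  box (map_mx intr z.2) (\row_i ((z.2 0 i)%:~R + 1)) `*` [set r z.1].
(** The first coordinate, up to an integer, is [clip (even_part w)], the quantity compared in
    [coincide]. *)
Definition cell_point (z : Z) (w : U) : T := (\row_i ((z.2 0 i)%:~R + clip (seed i w)), r z.1).

Lemma seed_ge0 k (w : R) : 0 <= seed k w.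
Proof. by have /andP[] := even_part01 (iter k (@odd_part R) w). Qed.

Lemma clip_seed01 k (w : R) : 0 <= clip (seed k w) < 1.
Proof. exact/clip01/seed_ge0. Qed.

Lemma cell_point_floor z w i : Num.floor ((cell_point z w).1 0 i) = z.2 0 i.
Proof.
rewrite mxE; apply: floor_def.
have /andP[h1 h2] := clip_seed01 i w.
by rewrite intrD lerDl h1 ltrD2l h2.
Qed.

Lemma unit_cell_floor z x : unit_cell z x -> forall i, Num.floor (x.1 0 i) = z.2 0 i.
Proof.
move=> [/= bx _] i; apply: floor_def; have := bx i; rewrite !mxE intrD; exact.
Qed.

Lemma cell_point_inj z z' w w' : cell_point z w = cell_point z' w' ->
  z = z' /\ clip (even_part w) = clip (even_part w').
Proof.
move=> e; have zz : z = z'.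
  have e2 : z.1 = z'.1 by apply: r_inj; exact: (congr1 snd e).
  have e1 : z.2 = z'.2 by apply/rowP => i; rewrite -(cell_point_floor z w) e cell_point_floor.
  by case: z z' e1 e2 {e} => [t q] [t' q'] /= -> ->.
split => //; have := congr1 (fun p : T => p.1 0 (Ordinal d0)) e; rewrite !mxE zz.
by move/addrI.
Qed.

Let boxes : set (set T) := [set A | exists l u (C : set R), measurable C /\ A = box l u `*` C].

Lemma setI_closed_boxes : setI_closed boxes.
Proof.
move=> _ _ [l [u [C [mC ->]]]] [l' [u' [C' [mC' ->]]]].
exists (\row_i Num.max (l 0 i) (l' 0 i)), (\row_i Num.min (u 0 i) (u' 0 i)), (C `&` C').
split; first exact: measurableI.
apply/seteqP; split => [[x s] [[/= h1 h2] [/= h3 h4]]|[x s] [/= h1 [h2 h3]]].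
  split => //= i; rewrite !mxE ge_max lt_min.
  by have /andP[-> ->] := h1 i; have /andP[-> ->] := h3 i.
by split; split => //= i; have := h1 i; rewrite !mxE ge_max lt_min => /andP[/andP[? ?] /andP[? ?]];
  apply/andP.
Qed.

Lemma Borel_boxes : @Borel R d `<=` <<s boxes >>.
Proof.
apply: smallest_sub => [|B /open_countable_box[l [u [C [mC ->]]]]].
  exact: smallest_sigma_algebra.
have [_ _ H] := smallest_sigma_algebra setT boxes; apply: H => n.
by apply: sub_sigma_algebra; exists (l n), (u n), (C n).
Qed.

Local Notation mI := (intensity_outer d nu lam0).

Lemma unit_cell_intensity z : intensity lam nu (unit_cell z) = (lam * m z.1)%:E.
Proof.
rewrite intensity_box// nur -EFinM; congr EFin; congr (_ * _).
rewrite -[RHS]mul1r; congr (_ * _); rewrite /boxvol big1// => i _.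
by rewrite !mxE addrC addKr; apply/max_idPr.
Qed.

Lemma cell_box_law z l u (C : set R) : measurable C ->
  measurable (cell_point z @^-1` (box l u `*` C)) /\
  ((lam * m z.1)%:E * P (cell_point z @^-1` (box l u `*` C)))%E =
  intensity lam nu ((box l u `*` C) `&` unit_cell z).
Proof.
move=> mC; pose a i : R := l 0 i - (z.2 0 i)%:~R; pose b i : R := u 0 i - (z.2 0 i)%:~R.
(* Seeds are indexed by all the integers; ranks beyond the dimension carry no constraint. *)
pose A (k : nat) : set U := if insub k is Some i then @clip R @^-1` [set s | a i <= s < b i] else setT.
have mA k : measurable (A k).
  rewrite /A; case: insubP => // i _ _; rewrite -[X in measurable X]setTI.
  apply: measurable_clip => //.
  have -> : [set s | a i <= s < b i] = `[a i, b i[%classic.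
    by apply/seteqP; split => s; rewrite /= in_itv.
  exact: measurable_itv.
pose E : set U := [set w | forall k, (k < d)%N -> A k (seed k w)].
have mE : measurable E.
  have -> : E = \bigcap_(k in `I_d) (seed k @^-1` A k) by [].
  apply: bigcap_measurableType => k _.
  by have := @measurable_seed R k measurableT (A k) (mA k); rewrite setTI.
have preE : cell_point z @^-1` (box l u `*` C) = if r z.1 \in C then E else set0.
  have EE w : E w <-> box l u (cell_point z w).1.
    split => H.
      move=> i; rewrite mxE; have := H i (ltn_ord i); rewrite /A valK /= /a /b.
      by rewrite lerBlDl ltrBrDl.
    move=> k kd; rewrite /A insubT /= /a /b; have := H (Ordinal kd).
    by rewrite mxE /= lerBlDl ltrBrDl.
  case: ifPn => [/set_mem rC|rC]; apply/seteqP; split => w.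
  - by move=> [/EE].
  - by move=> /EE H; split.
  - by move=> [_ /= /mem_set]; rewrite (negbTE rC).
  - by [].
rewrite preE; split; first by case: ifP.
have -> : (box l u `*` C) `&` unit_cell z =
  box (\row_i Num.max (l 0 i) (z.2 0 i)%:~R) (\row_i Num.min (u 0 i) ((z.2 0 i)%:~R + 1)) `*`
    (if r z.1 \in C then [set r z.1] else set0).
  apply/seteqP; split => [[x s] [[/= h1 h2] [/= h3 h4]]|[x s] [/= h1]].
    split; last by rewrite /= -h4 mem_set.
    move=> i /=; rewrite !mxE ge_max lt_min.
    by have /andP[-> ->] := h1 i; have := h3 i; rewrite !mxE => /andP[-> ->].
  case: ifPn => // /set_mem rC -> /=; split; split => //= i;
    have := h1 i; rewrite !mxE ge_max lt_min => /andP[/andP[? ?] /andP[? ?]]; exact/andP.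
case: ifPn => rC; last by rewrite measure0 mule0 intensity_box// measure0 mule0.
rewrite intensity_box// nur [in LHS](_ : P E = (boxvol (\row_i Num.max (l 0 i) (z.2 0 i)%:~R)
   (\row_i Num.min (u 0 i) ((z.2 0 i)%:~R + 1)))%:E).
  by rewrite -!EFinM; congr EFin; rewrite mulrC mulrA.
rewrite /E seed_indep// /boxvol -prodEFin; apply: eq_bigr => i _.
rewrite /A valK clip_law unit_law !mxE; congr EFin; congr (Num.max 0 _).
have minD (p q c : R) : Num.min (p - c) (q - c) = Num.min p q - c.
  by rewrite /Num.min ltrD2r; case: ifP.
have maxD (p q c : R) : Num.max (p - c) (q - c) = Num.max p q - c.
  by rewrite /Num.max ltrD2r; case: ifP.
rewrite /a /b; have e1 : 1 = (z.2 0 i)%:~R + 1 - (z.2 0 i)%:~R :> R by rewrite addrAC subrr add0r.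
have e0 : 0 = (z.2 0 i)%:~R - (z.2 0 i)%:~R :> R by rewrite subrr.
by rewrite [X in Num.min _ X]e1 [X in Num.max _ X]e0 minD maxD opprB addrA subrK.
Qed.

(** Dynkin's lemma from boxes. Complements are taken inside the cell, where the intensity is finite;
    Caratheodory measurability is carried along to make the outer measure additive. *)
Lemma cell_law_Borel z (A : set T) : Borel A ->
  measurable (cell_point z @^-1` A) /\
  ((lam * m z.1)%:E * P (cell_point z @^-1` A))%E = intensity lam nu (A `&` unit_cell z).
Proof.
pose H (A : set T) := [/\ mI.-caratheodory A, measurable (cell_point z @^-1` A) &
  ((lam * m z.1)%:E * P (cell_point z @^-1` A))%E = mI (A `&` unit_cell z)].
have mz : mI.-caratheodory (unit_cell z) by exact: caratheodory_box.
have lm0 : 0 <= lam * m z.1 by rewrite mulr_ge0.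
suff HB : @Borel R d `<=` H by move=> /HB[_ mA e]; split => //; rewrite e intensity_outerE.
apply: subset_trans Borel_boxes _.
apply: (lambda_system_subset setI_closed_boxes) => //; last first.
  move=> _ [l [u [C [mC ->]]]]; have [mA e] := cell_box_law z l u mC.
  by split => //; [exact: caratheodory_box|rewrite e intensity_outerE].
apply/dynkin_lambda_system; split.
- split; first exact: (@measurableT _ (caratheodory_type mI)).
    by rewrite preimage_setT.
  by rewrite preimage_setT probability_setT mule1 setTI intensity_outerE unit_cell_intensity.
- move=> B [cB mB eB]; split.
  + exact: (@measurableC _ (caratheodory_type mI)).
  + by rewrite preimage_setC; exact: measurableC.
  + have := cB (unit_cell z); rewrite intensity_outerE unit_cell_intensity !(setIC (unit_cell z)) -eB.
    rewrite preimage_setC.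
    have fB : P (cell_point z @^-1` B) \is a fin_num by exact: fin_num_measure.
    have -> : P (~` (cell_point z @^-1` B)) = (1 - P (cell_point z @^-1` B))%E by exact: probability_setC.
    move: fB; case: (P _) => // p _; case: (mI _) => [q| |] //=.
    by rewrite -EFinB -!EFinM -EFinD => -[e]; congr EFin; lra.
- move=> F tF HF; have mF n : measurable (cell_point z @^-1` F n) by have [] := HF n.
  have cF n : mI.-caratheodory (F n) by have [] := HF n.
  split.
  + exact: (@bigcupT_measurable _ (caratheodory_type mI)).
  + by rewrite preimage_bigcup; exact: bigcupT_measurable.
  + rewrite preimage_bigcup setI_bigcupl.
    have t1 : trivIset setT (fun n => cell_point z @^-1` F n).
      apply/trivIsetP => i j _ _ ij; rewrite -preimage_setI.
      by move/trivIsetP : tF => /(_ _ _ Logic.I Logic.I ij) ->; rewrite preimage_set0.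
    have t2 : trivIset setT (fun n => F n `&` unit_cell z).
      apply/trivIsetP => i j _ _ ij; rewrite setIACA.
      by move/trivIsetP : tF => /(_ _ _ Logic.I Logic.I ij) ->; rewrite set0I.
    have mFz n : (@measurable _ (caratheodory_type mI)) (F n `&` unit_cell z).
      by apply: measurableI; [exact: cF|exact: mz].
    have c1 := @measure_semi_sigma_additive _ U R P _ mF t1 (bigcupT_measurable _ mF).
    have c2 := @caratheodory_measure_sigma_additive R T mI _ mFz t2
      (@bigcupT_measurable _ (caratheodory_type mI) _ mFz).
    apply: (cvg_unique _ _ c2); first exact: ereal_hausdorff.
    have -> : (fun n => \sum_(0 <= i < n) mI (F i `&` unit_cell z))%E =
      (fun n => (lam * m z.1)%:E * \sum_(0 <= i < n) P (cell_point z @^-1` F i))%E.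
      apply: funext => n; rewrite ge0_sume_distrr//; apply: eq_bigr => i _.
      by have [_ _ ->] := HF i.
    by apply: cvgeZl.
Qed.

Definition cell_index (c : nat) : option Z := pickle_inv c.
(** An integer that codes no cell gets mean 0 and so never has an active slot; the default cell
    given to it by [index_point] is then harmless. *)
Definition cell_mean (c : nat) : R := if cell_index c is Some z then lam * m z.1 else 0.
Definition index_point (c : nat) : U -> T := cell_point (odflt (true, 0) (cell_index c)).
Definition index_cell (c : nat) : set T := if cell_index c is Some z then unit_cell z else set0.

Lemma cell_index_inj c c' z : cell_index c = Some z -> cell_index c' = Some z -> c = c'.
Proof.
move=> h h'; have := @pickle_invK Z c; have := @pickle_invK Z c'.
by rewrite -!/(cell_index _) h h' /= => -> ->.
Qed.

Lemma unit_cell_disjoint z z' x : unit_cell z x -> unit_cell z' x -> z = z'.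
Proof.
move=> zx zx'; have e1 : z.2 = z'.2.
  by apply/rowP => i; rewrite -(unit_cell_floor zx) (unit_cell_floor zx').
have e2 : z.1 = z'.1 by apply: r_inj; case: zx => _ /= <-; case: zx' => _ /= <-.
by case: z z' e1 e2 {zx zx'} => [t q] [t' q'] /= -> ->.
Qed.

Lemma intensity_index_cells (A : set T) : Borel A ->
  (\sum_(c < n) cell_mean c * fine (P (index_point c @^-1` A)))%:E @[n --> \oo] --> intensity lam nu A.
Proof.
move=> bA; pose F c := A `&` index_cell c.
have cA : mI.-caratheodory A by exact: Borel_caratheodory.
have mrg : measurable (range r).
  have -> : range r = [set r true] `|` [set r false].
    by apply/seteqP; split => [_ [[] _ <-]|_ [->|->]]; [left|right|exists true|exists false].
  by apply: measurableU; exact: measurable_set1.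
have cF c : (@measurable _ (caratheodory_type mI)) (F c).
  apply: measurableI; first exact: cA.
  rewrite /index_cell; case: cell_index => [z|]; last exact: (@measurable0 _ (caratheodory_type mI)).
  exact: caratheodory_box.
have tF : trivIset setT F.
  apply/trivIsetP => c c' _ _ cc; apply/seteqP; split => // x [[_ +] [_ +]].
  rewrite /index_cell; case e : (cell_index c) => [z|//]; case e' : (cell_index c') => [z'|//].
  move=> zx zx'; move/eqP: cc; apply; apply: (cell_index_inj e).
  by rewrite e' (unit_cell_disjoint zx zx').
have c2 := @caratheodory_measure_sigma_additive R T mI _ cF tF
  (@bigcupT_measurable _ (caratheodory_type mI) _ cF).
have FE : \bigcup_c F c = A `&` (setT `*` range r).
  rewrite /F -setI_bigcupr; apply/seteqP; split => x [Ax].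
    move=> [c _]; rewrite /index_cell; case: cell_index => // z [_ /= xr].
    by split => //; split => //=; exists z.1.
  move=> [_ /= [t _ tx]]; split => //.
  pose z : Z := (t, \row_i Num.floor (x.1 0 i)).
  exists (pickle z) => //; rewrite /index_cell /cell_index pickleK_inv; split => //= i.
  by rewrite !mxE; have := floor_itv (x.1 0 i); rewrite intrD.
(* Growing boxes over the complement of [range r] form a cover of total weight 0. *)
have null : mI (A `&` ~` (setT `*` range r)) = 0%E.
  apply/eqP; rewrite eq_le outer_measure_ge0 andbT intensity_outerE.
  apply: ereal_inf_lbound; exists (fun n => \row_i - n%:R), (fun n => \row_i n%:R), (fun=> ~` range r).
  split; first by move=> _; exact: measurableC.
  split; last by rewrite eseries0// => n _ _; rewrite nuC mule0.
  move=> x [_ nx]; have xr : (~` range r) x.2 by move=> rx; apply: nx; split.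
  have [n Hn] : exists n : nat, forall i, `|x.1 0 i| < n%:R.
    have [f Hf] := choice (fun i => ex_intro (fun n => `|x.1 0 i| < n%:R) _ (archi_boundP (normr_ge0 (x.1 0 i)))).
    exists (\max_i f i)%N => i; apply: lt_le_trans (Hf i) _.
    by rewrite ler_nat; exact: leq_bigmax.
  exists n => //; split => //= i; rewrite !mxE; have := Hn i.
  by rewrite ltr_norml => /andP[/ltW -> ->].
have -> : intensity lam nu A = mI (\bigcup_c F c).
  have := @caratheodory_cylinder R d lam nu lam0 (range r) mrg A.
  by rewrite null adde0 -FE intensity_outerE.
have -> : (fun n => (\sum_(c < n) cell_mean c * fine (P (index_point c @^-1` A)))%:E) =
    (fun n => \sum_(0 <= c < n) mI (F c))%E; last exact: c2.
apply: funext => n; rewrite big_mkord -sumEFin; apply: eq_bigr => c _.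
rewrite /F /cell_mean /index_point /index_cell; case: cell_index => [z|] /=.
  have [mz e] := cell_law_Borel z bA.
  by rewrite -[RHS]/(mI (A `&` unit_cell z)) intensity_outerE -e EFinM fineK// fin_num_measure.
by rewrite -[RHS]/(mI (A `&` set0)) mul0r setI0 outer_measure0.
Qed.

Lemma poisson_exists : exists xi : U -> set T,
  is_poisson_pp (@unif R) xi (intensity lam nu) /\ forall w p, xi w p -> exists t, p.2 = r t.
Proof.
exists (ppp cell_mean index_point); split; last first.
  by move=> w p [_ [s _ ->]]; exists (odflt (true, 0) (cell_index s.1)).1.
apply: ppp_poisson => [c|c A bA|c c' u u'|A bA].
- by rewrite /cell_mean; case: cell_index => [z|//]; exact: mulr_ge0.
- by have [] := cell_law_Borel (odflt (true, 0) (cell_index c)) bA.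
- rewrite /cell_mean /index_point.
  case e : (cell_index c) => [z|]; last by rewrite ltxx.
  case e' : (cell_index c') => [z'|]; last by rewrite ltxx.
  move=> _ _ /= /cell_point_inj[zz cc]; split => //.
  by apply: cell_index_inj e _; rewrite zz.
- exact: intensity_index_cells.
Qed.

End Cells.

(** * The limit *)

Section KappaBounds.
Variables (R : realType) (rho : R).
Hypothesis rho1 : 1 < rho.

Lemma rho_ratio : 0 < 4 * rho / (1 + rho) ^+ 2 < 1.
Proof.
have rho0 : 0 < rho by apply: lt_trans rho1.
have r0 : 0 < 1 + rho by rewrite addr_gt0.
have r2 : 0 < (1 + rho) ^+ 2 by rewrite exprn_gt0.
rewrite divr_gt0 ?mulr_gt0//=.
rewrite ltr_pdivrMr// mul1r -subr_gt0.
have -> : (1 + rho) ^+ 2 - 4 * rho = (rho - 1) ^+ 2 by ring.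
by rewrite exprn_gt0// subr_gt0.
Qed.

(** The first term of the maximum is at least c^(1/(k+1)) with c = 4 rho / (1 + rho)^2 < 1, hence at
    least c, whatever [k] and the cosines. *)
Lemma kappa_c_gt0 : 0 < kappa_c rho.
Proof.
have /andP[c0 c1] := rho_ratio; apply: (lt_le_trans c0).
apply: lb_le_inf; first by exists (kappa_k rho 1), 1%N.
move=> _ [k k1 <-]; apply: kappa_k_ge => a a01.
rewrite /kappa_term le_max; apply/orP; left.
set p := \prod_(2 <= i < k.+2) _.
have p01 : 0 < p <= 1.
  rewrite /p big_nat; elim/big_ind: _ => [|x y /andP[x0 x1] /andP[y0 y1]|i /andP[i1 i2]].
  - by rewrite ltr01 lexx.
  - by rewrite mulr_gt0//= mulr_ile1 ?(ltW x0) ?(ltW y0).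
  - have /andP[h0 h1] := a01 i ltac:(by rewrite i1 -ltnS).
    by rewrite subr_gt0 expr_lt1//= h1 gerBl sqr_ge0.
have /andP[p0 p1] := p01.
have s01 : 0 < Num.sqrt p <= 1 by rewrite sqrtr_gt0 p0 /= -sqrtr1 ler_sqrt.
have /andP[s0 s1] := s01.
have rho0 : 0 < rho by apply: lt_trans rho1.
have r2 : 0 < (1 + rho) ^+ 2 by rewrite exprn_gt0// addr_gt0.
have cX : 4 * rho / (1 + rho) ^+ 2 <= 4 * rho / ((1 + rho) ^+ 2 * Num.sqrt p).
  rewrite ler_pM2l; last by rewrite mulr_gt0.
  have m0 : 0 < (1 + rho) ^+ 2 * Num.sqrt p by exact: mulr_gt0.
  have m1 : (1 + rho) ^+ 2 * Num.sqrt p <= (1 + rho) ^+ 2 by rewrite -[leRHS]mulr1 ler_pM2l.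
  by rewrite lef_pV2 ?posrE.
apply: (@le_trans _ _ ((4 * rho / (1 + rho) ^+ 2) `^ k.+1%:R^-1)); last first.
  by apply: ge0_ler_powR => //; rewrite ?nnegrE ?invr_ge0 ?(ltW c0)// (le_trans (ltW c0)).
rewrite -[leLHS]powRr1 ?(ltW c0)//; apply: ger_powR; first by rewrite c0 ltW.
by rewrite invf_le1 ?ltr0n// ler1n.
Qed.

Lemma Dseq0_ge k n : (1 + rho) ^+ 2 + n%:R <= Dseq rho k (fun=> 0) n ^+ 2.
Proof.
elim: n => [|n IH]; first by rewrite addr0.
rewrite /= mulr0 mul0r addr0 sqr_sqrtr; last by rewrite addr_ge0 ?sqr_ge0.
have r1 := rho1.
have : 1 <= Defs.rad rho k n.+2 ^+ 2.
  by rewrite exprn_ege1// /Defs.rad; case: ifP => _; lra.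
by rewrite -natr1; lra.
Qed.

(** With all cosines 0, the first term is a root of a number below 1, and squared distances grow at
    least linearly in [k], so the second term ends below 1 as well. *)
Lemma kappa_c_lt1 : kappa_c rho < 1.
Proof.
have [K HK] : exists K, 4 * rho ^+ 2 < K%:R.
  by exists (Num.bound (4 * rho ^+ 2)); apply: archi_boundP; rewrite mulr_ge0// sqr_ge0.
have r1 := rho1.
apply: (@le_lt_trans _ _ (kappa_term rho K.+1 (fun=> 0))).
  by apply: kappa_c_le => // i _; rewrite lexx ltr01.
have /andP[c0 c1] := rho_ratio.
rewrite /kappa_term gt_max; apply/andP; split.
  rewrite big1 => [|i _]; last by rewrite expr0n subr0.
  have e1 : (1 : R) `^ K.+2%:R^-1 = 1 by rewrite powR1.
  rewrite sqrtr1 mulr1 -[ltRHS]e1.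
  by apply: gt0_ltr_powR; rewrite ?invr_gt0 ?ltr0n// nnegrE ltW.
have D0 : 0 <= Dseq rho K.+1 (fun=> 0) K.+1 by exact: Dseq_ge0.
have D2 : 4 * rho ^+ 2 < Dseq rho K.+1 (fun=> 0) K.+1 ^+ 2.
  apply: lt_le_trans (Dseq0_ge K.+1 K.+1); rewrite -natr1.
  by have := sqr_ge0 (1 + rho); lra.
have lt : 2 * rho < Dseq rho K.+1 (fun=> 0) K.+1.
  rewrite -(ltr_pXn2r (n := 2)) ?nnegrE//; last by lra.
  by rewrite (exprMn 2 2 rho); apply: le_lt_trans D2; rewrite -natrX.
rewrite ltr_pdivrMr ?mul1r//; apply: lt_trans lt; lra.
Qed.

End KappaBounds.

Section TwoAtoms.
Variables (R : realType) (a b alpha beta : R) (d : nat) (nu : {measure set R -> \bar R}).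
Hypothesis a0 : 0 < a.
Hypothesis ab : a < b.
Hypothesis alpha0 : 0 < alpha.
Hypothesis beta0 : 0 < beta.
Hypothesis nuE : forall A : set R, measurable A ->
  nu A = ((alpha * a ^- d)%:E * \d_a A + (beta * b ^- d)%:E * \d_b A)%E.

Lemma atom_a : nu [set a] = (alpha * a ^- d)%:E.
Proof.
rewrite nuE// !diracE mem_set// memNset ?mule0 ?adde0 ?mule1// => /= ba.
by move: ab; rewrite ba ltxx.
Qed.

Lemma atom_b : nu [set b] = (beta * b ^- d)%:E.
Proof.
rewrite nuE// !diracE [b \in _]mem_set// memNset ?mule0 ?add0e ?mule1// => /= ba.
by move: ab; rewrite ba ltxx.
Qed.

Lemma atoms_compl (A : set R) : measurable A -> ~ A a -> ~ A b -> nu A = 0%E.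
Proof. by move=> mA Aa Ab; rewrite nuE// !diracE !memNset// !mule0 adde0. Qed.

Lemma integral_ball_volume :
  (\int[nu]_(r in `]0%R, +oo[) (vol_ball R d * (2 * r) ^+ d)%:E =
   (vol_ball R d * 2 ^+ d * (alpha + beta))%:E)%E.
Proof.
have b0 : 0 < b by apply: lt_trans ab.
have ca : 0 <= alpha * a ^- d by rewrite mulr_ge0 ?invr_ge0 ?exprn_ge0 ?(ltW a0) ?(ltW alpha0).
have cb : 0 <= beta * b ^- d by rewrite mulr_ge0 ?invr_ge0 ?exprn_ge0 ?(ltW b0) ?(ltW beta0).
pose m1 : {measure set R -> \bar R} := mscale (NngNum ca) \d_a.
pose m2 : {measure set R -> \bar R} := mscale (NngNum cb) \d_b.
pose f (r : R) : \bar R := (vol_ball R d * (2 * r) ^+ d)%:E.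
pose D : set R := `]0%R, +oo[%classic.
have mD : measurable D by exact: measurable_itv.
have v0 : 0 <= vol_ball R d.
  case: (posnP d) => [->|d0]; last by rewrite ltW// vol_ball_gt0.
  by rewrite /vol_ball fine_ge0// lebesgue_d_ge0.
have f0 r : D r -> (0 <= f r)%E.
  rewrite /D /= in_itv /= andbT => r0; by rewrite lee_fin mulr_ge0// exprn_ge0// mulr_ge0// ltW.
have mf : measurable_fun D f.
  apply/measurable_EFinP; apply: measurable_funM => //; apply: measurable_funX.
  exact: measurable_funM.
transitivity (\int[measure_add m1 m2]_(r in D) f r)%E.
  apply: eq_measure_integral => A mA _.
  by rewrite nuE// -[RHS]/(measure_add m1 m2 A) measure_addE.
rewrite ge0_integral_measure_add// ge0_integral_mscale// ge0_integral_mscale//.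
rewrite !integral_dirac// !diracE !mem_set; try by rewrite /D /= in_itv /= andbT.
rewrite !mul1e /f -!EFinM -EFinD; congr EFin.
have an : a ^+ d != 0 by rewrite expf_neq0// gt_eqF.
have bn : b ^+ d != 0 by rewrite expf_neq0// gt_eqF.
rewrite /= (exprMn d 2 a) (exprMn d 2 b).
move: (a ^+ d) (b ^+ d) (2 ^+ d : R) an bn => x y z x0 y0.
by field; rewrite x0 y0.
Qed.

End TwoAtoms.

(** * Bounds on the critical covered volume *)

Section Sandwich.
Variables (R : realType) (a b alpha beta : R) (nu : nat -> {measure set R -> \bar R}).
Hypothesis a0 : 0 < a.
Hypothesis ab : a < b.
Hypothesis alpha0 : 0 < alpha.
Hypothesis beta0 : 0 < beta.
Hypothesis nuE : forall d (A : set R), measurable A ->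
  nu d A = ((alpha * a ^- d)%:E * \d_a A + (beta * b ^- d)%:E * \d_b A)%E.
Let rho := b / a.

Lemma rho_gt1 : 1 < rho.
Proof. by rewrite /rho ltr_pdivlMr// mul1r. Qed.

Lemma a_rho : a * rho = b.
Proof. by rewrite /rho mulrC divfK// gt_eqF. Qed.

Lemma crit_intensity_mean (kap : R) d : (0 < d)%N ->
  crit_intensity kap d * (vol_ball R d * 2 ^+ d * (alpha + beta)) = kap ^+ d * (alpha + beta).
Proof.
move=> d0; have v0 := vol_ball_gt0 R d0.
have z0 : (2 ^+ d : R) != 0 by rewrite expf_neq0.
rewrite /crit_intensity; move: (kap ^+ d) (2 ^+ d : R) (vol_ball R d) v0 z0 => x z v /lt0r_neq0 v0 z0.
by field; rewrite v0 z0.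
Qed.

Lemma crit_intensity_gt0 (kap : R) d : (0 < d)%N -> 0 < kap -> 0 < crit_intensity kap d.
Proof.
by move=> d0 k0; rewrite /crit_intensity divr_gt0 ?exprn_gt0// mulr_gt0 ?exprn_gt0// vol_ball_gt0.
Qed.

Lemma lambda_tildeE d : lambda_tilde d (nu d) =
  (lambda_c d (nu d) * (vol_ball R d * 2 ^+ d * (alpha + beta))%:E)%E.
Proof. by rewrite /lambda_tilde (integral_ball_volume a0 ab alpha0 beta0 (nuE d)). Qed.

Lemma lambda_tilde_le kap : kappa_c rho < kap -> kap < 1 ->
  \forall d \near \oo, (lambda_tilde d (nu d) <= (kap ^+ d * (alpha + beta))%:E)%E.
Proof.
move=> k1 k2; have kap01 : 0 < kap < 1.
  by rewrite k2 (lt_trans (kappa_c_gt0 rho_gt1) k1).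
have /andP[k0 _] := kap01.
have [N _ HN] := percolates_above rho_gt1 kap01 a0 alpha0 beta0 k1.
exists N.+1 => // d /= Nd; have d0 : (0 < d)%N by apply: leq_trans Nd.
rewrite lambda_tildeE -crit_intensity_mean// [leRHS]EFinM; apply: lee_wpmul2r.
  by rewrite lee_fin mulr_ge0 ?addr_ge0 ?(ltW alpha0) ?(ltW beta0)// mulr_ge0 ?exprn_ge0// ltW// vol_ball_gt0.
apply: ereal_inf_lbound; exists (crit_intensity kap d); split => //.
  exact: crit_intensity_gt0.
apply: HN; first by rewrite /= ltnW.
  exact: (atom_a ab (nuE d)).
by rewrite a_rho; exact: (atom_b ab (nuE d)).
Qed.

Lemma site_radius_inj : injective (fun t => a * site_radius rho t).
Proof.
have r1 := rho_gt1; move=> [] [] // /(mulfI (lt0r_neq0 a0)); rewrite /site_radius => e; exfalso; lra.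
Qed.

(** Percolation at a smaller intensity would give positive probability to an event that
    [subcritical_null] makes null for the process just constructed; [percolates] quantifies over
    processes, so exhibiting one is what refutes it. *)
Lemma lambda_tilde_ge kap : 0 < kap -> kap < kappa_c rho ->
  \forall d \near \oo, ((kap ^+ d * (alpha + beta))%:E <= lambda_tilde d (nu d))%E.
Proof.
move=> k0 k1; pose kap1 := (kap + kappa_c rho) / 2.
have kc1 := kappa_c_lt1 rho_gt1.
have kk : kap < kap1 by rewrite /kap1; lra.
have k1c : kap1 < kappa_c rho by rewrite /kap1; lra.
have k11 : kap1 < 1 by lra.
have [N HN] := subcritical_null rho_gt1 k0 kk k11 k1c alpha0 beta0 a0.
exists N.+1 => // d /= Nd; have d0 : (0 < d)%N by apply: leq_trans Nd.
rewrite lambda_tildeE -crit_intensity_mean// [leLHS]EFinM; apply: lee_wpmul2r.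
  by rewrite lee_fin mulr_ge0 ?addr_ge0 ?(ltW alpha0) ?(ltW beta0)// mulr_ge0 ?exprn_ge0// ltW// vol_ball_gt0.
apply: le_ereal_inf_tmp => _ [lam [lam0 perc ->]]; rewrite lee_fin leNgt; apply/negP => lt.
have b0 : 0 < b by apply: lt_trans ab.
have nua := atom_a ab (nuE d).
have nub : nu d [set a * rho] = (beta * (a * rho) ^- d)%:E.
  by rewrite a_rho; exact: (atom_b ab (nuE d)).
pose m (t : bool) := if t then beta * (a * rho) ^- d else alpha * a ^- d.
have m0 t : 0 <= m t.
  by rewrite /m a_rho; case: t; rewrite mulr_ge0 ?invr_ge0 ?exprn_ge0 ?(ltW b0) ?(ltW a0) ?(ltW beta0) ?(ltW alpha0).
have nur t : nu d [set a * site_radius rho t] = (m t)%:E.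
  by case: t; rewrite /site_radius /m ?mulr1.
have nuC : nu d (~` range (fun t => a * site_radius rho t)) = 0%E.
  apply: (atoms_compl (nuE d)).
  - apply: measurableC.
    have -> : range (fun t => a * site_radius rho t) =
        [set a * site_radius rho true] `|` [set a * site_radius rho false].
      by apply/seteqP; split => [_ [[] _ <-]|_ [->|->]]; [left|right|exists true|exists false].
    by apply: measurableU; exact: measurable_set1.
  - by apply; exists false => //=; rewrite mulr1.
  - by apply; exists true => //=; rewrite a_rho.
have [xi [ppp rad]] := poisson_exists d0 (ltW lam0) m0 site_radius_inj nur nuC.
have [F [mF Fsub]] := perc _ _ _ xi ppp.
rewrite (HN d (nu d) lam _ _ _ xi _ _ nua nub ppp rad F mF Fsub) ?ltxx// ?lt0r_neq0//.
by rewrite (ltW lam0) (ltW lt).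
Qed.

End Sandwich.

(** Positivity and finiteness belong to the conclusion so that [fine] and [ln] are applied to
    genuine values. *)
Theorem theorem1p4 (R : realType) (a b alpha beta : R)
  (mu_ : nat -> {measure set R -> \bar R}) :
  0 < a -> a < b -> 0 < alpha -> 0 < beta ->
  (forall (d : nat) (A : set R), measurable A ->
     mu_ d A = ((alpha * a ^- d)%:E * \d_a A + (beta * b ^- d)%:E * \d_b A)%E) ->
  let rho := b / a in
  [/\ 0 < kappa_c rho,
      (\forall d \near \oo, 0 < lambda_tilde d (mu_ d) < +oo)%E,
      (fun d : nat => ln (fine (lambda_tilde d (mu_ d))) / d%:R) @ \oo
        --> ln (kappa_c rho)
    & ln (kappa_c rho) < 0].
Proof.
move=> a0 ab alpha0 beta0 muE rho.
have rho1 : 1 < rho by exact: rho_gt1.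
have k0 := kappa_c_gt0 rho1; have k1 := kappa_c_lt1 rho1.
have s0 : 0 < alpha + beta by rewrite addr_gt0.
have lnk : ln (kappa_c rho) < 0 by apply: ln_lt0; rewrite k0.
set l := ln (kappa_c rho) in lnk *.
have between (e : R) : 0 < e -> \forall d \near \oo,
    ((expR ((l - e) * d%:R + ln (alpha + beta)))%:E <= lambda_tilde d (mu_ d) <=
     (expR ((l + e) * d%:R + ln (alpha + beta)))%:E)%E.
  (* The cap keeps exp(l + e') below 1, as [lambda_tilde_le] requires. *)
  move=> e0; pose e' := Num.min e (- l / 2).
  have e'0 : 0 < e' by rewrite lt_min e0 /=; lra.
  have e'e : e' <= e by rewrite ge_min lexx.
  have e'l : e' <= - l / 2 by rewrite ge_min lexx orbT.
  have kE : kappa_c rho = expR l by rewrite lnK.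
  have expE x d : expR (x * d%:R + ln (alpha + beta)) = expR x ^+ d * (alpha + beta).
    by rewrite expRD lnK ?posrE// (mulrC x) expRM_natl.
  have up := lambda_tilde_le a0 ab alpha0 beta0 muE (kap := expR (l + e')) _ _.
  have lo := lambda_tilde_ge a0 ab alpha0 beta0 muE (kap := expR (l - e')) _ _.
  have {}up := up ltac:(by rewrite -/rho kE ltr_expR ltrDl) ltac:(by rewrite expR_lt1; lra).
  have {}lo := lo ltac:(exact: expR_gt0) ltac:(by rewrite -/rho kE ltr_expR ltrBlDr ltrDl).
  near=> d; rewrite !expE; apply/andP; split.
    apply: le_trans (near lo d _); last by [].
    rewrite lee_fin ler_pM2r// lerXn2r ?nnegrE ?expR_ge0// ler_expR; lra.
  apply: le_trans (near up d _) _; first by [].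
  rewrite lee_fin ler_pM2r// lerXn2r ?nnegrE ?expR_ge0// ler_expR; lra.
split => //.
  have := between 1 ltr01; apply: filterS => d /andP[h1 h2].
  by rewrite (lt_le_trans _ h1) ?lte_fin ?expR_gt0//= (le_lt_trans h2) ?ltry.
apply/cvgrPdist_le => e e0; have e20 : 0 < e / 2 by rewrite divr_gt0.
have bt := between _ e20.
(* From rank [M] on, the constant [ln (alpha + beta)] divided by d costs at most e / 2; [between]
   uses the other half. *)
have [M HM] : exists M, `|ln (alpha + beta)| / (e / 2) < M%:R.
  by exists (Num.bound (`|ln (alpha + beta)| / (e / 2))); apply: archi_boundP; rewrite divr_ge0// ltW.
near=> d.
have d0 : (0 : R) < d%:R by rewrite ltr0n; near: d; exists 1%N.
have dM : M%:R <= d%:R :> R by rewrite ler_nat; near: d; exists M.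
have : ((expR ((l - e / 2) * d%:R + ln (alpha + beta)))%:E <= lambda_tilde d (mu_ d) <=
     (expR ((l + e / 2) * d%:R + ln (alpha + beta)))%:E)%E by near: d.
case: (lambda_tilde d (mu_ d)) => [x| |] /andP[] //; rewrite !lee_fin /= => h1 h2.
have x0 : 0 < x by apply: lt_le_trans h1; exact: expR_gt0.
have lx1 : (l - e / 2) * d%:R + ln (alpha + beta) <= ln x by rewrite -ler_expR lnK.
have lx2 : ln x <= (l + e / 2) * d%:R + ln (alpha + beta) by rewrite -ler_expR lnK.
have sM : `|ln (alpha + beta)| <= (e / 2) * d%:R.
  by rewrite mulrC -ler_pdivrMr// (le_trans (ltW HM)).
move: sM; rewrite ler_norml => /andP[s1 s2].
rewrite ler_distlC; apply/andP; split.
  by rewrite ler_pdivlMr//; lra.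
by rewrite ler_pdivrMr//; lra.
Unshelve. all: end_near. Qed.
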